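(* Let $\mathbb{k}$ be a field and let $R$ be a commutative $\mathbb{k}$-algebra essentially of finite type over $\mathbb{k}$. Assume that $R$ has no embedded associated primes, and let $R_{\rm red} = R/\sqrt{0}$. Then there exist a set of Noetherian operators $\delta_1,\ldots,\delta_m \in \mathrm{Diff}_{R/\mathbb{k}}(R, R_{\rm red})$ for $R$ and an integer $c \ge 0$ such that $$ I^{n+c} :_{R_{\rm red}} \{\delta_1,\ldots,\delta_m\} \;\subseteq\; J^n $$ for any ideal $J$ in $R$ with image $I$ in $R_{\rm red}$ and any integer $n \ge 0$ (the operators $\delta_i$ and the constant $c$ are independent of $J$ and $n$).
   Context: Differential operators: for a $\mathbb{k}$-algebra $R$ and $R$-modules $M,N$, define inductively $\mathrm{Diff}^0_{R/\mathbb{k}}(M,N) = \mathrm{Hom}_R(M,N)$ and, for $n\ge 1$, $\mathrm{Diff}^n_{R/\mathbb{k}}(M,N) = \{\delta \in \mathrm{Hom}_{\mathbb{k}}(M,N) \mid [\delta,f] \in \mathrm{Diff}^{n-1}_{R/\mathbb{k}}(M,N) \text{ for all } f\in R\}$, where $[\delta,f](m) = \delta(fm) - f\delta(m)$. Set $\mathrm{Diff}_{R/\mathbb{k}}(M,N) = \bigcup_{n\ge 0}\mathrm{Diff}^n_{R/\mathbb{k}}(M,N)$. A finite set $\delta_1,\ldots,\delta_m \in \mathrm{Diff}_{R/\mathbb{k}}(R,R_{\rm red})$ is a set of Noetherian operators for $R$ if $\{f\in R \mid \delta_i(f)=0 \text{ for all } 1\le i\le m\} = (0)$. For an ideal $I\subset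 R_{\rm red}$ and $\delta_1,\ldots,\delta_m \in \mathrm{Diff}_{R/\mathbb{k}}(R,R_{\rm red})$, set $I :_{R_{\rm red}} \{\delta_1,\ldots,\delta_m\} = \{f\in R \mid \delta_i(f)\in I \text{ for all } 1\le i\le m\}$ (a subset of $R$). *)

(* Defs.v *)
From HB Require Import structures.
From mathcomp Require Import all_boot all_algebra.
From mathcomp Require Import ring_quotient.
From mathcomp Require Import boolp classical_sets.
From mathcomp Require Import mpoly.

Set Implicit Arguments.
Unset Strict Implicit.
Unset Printing Implicit Defensive.

Import GRing.Theory.

Local Open Scope classical_set_scope.
Local Open Scope ring_scope.
Local Open Scope quotient_scope.

(* Commutative rings are comPzRingType, so the zero ring is allowed.  The      *)
(* library's comAlgType excludes it; a k-algebra R is therefore given by its   *)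
(* structure morphism iota : {rmorphism k -> R}.                               *)

Section Ideals.
Variable R : comPzRingType.

Definition is_ideal (J : set R) : Prop :=
  [/\ J 0, (forall x y, J x -> J y -> J (x + y)) & (forall a x, J x -> J (a * x))].

Definition is_prime_ideal (P : set R) : Prop :=
  [/\ is_ideal P, ~ P 1 & forall x y, P (x * y) -> P x \/ P y].

Definition ideal_mul (J K : set R) : set R :=
  [set x | exists (r : nat) (a b : 'I_r -> R),
     (forall i, J (a i) /\ K (b i)) /\ x = \sum_(i < r) a i * b i].

Definition ideal_pow (J : set R) (n : nat) : set R := iter n (ideal_mul J) setT.

Definition annihilator (x : R) : set R := [set a | a * x = 0].

Definition associated_prime (P : set R) : Prop :=
  is_prime_ideal P /\ exists x : R, P = annihilator x.

Definition embedded_prime (P : set R) : Prop :=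
  associated_prime P /\ exists2 Q, associated_prime Q & Q `<` P.

End Ideals.

Definition no_embedded_primes (R : comPzRingType) : Prop :=
  forall P : set R, ~ embedded_prime P.

Definition nilradical (R : comPzRingType) : {pred R} :=
  fun x => `[< exists n : nat, x ^+ n = 0 >].
Arguments nilradical R : clear implicits.

Section Nilradical.
Variable R : comPzRingType.

Lemma nilradicalP (x : R) :
  reflect (exists n : nat, x ^+ n = 0) (x \in nilradical R).
Proof. exact: asboolP. Qed.

Lemma nilradical_mull (a x : R) : x \in nilradical R -> a * x \in nilradical R.
Proof.
by move=> /nilradicalP[n xn]; apply/nilradicalP; exists n; rewrite exprMn xn mulr0.
Qed.

Lemma nilradical_zmod_closed : zmod_closed (nilradical R).
Proof.
split=> [|x y /nilradicalP[p xp] /nilradicalP[q yq]]; apply/nilradicalP.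
  by exists 1%N; rewrite expr1.
exists (p + q)%N; rewrite exprBn big1 // => i _.
have [le_qi|lt_iq] := leqP q i.
  by rewrite -(subnK le_qi) (exprD y) yq !mulr0 mul0rn.
have le_p : (p <= p + q - i)%N by rewrite -addnBA ?leq_addr // ltnW.
by rewrite -(subnK le_p) (exprD x) xp !(mulr0, mul0r) mul0rn.
Qed.

HB.instance Definition _ :=
  GRing.isZmodClosed.Build R (nilradical R) nilradical_zmod_closed.

End Nilradical.

(* The library makes quotient rings only of nonzero rings by proper ideals;    *)
(* the ring structure on the additive quotient is supplied here.               *)
Definition Rred (R : comPzRingType) : Type := {ideal_quot (nilradical R)}.

Section ReducedRing.
Variable R : comPzRingType.

HB.instance Definition _ := GRing.Zmodule.on (Rred R).

Definition to_red (x : R) : Rred R := \pi_({ideal_quot (nilradical R)}) x.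
Definition red_repr (u : Rred R) : R := repr (u : {ideal_quot (nilradical R)}).

Lemma red_reprK (u : Rred R) : to_red (red_repr u) = u.
Proof. exact: reprK. Qed.

Lemma to_red_eqP (x y : R) : to_red x = to_red y <-> x - y \in nilradical R.
Proof. rewrite Quotient.idealrBE; exact: (rwP eqP). Qed.

Lemma to_redB : zmod_morphism to_red.
Proof. by move=> x y; rewrite /to_red !piE. Qed.

HB.instance Definition _ := GRing.isZmodMorphism.Build R (Rred R) to_red to_redB.

Definition red_one : Rred R := to_red 1.
Definition red_mul (u v : Rred R) : Rred R := to_red (red_repr u * red_repr v).

Lemma to_redM (x y : R) : to_red (x * y) = red_mul (to_red x) (to_red y).
Proof.
apply/to_red_eqP.
set x' := red_repr _; set y' := red_repr _.
have hx : x - x' \in nilradical R by apply/to_red_eqP; rewrite red_reprK.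
have hy : y - y' \in nilradical R by apply/to_red_eqP; rewrite red_reprK.
have -> : x * y - x' * y' = y * (x - x') + x' * (y - y').
  by rewrite !mulrBr addrA [y * x]mulrC [y * x']mulrC subrK.
by rewrite rpredD // nilradical_mull.
Qed.

Fact red_mulA : associative red_mul.
Proof.
by move=> u v w; rewrite -[u]red_reprK -[v]red_reprK -[w]red_reprK
  -!to_redM mulrA.
Qed.

Fact red_mulC : commutative red_mul.
Proof. by move=> u v; rewrite /red_mul mulrC. Qed.

Fact red_mul1 : left_id red_one red_mul.
Proof. by move=> u; rewrite -[u]red_reprK -to_redM mul1r. Qed.

Fact red_mulDl : left_distributive red_mul +%R.
Proof.
move=> u v w; rewrite -[u]red_reprK -[v]red_reprK -[w]red_reprK.
by rewrite -(raddfD to_red) -!to_redM -(raddfD to_red) mulrDl.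
Qed.

HB.instance Definition _ :=
  GRing.Zmodule_isComPzRing.Build (Rred R) red_mulA red_mulC red_mul1 red_mulDl.

Fact to_red_monoid_morphism : monoid_morphism to_red.
Proof. by split=> // x y; exact: to_redM. Qed.

HB.instance Definition _ :=
  GRing.isMonoidMorphism.Build R (Rred R) to_red to_red_monoid_morphism.

Definition red_scale (a : R) (u : Rred R) : Rred R := to_red a * u.

Fact red_scaleA a b u : red_scale a (red_scale b u) = red_scale (a * b) u.
Proof. by rewrite /red_scale rmorphM mulrA. Qed.

Fact red_scale1 : left_id 1 red_scale.
Proof. by move=> u; rewrite /red_scale rmorph1 mul1r. Qed.

Fact red_scaleDr : right_distributive red_scale +%R.
Proof. by move=> a u v; rewrite /red_scale mulrDr. Qed.

Fact red_scaleDl u : {morph red_scale^~ u : a b / a + b}.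
Proof. by move=> a b; rewrite /red_scale rmorphD mulrDl. Qed.

HB.instance Definition _ := GRing.Zmodule_isLmodule.Build R (Rred R)
  red_scaleA red_scale1 red_scaleDr red_scaleDl.

End ReducedRing.

Definition multiplicative_subset (A : comPzRingType) (S : set A) : Prop :=
  S 1 /\ forall s t, S s -> S t -> S (s * t).

(* psi exhibits R as the localization of A at S. *)
Definition is_localization (A R : comPzRingType) (S : set A)
    (psi : {rmorphism A -> R}) : Prop :=
  [/\ forall s, S s -> exists u, psi s * u = 1,
      forall r, exists a s, S s /\ r * psi s = psi a
    & forall a, psi a = 0 -> exists2 s, S s & s * a = 0].

(* A is the finitely generated k-algebra with structure morphism c |-> phi c%:MP. *)
Definition essentially_of_finite_type (k : fieldType) (R : comPzRingType)
    (iota : {rmorphism k -> R}) : Prop :=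
  exists (d : nat) (A : comPzRingType) (phi : {rmorphism {mpoly k[d]} -> A})
         (S : set A) (psi : {rmorphism A -> R}),
    [/\ forall a, exists p, phi p = a,
        multiplicative_subset S,
        is_localization S psi
      & forall c : k, psi (phi c%:MP) = iota c].

Section DifferentialOperators.
Variables (k : fieldType) (R : comPzRingType) (iota : {rmorphism k -> R}).
Variables M N : lmodType R.

Definition k_linear (delta : M -> N) : Prop :=
  forall (c : k) (x y : M),
    delta (iota c *: x + y) = iota c *: delta x + delta y.

Definition bracket (delta : M -> N) (f : R) : M -> N :=
  fun m => delta (f *: m) - f *: delta m.

Fixpoint Diff_le (n : nat) (delta : M -> N) : Prop :=
  if n is n'.+1 then
    k_linear delta /\ forall f : R, Diff_le n' (bracket delta f)
  else linear delta.

Definition Diff (delta : M -> N) : Prop := exists n, Diff_le n delta.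

End DifferentialOperators.

Section NoetherianOperators.
Variables (k : fieldType) (R : comPzRingType) (iota : {rmorphism k -> R}).

Definition noetherian_operators (m : nat) (delta : 'I_m -> R^o -> Rred R) : Prop :=
  (forall i, Diff iota (delta i)) /\
  [set f : R | forall i, delta i f = 0] = [set 0].

Definition colon (I : set (Rred R)) (m : nat) (delta : 'I_m -> R^o -> Rred R) :
    set R :=
  [set f : R | forall i, I (delta i f)].

End NoetherianOperators.

(* Main.v *)
(* Write R as a localization of S/a with S = k[x], let q be the preimage in S of the nilradical,
   and let tau f = f(X) be the Taylor expansion of f in k[x, X] along the diagonal X = x.  An
   S-linear functional on k[x, X] / (X - x)^(N+1) that maps the ideal generated by tau(a) into q
   induces, for every theta in k[x, X], a differential operator f |-> lam(theta tau f) mod q of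
   order at most N.  For an associated prime p of a, the Artin-Rees lemma in k[x, X] and the fact
   that ideals in disjoint variables meet in their product give finitely many functionals with
   values modulo p that detect every f with p f contained in a.  As no associated prime is
   embedded, some s outside p satisfies s p <= q, so that s times these functionals are values
   modulo q; an f undetected at all associated primes lies in a.

   If all lam(theta tau f) lie in J^(n+c) modulo q, a uniform Artin-Rees theorem for submodules of
   free S-modules (with c independent of J and n) writes tau f, up to the joint kernel of the
   functionals, with coefficients in powers of J(x).  Modulo (X - x)^(N+1) these are coefficients
   in J(X) up to a shift by N, and a second application of the theorem over k[X] gives f in J^n.

   Uniform Artin-Rees, b /\ I^(n+c) <= b I^n, descends along a linear retraction from a perfect
   infinite extension of k.  With I and b extended in disjoint variables it holds with c = 0, and
   one comes back by cutting with one diagonal element z at a time.  Noetherian induction reduces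
   this to a prime b, where it is enough that some h outside b sends {w : z w in I^(N+c)} into I^N
   modulo b.  By Kronecker's trick such a w satisfies w M <= I^(N-1) M for a nonzero ideal M, and
   the Jacobian h of a Noether normalization then multiplies w into I^(N-c) by a Briançon-Skoda
   theorem: after reducing I to parameters this is the duality between the trace and the Jacobian
   of a complete intersection. *)

Require Import Defs.
From HB Require Import structures.
From mathcomp Require Import all_boot all_order all_algebra.
From mathcomp Require Import perm generic_quotient zify ring.
From mathcomp Require Import boolp classical_sets.
From mathcomp Require Import ssrcomplements mpoly.

Set Implicit Arguments.
Unset Strict Implicit.
Unset Printing Implicit Defensive.

Import Order.TTheory GRing.Theory.

Local Open Scope classical_set_scope.
Local Open Scope ring_scope.

(** * Ideals *)

(** Constants independent of [J] come from objects fixed in advance: uniform Artin-Rees is applied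
    to [order_module] and [tau_module], which are built from the functionals alone.

    The multipliers theta serve to make the undetected elements an ideal. One can then choose among
    them an element whose annihilator is maximal, hence an associated prime, and compare with
    detection at that prime.

    In the Briançon-Skoda step the Jacobian [h] belongs to a fixed normalization, while the
    parameters that form a reduction of [I] vary with [I] and have a Jacobian of their own. The link
    is a pencil: these parameters are perturbed by lam times t_0, t_0 t_1, ..., which lie in [I] as
    soon as t_0 does. The Jacobian is then a polynomial in lam with top coefficient h t_0^D, and
    what holds for almost all lam passes to this coefficient by interpolation. To have t_0 in [I], a
    variable y is adjoined to the ring and to the ideal; the factor y^D costs D powers of [I], which
    is where the constant of that theorem comes from. *)

Section IdealCalculus.
Variable R : comPzRingType.
Implicit Types (J K : set R) (x y a : R) (m n : nat).

Lemma ideal0 J : is_ideal J -> J 0. Proof. by case. Qed.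
Lemma idealD J x y : is_ideal J -> J x -> J y -> J (x + y).
Proof. by case=> _ + _; apply. Qed.
Lemma idealM J a x : is_ideal J -> J x -> J (a * x).
Proof. by case=> _ _; apply. Qed.
Lemma idealMr J a x : is_ideal J -> J x -> J (x * a).
Proof. by move=> hJ hx; rewrite mulrC; exact: idealM. Qed.
Lemma idealN J x : is_ideal J -> J x -> J (- x).
Proof. by move=> hJ hx; rewrite -mulN1r; exact: idealM. Qed.
Lemma idealB J x y : is_ideal J -> J x -> J y -> J (x - y).
Proof. by move=> hJ hx hy; apply: idealD => //; exact: idealN. Qed.
Lemma idealBr J x y : is_ideal J -> J (x - y) -> J y -> J x.
Proof. by move=> hJ h hy; rewrite -(subrK y x); exact: idealD. Qed.
Lemma ideal_sum J (T : Type) (s : seq T) (P : pred T) (F : T -> R) :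
  is_ideal J -> (forall i, P i -> J (F i)) -> J (\sum_(i <- s | P i) F i).
Proof.
by move=> hJ h; apply: big_ind => //; [exact: ideal0|move=> *; exact: idealD].
Qed.

Lemma ideal_mul_ind J K (P : R -> Prop) : P 0 ->
  (forall x y, P x -> P y -> P (x + y)) ->
  (forall a b, J a -> K b -> P (a * b)) -> forall x, ideal_mul J K x -> P x.
Proof.
move=> P0 PD PM x [r [a [b [hab ->]]]].
by apply: big_ind => // i _; case: (hab i) => *; exact: PM.
Qed.

Lemma ideal_mul_mem J K a b : J a -> K b -> ideal_mul J K (a * b).
Proof.
move=> ha hb; exists 1%N, (fun=> a), (fun=> b); split=> //.
by rewrite big_ord_recl big_ord0 addr0.
Qed.

Lemma ideal_mul0 J K : ideal_mul J K 0.
Proof. by exists 0%N, (fun=> 0), (fun=> 0); split=> [[]//|]; rewrite big_ord0. Qed.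

Lemma ideal_mulD J K x y :
  ideal_mul J K x -> ideal_mul J K y -> ideal_mul J K (x + y).
Proof.
move=> [r [a [b [hab ->]]]] [r' [a' [b' [hab' ->]]]].
exists (r + r')%N, (fun i => match split i with inl j => a j | inr j => a' j end),
  (fun i => match split i with inl j => b j | inr j => b' j end).
split=> [i|]; first by case: splitP => j _.
rewrite big_split_ord /=; congr (_ + _); apply: eq_bigr => i _.
  case: splitP => j /= hj; last by have := ltn_ord i; lia.
  by rewrite (ord_inj hj).
case: splitP => j /= hj; first by have := ltn_ord j; lia.
by have /ord_inj -> : i = j :> nat by lia.
Qed.

Lemma ideal_mul_ideal J K : is_ideal K -> is_ideal (ideal_mul J K).
Proof.
move=> hK; split; [exact: ideal_mul0|exact: ideal_mulD|move=> a x].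
elim/ideal_mul_ind => [|y z hy hz|b c hb hc].
- by rewrite mulr0; exact: ideal_mul0.
- by rewrite mulrDr; exact: ideal_mulD.
- by rewrite mulrCA; apply: ideal_mul_mem => //; exact: idealM.
Qed.

Lemma ideal_pow_ideal J n : is_ideal (ideal_pow J n).
Proof. by elim: n => [|n IHn] //=; exact: ideal_mul_ideal. Qed.

Lemma ideal_powD_mem J m n a b :
  ideal_pow J m a -> ideal_pow J n b -> ideal_pow J (m + n) (a * b).
Proof.
elim: m a => [|m IHm] a ha hb; first exact: idealM (ideal_pow_ideal _ _) hb.
move: ha; rewrite /=; elim/ideal_mul_ind => [|y z hy hz|c d hc hd].
- by rewrite mul0r; exact: ideal0 (ideal_pow_ideal _ (m + n).+1).
- by rewrite mulrDl; exact: (idealD (ideal_pow_ideal _ (m + n).+1)).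
- by rewrite -mulrA; apply: ideal_mul_mem => //; exact: IHm.
Qed.

(** The induction on [m] generalises [P], so that factors split off at the left are absorbed into
    the predicate. *)
Lemma ideal_pow_ind J m n (P : R -> Prop) : P 0 ->
  (forall x y, P x -> P y -> P (x + y)) ->
  (forall a b, ideal_pow J m a -> ideal_pow J n b -> P (a * b)) ->
  forall x, ideal_pow J (m + n) x -> P x.
Proof.
move=> P0 PD; elim: m P P0 PD => [|m IHm] P P0 PD PM x.
  by rewrite add0n => hx; rewrite -[x]mul1r; exact: PM.
rewrite addSn /=; elim/ideal_mul_ind => // a b ha; apply: (IHm (fun b => P (a * b))).
- by rewrite mulr0.
- by move=> y z; rewrite mulrDr; exact: PD.
- by move=> c d hc hd; rewrite mulrA; apply: PM => //; exact: ideal_mul_mem.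
Qed.

Lemma ideal_pow_le J m n x : (m <= n)%N -> ideal_pow J n x -> ideal_pow J m x.
Proof.
move=> /subnK <-; rewrite addnC; elim/ideal_pow_ind => [|y z|a b ha _].
- exact: ideal0 (ideal_pow_ideal _ _).
- exact: idealD (ideal_pow_ideal _ _).
- exact: idealMr (ideal_pow_ideal _ _) ha.
Qed.

Lemma ideal_pow_sub J K n x : J `<=` K -> ideal_pow J n x -> ideal_pow K n x.
Proof.
move=> sJK; elim: n x => [//|n IHn] x /=; elim/ideal_mul_ind => [|y z|a b ha hb].
- exact: ideal_mul0.
- exact: ideal_mulD.
- by apply: ideal_mul_mem; [exact: sJK|exact: IHn].
Qed.

Lemma ideal_pow1 J x : J x -> ideal_pow J 1 x.
Proof. by move=> hx; rewrite -[x]mulr1; exact: ideal_mul_mem. Qed.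

Lemma ideal_pow1E J x : is_ideal J -> ideal_pow J 1 x -> J x.
Proof.
move=> hJ /=; elim/ideal_mul_ind => [|y z|a b ha _].
- exact: ideal0.
- exact: idealD.
- exact: idealMr.
Qed.

Lemma ideal_powX J n x : J x -> ideal_pow J n (x ^+ n).
Proof.
by move=> hx; elim: n => [//|n IHn]; rewrite exprS; exact: ideal_mul_mem.
Qed.

(** Written as a product with the unit ideal, the generated ideal inherits [ideal_mul_ind] as its
    induction principle. *)
Definition ideal_gen (X : set R) : set R := ideal_mul X setT.

Lemma ideal_gen_ideal (X : set R) : is_ideal (ideal_gen X).
Proof. exact: ideal_mul_ideal. Qed.

Lemma sub_ideal_gen (X : set R) x : X x -> ideal_gen X x.
Proof. by move=> hx; rewrite -[x]mulr1; exact: ideal_mul_mem. Qed.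

Lemma ideal_gen_min (X : set R) J x :
  is_ideal J -> X `<=` J -> ideal_gen X x -> J x.
Proof.
move=> hJ sXJ; elim/ideal_mul_ind => [|y z|a b ha _].
- exact: ideal0.
- exact: idealD.
- by apply: idealMr => //; exact: sXJ.
Qed.

Definition ideal_add J K : set R := [set x | exists2 a, J a & K (x - a)].

Lemma ideal_add_ideal J K : is_ideal J -> is_ideal K -> is_ideal (ideal_add J K).
Proof.
move=> hJ hK; split=> [|x y [a ha hx] [b hb hy]|c x [a ha hx]].
- by exists 0; rewrite ?subr0; exact: ideal0.
- exists (a + b); first exact: idealD.
  by rewrite opprD addrACA; exact: idealD.
- by exists (c * a); rewrite -?mulrBr; exact: idealM.
Qed.

Lemma ideal_addl J K x : is_ideal K -> J x -> ideal_add J K x.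
Proof. by move=> hK hx; exists x; rewrite ?subrr //; exact: ideal0. Qed.

Lemma ideal_addr J K x : is_ideal J -> K x -> ideal_add J K x.
Proof. by move=> hJ hx; exists 0; rewrite ?subr0 //; exact: ideal0. Qed.

Lemma ideal_addP J K x : ideal_add J K x -> exists a b, [/\ J a, K b & x = a + b].
Proof. by move=> [a ha hb]; exists a, (x - a); split=> //; rewrite addrC subrK. Qed.

Lemma ideal_add_mem J K x y : J x -> K y -> ideal_add J K (x + y).
Proof. by move=> hx hy; exists x => //; rewrite addrC addKr. Qed.

Lemma ideal_add_sub J K J' K' x : J `<=` J' -> K `<=` K' ->
  ideal_add J K x -> ideal_add J' K' x.
Proof. by move=> sJ sK [a ha hb]; exists a; [exact: sJ|exact: sK]. Qed.

(* Every product of n elements of J + K lies in J^n or picks up a factor in K. *)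
Lemma ideal_pow_add J K n x : is_ideal J -> is_ideal K ->
  ideal_pow (ideal_add J K) n x -> ideal_add (ideal_pow J n) K x.
Proof.
move=> hJ hK; elim: n x => [|n IHn] x /=; first by move=> _; exact: ideal_addl.
have hI := ideal_add_ideal (ideal_pow_ideal J n.+1) hK.
elim/ideal_mul_ind => [|y z|a b ha /IHn hb]; [exact: ideal0|exact: idealD|].
have [a1 [a2 [ha1 ha2 ->]]] := ideal_addP ha.
have [b1 [b2 [hb1 hb2 ->]]] := ideal_addP hb.
rewrite mulrDl mulrDr -addrA; apply: ideal_add_mem; first exact: ideal_mul_mem.
by apply: idealD => //; [exact: idealM|exact: idealMr].
Qed.

End IdealCalculus.

Arguments idealM {R J a x}.
Arguments idealMr {R J a x}.

Lemma ideal_preim (R R' : comPzRingType) (f : {rmorphism R -> R'}) (J : set R') :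
  is_ideal J -> is_ideal (f @^-1` J).
Proof.
move=> hJ; split=> [|x y|a x] /=; rewrite ?rmorph0 ?rmorphD ?rmorphM.
- exact: ideal0.
- exact: idealD.
- exact: idealM.
Qed.

Lemma ideal_pow_rmorph (R R' : comPzRingType) (f : {rmorphism R -> R'})
    (J : set R) (K : set R') n x :
  (forall y, J y -> K (f y)) -> ideal_pow J n x -> ideal_pow K n (f x).
Proof.
move=> sJK; elim: n x => [//|n IHn] x /=; elim/ideal_mul_ind => [|y z|a b ha hb].
- by rewrite rmorph0; exact: ideal_mul0.
- by rewrite rmorphD; exact: ideal_mulD.
- by rewrite rmorphM; apply: ideal_mul_mem; [exact: sJK|exact: IHn].
Qed.

(** * Noetherian rings *)

Definition fin_gen (R : comPzRingType) (J : set R) : Prop :=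
  exists (r : nat) (g : 'I_r -> R),
    (forall i, J (g i)) /\ forall x, J x -> exists c : 'I_r -> R, x = \sum_i c i * g i.

Definition noetherian (R : comPzRingType) : Prop :=
  forall J : set R, is_ideal J -> fin_gen J.

Lemma noetherian_surj (R R' : comPzRingType) (f : {rmorphism R -> R'}) :
  (forall y, exists x, f x = y) -> noetherian R -> noetherian R'.
Proof.
move=> fsurj noR J hJ; have [r [g [hg gen]]] := noR _ (ideal_preim f hJ).
exists r, (f \o g); split=> // y hy.
have [x fx] := fsurj y; have [|c cE] := gen x; first by rewrite /preimage /= fx.
by exists (f \o c); rewrite -fx cE rmorph_sum; apply: eq_bigr => i _; rewrite rmorphM.
Qed.

(** Without a maximal member, dependent choice gives a strictly increasing chain in [F]; its union
    is finitely generated, and all generators occur at one stage. *)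
Lemma noetherian_max (R : comPzRingType) (F : set (set R)) J0 : noetherian R ->
  (forall J, F J -> is_ideal J) -> F J0 ->
  exists2 J, F J & forall K, F K -> J `<=` K -> K `<=` J.
Proof.
move=> noR hF F0; apply: contrapT => nomax.
have next J : F J -> exists K, [/\ F K, J `<=` K & ~ K `<=` J].
  move=> FJ; apply: contrapT => h; apply: nomax; exists J => // K FK sJK.
  by apply: contrapT => nK; apply: h; exists K.
have nextf (s : {J | F J}) :
    {t : {J | F J} | sval s `<=` sval t /\ ~ sval t `<=` sval s}.
  apply: cid; have [K [FK sK nK]] := next _ (svalP s).
  by exists (exist _ K FK).
pose u := fix u n : {J | F J} :=
  if n is n'.+1 then sval (nextf (u n')) else exist _ J0 F0.
have uS n : sval (u n) `<=` sval (u n.+1) by case: (svalP (nextf (u n))).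
have uN n : ~ sval (u n.+1) `<=` sval (u n) by case: (svalP (nextf (u n))).
have umono m n : (m <= n)%N -> sval (u m) `<=` sval (u n).
  move=> /subnK <-; elim: (n - m)%N => [//|k IHk] x /IHk hx.
  by rewrite addSn; exact: uS.
pose U := [set x | exists n, sval (u n) x].
have hI n : is_ideal (sval (u n)) by apply: hF; exact: svalP.
have hU : is_ideal U.
  split=> [|x y [m hx] [n hy]|a x [n hx]].
  - by exists 0%N; exact: ideal0.
  - exists (maxn m n); apply: idealD => //.
      exact: umono (leq_maxl _ _) _ hx.
    exact: umono (leq_maxr _ _) _ hy.
  - by exists n; exact: idealM.
have [r [g [hg gen]]] := noR _ hU.
pose N (i : 'I_r) := sval (cid (hg i)).
pose M := \max_(i < r) N i.
apply: (uN M) => x hx; have [|c ->] := gen x; first by exists M.+1.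
apply: ideal_sum => // i _; apply: idealM => //.
exact: umono (leq_bigmax i) _ (svalP (cid (hg i))).
Qed.

Lemma nondecreasing_subseq (u : nat -> nat) : exists s : nat -> nat,
  (forall n, (s n < s n.+1)%N) /\ forall n, (u (s n) <= u (s n.+1))%N.
Proof.
(* Beyond any index some value is minimal for the rest of the sequence, as values cannot decrease
   forever. The subsequence collects such indices. *)
have H k : exists m, (k <= m)%N /\ forall l, (m <= l)%N -> (u m <= u l)%N.
  have [v] := ubnP (u k); elim: v k => // v IHv k hk.
  have [h|/existsNP[l /not_implyP[hl /negP]]] :=
    pselect (forall l, (k <= l)%N -> (u k <= u l)%N); first by exists k.
  rewrite -ltnNge => hlk; have [|m [hm Hm]] := IHv l.
    by apply: leq_trans hlk _.
  by exists m; split=> //; exact: leq_trans hm.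
pose f k := sval (cid (H k)).
have fP k : (k <= f k)%N /\ forall l, (f k <= l)%N -> (u (f k) <= u l)%N.
  exact: (svalP (cid (H k))).
pose s := fix s n := if n is n'.+1 then f (s n').+1 else f 0%N.
have sS n : (s n < s n.+1)%N by exact: (fP (s n).+1).1.
by exists s; split=> // n; case: n => [|n]; apply: (fP _).2; exact: ltnW (sS _).
Qed.

Lemma dickson n (u : nat -> 'X_{1..n}) :
  exists i j, (i < j)%N /\ (u i <= u j)%MM.
Proof.
have H b : exists s : nat -> nat, (forall k, (s k < s k.+1)%N) /\
    forall i : 'I_n, (i < b)%N -> forall k, (u (s k) i <= u (s k.+1) i)%N; last first.
  have [s [sS su]] := H n; exists (s 0%N), (s 1%N); split=> //.
  by apply/mnm_lepP => i; exact: su (ltn_ord i) 0%N.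
elim: b => [|b [s [sS su]]]; first by exists id.
have [bn|nb] := ltnP b n; last first.
  by exists s; split=> // i hi; apply: su; have := ltn_ord i; lia.
have [t [tS tu]] := nondecreasing_subseq (fun k => u (s k) (Ordinal bn)).
have sm k l : (k < l)%N -> (s k < s l)%N.
  by apply: (homo_ltn (f := s) (r := fun a b => (a < b)%N)) => // x y z; exact: ltn_trans.
exists (s \o t); split=> [k|i]; first exact: sm.
rewrite ltnS leq_eqVlt => /orP[/eqP ib|ib] k.
  have -> : i = Ordinal bn by exact: val_inj.
  exact: tu.
have sml k' l : (k' <= l)%N -> (u (s k') i <= u (s l) i)%N.
  apply: (homo_leq (f := fun a => u (s a) i) (r := fun a b => (a <= b)%N)) => // [x y z|j].
    exact: leq_trans.
  exact: su.
exact: sml (ltnW (tS _)).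
Qed.

(** Were [J] not finitely generated, one could choose forever an element of [J] outside the ideal of
    the previous choices, with smallest leading monomial. By Dickson's lemma some leading monomial
    divides a later one, and cancelling the latter contradicts minimality. *)
Lemma mpoly_noetherian (K : fieldType) n : noetherian {mpoly K[n]}.
Proof.
move=> J hJ; apply: contrapT => nfg.
pose G (s : seq {mpoly K[n]}) := ideal_gen [set x | x \in s].
have step (s : seq {mpoly K[n]}) : (forall x, x \in s -> J x) ->
    exists f, [/\ J f, ~ G s f & forall h, J h -> ~ G s h -> (mlead f <= mlead h)%O].
  move=> sJ.
  have [f0 [Jf0 nf0]] : exists f, J f /\ ~ G s f.
    apply: contrapT => h; apply: nfg.
    exists (size s), (fun i => s`_i); split=> [i|x Jx]; first by apply: sJ; exact: mem_nth.
    have : G s x by apply: contrapT => nx; apply: h; exists x.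
    elim/ideal_mul_ind => [|y z [c ->] [d ->]|a b + _].
    - by exists (fun=> 0); rewrite big1 // => i _; rewrite mul0r.
    - exists (fun i => c i + d i); rewrite -big_split; apply: eq_bigr => i _.
      by rewrite mulrDl.
    - move=> /= /(nthP 0)[i hi <-].
      exists (fun j => if j == Ordinal hi then b else 0).
      rewrite (bigD1 (Ordinal hi)) //= eqxx big1 ?addr0 1?mulrC // => j /negbTE ->.
      by rewrite mul0r.
  have := Logic.eq_refl (mlead f0); move: {2}(mlead f0) => m.
  elim/(well_founded_ind (@ltom_wf n)): m f0 Jf0 nf0 => m IH f Jf nf fm.
  have [h|/existsNP[h /not_implyP[Jh /not_implyP[nh /negP]]]] := pselect
    (forall h, J h -> ~ G s h -> (mlead f <= mlead h)%O); first by exists f.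
  by rewrite -ltNge => lt; apply: (IH (mlead h)) _ Jh nh erefl; rewrite -fm.
pose nextf (s : {s : seq {mpoly K[n]} | forall x, x \in s -> J x}) := cid (step _ (svalP s)).
have nextP s f : (forall x, x \in s -> J x) -> J f -> forall x, x \in f :: s -> J x.
  by move=> sJ Jf x; rewrite inE => /orP[/eqP->//|]; exact: sJ.
pose T := {s : seq {mpoly K[n]} | forall x, x \in s -> J x}.
pose nx (s : T) : T := exist _ (sval (nextf s) :: sval s)
  (nextP _ _ (svalP s) (let: And3 h _ _ := svalP (nextf s) in h)).
have nil0 (x : {mpoly K[n]}) : x \in [::] -> J x by [].
pose S k : T := iter k nx (exist _ [::] nil0).
pose f k := sval (nextf (S k)).
have [i [j [ij le_ij]]] := dickson (fun k => mlead (f k)).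
have fS k l : (k < l)%N -> f k \in sval (S l).
  elim: l => // l IHl; rewrite ltnS leq_eqVlt => /orP[/eqP<-|/IHl h].
    exact: mem_head.
  by rewrite /= in_cons h orbT.
have [Jfj nfj minj] := svalP (nextf (S j)); have [Jfi nfi _] := svalP (nextf (S i)).
rewrite -/(f j) -/(f i) in Jfj nfj minj Jfi nfi.
have hG : is_ideal (G (sval (S j))) by exact: ideal_gen_ideal.
have fi0 : f i != 0.
  by apply/eqP => h; apply: nfi; rewrite h; exact: ideal0 (ideal_gen_ideal _).
have fj0 : f j != 0 by apply/eqP => h; apply: nfj; rewrite h; exact: ideal0.
pose c := mleadc (f j) / mleadc (f i).
pose q := (c *: 'X_[mlead (f j) - mlead (f i)]) * f i.
have Gq : G (sval (S j)) q by apply: idealM => //; apply: sub_ideal_gen; exact: fS.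
have c0 : c != 0 by rewrite mulf_neq0 ?invr_eq0 ?mleadc_eq0.
have cX0 : c *: 'X_[mlead (f j) - mlead (f i)] != 0 :> {mpoly K[n]}.
  by rewrite mscalerI negb_or c0 /= -mleadc_eq0 mleadXm mcoeffX eqxx oner_eq0.
have qlead : mlead q = mlead (f j) by rewrite mleadM // mleadZ // mleadXm submK.
have qlc : mleadc q = mleadc (f j).
  by rewrite mleadM // mleadcM mleadcZE mleadXm mcoeffX eqxx mulr1 divfK // mleadc_eq0.
have nfq : ~ G (sval (S j)) (f j - q).
  by move=> h; apply: nfj; exact: idealBr h Gq.
have Jfq : J (f j - q) by apply: idealB => //; exact: idealM.
have := minj _ Jfq nfq.
have fq0 : f j - q != 0.
  by apply/eqP => h; apply: nfq; rewrite h; exact: ideal0.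
have lele : (mlead (f j - q) <= mlead (f j))%O.
  by apply: (le_trans (mleadB_le _ _)); rewrite qlead joinxx.
move=> ge; have /eqP eqm : mlead (f j - q) == mlead (f j).
  by rewrite eq_le lele ge.
have : (f j - q)@_(mlead (f j - q)) == 0.
  by rewrite eqm mcoeffB -{2}qlead qlc subrr.
by rewrite mleadc_eq0 (negbTE fq0).
Qed.

(** * Linear functionals *)

Section Functionals.
Variables (K : fieldType) (U : lmodType K).

Definition subspace (V : set U) : Prop :=
  V 0 /\ forall (a : K) x y, V x -> V y -> V (a *: x + y).

Lemma exists_functional (V : set U) (e : U) : subspace V -> ~ V e ->
  exists l : U -> K,
    [/\ forall a x y, l (a *: x + y) = a * l x + l y,
        forall x, V x -> l x = 0 & l e = 1].
Proof.
move=> hV nVe.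
pose good W := [/\ subspace W, V `<=` W & ~ W e].
have [|W [PW maxW]] := @Zorn_bigcup U [set W | W = set0 \/ good W].
  move=> F sF totF.
  have [[X [FX gX]]|nX] := pselect (exists X, F X /\ good X); last first.
    left; apply/seteqP; split=> // x [X FX Xx]; case: (sF _ FX) => [X0|gX].
      by move: Xx; rewrite X0.
    by case: nX; exists X.
  right; split.
  - split=> [|a x y [Y FY Yx] [Z FZ Zy]].
      by exists X => //; case: gX => [[]].
    have main Y' Z' : F Y' -> F Z' -> Y' x -> Z' y -> Y' `<=` Z' -> 
        (\bigcup_(X in F) X) (a *: x + y).
      move=> FY' FZ' Yx' Zy' YZ; exists Z' => //; case: (sF _ FZ') => [Z0|[[_ h] _ _]].
        by move: Zy'; rewrite Z0.
      by apply: h => //; exact: YZ.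
    have main2 Y' Z' : F Y' -> F Z' -> Y' x -> Z' y -> Z' `<=` Y' -> 
        (\bigcup_(X in F) X) (a *: x + y).
      move=> FY' FZ' Yx' Zy' YZ; exists Y' => //; case: (sF _ FY') => [Z0|[[_ h] _ _]].
        by move: Yx'; rewrite Z0.
      by apply: h => //; exact: YZ.
    by case: (totF _ _ FY FZ) => h; [apply: (main Y Z)|apply: (main2 Y Z)].
  - by move=> x Vx; exists X => //; case: gX => _ + _; apply.
  - move=> [Y FY Ye]; case: (sF _ FY) => [Y0|[_ _]//]; by move: Ye; rewrite Y0.
have gW : good W.
  case: PW => // W0; exfalso; apply: (maxW V); last by right; split.
  by rewrite W0; split=> [x []|h]; apply: (h 0); case: hV.
have [[W0 WD] sVW nWe] := gW.
have WZ a x : W x -> W (a *: x) by move=> Wx; rewrite -[_ *: _]addr0; exact: WD.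
have WB x y : W x -> W y -> W (x - y).
  by move=> Wx Wy; rewrite addrC -scaleN1r; exact: WD.
(* By maximality [W] and [e] span everything; the coefficient of [e] modulo [W] is the functional
   sought. *)
have key v : exists c, W (v - c *: e).
  have [Wv|nWv] := pselect (W v); first by exists 0; rewrite scale0r subr0.
  pose W' := [set x | exists c, W (x - c *: v)].
  have [c Wc] : W' e.
    apply: contrapT => nW'e; apply: (maxW W').
      split=> [x Wx|h]; first by exists 0; rewrite scale0r subr0.
      by apply: nWv; apply: h; exists 1; rewrite scale1r subrr.
    right; split=> //.
      split=> [|a x y [c Wc] [d Wd]]; first by exists 0; rewrite scale0r subr0.
      exists (a * c + d); rewrite scalerDl -scalerA opprD addrACA -scalerBr.
      exact: WD.
    by move=> x Vx; exists 0; rewrite scale0r subr0; exact: sVW.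
  exists c^-1; have c0 : c != 0.
    by apply/eqP => c0; apply: nWe; rewrite -[e]subr0 -(scale0r v) -c0.
  have -> : v - c^-1 *: e = - c^-1 *: (e - c *: v).
    by rewrite scalerBr !scaleNr opprK scalerA mulVf // scale1r addrC.
  exact: WZ.
pose l v := sval (cid (key v)).
have lP v : W (v - l v *: e) by exact: (svalP (cid (key v))).
have uniq v c : W (v - c *: e) -> c = l v.
  move=> Wc; apply/eqP; rewrite -subr_eq0; apply: contraT => nz; case: nWe.
  have := WB _ _ Wc (lP v); rewrite opprB addrC addrA subrK -scaleNr -scalerDl addrC.
  move=> /(WZ (l v - c)^-1); rewrite addrC scalerA mulVf ?scale1r //.
  by rewrite -opprB oppr_eq0.
exists l; split=> [a x y|x Vx|].
- apply/esym/uniq; rewrite scalerDl -scalerA opprD addrACA -scalerBr.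
  exact: WD.
- by apply/esym/uniq; rewrite scale0r subr0; exact: sVW.
- by apply/esym/uniq; rewrite scale1r subrr.
Qed.

End Functionals.

(** * Polynomial rings and disjoint variables *)

Lemma ideal_pow_gen (R R' : comPzRingType) (f : {rmorphism R -> R'}) (J : set R) n x :
  ideal_pow (ideal_gen (f @` J)) n x -> ideal_gen (f @` ideal_pow J n) x.
Proof.
elim: n x => [x _|n IHn x /=].
  rewrite -[x]mul1r; apply: ideal_mul_mem => //; exists 1 => //; exact: rmorph1.
have hI := ideal_gen_ideal (f @` ideal_pow J n.+1).
elim/ideal_mul_ind => [|y z|a b ha /IHn hb]; [exact: ideal0|exact: idealD|].
move: ha; elim/ideal_mul_ind => [|y z|_ a' [u Ju <-] _].
- by rewrite mul0r; exact: ideal0.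
- by rewrite mulrDl; exact: idealD.
move: hb; elim/ideal_mul_ind => [|y z|_ b' [v Jv <-] _].
- by rewrite mulr0; exact: ideal0.
- by rewrite mulrDr; exact: idealD.
rewrite mulrACA; apply: ideal_mul_mem => //; exists (u * v); last exact: rmorphM.
exact: ideal_mul_mem.
Qed.

Lemma mpoly_rmorph_mod (K : nzRingType) d (R : comPzRingType)
    (f g : {rmorphism {mpoly K[d]} -> R}) (Z : set R) : is_ideal Z ->
  (forall c, Z (f c%:MP - g c%:MP)) -> (forall i, Z (f 'X_i - g 'X_i)) ->
  forall p, Z (f p - g p).
Proof.
move=> hZ hC hX.
have ZM p q : Z (f p - g p) -> Z (f q - g q) -> Z (f (p * q) - g (p * q)).
  move=> hp hq; rewrite !rmorphM.
  have -> : f p * f q - g p * g q = f p * (f q - g q) + (f p - g p) * g q.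
    by rewrite mulrBr mulrBl addrA subrK.
  by apply: idealD => //; [exact: idealM|exact: idealMr].
have Z1 : Z (f 1 - g 1) by rewrite !rmorph1 subrr; exact: ideal0.
have ZX m : Z (f 'X_[m] - g 'X_[m]).
  rewrite mpolyXE_id; apply: (big_ind (fun p => Z (f p - g p))) => // i _.
  by elim: (m i) => [|k IHk]; rewrite ?expr0 // exprS; exact: ZM.
elim/mpolyind => [|c m p _ _ hp]; first by rewrite !rmorph0 subrr; exact: ideal0.
rewrite !rmorphD opprD addrACA; apply: idealD => //.
by rewrite -mul_mpolyC; exact: ZM.
Qed.

Section DisjointVariables.
Variables (K : fieldType) (C : comNzRingType) (iC : {rmorphism K -> C}) (d : nat).
Local Notation PP := {mpoly C[d]}.
Implicit Types (l : {mpoly K[d]} -> K) (p : PP) (b : set C) (V : set {mpoly K[d]}).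

Definition coef_ideal b : set PP := [set p | forall m, b p@_m].

Lemma coef_ideal_ideal b : is_ideal b -> is_ideal (coef_ideal b).
Proof.
move=> hb; split=> [m|p q hp hq m|q p hp m].
- by rewrite mcoeff0; exact: ideal0.
- by rewrite mcoeffD; exact: idealD.
- by rewrite mcoeffM; apply: ideal_sum => // i _; exact: idealM.
Qed.

Lemma coef_idealC b c : is_ideal b -> b c -> coef_ideal b c%:MP.
Proof.
by move=> hb hc m; rewrite mcoeffC; exact: idealMr.
Qed.

Definition linear_form l := forall a x y, l (a *: x + y) = a * l x + l y.

(** The [C]-linear extension to C[X] of a linear form [l] on K[X]. *)
Definition coef_form l (p : PP) : C := \sum_(m <- msupp p) p@_m * iC (l 'X_[m]).

Lemma coef_formE l p k : (msize p <= k)%N ->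
  coef_form l p = \sum_(m : 'X_{1..d < k}) p@_m * iC (l 'X_[m]).
Proof.
pose I := [the subFinType _ of 'X_{1..d < k}] => le_pk.
rewrite /coef_form (big_mksub I) ?msupp_uniq //=; first last.
  by move=> x /msize_mdeg_lt /leq_trans; apply.
rewrite big_rmcond //= => i /memN_msupp_eq0 ->.
by rewrite mul0r.
Qed.

Lemma coef_formD l p q : coef_form l (p + q) = coef_form l p + coef_form l q.
Proof.
pose k := maxn (msize (p + q)) (maxn (msize p) (msize q)).
rewrite !(@coef_formE _ _ k) ?leq_max ?leqnn ?orbT //.
by rewrite -big_split; apply: eq_bigr => i _; rewrite mcoeffD mulrDl.
Qed.

Lemma coef_formCM l c p : coef_form l (c%:MP * p) = c * coef_form l p.
Proof.
pose k := maxn (msize (c%:MP * p)) (msize p).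
rewrite !(@coef_formE _ _ k) ?leq_max ?leqnn ?orbT //.
by rewrite mulr_sumr; apply: eq_bigr => i _; rewrite mcoeffCM mulrA.
Qed.

Lemma linear_form0 l : linear_form l -> l 0 = 0.
Proof.
move=> hl; have := hl 1 0 0; rewrite scaler0 mul1r addr0 => h.
by apply: (addrI (l 0)); rewrite -h addr0.
Qed.

Lemma linear_formD l x y : linear_form l -> l (x + y) = l x + l y.
Proof. by move=> hl; rewrite -[x in LHS]scale1r hl mul1r. Qed.

Lemma linear_formZ l a x : linear_form l -> l (a *: x) = a * l x.
Proof. by move=> hl; rewrite -[a *: x]addr0 hl linear_form0 // addr0. Qed.

Lemma coef_form_map l v : linear_form l -> coef_form l (map_mpoly iC v) = iC (l v).
Proof.
move=> hl; elim/mpolyind: v => [|c m p _ _ hp].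
  by rewrite rmorph0 /coef_form msupp0 big_nil linear_form0 // rmorph0.
rewrite !rmorphD coef_formD hp linear_formD // rmorphD; congr (_ + _).
rewrite -mul_mpolyC rmorphM /= map_mpolyC map_mpolyX coef_formCM mul_mpolyC.
rewrite linear_formZ // rmorphM; congr (_ * _).
by rewrite /coef_form msuppX big_seq1 mcoeffX eqxx mul1r.
Qed.

Lemma coef_form0 l : coef_form l 0 = 0.
Proof. by rewrite /coef_form msupp0 big_nil. Qed.

Lemma coef_form_sum l r (F : 'I_r -> PP) :
  coef_form l (\sum_i F i) = \sum_i coef_form l (F i).
Proof. by apply: (big_morph (coef_form l)) => [x y|]; rewrite ?coef_formD ?coef_form0. Qed.

Lemma coef_form_in l p b : is_ideal b -> coef_ideal b p -> b (coef_form l p).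
Proof. by move=> hb hp; apply: ideal_sum => // m _; exact: idealMr. Qed.

Definition ext_ideal V : set PP := ideal_gen (map_mpoly iC @` V).

Lemma ext_ideal_mem V v c : V v -> ext_ideal V (c * map_mpoly iC v).
Proof.
by move=> Vv; apply: idealM; [exact: ideal_gen_ideal|apply: sub_ideal_gen; exists v].
Qed.

Lemma ext_ideal_ind V (P : PP -> Prop) : is_ideal V -> P 0 ->
  (forall x y, P x -> P y -> P (x + y)) ->
  (forall c v, V v -> P (c%:MP * map_mpoly iC v)) -> forall x, ext_ideal V x -> P x.
Proof.
move=> hV P0 PD PM; apply: ideal_mul_ind => // _ q [v Vv <-] _.
rewrite mulrC; elim/mpolyind: q => [|c m q _ _ hq]; first by rewrite mul0r.
rewrite mulrDl; apply: PD => //.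
rewrite -mul_mpolyC -(map_mpolyX iC) -mulrA -rmorphM; apply: PM; exact: idealM.
Qed.

Lemma ext_ideal_sum V x : is_ideal V -> ext_ideal V x ->
  exists r (c : 'I_r -> C) (v : 'I_r -> {mpoly K[d]}),
    (forall i, V (v i)) /\ x = \sum_i (c i)%:MP * map_mpoly iC (v i).
Proof.
move=> hV; move: x; apply: (ext_ideal_ind hV) => [|y z|c v Vv].
- by exists 0%N, (fun=> 0), (fun=> 0); rewrite big_ord0; split=> [[]|].
- move=> [r [c [v [Vv ->]]]] [r' [c' [v' [Vv' ->]]]].
  exists (r + r')%N, (fun i => match split i with inl j => c j | inr j => c' j end),
    (fun i => match split i with inl j => v j | inr j => v' j end).
  split=> [i|]; first by case: splitP => j _.
  rewrite big_split_ord; congr (_ + _); apply: eq_bigr => i _.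
    by rewrite -[lshift _ _]/(unsplit (inl i)) unsplitK.
  by rewrite -[rshift _ _]/(unsplit (inr i)) unsplitK.
- by exists 1%N, (fun=> c), (fun=> v); rewrite big_ord1.
Qed.

Definition span_of r (e : 'I_r -> {mpoly K[d]}) V : set {mpoly K[d]} :=
  [set x | exists a : 'I_r -> K, V (x - \sum_i a i *: e i)].

(** Induction on the length of the sum. If the last [e] depends on the others modulo [V], it is
    eliminated; otherwise a form that kills [V] and the other [e] and is 1 on the last shows that
    its coefficient lies in [b]. The set [S] is abstract because the lemma serves both for the sum
    of two ideals, with [E] everything, and for their intersection, with [V] zero. *)
Lemma separation_sum b V (S E : set _) r (c : 'I_r -> C) e :
  is_ideal b -> subspace V -> (forall x y, S x -> S y -> S (x + y)) ->
  (forall x y, S x -> S y -> S (x - y)) -> S 0 ->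
  (forall a v, V v -> S (a%:MP * map_mpoly iC v)) ->
  (forall a v, b a -> E v -> S (a%:MP * map_mpoly iC v)) ->
  (forall l s, linear_form l -> (forall v, V v -> l v = 0) -> S s -> b (coef_form l s)) ->
  (forall i, E (e i)) ->
  let w := \sum_i (c i)%:MP * map_mpoly iC (e i) in
  (forall l, linear_form l -> (forall v, V v -> l v = 0) -> b (coef_form l w)) -> S w.
Proof.
move=> hb hV SD SB S0 SV SE Sl; elim: r c e => [|r IHr] c e Ee w hw; rewrite {}/w in hw *.
  by rewrite big_ord0.
pose e' i := e (widen_ord (leqnSn r) i); pose c' i := c (widen_ord (leqnSn r) i).
have Ee' i : E (e' i) by exact: Ee.
rewrite big_ord_recr /=; set last := _ * _.
have [[a Va]|nV] := pselect (span_of e' V (e ord_max)).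
  have eE : last = (c ord_max)%:MP * map_mpoly iC (e ord_max - \sum_i a i *: e' i)
      + \sum_i (c ord_max * iC (a i))%:MP * map_mpoly iC (e' i).
    rewrite rmorphB mulrBr; apply/eqP; rewrite -subr_eq; apply/eqP; congr (_ - _).
    rewrite rmorph_sum mulr_sumr; apply: eq_bigr => i _.
    by rewrite /= map_mpolyZ -mul_mpolyC mulrA -mpolyCM.
  have Sv := SV (c ord_max) _ Va.
  have sumE : \sum_i (c' i)%:MP * map_mpoly iC (e' i) + last =
     \sum_i (c' i + c ord_max * iC (a i))%:MP * map_mpoly iC (e' i) +
     (c ord_max)%:MP * map_mpoly iC (e ord_max - \sum_i a i *: e' i).
    rewrite eE addrCA addrC; congr (_ + _); rewrite -big_split; apply: eq_bigr => i _.
    by rewrite mpolyCD mulrDl.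
  rewrite sumE; apply: SD => //; apply: IHr => // l hl lV.
  have := hw l hl lV; rewrite big_ord_recr /= -/last sumE coef_formD.
  by move=> h; have := idealB hb h (Sl _ _ hl lV Sv); rewrite addrK.
have [|l [hl lW l1]] := @exists_functional K _ _ (e ord_max) _ nV.
  split=> [|a x y [f hf] [g hg]].
    exists (fun=> 0); rewrite sub0r big1 ?oppr0; last by move=> i _; rewrite scale0r.
    by case: hV.
  exists (fun i => a * f i + g i).
  have -> : \sum_i (a * f i + g i) *: e' i = a *: (\sum_i f i *: e' i) + \sum_i g i *: e' i.
    rewrite scaler_sumr -big_split; apply: eq_bigr => i _.
    by rewrite scalerDl scalerA.
  by rewrite opprD addrACA -scalerBr; case: hV => _; apply.
have lV v : V v -> l v = 0.
  move=> Vv; apply: lW; exists (fun=> 0); rewrite big1 ?subr0 // => i _.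
  by rewrite scale0r.
have le' i : l (e' i) = 0.
  apply: lW; exists (fun j => (j == i)%:R); rewrite (bigD1 i) //= eqxx scale1r big1.
    by rewrite addr0 subrr; case: hV.
  by move=> j /negbTE->; rewrite scale0r.
have bc : b (c ord_max).
  have := hw l hl lV; rewrite big_ord_recr /= coef_formD coef_form_sum big1 => [|i _].
    by rewrite add0r coef_formCM coef_form_map // l1 rmorph1 mulr1.
  by rewrite coef_formCM coef_form_map // le' rmorph0 mulr0.
have Sla : S last by exact: SE.
apply: SD => //; apply: IHr => // f hf fV.
have := hw f hf fV; rewrite big_ord_recr /= -/last coef_formD => h.
by have := idealB hb h (Sl _ _ hf fV Sla); rewrite addrK.
Qed.

Lemma mpoly_sum_ord (p : PP) : exists r (c : 'I_r -> C) (e : 'I_r -> {mpoly K[d]}),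
  p = \sum_i (c i)%:MP * map_mpoly iC (e i).
Proof.
exists (size (msupp p)), (fun i => p@_(nth 0%MM (msupp p) i)), (fun i => 'X_[nth 0%MM (msupp p) i]).
rewrite {1}[p]mpolyE (big_nth 0%MM) big_mkord; apply: eq_bigr => i _.
by rewrite map_mpolyX mul_mpolyC.
Qed.

Lemma ideal_subspace V : is_ideal V -> subspace V.
Proof.
move=> hV; split=> [|a x y Vx Vy]; first exact: ideal0.
by apply: idealD => //; rewrite -mul_mpolyC; exact: idealM.
Qed.

Lemma coef_form_ext l V x : is_ideal V -> linear_form l ->
  (forall v, V v -> l v = 0) -> ext_ideal V x -> coef_form l x = 0.
Proof.
move=> hV hl lV; move: x; apply: (ext_ideal_ind hV) => [|y z hy hz|c v Vv].
- exact: coef_form0.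
- by rewrite coef_formD hy hz addr0.
- by rewrite coef_formCM coef_form_map // lV // rmorph0 mulr0.
Qed.

Lemma separation b V p : is_ideal b -> is_ideal V ->
  (forall l, linear_form l -> (forall v, V v -> l v = 0) -> b (coef_form l p)) ->
  ideal_add (coef_ideal b) (ext_ideal V) p.
Proof.
move=> hb hV; have [r [c [e ->]]] := mpoly_sum_ord p => hp.
have hB := coef_ideal_ideal hb; have hE : is_ideal (ext_ideal V) by exact: ideal_gen_ideal.
have hS := ideal_add_ideal hB hE.
apply: (separation_sum (E := setT) hb (ideal_subspace hV)) hp => //.
- by move=> *; exact: idealD.
- by move=> *; exact: idealB.
- exact: ideal0.
- by move=> a v Vv; apply: ideal_addr => //; exact: ext_ideal_mem.
- by move=> a v ba _; apply: ideal_addl => //; refine (idealMr hB _); exact: coef_idealC.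
- move=> l s hl lV /ideal_addP[x [y [hx hy ->]]]; rewrite coef_formD.
  by rewrite (coef_form_ext hV hl lV hy) addr0; exact: coef_form_in.
Qed.

(** Tensor products over a field are exact, so ideals in disjoint variables meet in their product.
    This case without loss starts the induction on the diagonal elements. *)
Lemma coef_ext_cap b V p : is_ideal b -> is_ideal V -> coef_ideal b p ->
  ext_ideal V p -> ideal_mul (coef_ideal b) (ext_ideal V) p.
Proof.
move=> hb hV bp /(ext_ideal_sum hV)[r [c [v [Vv pE]]]].
have hB := coef_ideal_ideal hb; have hE : is_ideal (ext_ideal V) by exact: ideal_gen_ideal.
have hS := ideal_mul_ideal (coef_ideal b) hE.
have SB x : ideal_mul (coef_ideal b) (ext_ideal V) x -> coef_ideal b x.
  by apply: ideal_mul_ind => [|y z|y z hy _]; [exact: ideal0|exact: idealD|refine (idealMr hB _)].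
rewrite pE; apply: (separation_sum (E := V) (V := [set 0]) hb) => //.
- by split=> // a x y -> ->; rewrite scaler0 addr0.
- by move=> *; exact: idealD.
- by move=> *; exact: idealB.
- exact: ideal0.
- by move=> a w ->; rewrite rmorph0 mulr0; exact: ideal0.
- move=> a w ba Vw; apply: ideal_mul_mem; first exact: coef_idealC.
  by rewrite -[map_mpoly _ _]mul1r; exact: ext_ideal_mem.
- by move=> l s hl _ /SB hs; exact: coef_form_in.
- by move=> l hl _; rewrite -pE; exact: coef_form_in.
Qed.

End DisjointVariables.

(** * Uniform Artin-Rees along the diagonal *)

Lemma ideal_gen1 (R : comPzRingType) (a x : R) :
  ideal_gen [set a] x -> exists v, x = a * v.
Proof.
elim/ideal_mul_ind => [|y z [v ->] [w ->]|_ b -> _].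
- by exists 0; rewrite mulr0.
- by exists (v + w); rewrite mulrDr.
- by exists b.
Qed.

Lemma colon_ideal (R : comPzRingType) (b : set R) a :
  is_ideal b -> is_ideal [set x | b (a * x)].
Proof.
move=> hb; split=> [|x y|c x] /=.
- by rewrite mulr0; exact: ideal0.
- by rewrite mulrDr; exact: idealD.
- by rewrite mulrCA; exact: idealM.
Qed.

Section Diagonal.
Variables (K : fieldType) (C : comNzRingType) (iC : {rmorphism K -> C}).
Variables (d : nat) (xi : 'I_d -> C).
Local Notation PP := {mpoly C[d]}.
Implicit Types (b : set C) (a h : C) (I V : set {mpoly K[d]}) (p w : PP).

(* Ideals of K[X] and ideals of C live in disjoint variables of C[X]; setting the diagonal
   elements X_i - xi_i to zero one at a time identifies the two sets of variables. *)
Definition diag (i : 'I_d) : PP := 'X_i - (xi i)%:MP.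
Definition diag_ideal (j : nat) : set PP :=
  ideal_gen [set p | exists2 i : 'I_d, (i < j)%N & p = diag i].
Definition diag_mod b V j : set PP :=
  ideal_add (coef_ideal b) (ideal_add (ext_ideal iC V) (diag_ideal j)).

Lemma diag_ideal_ideal j : is_ideal (diag_ideal j).
Proof. exact: ideal_gen_ideal. Qed.

Lemma ext_ideal_ideal V : is_ideal (ext_ideal iC V).
Proof. exact: ideal_gen_ideal. Qed.

Lemma diag_mod_ideal b V j : is_ideal b -> is_ideal (diag_mod b V j).
Proof.
move=> hb; apply: ideal_add_ideal; first exact: coef_ideal_ideal.
by apply: ideal_add_ideal; [exact: ext_ideal_ideal|exact: diag_ideal_ideal].
Qed.

Lemma diag_ideal_mem (i : 'I_d) j p : (i < j)%N -> diag_ideal j (diag i * p).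
Proof.
by move=> ij; apply: idealMr; [exact: diag_ideal_ideal|apply: sub_ideal_gen; exists i].
Qed.

Lemma diag_ideal_le i j p : (i <= j)%N -> diag_ideal i p -> diag_ideal j p.
Proof.
move=> ij; apply: ideal_gen_min; first exact: diag_ideal_ideal.
by move=> _ [k ki ->]; rewrite -[diag k]mulr1; apply: diag_ideal_mem; exact: leq_trans ij.
Qed.

Lemma diag_ideal0 p : diag_ideal 0 p -> p = 0.
Proof.
by apply: (ideal_gen_min (J := [set 0])) => [|_ [//]]; split=> //= [x y -> ->|c x ->]; rewrite ?addr0 ?mulr0.
Qed.

Lemma diag_idealS (j : 'I_d) p : diag_ideal j.+1 p ->
  exists z v, diag_ideal j z /\ p = z + diag j * v.
Proof.
have hz := diag_ideal_ideal j.
elim/ideal_mul_ind => [|x y [z [v [hv ->]]] [z' [v' [hv' ->]]]|_ q [i ij ->] _].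
- by exists 0, 0; rewrite mulr0 addr0; split=> //; exact: ideal0.
- exists (z + z'), (v + v'); rewrite mulrDr addrACA; split=> //; exact: idealD.
- move: ij; rewrite ltnS leq_eqVlt => /orP[/eqP/val_inj->|ij].
    by exists 0, q; rewrite add0r; split=> //; exact: ideal0.
  by exists (diag i * q), 0; rewrite mulr0 addr0; split=> //; exact: diag_ideal_mem.
Qed.

Lemma diag_modP b V j p : diag_mod b V j p -> exists q r z : PP,
  [/\ coef_ideal b q, ext_ideal iC V r, diag_ideal j z & p = q + (r + z)].
Proof.
by move=> /ideal_addP[q [_ [hq /ideal_addP[r [z [hr hz ->]]] ->]]]; exists q, r, z.
Qed.

Lemma diag_mod_coef b V j p : coef_ideal b p -> diag_mod b V j p.
Proof.
move=> hp; apply: ideal_addl => //; apply: ideal_add_ideal.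
  exact: ext_ideal_ideal.
exact: diag_ideal_ideal.
Qed.

Lemma diag_mod_ext b V j p : is_ideal b -> ext_ideal iC V p -> diag_mod b V j p.
Proof.
move=> hb hp; apply: ideal_addr; first exact: coef_ideal_ideal.
by apply: ideal_addl => //; exact: diag_ideal_ideal.
Qed.

Lemma diag_mod_diag b V j p : is_ideal b -> diag_ideal j p -> diag_mod b V j p.
Proof.
move=> hb hp; apply: ideal_addr; first exact: coef_ideal_ideal.
by apply: ideal_addr => //; exact: ext_ideal_ideal.
Qed.

Lemma ext_ideal_sub V V' p : V `<=` V' -> ext_ideal iC V p -> ext_ideal iC V' p.
Proof.
move=> sV; apply: ideal_gen_min; first exact: ext_ideal_ideal.
by move=> _ [v Vv <-]; apply: sub_ideal_gen; exists v => //; exact: sV.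
Qed.

Lemma ext_pow_le I m n p : (m <= n)%N ->
  ext_ideal iC (ideal_pow I n) p -> ext_ideal iC (ideal_pow I m) p.
Proof. by move=> mn; apply: ext_ideal_sub => v; exact: ideal_pow_le. Qed.

Definition adj_ideal b a : set C := ideal_add b (ideal_gen [set a]).
Definition colon1 b a : set C := [set x | b (a * x)].

Lemma adj_ideal_ideal b a : is_ideal b -> is_ideal (adj_ideal b a).
Proof. by move=> hb; apply: ideal_add_ideal => //; exact: ideal_gen_ideal. Qed.

Lemma coef_adj b a p : is_ideal b -> coef_ideal (adj_ideal b a) p ->
  exists q v : PP, coef_ideal b q /\ p = q + a%:MP * v.
Proof.
move=> hb hp; have H m : exists yv : C * C, b yv.1 /\ p@_m = yv.1 + a * yv.2.
  have [y [_ [hy /ideal_gen1[v ->] ->]]] := ideal_addP (hp m).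
  by exists (y, v).
pose f m := sval (cid (H m)); have fP m := svalP (cid (H m)).
exists (\sum_(m <- msupp p) (f m).1 *: 'X_[m]), (\sum_(m <- msupp p) (f m).2 *: 'X_[m]).
split=> [m|].
  rewrite raddf_sum; apply: ideal_sum => // k _ /=.
  by rewrite mcoeffZ; apply: idealMr => //; exact: (fP k).1.
rewrite {1}[p]mpolyE mulr_sumr -big_split; apply: eq_bigr => m _ /=.
by rewrite {1}(fP m).2 scalerDl mul_mpolyC scalerA.
Qed.

Lemma coef_ideal_adj b a (q : PP) : is_ideal b -> coef_ideal b q -> coef_ideal (adj_ideal b a) q.
Proof. by move=> hb hq m; apply: ideal_addl => //; exact: ideal_gen_ideal. Qed.

Lemma coef_adj_mem b a w : is_ideal b -> coef_ideal (adj_ideal b a) (a%:MP * w).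
Proof.
move=> hb m; rewrite mcoeffCM; apply: ideal_addr => //; apply: idealMr.
  exact: ideal_gen_ideal.
exact: sub_ideal_gen.
Qed.

(** Injectivity of multiplication by a diagonal element on the inverse system of quotients by [I^n]:
    a shift of the exponent is allowed, but it may not depend on [I]. *)
Definition diag_injective b (j : 'I_d) : Prop := exists c, forall I n w, is_ideal I ->
  diag_mod b (ideal_pow I (n + c)) j (diag j * w) -> diag_mod b (ideal_pow I n) j w.

Definition const_injective b a (j : nat) : Prop := exists c, forall I n w, is_ideal I ->
  diag_mod b (ideal_pow I (n + c)) j (a%:MP * w) ->
  diag_mod (colon1 b a) (ideal_pow I n) j w.

(** There is no shift here: a form that kills [I^n] turns the relation into one in [C], where [a]
    times the value at [w] is in [b]; then [separation] applies. *)
Lemma const_injective0 b a : is_ideal b -> const_injective b a 0.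
Proof.
move=> hb; exists 0%N => I n w hI; rewrite addn0 => /diag_modP[q [r [z [hq hr]]]].
move=> /diag_ideal0->; rewrite addr0 => aw.
have hV := ideal_pow_ideal I n.
have /ideal_addP[x [y [hx hy ->]]] : ideal_add (coef_ideal (colon1 b a)) (ext_ideal iC (ideal_pow I n)) w.
  apply: separation => // [|l hl lV]; first exact: colon_ideal.
  rewrite /colon1 /= -coef_formCM aw coef_formD (coef_form_ext hV hl lV hr) addr0.
  exact: coef_form_in.
apply: idealD; first exact: diag_mod_ideal (colon_ideal _ hb).
  exact: diag_mod_coef.
by apply: diag_mod_ext => //; exact: colon_ideal.
Qed.

(** A relation a w = diag j v up to negligible terms gives v = a v', by injectivity modulo (b, a).
    Then a (w - diag j v') is negligible and the case of [j] applies. *)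
Lemma const_injectiveS b a (j : 'I_d) : is_ideal b -> diag_injective (adj_ideal b a) j ->
  const_injective b a j -> const_injective b a j.+1.
Proof.
move=> hb [cP hP] [cX hX]; exists (cX + cP)%N => I n w hI.
move=> /diag_modP[q [r [_ [hq hr /diag_idealS[z [v [hz ->]]] aw]]]].
have ha := adj_ideal_ideal a hb.
have hM := diag_mod_ideal (ideal_pow I (n + cX + cP)) j ha.
have [] := hP I (n + cX)%N v hI.
  have -> : diag j * v = a%:MP * w - q - r - z by rewrite aw; ring.
  apply: idealB => //; last exact: diag_mod_diag.
  apply: idealB => //; last by apply: diag_mod_ext => //; rewrite -addnA.
  apply: idealB => //; apply: diag_mod_coef; first exact: coef_adj_mem.
  exact: coef_ideal_adj.
move=> _ /(coef_adj hb)[q' [v' [hq' ->]]] /ideal_addP[r' [z' [hr' hz' vE]]].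
have vE' : v = q' + a%:MP * v' + (r' + z') by rewrite -vE addrC subrK.
have hM2 := diag_mod_ideal (ideal_pow I (n + cX)) j hb.
have h2 := hX I n (w - diag j * v') hI.
have {h2} : diag_mod (colon1 b a) (ideal_pow I n) j (w - diag j * v').
  apply: h2.
  have -> : a%:MP * (w - diag j * v') = q + r + z + diag j * (q' + r' + z').
    by rewrite mulrBr aw vE'; ring.
  apply: idealD => //.
    apply: idealD => //; last exact: diag_mod_diag.
    apply: idealD => //; first exact: diag_mod_coef.
    by apply: diag_mod_ext => //; apply: ext_pow_le hr; rewrite addnA leq_addr.
  apply: idealM => //; apply: idealD => //; last exact: diag_mod_diag.
  by apply: idealD => //; [exact: diag_mod_coef|exact: diag_mod_ext].
move=> /diag_modP[q2 [r2 [z2 [hq2 hr2 hz2 wE]]]].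
have hc := colon_ideal a hb; have hM3 := diag_mod_ideal (ideal_pow I n) j.+1 hc.
rewrite -(subrK (diag j * v') w) wE; apply: idealD => //.
  apply: idealD => //; first exact: diag_mod_coef.
  apply: idealD => //; first exact: diag_mod_ext.
  by apply: diag_mod_diag => //; exact: diag_ideal_le hz2.
by apply: diag_mod_diag => //; exact: diag_ideal_mem.
Qed.

Lemma const_injective_all b a : is_ideal b ->
  (forall j, diag_injective (adj_ideal b a) j) ->
  forall j : nat, (j <= d)%N -> const_injective b a j.
Proof.
move=> hb hP; elim=> [|j IHj] jd; first exact: const_injective0.
by apply: (@const_injectiveS b a (Ordinal jd)) => //; apply: IHj; exact: ltnW.
Qed.

Lemma coef_colon b a (q : PP) : coef_ideal (colon1 b a) q -> coef_ideal b (a%:MP * q).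
Proof. by move=> hq m; rewrite mcoeffCM; exact: hq. Qed.

(** A diagram chase along 0 -> C/(b : a) -> C/b -> C/(b, a) -> 0. Modulo powers of [I] the left map
    is injective only up to a shift, which [const_injective] supplies. *)
Lemma diag_injective_ext b a : is_ideal b ->
  (forall j, diag_injective (adj_ideal b a) j) ->
  (forall j, diag_injective (colon1 b a) j) -> forall j, diag_injective b j.
Proof.
move=> hb hS hC j; have [cX hX] := const_injective_all hb hS (ltnW (ltn_ord j)).
have [cS {}hS] := hS j; have [cC {}hC] := hC j; exists (cC + cX + cS)%N => I n w hI hw.
have hc := colon_ideal a hb; have ha := adj_ideal_ideal a hb.
have [] := hS I (n + cC + cX)%N w hI.
  move: hw; rewrite -!addnA => /diag_modP[q [r [z [hq hr hz ->]]]].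
  have hM := diag_mod_ideal (ideal_pow I (n + (cC + (cX + cS)))) j ha.
  apply: idealD => //; first by apply: diag_mod_coef; exact: coef_ideal_adj.
  by apply: idealD => //; [exact: diag_mod_ext|exact: diag_mod_diag].
move=> _ /(coef_adj hb)[q' [v [hq' ->]]] /ideal_addP[r' [z' [hr' hz' wE]]].
have wE' : w = q' + a%:MP * v + (r' + z') by rewrite -wE addrC subrK.
have hM k := diag_mod_ideal (ideal_pow I k) j hb.
have {}hw : diag_mod b (ideal_pow I (n + cC + cX)) j (diag j * w).
  move: hw => /diag_modP[q [r [z [hq hr hz ->]]]].
  apply: (idealD (hM _)); first exact: diag_mod_coef.
  apply: (idealD (hM _)); last exact: diag_mod_diag.
  by apply: diag_mod_ext => //; apply: ext_pow_le hr; lia.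
have hv : diag_mod (colon1 b a) (ideal_pow I n) j v.
  apply: hC => //; apply: hX => //.
  have -> : a%:MP * (diag j * v) = diag j * w - diag j * (q' + (r' + z')).
    by rewrite wE'; ring.
  apply: (idealB (hM _)) => //; apply: (idealM (hM _)).
  apply: (idealD (hM _)); first exact: diag_mod_coef.
  by apply: (idealD (hM _)); [exact: diag_mod_ext|exact: diag_mod_diag].
have [q2 [r2 [z2 [hq2 hr2 hz2 vE]]]] := diag_modP hv.
rewrite wE'; apply: (idealD (hM _)).
  apply: (idealD (hM _)); first exact: diag_mod_coef.
  rewrite vE mulrDr; apply: (idealD (hM _)); first by apply: diag_mod_coef; exact: coef_colon.
  apply: (idealM (hM _)).
  by apply: (idealD (hM _)); [exact: diag_mod_ext|exact: diag_mod_diag].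
apply: (idealD (hM _)); last exact: diag_mod_diag.
by apply: diag_mod_ext => //; apply: ext_pow_le hr'; lia.
Qed.

Definition diag_killed b h (j : 'I_d) : Prop := exists c, forall I n w, is_ideal I ->
  diag_mod b (ideal_pow I (n + c)) j (diag j * w) ->
  diag_mod b (ideal_pow I n) j (h%:MP * w).

(** As [h] is regular modulo [b], it can be cancelled from h w, again up to the shift of
    [const_injective]. *)
Lemma diag_injective_kill b h : is_ideal b -> colon1 b h `<=` b ->
  (forall j, diag_injective (adj_ideal b h) j) ->
  (forall j, diag_killed b h j) -> forall j, diag_injective b j.
Proof.
move=> hb hh hS hK j; have [cX hX] := const_injective_all hb hS (ltnW (ltn_ord j)).
have [cK {}hK] := hK j; exists (cX + cK)%N => I n w hI; rewrite addnA => /hK/hX H.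
have [q [r [z [hq hr hz ->]]]] := diag_modP (H hI hI).
have hM := diag_mod_ideal (ideal_pow I n) j hb.
apply: idealD => //; first by apply: diag_mod_coef => m; exact: hh.
by apply: idealD => //; [exact: diag_mod_ext|exact: diag_mod_diag].
Qed.

(** A maximal counterexample [b] is prime: if x y is in [b] but neither factor is, then (b, x) and
    (b : x) are strictly larger, and [diag_injective_ext] applies. For the prime itself, the larger
    ideal (b, h) and the killing by [h] are enough. *)
Theorem diag_injective_noetherian : noetherian C ->
  (forall P, is_prime_ideal P -> exists2 h, ~ P h & forall j, diag_killed P h j) ->
  forall b, is_ideal b -> forall j, diag_injective b j.
Proof.
move=> noC kill b0 hb0; apply: contrapT => nb0.
have [||b [hb nb] maxb] := @noetherian_max C
  [set b | is_ideal b /\ ~ forall j, diag_injective b j] b0 noC; [by move=> J []|by []|].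
have good b' : is_ideal b' -> b `<=` b' -> ~ b' `<=` b -> forall j, diag_injective b' j.
  by move=> hb' sb nsb; apply: contrapT => nb'; apply: nsb; exact: maxb.
have goodS a : ~ b a -> forall j, diag_injective (adj_ideal b a) j.
  move=> nba; apply: good; first exact: adj_ideal_ideal.
    by move=> x bx; apply: ideal_addl => //; exact: ideal_gen_ideal.
  move=> /(_ a) h; apply: nba; apply: h; apply: ideal_addr => //; exact: sub_ideal_gen.
have pb : is_prime_ideal b.
  split=> // [b1|x y bxy].
    apply: nb => j; exists 0%N => I n w _ _; apply: diag_mod_coef => m.
    by rewrite -[_@_m]mulr1; exact: idealM.
  apply: contrapT => /not_orP[nx ny]; apply: nb.
  apply: (@diag_injective_ext b x hb (goodS x nx)); apply: good.
  - exact: colon_ideal.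
  - by move=> z bz; exact: idealM.
  - by move=> /(_ y) h; apply: ny; exact: h.
have [h nh hk] := kill _ pb; apply: nb.
apply: (diag_injective_kill hb _ (goodS h nh) hk) => x hx.
by case: pb => _ _ /(_ _ _ hx)[].
Qed.

(** * Intersections with powers, one diagonal element at a time *)

Definition inter_mul b (j : nat) : Prop := exists c, forall I n p, is_ideal I ->
  coef_ideal b p -> ideal_add (ext_ideal iC (ideal_pow I (n + c))) (diag_ideal j) p ->
  ideal_mul (coef_ideal b) (ideal_add (ext_ideal iC (ideal_pow I n)) (diag_ideal j)) p.

Lemma inter_mul0 b : is_ideal b -> inter_mul b 0.
Proof.
move=> hb; exists 0%N => I n p hI bp; rewrite addn0 => /ideal_addP[r [z [hr /diag_ideal0->]]].
rewrite addr0 => pr; rewrite -pr in hr.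
have := coef_ext_cap hb (ideal_pow_ideal I n) bp hr.
have hI2 := ideal_add_ideal (ext_ideal_ideal (ideal_pow I n)) (diag_ideal_ideal 0).
have hM := ideal_mul_ideal (coef_ideal b) hI2.
elim/ideal_mul_ind => [|x y|x y bx hy]; [exact: ideal0|exact: idealD|].
by apply: ideal_mul_mem => //; apply: ideal_addl => //; exact: diag_ideal_ideal.
Qed.

(** Write p = r + z + diag j v. Injectivity gives v = q' + r' + z' with q' over [b]. The term diag j
    q' already lies in the product, and the rest of p falls under the case of [j]. *)
Lemma inter_mulS b (j : 'I_d) : is_ideal b -> diag_injective b j ->
  inter_mul b j -> inter_mul b j.+1.
Proof.
move=> hb [cP hP] [cI hI]; exists (cI + cP)%N => I n p iI bp.
move=> /ideal_addP[r [_ [hr /diag_idealS[z [v [hz ->]]] pE]]].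
have hB := coef_ideal_ideal d hb.
have hM k := diag_mod_ideal (ideal_pow I k) j hb.
have [|q' [r' [z' [hq' hr' hz' vE]]]] := diag_modP (hP I (n + cI)%N v iI _).
  have -> : diag j * v = p - r - z by rewrite pE; ring.
  apply: (idealB (hM _)); last exact: diag_mod_diag.
  apply: (idealB (hM _)); first exact: diag_mod_coef.
  by apply: diag_mod_ext => //; rewrite -addnA.
have bq' : coef_ideal b (diag j * q') by refine (idealM hB _).
have h : coef_ideal b (p - diag j * q') by refine (idealB hB _ _).
have hI2 k l := ideal_add_ideal (ext_ideal_ideal (ideal_pow I k)) (diag_ideal_ideal l).
have {}h : ideal_mul (coef_ideal b) (ideal_add (ext_ideal iC (ideal_pow I n)) (diag_ideal j))
    (p - diag j * q').
  apply: hI => //.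
  have -> : p - diag j * q' = r + z + diag j * (r' + z') by rewrite pE vE; ring.
  apply: (idealD (hI2 _ _)); last by apply: (idealM (hI2 _ _)); exact: ideal_add_mem.
  by apply: ideal_add_mem => //; apply: ext_pow_le hr; lia.
have hM2 := ideal_mul_ideal (coef_ideal b) (hI2 n j.+1).
rewrite -(subrK (diag j * q') p); apply: idealD => //; last first.
  rewrite mulrC; apply: ideal_mul_mem => //; apply: ideal_addr; first exact: ext_ideal_ideal.
  by rewrite -[diag j]mulr1; exact: diag_ideal_mem.
move: h; elim/ideal_mul_ind => [|x y|x y bx hy]; [exact: ideal0|exact: idealD|].
apply: ideal_mul_mem => //; move: hy; apply: ideal_add_sub => // t.
exact: diag_ideal_le.
Qed.

Local Notation ev := (mmap iC xi).

Theorem uniform_artin_rees_kill : noetherian C ->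
  (forall P, is_prime_ideal P -> exists2 h, ~ P h & forall j, diag_killed P h j) ->
  forall b, is_ideal b -> exists c, forall I n u, is_ideal I -> b u ->
    ideal_pow (ideal_gen (ev @` I)) (n + c) u ->
    ideal_mul b (ideal_pow (ideal_gen (ev @` I)) n) u.
Proof.
move=> noC kill b hb; have hP := diag_injective_noetherian noC kill hb.
have inter j : (j <= d)%N -> inter_mul b j.
  elim: j => [|j IHj] jd; first exact: inter_mul0.
  by apply: (@inter_mulS b (Ordinal jd)) => //; apply: IHj; exact: ltnW.
have [c hc] := inter d (leqnn d); exists c => I n u hI bu /ideal_pow_gen hu.
have hS := ideal_add_ideal (ext_ideal_ideal (ideal_pow I (n + c))) (diag_ideal_ideal d).
have evE v : diag_ideal d ((ev v)%:MP - map_mpoly iC v).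
  have H := mpoly_rmorph_mod (f := @mpolyC d C \o ev) (g := map_mpoly iC)
    (Z := diag_ideal d) (diag_ideal_ideal d); apply: H => [a|i] /=.
    by rewrite mmapC map_mpolyC subrr; exact: ideal0 (diag_ideal_ideal d).
  rewrite mmapX mmap1U map_mpolyX -opprB -mulN1r mulrC.
  exact: diag_ideal_mem.
(* The constant polynomial [u] is moved from the power of ev(I) to the power of [I] in the variables
   X, at the price of diagonal terms. *)
have {}hu : ideal_add (ext_ideal iC (ideal_pow I (n + c))) (diag_ideal d) u%:MP.
  move: hu; elim/ideal_mul_ind => [|x y hx hy|_ q [v Vv <-] _].
  - by rewrite rmorph0; exact: ideal0.
  - by rewrite rmorphD; exact: idealD.
  - rewrite rmorphM /= mulrC -(subrK (map_mpoly iC v) (ev v)%:MP) mulrDr.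
    rewrite addrC; apply: ideal_add_mem; first exact: ext_ideal_mem.
    by apply: (idealM (diag_ideal_ideal d)).
have {hc}hu := hc I n u%:MP hI (coef_idealC hb bu) hu.
have evP v : meval xi (map_mpoly iC v) = ev v.
  have := mpoly_rmorph_mod (f := meval xi \o map_mpoly iC) (g := ev)
    (Z := [set 0]) _ _ _ v => h; apply/eqP; rewrite -subr_eq0; apply/eqP; apply: h.
  - by split=> //= [x y -> ->|a x ->]; rewrite ?addr0 ?mulr0.
  - by move=> a /=; rewrite map_mpolyC mevalC mmapC subrr.
  - by move=> i /=; rewrite map_mpolyX mevalXU mmapX mmap1U subrr.
(* Evaluation at [xi] kills the diagonal and brings the inclusion back to [C]. *)
rewrite -(mevalC xi u); move: (u%:MP) hu => p.
have hG := ideal_pow_ideal (ideal_gen (ev @` I)) n.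
have hM := ideal_mul_ideal b hG.
elim/ideal_mul_ind => [|x y hx hy|x y bx hy]; rewrite ?(rmorph0, rmorphD, rmorphM) /=.
- exact: ideal0.
- exact: idealD.
apply: ideal_mul_mem; first by rewrite mevalE; apply: ideal_sum => // m _; exact: idealMr.
move: hy => /ideal_addP[r [z [hr hz ->]]]; rewrite rmorphD; apply: idealD => //.
  move: hr; elim/ideal_mul_ind => [|s t hs ht|_ q [v Vv <-] _].
  - by rewrite rmorph0; exact: ideal0.
  - by rewrite rmorphD; exact: idealD.
  - rewrite rmorphM /= evP; apply: idealMr => //.
    by apply: (ideal_pow_rmorph (f := ev)) Vv => t It; apply: sub_ideal_gen; exists t.
have z0 : meval xi z = 0; last by rewrite [X in ideal_pow _ _ X]z0; exact: ideal0.
move: hz; elim/ideal_mul_ind => [|s t hs ht|_ q [i _ ->] _].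
- by rewrite rmorph0.
- by rewrite rmorphD /= hs ht addr0.
- by rewrite rmorphM /= rmorphB /= mevalXU mevalC subrr mul0r.
Qed.

End Diagonal.

(** * Polynomials over infinite fields *)

Lemma mpoly_rmorph_eq (K : nzRingType) d (R : comPzRingType)
    (f g : {rmorphism {mpoly K[d]} -> R}) :
  (forall c, f c%:MP = g c%:MP) -> (forall i, f 'X_i = g 'X_i) -> f =1 g.
Proof.
move=> hC hX p; apply/eqP; rewrite -subr_eq0; apply/eqP.
apply: (mpoly_rmorph_mod (Z := [set 0])) => [|c|i]; rewrite ?hC ?hX /= ?subrr //.
by split=> //= [x y -> ->|a x ->]; rewrite ?addr0 ?mulr0.
Qed.

Definition ext_last (T : Type) d (c : 'I_d -> T) (x : T) (i : 'I_d.+1) : T :=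
  oapp c x (unlift ord_max i).

Lemma ext_last_lift T d (c : 'I_d -> T) x j : ext_last c x (lift ord_max j) = c j.
Proof. by rewrite /ext_last liftK. Qed.

Lemma ext_last_max T d (c : 'I_d -> T) x : ext_last c x ord_max = x.
Proof. by rewrite /ext_last unlift_none. Qed.

Definition infinite_field (K : fieldType) := forall s : seq K, exists x, x \notin s.

Section Shear.
Variables (K : comNzRingType) (d : nat).
Implicit Types (c : 'I_d -> K) (p : {mpoly K[d.+1]}).

(** The substitution X_j -> X_j + c_j Z, with Z for the last variable. For generic [c] it makes a
    polynomial monic in Z up to a scalar; for c = 0 it is the isomorphism of K[X, Z] with K[X][Z],
    and is often used only as such. *)
Definition shear c : {mpoly K[d.+1]} -> {poly {mpoly K[d]}} :=
  mmap (polyC \o @mpolyC d K)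
    (ext_last (fun j => ('X_j)%:P + ((c j)%:MP)%:P * 'X) 'X).

HB.instance Definition _ c := GRing.RMorphism.on (shear c).

Definition eval2 (L : comNzRingType) (io : {rmorphism K -> L}) (eta : 'I_d -> L) (x : L)
    (P : {poly {mpoly K[d]}}) : L := (map_poly (mmap io eta) P).[x].

Lemma eval2_shear (L : comNzRingType) (io : {rmorphism K -> L}) eta x c p :
  eval2 io eta x (shear c p) = mmap io (ext_last (fun j => eta j + io (c j) * x) x) p.
Proof.
apply: (mpoly_rmorph_eq (f := horner_eval x \o map_poly (mmap io eta) \o shear c)
  (g := mmap io (ext_last (fun j => eta j + io (c j) * x) x))) => [a|i] /=.
  rewrite /shear mmapC /=; rewrite map_polyC /=; rewrite horner_evalE; rewrite hornerC; by rewrite !mmapC.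
rewrite /shear !mmapX !mmap1U; case: (unliftP ord_max i) => [j|] ->.
  rewrite !ext_last_lift rmorphD rmorphM /= !map_polyC map_polyX /= horner_evalE.
  by rewrite !hornerE mmapC mmapX mmap1U.
by rewrite !ext_last_max map_polyX horner_evalE hornerX.
Qed.

Lemma shear_inj c : injective (shear c).
Proof.
pose eta j : {mpoly K[d.+1]} := 'X_(lift ord_max j) - (c j)%:MP * 'X_ord_max.
move=> p q e; suff H r : r = eval2 (@mpolyC d.+1 K) eta 'X_ord_max (shear c r).
  by rewrite (H p) (H q) e.
rewrite eval2_shear; apply: (mpoly_rmorph_eq (f := idfun)
  (g := mmap (@mpolyC d.+1 K) _)) => [a|i] /=; first by rewrite mmapC.
rewrite mmapX mmap1U; case: (unliftP ord_max i) => [j|] ->.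
  by rewrite ext_last_lift subrK.
by rewrite ext_last_max.
Qed.

Definition mrestr (m : 'X_{1..d.+1}) : 'X_{1..d} := [multinom m (lift ord_max j) | j < d].

(** The form of highest degree with the last variable set to 1. No terms collapse, as [mrestr] is
    injective on monomials of equal degree. *)
Definition topform p : {mpoly K[d]} :=
  \sum_(m <- msupp p | mdeg m == (msize p).-1) p@_m *: 'X_[mrestr m].

Lemma mrestr_inj m m' : mdeg m = mdeg m' -> mrestr m = mrestr m' -> m = m'.
Proof.
move=> dm /mnmP r; apply/mnmP => i; case: (unliftP ord_max i) => [j|] ->.
  by have := r j; rewrite !mnmE.
move: dm; rewrite !mdegE !big_ord_recr /= => dm.
have e : (\sum_(i < d) m (widen_ord (leqnSn d) i) = 
          \sum_(i < d) m' (widen_ord (leqnSn d) i))%N.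
  apply: eq_bigr => j _; have := r j; rewrite !mnmE.
  by have -> : lift ord_max j = widen_ord (leqnSn d) j by apply: val_inj; rewrite /= /bump leqNgt ltn_ord.
by move: dm; rewrite e => /addnI.
Qed.

Lemma topform_neq0 p : p != 0 -> topform p != 0.
Proof.
move=> p0; apply/eqP => /(congr1 (mcoeff (mrestr (mlead p)))).
rewrite mcoeff0 /topform raddf_sum /= big_mkcond /=.
rewrite (bigD1_seq (mlead p)) ?msupp_uniq ?mlead_supp //= -{1}mlead_deg //= eqxx.
rewrite mcoeffZ mcoeffX eqxx mulr1 big1 ?addr0 => [/eqP|m nm].
  by rewrite mleadc_eq0 (negbTE p0).
case: ifP => // /eqP dm; rewrite mcoeffZ mcoeffX; case: eqP => [e|]; rewrite ?mulr0 //.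
by case/eqP: nm; apply: mrestr_inj => //; rewrite dm -mlead_deg.
Qed.

Lemma coef_mul_top (R : comNzRingType) (p q : {poly R}) m n :
  (size p <= m.+1)%N -> (size q <= n.+1)%N ->
  (size (p * q)%R <= (m + n).+1)%N /\ (p * q)`_(m + n) = p`_m * q`_n.
Proof.
move=> sp sq; split.
  by apply: leq_trans (size_polyMleq _ _) _; have := leq_add sp sq; lia.
rewrite coefM (bigD1 (inord m)) //= inordK ?ltnS ?leq_addr // addKn big1 ?addr0 // => i ni.
have [lt|ge] := ltnP i m; last first.
  rewrite [p`_i]nth_default ?mul0r //; apply: leq_trans sp _.
  rewrite ltn_neqAle ge andbT; apply: contra ni => /eqP e.
  by apply/eqP/val_inj; rewrite /= inordK ?ltnS ?leq_addr // e.
rewrite [q`__]nth_default ?mulr0 //; apply: leq_trans sq _.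
by have := ltn_ord i; lia.
Qed.

Lemma coef_exp_top (R : comNzRingType) (p : {poly R}) n :
  (size p <= 2)%N -> (size (p ^+ n)%R <= n.+1)%N /\ (p ^+ n)`_n = p`_1 ^+ n.
Proof.
move=> sp; elim: n => [|n [s c]]; first by rewrite !expr0 size_poly1 coef1.
by rewrite !exprS; have [? ->] := @coef_mul_top _ p (p ^+ n) 1 n sp s; rewrite c.
Qed.

Lemma shear_monomial c (m : 'X_{1..d.+1}) :
  (size (shear c 'X_[m]) <= (mdeg m).+1)%N /\
  (shear c 'X_[m])`_(mdeg m) = ('X_[mrestr m].@[c])%:MP.
Proof.
pose X := ext_last (fun j => ('X_j)%:P + ((c j)%:MP)%:P * 'X) 'X : 'I_d.+1 -> {poly {mpoly K[d]}}.
have sX i : (size (X i) <= 2)%N.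
  rewrite /X; case: (unliftP ord_max i) => [j|] ->; rewrite (ext_last_lift, ext_last_max).
    by rewrite addrC size_MXaddC; case: ifP => // _; rewrite ltnS size_polyC leq_b1.
  by rewrite size_polyX.
have cX i : (X i)`_1 = (ext_last c 1 i)%:MP.
  rewrite /X; case: (unliftP ord_max i) => [j|] ->; rewrite !(ext_last_lift, ext_last_max).
    by rewrite coefD coefC coefCM coefX mulr1 add0r.
  by rewrite coefX mpolyC1.
rewrite /shear mmapX /mmap1 -/X mdegE.
have -> : 'X_[mrestr m].@[c] = \prod_i ext_last c 1 i ^+ m i.
  rewrite mevalX big_ord_recr /= ext_last_max expr1n mulr1; apply: eq_bigr => j _.
  have -> : widen_ord (leqnSn d) j = lift ord_max j by apply: val_inj; rewrite /= /bump leqNgt ltn_ord.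
  by rewrite ext_last_lift mnmE.
elim/big_rec3: _ => [|i x y z _ [s e]]; first by rewrite size_poly1 coef1 eqxx mpolyC1.
have [s1 c1] := coef_exp_top (m i) (sX i).
have [s2 c2] := coef_mul_top s1 s; split=> //.
by rewrite c2 c1 e cX mpolyCM (rmorphXn (@mpolyC d K)).
Qed.

Lemma shear_top c p : p != 0 ->
  (size (shear c p) <= msize p)%N /\
  (shear c p)`_(msize p).-1 = ((topform p).@[c])%:MP.
Proof.
move=> p0; have msp : msize p = (msize p).-1.+1 by rewrite -mlead_deg.
have sE : shear c p = \sum_(m <- msupp p) ((p@_m)%:MP)%:P * shear c 'X_[m].
  rewrite {1}[p]mpolyE rmorph_sum; apply: eq_bigr => m _.
  by rewrite -mul_mpolyC rmorphM /= {1}/shear mmapC.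
split.
  rewrite sE big_seq; apply: (big_ind (fun q : {poly _} => (size q <= msize p)%N)) => [|x y hx hy|m hm].
  - by rewrite size_poly0.
  - by apply: leq_trans (size_polyD _ _) _; rewrite geq_max hx hy.
  - rewrite mul_polyC; apply: leq_trans (size_scale_leq _ _) _.
    by apply: leq_trans (shear_monomial c m).1 _; exact: msize_mdeg_lt.
rewrite sE coef_sum /topform (rmorph_sum (meval c)) (rmorph_sum (@mpolyC d K)) /=.
rewrite [RHS]big_mkcond /=.
rewrite big_seq [RHS]big_seq; apply: eq_bigr => m hm; rewrite coefCM.
case: ifP => [/eqP<-|ne].
  by rewrite (shear_monomial c m).2 mevalZ mpolyCM.
rewrite nth_default ?mulr0 //; apply: leq_trans (shear_monomial c m).1 _.
by have := msize_mdeg_lt hm; rewrite {1}msp ltnS leq_eqVlt ne.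
Qed.

End Shear.

(** The point has coordinates in [K] although the coefficients lie in [L]: a nonzero polynomial in
    one variable over a domain has only finitely many roots among the images of [K]. *)
Lemma nonvanishing (K : fieldType) (L : idomainType) (io : {rmorphism K -> L}) d
    (G : {mpoly L[d]}) : infinite_field K -> G != 0 ->
  exists c : 'I_d -> K, G.@[fun i => io (c i)] != 0.
Proof.
move=> infK; elim: d G => [|d IHd] G G0.
  exists (fun=> 0); have [c e] : exists c, G = c%:MP.
    by exists G@_0%MM; exact: nvar0_mpolyC.
  by rewrite e mevalC; move: G0; rewrite e mpolyC_eq0.
pose P := shear (fun=> 0) G.
have P0 : P != 0 by rewrite -(rmorph0 (shear (fun=> 0))) (inj_eq (@shear_inj _ _ _)).
have [|c hc] := IHd (lead_coef P); first by rewrite lead_coef_eq0.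
pose Q := map_poly (meval (fun i => io (c i))) P.
have Q0 : Q != 0.
  apply/eqP => /(congr1 (fun q : {poly L} => q`_(size P).-1)).
  by rewrite coef_map coef0 -lead_coefE; apply/eqP.
have [x hx] : exists x, Q.[io x] != 0.
  apply: contrapT => none.
  have all x : root Q (io x).
    by rewrite /root; apply/negPn/negP => h; apply: none; exists x.
  have big n : exists s : seq K, uniq s /\ size s = n.
    elim: n => [|n [s [us ss]]]; first by exists [::].
    by have [y ny] := infK s; exists (y :: s); rewrite /= ny us ss.
  have [s [us ss]] := big (size Q).
  have := @max_poly_roots _ Q (map io s) Q0.
  rewrite size_map ss ltnn => h; suff: false by []; apply: h.
    by apply/allP => _ /mapP[y _ ->]; exact: all.
  by rewrite map_inj_uniq //; exact: fmorph_inj.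
exists (ext_last c x).
have -> : G.@[fun i => io (ext_last c x i)] = Q.[io x]; last by [].
have := @eval2_shear L d L idfun (fun i => io (c i)) (io x) (fun=> 0) G.
rewrite /eval2 -/P => e.
transitivity (mmap idfun (ext_last (fun j => io (c j) + 0 * io x) (io x)) G).
  rewrite /meval /mmap; apply: eq_bigr => m _; congr (_ * _).
  apply: eq_bigr => i _; congr (_ ^+ _).
  by case: (unliftP ord_max i) => [j|] ->; rewrite !(ext_last_lift, ext_last_max) ?mul0r ?addr0.
by rewrite -e.
Qed.

(** * Counting and algebraic dependence *)

Lemma linear_dependence (K : fieldType) (A : pzRingType) (io : {rmorphism K -> A})
    (I J : finType) (v : I -> A) (w : J -> A) (a : I -> J -> K) :
  (#|J| < #|I|)%N -> (forall i, v i = \sum_j io (a i j) * w j) ->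
  exists u : I -> K, (exists i, u i != 0) /\ \sum_i io (u i) * v i = 0.
Proof.
move=> ltJI vE; pose M := \matrix_(i < #|I|, j < #|J|) a (enum_val i) (enum_val j).
have /eqP kM : kermx M != 0.
  rewrite kermx_eq0 /row_free neq_ltn; apply/orP; left.
  exact: leq_ltn_trans (rank_leq_col M) ltJI.
have [i0 /eqP ri0] : exists i, row i (kermx M) != 0.
  by apply/existsP; apply: contraT => /existsPn h; case: kM; apply/row_matrixP => i;
    rewrite row0; apply/eqP; exact: negbNE (h i).
have rM : row i0 (kermx M) *m M = 0 by rewrite -row_mul mulmx_ker row0.
exists (fun i => row i0 (kermx M) 0 (enum_rank i)); split.
  apply/not_existsP => h; apply: ri0; apply/rowP => j; rewrite !mxE.
  by have /negP/negPn/eqP := h (enum_val j); rewrite enum_valK !mxE.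
under eq_bigr do rewrite vE mulr_sumr.
rewrite exchange_big /= big1 // => j _.
under eq_bigr do rewrite mulrA -rmorphM.
rewrite -mulr_suml -rmorph_sum; have /rowP/(_ (enum_rank j)) := rM; rewrite !mxE => h.
suff -> : \sum_i row i0 (kermx M) 0 (enum_rank i) * a i j = 0 by rewrite rmorph0 mul0r.
rewrite -[RHS]h (reindex (@enum_val I I)) /=; last first.
  by apply: onW_bij; exact: enum_val_bij.
by apply: eq_bigr => i _; rewrite enum_valK !mxE enum_rankK.
Qed.

Definition finite_over (K : nzRingType) (A : comNzRingType) (io : {rmorphism K -> A})
    D (t : 'I_D -> A) : Prop :=
  exists (q : nat) (e : 'I_q -> A), forall a,
    exists c : 'I_q -> {mpoly K[D]}, a = \sum_i mmap io t (c i) * e i.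

Lemma mpoly_box (K : nzRingType) D M (p : {mpoly K[D]}) : (msize p <= M)%N ->
  p = \sum_(f : {ffun 'I_D -> 'I_M}) p@_[multinom (f i : nat) | i < D] *:
        'X_[[multinom (f i : nat) | i < D]].
Proof.
move=> sp; apply/mpolyP => m; rewrite raddf_sum /=.
under eq_bigr do rewrite mcoeffZ mcoeffX.
have [lt|] := boolP [forall i, (m i < M)%N].
  have lt' i : (m i < M)%N by move/forallP: lt.
  rewrite (bigD1 [ffun i => Ordinal (lt' i)]) //=.
  have e : [multinom ([ffun i => Ordinal (lt' i)] i : nat) | i < D] = m.
    by apply/mnmP => i; rewrite mnmE ffunE.
  rewrite e eqxx mulr1 big1 ?addr0 // => f nf; case: eqP => [fm|]; rewrite ?mulr0 //.
  case/eqP: nf; apply/ffunP => i; apply: val_inj; rewrite ffunE /= -[in RHS]fm.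
  by rewrite mnmE.
move/forallPn => [i]; rewrite -leqNgt => hi.
rewrite [LHS]memN_msupp_eq0 ?big1 // => [f _|].
  by case: eqP => [fm|]; rewrite ?mulr0 //; move: hi; rewrite -fm mnmE leqNgt ltn_ord.
apply: msize_mdeg_ge; apply: leq_trans sp _; apply: leq_trans hi _.
by rewrite mdegE (bigD1 i) //= leq_addr.
Qed.

(** A count: there are N^(D+1) monomials in [x] with exponents below N, and they lie in a span of at
    most q (cc N)^D elements, because the degrees of coordinates grow only linearly with the degree
    of the monomial. *)
Lemma alg_dependence (K : fieldType) (A : comNzRingType) (io : {rmorphism K -> A}) D
    (F : 'I_D -> A) (x : 'I_D.+1 -> A) : finite_over io F ->
  exists2 P : {mpoly K[D.+1]}, P != 0 & mmap io x P = 0.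
Proof.
move=> [q [e he]].
pose c i r := sval (cid (he (x i * e r))).
have cE i r : x i * e r = \sum_s mmap io F (c i r s) * e s by exact: (svalP (cid (he _))).
pose c1 := sval (cid (he 1)).
have c1E : 1 = \sum_s mmap io F (c1 s) * e s by exact: (svalP (cid (he _))).
pose tau := (\max_i \max_r \max_s msize (c i r s) + \max_s msize (c1 s)).+1%N.
have tau1 s : (msize (c1 s) <= tau.+1)%N.
  by do 2!apply: leq_trans (leqnSn _); apply: leq_trans (leq_addl _ _); exact: (leq_bigmax s).
have tauc i r s : (msize (c i r s) < tau)%N.
  rewrite ltnS; apply: leq_trans (leq_addr _ _).
  apply: leq_trans (leq_bigmax i); apply: leq_trans (leq_bigmax r).
  exact: (leq_bigmax (F := fun s => msize (c i r s)) s).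
pose Sp (n : nat) a := exists b : 'I_q -> {mpoly K[D]},
  (forall s, msize (b s) <= n.+1)%N /\ a = \sum_s mmap io F (b s) * e s.
have SpM n a i : Sp n a -> Sp (n + tau)%N (x i * a).
  move=> [b [hb ->]]; exists (fun s => \sum_r b r * c i r s); split=> [s|].
    apply: leq_trans (msize_sum _ _ _) _; apply/bigmax_leqP => r _.
    by apply: leq_trans (msizeM_le _ _) _; have := leq_add (hb r) (tauc i r s); lia.
  rewrite mulr_sumr; under eq_bigr do rewrite mulrCA cE mulr_sumr.
  rewrite exchange_big; apply: eq_bigr => s _; rewrite rmorph_sum mulr_suml.
  by apply: eq_bigr => r _; rewrite rmorphM mulrA.
have Sp_le m n a : (m <= n)%N -> Sp m a -> Sp n a.
  by move=> mn [b [hb ->]]; exists b; split=> // s; apply: leq_trans (hb s) _.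
have SpX (m : 'X_{1..D.+1}) : Sp (tau * (mdeg m).+1)%N (mmap1 x m).
  have Hx i k n a : Sp n a -> Sp (n + tau * k)%N (x i ^+ k * a).
    elim: k => [|k IHk]; first by rewrite muln0 addn0 mul1r.
    by rewrite exprS -mulrA mulnS addnCA addnC => /IHk; exact: SpM.
  rewrite /mmap1 mdegE mulnS; elim/big_rec2: _ => [|i k a _ h].
    by rewrite muln0 addn0; exists c1.
  by rewrite mulnDr addnCA addnC; exact: Hx.
(* [cc] absorbs the growth rate [tau] and the D+1 exponents; with this N, N^(D+1) exceeds q (cc
   N)^D. *)
pose cc := (tau * D.+2 + 1)%N; pose N := (cc ^ D * q).+1.
pose M := (tau * (D.+1 * N).+1).+1.
have MN : (M <= cc * N)%N.
  by rewrite /M /cc mulnDl mul1n -/N; have : (0 < N)%N by []; nia.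
pose mI (f : {ffun 'I_D.+1 -> 'I_N}) : 'X_{1..D.+1} := [multinom (f i : nat) | i < D.+1].
pose mJ (f : {ffun 'I_D -> 'I_M}) : 'X_{1..D} := [multinom (f i : nat) | i < D].
have Spf f : Sp (tau * (D.+1 * N).+1)%N (mmap1 x (mI f)).
  apply: Sp_le (SpX _); rewrite leq_mul2l; apply/orP; right; rewrite ltnS mdegE.
  have -> : (D.+1 * N = \sum_(i < D.+1) N)%N by rewrite sum_nat_const card_ord.
  apply: leq_sum => i _.
  by rewrite mnmE; exact: ltnW.
pose b f := sval (cid (Spf f)).
have bP f : (forall s, msize (b f s) <= M)%N /\
   mmap1 x (mI f) = \sum_s mmap io F (b f s) * e s by exact: (svalP (cid (Spf f))).
have [||u [[f0 uf0] hu]] := @linear_dependence K A io {ffun 'I_D.+1 -> 'I_N}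
   ({ffun 'I_D -> 'I_M} * 'I_q)%type (fun f => mmap1 x (mI f))
   (fun g => mmap1 F (mJ g.1) * e g.2) (fun f g => (b f g.2)@_(mJ g.1)).
- rewrite card_prod !card_ffun !card_ord.
  apply: leq_ltn_trans (_ : (cc * N) ^ D * q < _)%N.
    rewrite leq_mul2r; apply/orP; right; case: (D) => [//|D']; by rewrite leq_exp2r.
  rewrite expnMn mulnAC expnS ltn_pmul2r ?expn_gt0 //; by rewrite ltnS.
- move=> f; rewrite (bP f).2 -(pair_bigA _ (fun g s => io (b f s)@_(mJ g) * (mmap1 F (mJ g) * e s))) /=.
  rewrite exchange_big; apply: eq_bigr => s _.
  rewrite {1}(mpoly_box ((bP f).1 s)) rmorph_sum mulr_suml; apply: eq_bigr => g _.
  by rewrite /= mmapZ mmapX mulrA.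
exists (\sum_f u f *: 'X_[mI f]).
  apply/eqP => /(congr1 (mcoeff (mI f0))); rewrite mcoeff0 raddf_sum /=.
  rewrite (bigD1 f0) //= mcoeffZ mcoeffX eqxx mulr1 big1 ?addr0 => [h|f nf].
    by rewrite h eqxx in uf0.
  rewrite mcoeffZ mcoeffX; case: eqP => [/mnmP h|]; rewrite ?mulr0 //.
  by case/eqP: nf; apply/ffunP => i; apply: val_inj; have := h i; rewrite !mnmE.
by rewrite -[RHS]hu rmorph_sum; apply: eq_bigr => f _; rewrite /= mmapZ mmapX.
Qed.

(** * Noether normalization with a Jacobian *)

Definition alg_indep (K : nzRingType) (A : comNzRingType) (io : {rmorphism K -> A})
    D (t : 'I_D -> A) : Prop := forall P, mmap io t P = 0 -> P = 0.

Definition join_fun (T : Type) D g (t : 'I_D -> T) (s : 'I_g -> T) (i : 'I_(D + g)) : T :=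
  match split i with inl j => t j | inr j => s j end.

Lemma join_funl T D g (t : 'I_D -> T) (s : 'I_g -> T) j : join_fun t s (lshift g j) = t j.
Proof. by rewrite /join_fun -[lshift _ _]/(unsplit (inl j)) unsplitK. Qed.

Lemma join_funr T D g (t : 'I_D -> T) (s : 'I_g -> T) j : join_fun t s (rshift D j) = s j.
Proof. by rewrite /join_fun -[rshift _ _]/(unsplit (inr j)) unsplitK. Qed.

Lemma mmapXU (K : nzRingType) (A : comNzRingType) (io : {rmorphism K -> A}) n (x : 'I_n -> A) i :
  mmap io x 'X_i = x i.
Proof. by rewrite mmapX mmap1U. Qed.

Lemma eq_mmap (K : nzRingType) (A : comNzRingType) (io : {rmorphism K -> A}) n
  (x y : 'I_n -> A) P : x =1 y -> mmap io x P = mmap io y P.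
Proof.
move=> e; apply: (mpoly_rmorph_eq (f := mmap io x) (g := mmap io y)) => [c|i] /=.
  by rewrite !mmapC.
by rewrite !mmapXU.
Qed.

Lemma mmap_comp (K : nzRingType) (A : comNzRingType) (B : comNzRingType)
  (io : {rmorphism K -> A}) (f : {rmorphism A -> B}) n (x : 'I_n -> A) P :
  f (mmap io x P) = mmap (f \o io) (f \o x) P.
Proof.
apply: (mpoly_rmorph_eq (f := f \o mmap io x) (g := mmap (f \o io) (f \o x))) => [c|i] /=.
  by rewrite !mmapC.
by rewrite !mmapXU.
Qed.

Lemma mmap_closed (K : nzRingType) (A : comNzRingType) (io : {rmorphism K -> A}) n
    (x : 'I_n -> A) (S : A -> Prop) : S 1 -> (forall a b, S a -> S b -> S (a + b)) ->
  (forall c a, S a -> S (io c * a)) -> (forall i a, S a -> S (x i * a)) ->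
  forall P, S (mmap io x P).
Proof.
move=> S1 SD SC SX P; elim/mpolyind: P => [|c m p _ _ hp].
  by rewrite rmorph0 -[0](mul0r 1) -(rmorph0 io); exact: SC.
rewrite rmorphD; apply: SD => //=; rewrite mmapZ mmapX; apply: SC.
rewrite /mmap1; elim/big_rec: _ => // i a _ Sa.
by elim: (m i) => [|k IHk]; rewrite ?mul1r // exprS -mulrA; exact: SX.
Qed.

Lemma finite_overI (K : nzRingType) (A : comNzRingType) (io : {rmorphism K -> A}) D
    (t : 'I_D -> A) (I : finType) (e : I -> A) (S : A -> Prop) :
  (forall a, S a -> exists c : I -> {mpoly K[D]}, a = \sum_i mmap io t (c i) * e i) ->
  exists (q : nat) (e' : 'I_q -> A), forall a, S a ->
    exists c : 'I_q -> {mpoly K[D]}, a = \sum_i mmap io t (c i) * e' i.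
Proof.
move=> h; exists #|I|, (fun i => e (enum_val i)) => a /h[c ->].
exists (fun i => c (enum_val i)); rewrite (reindex (@enum_val I I)) //=.
by apply: onW_bij; exact: enum_val_bij.
Qed.

Lemma det_trick (A : comNzRingType) q (M : 'M[A]_q) (e : 'I_q -> A) :
  (forall i, \sum_j M i j * e j = 0) -> forall j, \det M * e j = 0.
Proof.
move=> h j; have Me : M *m \col_i e i = 0.
  by apply/colP => i; rewrite !mxE -[RHS](h i); apply: eq_bigr => k _; rewrite mxE.
have /colP/(_ j) : (\adj M *m M) *m \col_i e i = 0 by rewrite -mulmxA Me mulmx0.
by rewrite mul_adj_mx mul_scalar_mx !mxE.
Qed.

(** After the shear, [f] is monic in the last element up to the scalar topform(c), so division
    leaves remainders of bounded degree: one step of Noether normalization. *)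
Lemma shear_reduce (K : fieldType) (L : comNzRingType) (io : {rmorphism K -> L}) d
    (xi : 'I_d.+1 -> L) (f : {mpoly K[d.+1]}) (c : 'I_d -> K) :
  f != 0 -> mmap io xi f = 0 -> (topform f).@[c] != 0 ->
  exists m, forall Q, exists r : 'I_m -> {mpoly K[d]},
    mmap io xi Q = \sum_j mmap io (fun j => xi (lift ord_max j) - io (c j) * xi ord_max) (r j)
      * xi ord_max ^+ j.
Proof.
move=> f0 fxi top; pose eta (j : 'I_d) := xi (lift ord_max j) - io (c j) * xi ord_max.
have evE Q : eval2 io eta (xi ord_max) (shear c Q) = mmap io xi Q.
  rewrite eval2_shear; apply: eq_mmap => i.
  by case: (unliftP ord_max i) => [j|] ->; rewrite (ext_last_lift, ext_last_max) // /eta subrK.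
have [sP tP] := shear_top c f0.
pose a := (topform f).@[c]; pose P := (a^-1%:MP)%:P * shear c f.
have msp : msize f = (msize f).-1.+1 by rewrite -mlead_deg.
have Ptop : P`_(msize f).-1 = 1 by rewrite coefCM tP -mpolyCM mulVf // mpolyC1.
have szP : size P = msize f.
  apply/eqP; rewrite eqn_leq; apply/andP; split.
    by rewrite /P mul_polyC; apply: leq_trans (size_scale_leq _ _) sP.
  rewrite msp ltnNge; apply/negP => h; move: Ptop; rewrite nth_default //.
  by move/eqP; rewrite eq_sym oner_eq0.
have Pmon : P \is monic by rewrite monicE lead_coefE szP Ptop.
exists (msize f).-1 => Q; pose R := Pdiv.CommonRing.rmodp (shear c Q) P.
have szR : (size R <= (msize f).-1)%N.
  by rewrite -ltnS -msp -szP Pdiv.CommonRing.ltn_rmodpN0 // monic_neq0.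
exists (fun j => R`_j); rewrite -evE (Pdiv.RingMonic.rdivp_eq Pmon (shear c Q)) -/R.
rewrite /eval2 rmorphD rmorphM /= hornerD hornerM.
have -> : (map_poly (mmap io eta) P).[xi ord_max] = 0.
  by rewrite rmorphM /= hornerM [X in _ * X]evE fxi mulr0.
rewrite mulr0 add0r (@horner_coef_wide _ (msize f).-1).
  by apply: eq_bigr => j _; rewrite coef_map.
by apply: leq_trans (size_poly _ _) _.
Qed.

(** A relation between the [F] would make [A] finite over D-1 elements, and then the D elements [t]
    would be dependent. *)
Lemma finite_alg_indep (K : fieldType) (A : comNzRingType) (io : {rmorphism K -> A}) D
    (F t : 'I_D -> A) : infinite_field K -> finite_over io F -> alg_indep io t ->
  alg_indep io F.
Proof.
move=> infK finF it P PF; apply/eqP; apply: contraT => P0.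
case: D => [|d] in F t finF it P PF P0 *.
  by case/eqP: P0; apply: it; rewrite -PF; apply: eq_mmap => -[].
have [c hc] := nonvanishing idfun infK (topform_neq0 P0).
have [m hm] := shear_reduce P0 PF hc.
pose eta (j : 'I_d) := F (lift ord_max j) - io (c j) * F ord_max; rewrite -/eta in hm.
have [q [e he]] := finF.
have [|Q Q0 Qt] := @alg_dependence K A io d eta t.
  have [|q' [e' h]] := @finite_overI K A io d eta ('I_q * 'I_m)%type
    (fun ij => e ij.1 * F ord_max ^+ ij.2) (fun=> True); last by exists q', e' => a; exact: h.
  move=> a _; have [b ->] := he a.
  pose r i := sval (cid (hm (b i))).
  exists (fun ij => r ij.1 ij.2); rewrite -(pair_bigA _ (fun i j => mmap io eta (r i j) * (e i * F ord_max ^+ j))) /=.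
  apply: eq_bigr => i _; rewrite (svalP (cid (hm (b i)))) mulr_suml; apply: eq_bigr => j _.
  by rewrite mulrAC -!mulrA.
by move: Q0; rewrite (it _ Qt) eqxx.
Qed.

Definition perfect_field (K : fieldType) :=
  forall p, p \in [pchar K] -> forall a : K, exists b, b ^+ p = a.

(** In characteristic p all exponents of [f] are divisible by p, and perfectness supplies the p-th
    roots of its coefficients. *)
Lemma mderiv_all0 (K : fieldType) n (f : {mpoly K[n]}) : perfect_field K ->
  (forall i, f^`M(i) = 0) ->
  (exists c, f = c%:MP) \/ exists p g, [/\ prime p, (1 < p)%N & f = g ^+ p].
Proof.
move=> perfK df.
have nat0 m i : m \in msupp f -> (m i)%:R = 0 :> K.
  rewrite mcoeff_msupp => fm; case: (posnP (m i)) => [->//|mi].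
  have := mcoeff_deriv i (m - U_(i))%MM f; rewrite df mcoeff0 submK ?lep1mP -?lt0n //.
  rewrite mnmBE mnm1E eqxx subn1 prednK // => /esym/eqP.
  by rewrite -[X in X == 0]mulr_natr mulf_eq0 (negbTE fm) => /eqP.
have [[p pK]|nochar] := pselect (exists p, p \in [pchar K]); last first.
  left; exists f@_0; apply/mpolyP => m; rewrite mcoeffC.
  case: (eqVneq m 0%MM) => [->|m0]; first by rewrite mulr1.
  rewrite mulr0; apply/eqP; rewrite mcoeff_eq0; apply: contraNN m0 => hm.
  apply/eqP/mnmP => i; rewrite mnm0E; have := nat0 m i hm.
  case: (posnP (m i)) => [->//|mi] mi0; case: nochar.
  by have [p pK] := natf0_pchar mi (introT eqP mi0); exists p.
right; pose r a := sval (cid (perfK p pK a)).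
have rE a : r a ^+ p = a by exact: (svalP (cid (perfK p pK a))).
have pP : p \in [pchar {mpoly K[n]}].
  rewrite inE (pcharf_prime pK) -(rmorph_nat (@mpolyC n K)) /= mpolyC_eq0.
  exact/eqP/pcharf0.
pose dv (m : 'X_{1..n}) : 'X_{1..n} := [multinom (m i %/ p)%N | i < n].
exists p, (\sum_(m <- msupp f) r f@_m *: 'X_[dv m]); split.
- exact: pcharf_prime pK.
- exact: prime_gt1 (pcharf_prime pK).
rewrite -(pFrobenius_autE pP) rmorph_sum {1}[f]mpolyE big_seq [RHS]big_seq.
apply: eq_bigr => m hm; rewrite /= pFrobenius_autE exprZn rE mpolyXn; congr (_ *: 'X_[_]); apply/mnmP => i.
rewrite mulmnE mnmE divnK // (dvdn_pcharf pK); exact/eqP/nat0.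
Qed.

Lemma mderiv_comp (K : comNzRingType) n k (u : 'I_n -> {mpoly K[k]}) (q : {mpoly K[n]}) j :
  (mmap (@mpolyC k K) u q)^`M(j) = \sum_i mmap (@mpolyC k K) u q^`M(i) * (u i)^`M(j).
Proof.
pose G (q : {mpoly K[n]}) := \sum_i mmap (@mpolyC k K) u q^`M(i) * (u i)^`M(j).
have GM p r : (mmap (@mpolyC k K) u p)^`M(j) = G p -> (mmap (@mpolyC k K) u r)^`M(j) = G r ->
   (mmap (@mpolyC k K) u (p * r))^`M(j) = G (p * r).
  move=> hp hr; rewrite rmorphM mderivM hp hr /G mulr_suml mulr_sumr -big_split.
  apply: eq_bigr => i _; rewrite mderivM rmorphD !rmorphM /=; ring.
have GC c : (mmap (@mpolyC k K) u c%:MP)^`M(j) = G c%:MP.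
  rewrite mmapC mderivC /G big1 // => i _; by rewrite mderivC mmap0 mul0r.
have GX m : (mmap (@mpolyC k K) u 'X_[m])^`M(j) = G 'X_[m].
  rewrite mpolyXE_id; apply: (big_ind (fun q => (mmap (@mpolyC k K) u q)^`M(j) = G q)).
  - exact: (GC 1).
  - exact: GM.
  move=> i _; elim: (m i) => [|a IHa]; first by rewrite expr0; exact: (GC 1).
  rewrite exprS; apply: GM => //; rewrite mmapXU /G (bigD1 i) //= big1 => [|l nl].
    have UU : (U_(i) - U_(i))%MM = 0%MM :> 'X_{1..n}.
      by apply/mnmP => x; rewrite mnmBE subnn mnm0E.
    by rewrite mderivX mnm1E eqxx scale1r UU mpolyX0 rmorph1 mul1r addr0.
  by rewrite mderivX mnm1E eq_sym (negbTE nl) scale0r mmap0 mul0r.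
elim/mpolyind: q => [|c m p _ _ hp].
  by rewrite mmap0 mderiv0 big1 // => i _; rewrite mderiv0 mmap0 mul0r.
rewrite mmapD mderivD hp -mul_mpolyC (GM _ _ (GC c) (GX m)) -big_split /=.
by apply: eq_bigr => i _; rewrite mderivD mmapD mulrDl.
Qed.

(** The variables of [p] are the parameters [t] followed by further generators [s]. Only derivatives
    in the latter enter [h], whose nonvanishing expresses separability over the parameters. *)
Definition jacobian_datum (K : fieldType) (L : comNzRingType) (io : {rmorphism K -> L})
    D g (t : 'I_D -> L) (s : 'I_g -> L) (p : 'I_g -> {mpoly K[D + g]}) (h : L) : Prop :=
  [/\ alg_indep io t, forall r, mmap io (join_fun t s) (p r) = 0,
      h = \det (\matrix_(r, r') mmap io (join_fun t s) (p r)^`M(rshift D r')) & h != 0].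

Lemma mmap_injC (K : fieldType) (L : comNzRingType) (io : {rmorphism K -> L}) n
  (x : 'I_n -> L) : n = 0%N -> alg_indep io x.
Proof.
move=> n0 P; rewrite (nvar0_mpolyC_eq P n0) mmapC => /eqP.
by rewrite fmorph_eq0 => /eqP->; rewrite mpolyC0.
Qed.

Section NormalForm.
Variables (K : fieldType) (L : idomainType) (io : {rmorphism K -> L}).
Hypotheses (infK : infinite_field K) (perfK : perfect_field K).

Definition module_finite D g (t : 'I_D -> L) (s : 'I_g -> L) : Prop :=
  exists (q : nat) (e : 'I_q -> L), forall P,
    exists c : 'I_q -> {mpoly K[D]}, mmap io (join_fun t s) P = \sum_i mmap io t (c i) * e i.

(** In a relation of least size, a derivative that vanishes at [xi] is the zero polynomial, being
    smaller. If all vanish, [f] is a constant or a p-th power whose root is a smaller relation. *)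
Lemma minimal_relation n (xi : 'I_n -> L) : ~ alg_indep io xi ->
  exists f, [/\ f != 0, mmap io xi f = 0 & exists i, mmap io xi f^`M(i) != 0].
Proof.
move=> /existsNP[f0 /not_implyP[f0xi /eqP f00]].
have [f [nz fxi minf]] : exists f, [/\ f != 0, mmap io xi f = 0 &
    forall f', f' != 0 -> mmap io xi f' = 0 -> (msize f <= msize f')%N].
  have [N] := ubnP (msize f0); elim: N f0 f0xi f00 => // N IHN f fxi f0 hN.
  have [h|/existsNP[f' /not_implyP[f'0 /not_implyP[f'xi /negP]]]] := pselect
    (forall f', f' != 0 -> mmap io xi f' = 0 -> (msize f <= msize f')%N); first by exists f.
  by rewrite -ltnNge => lt; apply: (IHN f') => //; exact: leq_trans lt _.
exists f; split=> //; apply: contrapT => nd.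
have df i : f^`M(i) = 0.
  apply/eqP; apply: contraT => dn0; have := minf _ dn0.
  have -> : mmap io xi f^`M(i) = 0 by apply/eqP/negPn/negP => h; apply: nd; exists i.
  move=> /(_ erefl); suff lt : (msize f^`M(i) < msize f)%N by rewrite leqNgt lt.
  rewrite -(mlead_deg dn0); have := mlead_supp dn0; rewrite mcoeff_msupp mcoeff_deriv.
  move=> h; have := @msize_mdeg_lt _ _ f (mlead f^`M(i) + U_(i))%MM.
  rewrite mcoeff_msupp mdegD mdeg1 addn1; apply.
  by apply: contraNneq h => ->; rewrite mul0rn.
have [[c fc]|[p [g [pp p1 fg]]]] := mderiv_all0 perfK df.
  by move: fxi nz; rewrite fc mmapC mpolyC_eq0 => /eqP; rewrite fmorph_eq0 => ->.
have g0 : g != 0.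
  by apply: contraNneq nz => g0; rewrite fg g0 expr0n eqn0Ngt prime_gt0.
have gxi : mmap io xi g = 0.
  by apply/eqP; move/eqP: fxi; rewrite fg rmorphXn expf_eq0 => /andP[].
have := minf _ g0 gxi; rewrite -(mlead_deg nz) -(mlead_deg g0) ltnS fg mleadX // mdegMn.
have [d0|dpos] := posnP (mdeg (mlead g)); last by rewrite -{2}[mdeg _]muln1 leq_pmul2l // leqNgt p1.
move=> _; have gC : g = (g@_0)%:MP by apply: msize1_polyC; rewrite -mlead_deg // d0.
by move: gxi g0; rewrite gC mmapC mpolyC_eq0 => /eqP; rewrite fmorph_eq0 => ->.
Qed.

Lemma join_mmapM D g (t : 'I_D -> L) (s : 'I_g -> L) q (e : 'I_q -> L) :
  (forall i j, exists c : 'I_q -> {mpoly K[D]}, s i * e j = \sum_k mmap io t (c k) * e k) ->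
  (exists c : 'I_q -> {mpoly K[D]}, 1 = \sum_k mmap io t (c k) * e k) ->
  forall P, exists c : 'I_q -> {mpoly K[D]},
    mmap io (join_fun t s) P = \sum_i mmap io t (c i) * e i.
Proof.
move=> hs h1; apply: (mmap_closed (S := fun a =>
  exists c : 'I_q -> {mpoly K[D]}, a = \sum_i mmap io t (c i) * e i)) => //.
- move=> a b [c ->] [c' ->]; exists (fun i => c i + c' i); rewrite -big_split.
  by apply: eq_bigr => i _; rewrite rmorphD mulrDl.
- move=> x a [c ->]; exists (fun i => x%:MP * c i); rewrite mulr_sumr.
  by apply: eq_bigr => i _; rewrite rmorphM /= mmapC mulrA.
- move=> i a [c ->]; rewrite /join_fun; case: (split i) => [j|j].
    exists (fun i => 'X_j * c i); rewrite mulr_sumr.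
    by apply: eq_bigr => k _; rewrite rmorphM /= mmapXU mulrA.
  pose b k := sval (cid (hs j k)).
  exists (fun l => \sum_k c k * b k l); rewrite mulr_sumr.
  under eq_bigr do rewrite mulrCA (svalP (cid (hs j _))) mulr_sumr.
  rewrite exchange_big; apply: eq_bigr => l _ /=; rewrite rmorph_sum mulr_suml.
  by apply: eq_bigr => k _; rewrite rmorphM mulrA.
Qed.

(** Induction on the number of generators. The shear is chosen so that a relation becomes monic in
    the last generator and also keeps a nonzero derivative in it; the second condition makes the
    normalization separable. *)
Theorem normal_form n (xi : 'I_n -> L) : exists D g (t : 'I_D -> L) (s : 'I_g -> L) p h,
  [/\ jacobian_datum io t s p h, module_finite t s &
      forall i, exists P, xi i = mmap io (join_fun t s) P].
Proof.
have indep m (x : 'I_m -> L) : alg_indep io x -> exists D g (t : 'I_D -> L) (s : 'I_g -> L) p h,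
  [/\ jacobian_datum io t s p h, module_finite t s &
      forall i, exists P, x i = mmap io (join_fun t s) P].
  move=> hx; exists m, 0%N, x, (fun=> 0), (fun=> 0), 1; split.
  - by split=> // [[]//||]; rewrite ?det_mx00 ?oner_eq0.
  - exists 1%N, (fun=> 1); apply: join_mmapM => [[]//|].
    by exists (fun=> 1); rewrite big_ord1 rmorph1 mulr1.
  - by move=> i; exists 'X_(lshift 0 i); rewrite mmapXU join_funl.
elim: n xi => [|d IHd] xi; first by apply: indep; exact: mmap_injC.
have [/indep//|/minimal_relation[f [f0 fxi [i0 di0]]]] := pselect (alg_indep io xi).
(* As a function of [c], this is the derivative at [xi] of the sheared relation with respect to the
   last variable. *)
pose lin : {mpoly L[d]} := \sum_(j < d) mmap io xi f^`M(lift ord_max j) *: 'X_j +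
  (mmap io xi f^`M(ord_max))%:MP.
have lin0 : lin != 0.
  apply/eqP => l0; move: di0; case: (unliftP ord_max i0) => [j|] ->.
    have := congr1 (mcoeff U_(j)) l0; rewrite mcoeff0 mcoeffD mcoeffC mnm1_eq0 mulr0 addr0.
    rewrite raddf_sum (bigD1 j) //= mcoeffZ mcoeffXU eqxx mulr1 big1 ?addr0 => [->|k nk].
      by rewrite eqxx.
    by rewrite mcoeffZ mcoeffXU (negbTE nk) mulr0.
  have := congr1 (mcoeff 0%MM) l0; rewrite mcoeff0 mcoeffD mcoeffC eqxx mulr1.
  rewrite raddf_sum big1 ?add0r /= => [->|k _]; first by rewrite eqxx.
  by rewrite mcoeffZ mcoeffX mnm1_eq0 mulr0.
have H0 : map_mpoly io (topform f) * lin != 0.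
  rewrite mulf_neq0 //; apply: contraNneq (topform_neq0 f0) => e.
  apply/eqP/mpolyP => m; have := congr1 (mcoeff m) e; rewrite mcoeff_map_mpoly !mcoeff0.
  by move/eqP; rewrite fmorph_eq0 => /eqP.
have [c] := nonvanishing io infK H0; rewrite mevalM mulf_eq0 => /norP[top lin_c].
have {}top : (topform f).@[c] != 0.
  have evc P : (map_mpoly io P).@[fun i => io (c i)] = io P.@[c].
    apply: (mpoly_rmorph_eq (f := meval (fun i => io (c i)) \o map_mpoly io)
      (g := io \o meval c)) => [a|i] /=; first by rewrite map_mpolyC !mevalC.
    by rewrite map_mpolyX !mevalXU.
  by apply: contraNneq top => e; rewrite evc e rmorph0.
have [m hm] := shear_reduce f0 fxi top.
pose eta (j : 'I_d) := xi (lift ord_max j) - io (c j) * xi ord_max; rewrite -/eta in hm.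
have [D [g [t [s [p [h [[it hp hE h0] [q [e fin]] gen]]]]]]] := IHd eta.
pose x := xi ord_max; pose s' := ext_last s x : 'I_g.+1 -> L.
pose Y : 'I_(D + g) -> {mpoly K[D + g.+1]} :=
  join_fun (fun j => 'X_(lshift g.+1 j)) (fun r => 'X_(rshift D (lift ord_max r))).
pose emb := mmap (@mpolyC (D + g.+1) K) Y.
have embE P : mmap io (join_fun t s') (emb P) = mmap io (join_fun t s) P.
  rewrite /emb mmap_comp; apply: (mpoly_rmorph_eq
   (f := mmap (mmap io (join_fun t s') \o @mpolyC _ K) (mmap io (join_fun t s') \o Y))
   (g := mmap io (join_fun t s))) => [a|i] /=; rewrite ?mmapC ?mmapXU //= /Y.
    by rewrite mmapC.
  rewrite -(splitK i); case: (split i) => j /=; rewrite ?(join_funl, join_funr) mmapXU.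
    by rewrite join_funl.
  by rewrite join_funr /s' ext_last_lift.
pose Pi j := sval (cid (gen j)); have PiE j : eta j = mmap io (join_fun t s) (Pi j).
  exact: (svalP (cid (gen j))).
pose X' : {mpoly K[D + g.+1]} := 'X_(rshift D ord_max).
have X'E : mmap io (join_fun t s') X' = x by rewrite mmapXU join_funr /s' ext_last_max.
pose u := ext_last (fun j => emb (Pi j) + (c j)%:MP * X') X'.
have uE P : mmap io (join_fun t s') (mmap (@mpolyC _ K) u P) = mmap io xi P.
  rewrite mmap_comp; apply: (mpoly_rmorph_eq
   (f := mmap (mmap io (join_fun t s') \o @mpolyC _ K) (mmap io (join_fun t s') \o u))
   (g := mmap io xi)) => [a|i] /=; rewrite ?mmapC ?mmapXU //= ?mmapC // /u.
  case: (unliftP ord_max i) => [j|] ->; rewrite ?ext_last_lift ?ext_last_max //.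
  by rewrite rmorphD rmorphM /= X'E mmapC embE -PiE /eta subrK.
pose p' := ext_last (fun r => emb (p r)) (mmap (@mpolyC _ K) u f) : 'I_g.+1 -> _.
have dY0 P : (emb P)^`M(rshift D ord_max) = 0.
  rewrite /emb mderiv_comp big1 // => i _; rewrite /Y /join_fun.
  case: (split i) => j; rewrite mderivX mnm1E.
    by rewrite eq_lrshift scale0r mulr0.
  by rewrite eq_rshift eq_sym (negbTE (neq_lift _ _)) scale0r mulr0.
have dY P r : (emb P)^`M(rshift D (lift ord_max r)) = emb P^`M(rshift D r).
  rewrite /emb mderiv_comp (bigD1 (rshift D r)) //= big1 ?addr0 => [|i ni].
    rewrite /Y join_funr mderivX mnm1E eqxx scale1r.
    have -> : forall n (j : 'I_n), (U_(j) - U_(j))%MM = 0%MM :> 'X_{1..n}.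
      by move=> n j; apply/mnmP => k; rewrite mnmBE subnn mnm0E.
    by rewrite mpolyX0 mulr1.
  have {ni} : i != rshift D r by [].
  rewrite -(splitK i) /Y /join_fun unsplitK; case: (split i) => j /= nj.
    by rewrite mderivX mnm1E eq_lrshift scale0r mulr0.
  rewrite mderivX mnm1E eq_rshift (inj_eq lift_inj).
  by move: nj; rewrite eq_rshift => /negbTE->; rewrite scale0r mulr0.
pose h' := mmap io (join_fun t s') (mmap (@mpolyC _ K) u f)^`M(rshift D ord_max) * h.
exists D, g.+1, t, s', p', h'; split; last first.
- move=> i; case: (unliftP ord_max i) => [j|] ->; last by exists X'; rewrite X'E.
  by exists (emb (Pi j) + (c j)%:MP * X'); rewrite rmorphD rmorphM /= embE X'E mmapC -PiE subrK.
- pose S a := exists b : 'I_m -> {mpoly K[D + g]},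
     a = \sum_j mmap io (join_fun t s) (b j) * x ^+ j.
  have hmS Q : S (mmap io xi Q).
    have [r ->] := hm Q; exists (fun j => mmap (@mpolyC _ K) Pi (r j)).
    apply: eq_bigr => j _; congr (_ * _); rewrite [RHS]mmap_comp.
    apply: (mpoly_rmorph_eq (f := mmap io eta)
      (g := mmap (mmap io (join_fun t s) \o @mpolyC _ K) (mmap io (join_fun t s) \o Pi))) => [a|i] /=.
      by rewrite !mmapC /= mmapC.
    by rewrite !mmapXU /= PiE.
  have SD a b : S a -> S b -> S (a + b).
    move=> [a1 ->] [b1 ->]; exists (fun j => a1 j + b1 j); rewrite -big_split.
    by apply: eq_bigr => j _; rewrite rmorphD mulrDl.
  have SM P a : S a -> S (mmap io (join_fun t s) P * a).
    move=> [a1 ->]; exists (fun j => P * a1 j); rewrite mulr_sumr.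
    by apply: eq_bigr => j _; rewrite rmorphM mulrA.
  have Sx a : S a -> S (x * a).
    move=> [a1 ->]; rewrite mulr_sumr; apply: (big_ind S) => //.
      by exists (fun=> 0); rewrite big1 // => j _; rewrite rmorph0 mul0r.
    move=> j _; rewrite mulrCA -exprS; apply: SM.
    by have := hmS ('X_ord_max ^+ j.+1); rewrite rmorphXn /= mmapXU.
  have [|q' [e' he']] := @finite_overI K L io D t ('I_q * 'I_m)%type (fun ij => e ij.1 * x ^+ ij.2) S.
    move=> a [b ->]; pose cc j := sval (cid (fin (b j))).
    exists (fun ij => cc ij.2 ij.1).
    rewrite -(pair_bigA _ (fun i j => mmap io t (cc j i) * (e i * x ^+ j))) /= exchange_big.
    apply: eq_bigr => j _; rewrite (svalP (cid (fin (b j)))) mulr_suml.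
    by apply: eq_bigr => i _; rewrite mulrA.
  exists q', e' => P; apply: he'; apply: mmap_closed => //.
  + by have := hmS 1; rewrite rmorph1.
  + by move=> a b Sb; have := SM a%:MP b Sb; rewrite mmapC.
  + move=> i a Sa; rewrite -(splitK i) /join_fun unsplitK; case: (split i) => j.
      by have := SM 'X_(lshift g j) a Sa; rewrite mmapXU join_funl.
    rewrite /s'; case: (unliftP ord_max j) => [k|] ->; rewrite (ext_last_lift, ext_last_max).
      by have := SM 'X_(rshift D k) a Sa; rewrite mmapXU join_funr.
    exact: Sx.
have dlast : mmap io (join_fun t s') (mmap (@mpolyC _ K) u f)^`M(rshift D ord_max) =
    lin.@[fun i => io (c i)].
  rewrite mderiv_comp rmorph_sum big_ord_recr /= /lin mevalD mevalC; congr (_ + _).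
    rewrite (rmorph_sum (meval _)); apply: eq_bigr => j _.
    have -> : widen_ord (leqnSn d) j = lift ord_max j.
      by apply: val_inj; rewrite /= /bump leqNgt ltn_ord.
    rewrite rmorphM /= uE mevalZ mevalXU; congr (_ * _).
    rewrite /u ext_last_lift mderivD dY0 add0r mderiv_mulC rmorphM /= mmapC.
    rewrite mderivX mnm1E eqxx scale1r; have -> : (U_(rshift D ord_max) - U_(rshift D ord_max))%MM = 0%MM :> 'X_{1..D + g.+1}.
      by apply/mnmP => k; rewrite mnmBE subnn mnm0E.
    by rewrite mpolyX0 rmorph1 mulr1.
  rewrite rmorphM /= uE /u ext_last_max mderivX mnm1E eqxx scale1r.
  have -> : (U_(rshift D ord_max) - U_(rshift D ord_max))%MM = 0%MM :> 'X_{1..D + g.+1}.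
    by apply/mnmP => k; rewrite mnmBE subnn mnm0E.
  by rewrite mpolyX0 rmorph1 mulr1.
split=> //.
- move=> r; rewrite /p'; case: (unliftP ord_max r) => [k|] ->.
    by rewrite ext_last_lift embE.
  by rewrite ext_last_max uE.
(* The old relations are free of the new variable, so only one entry of the last column survives,
   and its cofactor is the old [h]. *)
- rewrite (expand_det_col _ ord_max) (bigD1 ord_max) //= big1 ?addr0 => [|r nr]; last first.
    rewrite mxE; case: (unliftP ord_max r) nr => [k|] ->; rewrite ?eqxx // => _.
    by rewrite /p' ext_last_lift dY0 rmorph0 mul0r.
  rewrite mxE /p' ext_last_max /h'; congr (_ * _).
  rewrite /cofactor -signr_odd addnn odd_double expr0 mul1r hE; congr (\det _).
  by apply/matrixP => i j; rewrite !mxE /= ext_last_lift dY embE.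
- by rewrite mulf_neq0 // dlast.
Qed.

End NormalForm.

(** * Finite extensions, Nakayama's lemma, interpolation *)

Lemma mmap1_add (A : comNzRingType) n (h : 'I_n -> A) m1 m2 :
  mmap1 h (m1 + m2)%MM = mmap1 h m1 * mmap1 h m2.
Proof. by apply: commr_mmap1_M => i x; exact: mulrC. Qed.

Lemma mmap1_mul (A : comNzRingType) n (h : 'I_n -> A) m k :
  mmap1 h (m *+ k)%MM = mmap1 h m ^+ k.
Proof.
by elim: k => [|k IHk]; rewrite ?mulm0n ?mmap11 // mulmS mmap1_add exprS IHk.
Qed.

Section Span.
Variables (K : nzRingType) (A : comNzRingType) (io : {rmorphism K -> A}).
Variables (D : nat) (t : 'I_D -> A).

Definition mspan (I : finType) (e : I -> A) (a : A) : Prop :=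
  exists c : I -> {mpoly K[D]}, a = \sum_i mmap io t (c i) * e i.

Variables (I : finType) (e : I -> A).

Lemma mspan0 : mspan e 0.
Proof. by exists (fun=> 0); rewrite big1 // => i _; rewrite rmorph0 mul0r. Qed.

Lemma mspanD a b : mspan e a -> mspan e b -> mspan e (a + b).
Proof.
move=> [c ->] [c' ->]; exists (fun i => c i + c' i); rewrite -big_split.
by apply: eq_bigr => i _; rewrite rmorphD mulrDl.
Qed.

Lemma mspanM P a : mspan e a -> mspan e (mmap io t P * a).
Proof.
move=> [c ->]; exists (fun i => P * c i); rewrite mulr_sumr.
by apply: eq_bigr => i _; rewrite rmorphM mulrA.
Qed.

Lemma mspanC x a : mspan e a -> mspan e (io x * a).
Proof. by move=> h; rewrite -(mmapC t); exact: mspanM. Qed.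

Lemma mspanX i a : mspan e a -> mspan e (t i * a).
Proof. by move=> h; rewrite -(mmapXU io t); exact: mspanM. Qed.

Lemma mspanN a : mspan e a -> mspan e (- a).
Proof. by move=> h; rewrite -mulN1r -(rmorphN1 io); exact: mspanC. Qed.

Lemma mspan_sum (J : Type) (s : seq J) (Q : pred J) (F : J -> A) :
  (forall j, Q j -> mspan e (F j)) -> mspan e (\sum_(j <- s | Q j) F j).
Proof. by move=> h; apply: big_ind => //; [exact: mspan0|exact: mspanD]. Qed.

Lemma mspan_mem i : mspan e (e i).
Proof.
exists (fun j => (j == i)%:R); rewrite (bigD1 i) //= eqxx rmorph1 mul1r big1 ?addr0 // => j /negbTE->.
by rewrite rmorph0 mul0r.
Qed.

End Span.

(** As [msize] is the degree plus one, F_i acts on the [e] as t_i^T_i plus terms of lower degree. A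
    monomial with some exponent at least T_i is thus rewritten by F_i in lower degree, and the
    finitely many others, times the [e], span. *)
Lemma finite_over_perturb (K : nzRingType) (A : comNzRingType) (io : {rmorphism K -> A}) D
    (t F : 'I_D -> A) q (e : 'I_q -> A) (T : 'I_D -> nat) :
  (forall a, mspan io t e a) -> (forall i, 0 < T i)%N ->
  (forall i r, exists c : 'I_q -> {mpoly K[D]}, (forall s, (msize (c s) <= T i)%N) /\
     (F i - t i ^+ T i) * e r = \sum_s mmap io t (c s) * e s) ->
  finite_over io F.
Proof.
move=> he T0 hF; pose B := \max_i T i.
pose E (fr : {ffun 'I_D -> 'I_B.+1} * 'I_q) := (\prod_i t i ^+ fr.1 i) * e fr.2.
have key N m r : (mdeg m < N)%N -> mspan io F E (mmap1 t m * e r).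
  elim: N m r => // N IHN m r hm.
  have [/forallP small|/forallPn[i]] := boolP [forall i, m i < T i]%N.
    have -> : mmap1 t m * e r = E ([ffun i => inord (m i)], r); last exact: mspan_mem.
    rewrite /E /mmap1 /=; congr (_ * _); apply: eq_bigr => i _; rewrite ffunE inordK //.
    by apply: leq_trans (small i) _; apply: leqW; exact: leq_bigmax.
  rewrite -leqNgt => Tm; pose m' := (m - U_(i) *+ T i)%MM.
  have mE : m = (m' + U_(i) *+ T i)%MM.
    apply/mnmP => j; rewrite mnmDE mnmBE mulmnE mnm1E.
    by case: eqP => [<-|_]; rewrite ?mul1n ?mul0n ?subnK // subn0 addn0.
  have dm : mdeg m = (mdeg m' + T i)%N by rewrite {1}mE mdegD mdegMn mdeg1 mul1n.
  have -> : mmap1 t m = mmap1 t m' * t i ^+ T i.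
    by rewrite {1}mE mmap1_add mmap1_mul mmap1U.
  have [c [sc hc]] := hF i r.
  have -> : mmap1 t m' * t i ^+ T i * e r = F i * (mmap1 t m' * e r) -
      \sum_s mmap1 t m' * mmap io t (c s) * e s.
    have -> : \sum_s mmap1 t m' * mmap io t (c s) * e s = mmap1 t m' * ((F i - t i ^+ T i) * e r).
      by rewrite hc mulr_sumr; apply: eq_bigr => s _; rewrite mulrA.
    ring.
  have lt : (mdeg m' < N)%N by have := T0 i; lia.
  apply: mspanD; first by apply: mspanX; exact: IHN.
  apply: mspanN; apply: mspan_sum => s _; rewrite {1}[c s]mpolyE rmorph_sum mulr_sumr mulr_suml big_seq.
  apply: mspan_sum => k kc; rewrite /= mmapZ mmapX mulrCA -mulrA; apply: mspanC.
  rewrite -mmap1_add; apply: IHN; rewrite mdegD.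
  by have := msize_mdeg_lt kc; have := sc s; lia.
suff spanE a : mspan io F E a.
  have [q' [e' h]] := @finite_overI K A io D F _ E (fun=> True) (fun a _ => spanE a).
  by exists q', e' => a; exact: h.
have [c ->] := he a; apply: mspan_sum => r _.
rewrite [c r]mpolyE rmorph_sum mulr_suml; apply: mspan_sum => k _.
by rewrite /= mmapZ mmapX -mulrA; apply: mspanC; exact: (key (mdeg k).+1).
Qed.

Lemma alg_dependence_lt (K : fieldType) (A : comNzRingType) (io : {rmorphism K -> A}) D m
    (F : 'I_D -> A) (x : 'I_m -> A) : (D < m)%N -> finite_over io F ->
  exists2 P : {mpoly K[m]}, P != 0 & mmap io x P = 0.
Proof.
case: m x => // m x; rewrite ltnS => Dm [q [e he]].
pose F' (i : 'I_m) := oapp F 0 (insub (i : nat)).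
apply: (alg_dependence (F := F')); exists q, e => a; have [c ->] := he a.
pose em := mmap (@mpolyC m K) (fun j : 'I_D => 'X_(widen_ord Dm j)).
exists (fun i => em (c i)); apply: eq_bigr => i _; congr (_ * _).
rewrite /em mmap_comp; apply: (mpoly_rmorph_eq (f := mmap io F)
  (g := mmap (mmap io F' \o @mpolyC _ K) (mmap io F' \o _))) => [b|j] /=; rewrite ?mmapC //= ?mmapC //.
by rewrite !mmapXU /= mmapXU /F' /= valK.
Qed.

Lemma det_mod (A : comNzRingType) (J : set A) n (M N : 'M[A]_n) : is_ideal J ->
  (forall i j, J (M i j - N i j)) -> J (\det M - \det N).
Proof.
move=> hJ h; rewrite -sumrB; apply: ideal_sum => // s _; rewrite -mulrBr; apply: idealM => //.
elim/big_ind2: _ => [|x y z w hx hy|i _] //; first by rewrite subrr; exact: ideal0.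
have -> : y * w - x * z = (y - x) * w + x * (w - z) by ring.
by apply: idealD => //; [exact: idealMr|exact: idealM].
Qed.

(** Modulo [Q] the generators satisfy v = N v with the entries of N in [J]; by Cramer's rule g =
    det(1 - N) works. *)
Lemma nakayama (A : comNzRingType) (M Q J : set A) : is_ideal Q -> is_ideal J -> fin_gen M ->
  (forall x, M x -> ideal_add Q (ideal_mul J M) x) ->
  exists g, J (1 - g) /\ forall x, M x -> Q (g * x).
Proof.
move=> hQ hJ [r [v [Mv gen]]] hM.
have mulE x : ideal_mul J M x -> exists c : 'I_r -> A, (forall k, J (c k)) /\ x = \sum_k c k * v k.
  elim/ideal_mul_ind => [|y z [c [hc ->]] [c' [hc' ->]]|a b ha /gen[c ->]].
  - by exists (fun=> 0); split=> [_|]; [exact: ideal0|rewrite big1 // => k _; rewrite mul0r].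
  - exists (fun k => c k + c' k); split=> [k|]; first exact: idealD.
    by rewrite -big_split; apply: eq_bigr => k _; rewrite mulrDl.
  - exists (fun k => a * c k); split=> [k|]; first exact: idealMr.
    by rewrite mulr_sumr; apply: eq_bigr => k _; rewrite mulrA.
have /choice[N hN] k : exists c : 'I_r -> A, (forall l, J (c l)) /\ Q (v k - \sum_l c l * v l).
  have [a [_ [Qa /mulE[c [hc ->]] vE]]] := ideal_addP (hM _ (Mv k)).
  by exists c; split=> //; rewrite vE addrK.
pose M' : 'M[A]_r := \matrix_(i, j) ((i == j)%:R - N i j).
exists (\det M'); split=> [|x /gen[c ->]].
  rewrite -(det1 A r); apply: det_mod => // i j; rewrite !mxE opprB addrC addrNK.
  by case: (hN i).
rewrite mulr_sumr; apply: ideal_sum => // k _; rewrite mulrCA; apply: idealM => //.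
have -> : \det M' * v k = (\adj M' *m (M' *m \col_i v i)) k 0.
  by rewrite mulmxA mul_adj_mx mul_scalar_mx !mxE.
rewrite mxE; apply: ideal_sum => // i _; apply: idealM => //.
rewrite mxE; have -> : \sum_j M' i j * (\col_i0 v i0) j 0 = v i - \sum_l N i l * v l.
  under eq_bigr do rewrite !mxE mulrBl.
  rewrite sumrB; congr (_ - _); rewrite (bigD1 i) //= eqxx mul1r big1 ?addr0 // => j nj.
  by rewrite eq_sym (negbTE nj) mul0r.
by case: (hN i).
Qed.

Lemma infinite_seq (K : fieldType) (chi : {poly K}) n : infinite_field K -> chi != 0 ->
  exists s : n.-tuple K, uniq s /\ forall x, x \in s -> chi.[x] != 0.
Proof.
move=> infK chi0; elim: n => [|n [s [us hs]]]; first by exists [tuple].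
have [r hr] : exists r : seq K, forall x, chi.[x] = 0 -> x \in r.
  elim: {chi}(size chi) {-2}chi (leqnn (size chi)) chi0 {hs} => [|k IHk] chi.
    by rewrite size_poly_leq0 => ->.
  move=> sz chi0; have [[x /eqP rx]|nr] := pselect (exists x, chi.[x] = 0); last first.
    by exists [::] => x hx; case: nr; exists x.
  have /factor_theorem[p pE] : root chi x by [].
  have p0 : p != 0 by apply: contraNneq chi0 => p0; rewrite pE p0 mul0r.
  have [|r hr] := IHk p _ p0.
    by move: sz; rewrite pE size_Mmonic ?monicXsubC // size_XsubC addn2.
  exists (x :: r) => y; rewrite pE hornerM !hornerE => /eqP; rewrite mulf_eq0 subr_eq0 inE.
  by case/orP=> [/eqP/hr->|->]; rewrite ?orbT.
have [x] := infK (s ++ r); rewrite mem_cat => /norP[xs xr].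
exists [tuple of x :: s]; split=> /= [|y]; first by rewrite xs.
rewrite inE => /predU1P[->|/hs//]; by apply: contra xr => /eqP/hr.
Qed.

(** An inverse Vandermonde matrix over [K] expresses the coefficients of [P] by its values at
    distinct points where [chi] does not vanish. *)
Lemma interpolation (K : fieldType) (A : comNzRingType) (io : {rmorphism K -> A})
    (V : set A) (P : {poly A}) (chi : {poly K}) : infinite_field K ->
  V 0 -> (forall x y, V x -> V y -> V (x + y)) -> (forall c x, V x -> V (io c * x)) ->
  chi != 0 -> (forall x, chi.[x] != 0 -> V P.[io x]) -> forall i, V P`_i.
Proof.
move=> infK V0 VD VC chi0 hP i.
have [le|lt] := leqP (size P) i; first by rewrite nth_default.
have [s [us hs]] := infinite_seq (size P) infK chi0.
pose a : 'rV[K]_(size P) := \row_j tnth s j.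
pose W := invmx (Vandermonde (size P) a).
have VW : Vandermonde (size P) a *m W = 1%:M.
  apply: mulmxV; rewrite unitmxE unitfE det_Vandermonde.
  apply/prodf_neq0 => k _; apply/prodf_neq0 => l kl; rewrite !mxE subr_eq0.
  by apply: contraTneq kl => /(elimT (tuple_uniqP s) us) ->; rewrite ltnn.
have -> : P`_i = \sum_j io (W j (Ordinal lt)) * P.[io (tnth s j)].
  under eq_bigr do rewrite horner_coef mulr_sumr.
  rewrite exchange_big -[LHS]mulr1.
  have VWE (k : 'I_(size P)) : \sum_j io (W j (Ordinal lt)) * (P`_k * io (tnth s j) ^+ k) =
      P`_k * io (k == Ordinal lt)%:R.
    have := congr1 (fun M : 'M_(_) => M k (Ordinal lt)) VW; rewrite !mxE => <-.
    rewrite rmorph_sum mulr_sumr; apply: eq_bigr => j _ /=.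
    by rewrite mulrCA -rmorphXn -rmorphM !mxE [X in io X]mulrC.
  under [RHS]eq_bigr do rewrite VWE.
  rewrite (bigD1 (Ordinal lt)) //= eqxx rmorph1 big1 ?addr0 // => k /negbTE->.
  by rewrite rmorph0 mulr0.
by apply: big_ind => // j _; apply: VC; apply: hP; apply: hs; exact: mem_tnth.
Qed.

(** * Forms in elements of an ideal *)

Section Homogeneous.
Variables (K : nzRingType) (A : comNzRingType) (io : {rmorphism K -> A}).
Variables (I : set A) (m : nat) (b : 'I_m -> A).
Hypotheses (hI : is_ideal I) (Ib : forall i, I (b i)).

Lemma mmap1_pow k : ideal_pow I (mdeg k) (mmap1 b k).
Proof.
rewrite mdegE /mmap1; elim/big_rec2: _ => // i x n _ h.
by apply: ideal_powD_mem => //; exact: ideal_powX.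
Qed.

Lemma mmap_homog n Psi : Psi \is n.-homog -> ideal_pow I n (mmap io b Psi).
Proof.
move=> /dhomogP h; rewrite [Psi]mpolyE rmorph_sum big_seq.
apply: ideal_sum; first exact: ideal_pow_ideal.
move=> k kP; rewrite /= mmapZ mmapX; apply: idealM; first exact: ideal_pow_ideal.
by rewrite -(h k kP); exact: mmap1_pow.
Qed.

Variables (v : 'I_m -> K) (i0 : 'I_m).

(** The part of [I^n] with one factor among the differences b_i - v_i b_i0. Modulo it, a form of
    degree [n] in the [b] is its value at [v] times b_i0^n. *)
Definition reduced_pow n : set A := if n is k.+1
  then ideal_mul (ideal_gen (range (fun i => b i - io (v i) * b i0))) (ideal_pow I k) else [set 0].

Lemma reduced_pow_ideal n : is_ideal (reduced_pow n).
Proof.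
case: n => [|n] /=; last exact/ideal_mul_ideal/ideal_pow_ideal.
by split=> //= [x y -> ->|c x ->]; rewrite ?addr0 ?mulr0.
Qed.

Lemma mmap1_reduce k :
  reduced_pow (mdeg k) (mmap1 b k - mmap1 (io \o v) k * b i0 ^+ mdeg k).
Proof.
move: {-1}(mdeg k) (erefl (mdeg k)) => n; elim: n k => [|n IHn] k kn.
  by move/eqP: kn; rewrite mdeg_eq0 => /eqP->; rewrite !mmap11 mul1r expr0 subrr.
have [i ki] : exists i, k i != 0%N.
  apply: contrapT => nk; move: kn; rewrite mdegE big1 // => i _.
  by apply/eqP/negPn/negP => h; apply: nk; exists i.
pose k' := (k - U_(i))%MM; have kE : k = (U_(i) + k')%MM by rewrite addmC submK // lep1mP.
have k'n : mdeg k' = n by move: kn; rewrite kE mdegD mdeg1 => -[].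
rewrite kE !mmap1_add !mmap1U exprS /=.
have -> : b i * mmap1 b k' - io (v i) * mmap1 (io \o v) k' * (b i0 * b i0 ^+ n) =
  (b i - io (v i) * b i0) * mmap1 b k' + io (v i) * (b i0 * (mmap1 b k' - mmap1 (io \o v) k' * b i0 ^+ n)).
  ring.
apply: (idealD (reduced_pow_ideal n.+1)).
  apply: ideal_mul_mem; first by apply: sub_ideal_gen; exists i.
  by rewrite -k'n; exact: mmap1_pow.
refine (idealM (reduced_pow_ideal n.+1) _); have := IHn k' k'n.
case: (n) => [/= ->|l /=]; first by rewrite mulr0; exact: ideal_mul0.
elim/ideal_mul_ind => [|x y hx hy|x y hx hy].
- by rewrite mulr0; exact: ideal_mul0.
- by rewrite mulrDr; exact: ideal_mulD.
- by rewrite mulrCA; apply: ideal_mul_mem => //; exact: ideal_mul_mem.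
Qed.

Lemma mmap_reduce n Psi : Psi \is n.-homog ->
  reduced_pow n (mmap io b Psi - mmap io (io \o v) Psi * b i0 ^+ n).
Proof.
have hR := reduced_pow_ideal n.
move=> /dhomogP h; rewrite [Psi]mpolyE !rmorph_sum mulr_suml -sumrB big_seq.
apply: ideal_sum => // k kP; rewrite /= !mmapZ !mmapX -mulrA -mulrBr; apply: idealM => //.
by rewrite -(h k kP); exact: mmap1_reduce.
Qed.

End Homogeneous.

(** * Completely integrally closed domains *)

Definition divides (R : comPzRingType) (a b : R) : Prop := exists c, b = a * c.

(** A fraction p/d all of whose powers have the common denominator [c] must lie in the ring;
    divisibility avoids the field of fractions. *)
Definition completely_closed (R : comNzRingType) : Prop := forall c d p : R,
  c != 0 -> d != 0 -> (forall j, divides (d ^+ j) (c * p ^+ j)) -> divides d p.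

Lemma fraction_ratio (R : idomainType) (x : {fraction R}) :
  exists u v : R, v != 0 /\ x = (tofrac u) / (tofrac v).
Proof.
elim/(@quotW _ (FracField.type R)): x => x; exists x.1, x.2; split; first exact: denom_ratioP.
apply: (canRL (mulfK _)); first by rewrite tofrac_eq0 denom_ratioP.
unlock FracField.tofrac; rewrite -[LHS]FracField.pi_mul; apply/eqmodP.
rewrite /= FracField.equivfE /FracField.mulf.
by rewrite !numden_Ratio ?(mulr1, oner_eq0, mulf_neq0, denom_ratioP) // mulrC.
Qed.

Lemma completely_closed_poly_field (F : fieldType) : completely_closed {poly F}.
Proof.
move=> c d p c0 d0 h; have [g0|g0] := eqVneq (gcdp d p) 0.
  by move/eqP: g0; rewrite gcdp_eq0 (negbTE d0).
have dE : d = (d %/ gcdp d p) * gcdp d p by rewrite divpK // dvdp_gcdl.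
have pE : p = (p %/ gcdp d p) * gcdp d p by rewrite divpK // dvdp_gcdr.
have cop : coprimep (d %/ gcdp d p) (p %/ gcdp d p).
  by apply: coprimep_div_gcd; rewrite d0.
set d1 := d %/ _ in dE cop; set p1 := p %/ _ in pE cop.
set g := gcdp d p in g0 dE pE.
have d10 : d1 != 0 by apply: contraNneq d0 => e; rewrite dE e mul0r.
have dvd j : d1 ^+ j %| c.
  have [q] := h j; rewrite {1}pE {1}dE !exprMn mulrA [RHS]mulrAC => e0.
  have e := mulIf (expf_neq0 j g0) e0.
  by rewrite -(Gauss_dvdpl _ (coprimep_expl j (coprimep_expr j cop))) e dvdp_mulr.
have sz1 : size d1 = 1%N.
  apply/eqP; rewrite eqn_leq size_poly_gt0 d10 andbT leqNgt; apply/negP => s1.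
  have := dvdp_leq c0 (dvd (size c)); rewrite leqNgt => /negP; apply.
  have := size_exp d1 (size c); have := size_poly_gt0 (d1 ^+ size c); rewrite expf_neq0 // => h1 h2.
  have : (size c <= (size d1).-1 * size c)%N by rewrite leq_pmull // -ltnS prednK // ltnW.
  by rewrite -h2 => h3; rewrite -(prednK h1) ltnS.
have [a a0 aE] : exists2 a, a != 0 & d1 = a%:P by apply/size_poly1P; rewrite sz1.
exists (a^-1%:P * p1); rewrite dE pE aE mulrACA -polyCM mulfV // mul1r mulrC.
by rewrite mulrC.
Qed.

(** Over the fraction field q = p/d is a polynomial. Its leading coefficient is almost integral over
    [R], hence in [R], and subtracting the leading term lowers the degree. *)
Lemma completely_closed_poly (R : idomainType) :
  completely_closed R -> completely_closed {poly R}.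
Proof.
move=> ccR c d p c0 d0 h; pose io : {rmorphism R -> {fraction R}} := @tofrac R; pose mp := map_poly io.
have mp_inj : injective mp by apply: map_inj_poly; [move=> x y /eqP; rewrite tofrac_eq => /eqP|exact: tofrac0].
have mp0 q : (mp q == 0) = (q == 0) by rewrite -(inj_eq mp_inj) /mp rmorph0.
have mpM x y : mp (x * y) = mp x * mp y by exact: rmorphM.
have mpD x y : mp (x + y) = mp x + mp y by exact: rmorphD.
have mpX x j : mp (x ^+ j) = mp x ^+ j by exact: rmorphXn.
have [|||q qE] := @completely_closed_poly_field _ (mp c) (mp d) (mp p); rewrite ?mp0 //.
  by move=> j; have [w /(congr1 mp)] := h j; rewrite !mpM !mpX => e; exists (mp w).
have int j : exists w, mp c * q ^+ j = mp w.
  have [w /(congr1 mp)] := h j; rewrite !mpM !mpX => e.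
  exists w; apply: (@mulfI _ (mp d ^+ j)); first by rewrite expf_neq0 ?mp0.
  by rewrite -e qE exprMn; ring.
suff [q0 q0E] : exists q0, q = mp q0.
  by exists q0; apply: mp_inj; rewrite mpM qE q0E.
have [n] := ubnP (size q); elim: n q {qE} int => // n IHn q int.
rewrite ltnS => sz; have [->|q0] := eqVneq q 0; first by exists 0; rewrite /mp rmorph0.
have [a0 a0E] : exists a0, lead_coef q = io a0.
  have [u [v [v0 aE]]] := fraction_ratio (lead_coef q).
  have [||b ub] := ccR (lead_coef c) v u _ v0.
  - by rewrite lead_coef_eq0.
  - move=> j; have [w /(congr1 lead_coef)] := int j.
    rewrite lead_coefM lead_coef_exp aE expr_div_n => e.
    exists (lead_coef w); apply/eqP; rewrite -tofrac_eq !tofracM !tofracXn; apply/eqP.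
    have := e; rewrite !lead_coef_map_inj ?tofrac0 //; try by move=> x y /eqP; rewrite tofrac_eq => /eqP.
    by rewrite /= => <-; rewrite mulrCA [tofrac v ^+ j * _]mulrCA mulfV ?mulr1 // expf_neq0 ?tofrac_eq0.
  - by exists b; rewrite aE ub tofracM mulrAC mulfV ?mul1r // tofrac_eq0.
pose k := (size q).-1; pose r := q - mp (a0%:P * 'X^k).
have rE : mp (a0%:P * 'X^k) = (lead_coef q)%:P * 'X^k.
  by rewrite /mp rmorphM /= map_polyC map_polyXn a0E.
have szr : (size r < n)%N.
  apply: leq_trans sz; rewrite -(prednK (n := size q)) ?size_poly_gt0 // ltnS -/k.
  apply/leq_sizeP => i; rewrite leq_eqVlt => /predU1P[<-|ki].
    by rewrite coefB rE coefCM coefXn eqxx mulr1 subrr.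
  rewrite coefB rE coefCM coefXn gtn_eqF // mulr0 subr0 nth_default //.
  by rewrite -(prednK (n := size q)) ?size_poly_gt0.
have [|r0 r0E] := IHn r _ szr; last first.
  by exists (r0 + a0%:P * 'X^k); rewrite mpD -r0E /r subrK.
move=> j; rewrite exprBn mulr_sumr.
apply: (big_ind (fun x => exists w, x = mp w)) => [|x y [w ->] [w' ->]|i _].
- by exists 0; rewrite /mp rmorph0.
- by exists (w + w'); rewrite mpD.
have [w hw] := int (j - i)%N.
exists ((-1) ^+ i * w * (a0%:P * 'X^k) ^+ i *+ 'C(j, i)).
have -> : mp ((-1) ^+ i * w * (a0%:P * 'X^k) ^+ i *+ 'C(j, i)) =
    mp ((-1) ^+ i * w * (a0%:P * 'X^k) ^+ i) *+ 'C(j, i) by exact: rmorphMn.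
have mpN : mp (-1) = -1 by exact: rmorphN1.
move: (a0%:P * 'X^k) => z.
rewrite !mpM !mpX mpN -hw mulrnAr; congr (_ *+ _).
by rewrite !mulrA [mp c * _]mulrC.
Qed.

Lemma completely_closed_mpoly (K : fieldType) n : completely_closed {mpoly K[n]}.
Proof.
elim: n => [|n IHn] c d p c0 d0 h.
  have := d0; rewrite (nvar0_mpolyC d) mpolyC_eq0 => a0.
  by exists ((d@_0)^-1%:MP * p); rewrite mulrA -mpolyCM mulfV // mpolyC1 mul1r.
pose f := @shear K n (fun=> 0) : {rmorphism {mpoly K[n.+1]} -> {poly {mpoly K[n]}}}.
pose eta (j : 'I_n) : {mpoly K[n.+1]} := 'X_(lift ord_max j).
pose g (P : {poly {mpoly K[n]}}) := eval2 (@mpolyC n.+1 K) eta 'X_ord_max P.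
have fK q : g (f q) = q.
  rewrite /g eval2_shear -[RHS](comp_mpoly_id q) /comp_mpoly; apply: eq_mmap => i.
  rewrite tnth_mktuple; case: (unliftP ord_max i) => [j|] ->.
    by rewrite ext_last_lift rmorph0 mul0r addr0.
  by rewrite ext_last_max.
have f0 q : (f q == 0) = (q == 0) by rewrite -(inj_eq (can_inj fK)) rmorph0.
have [|||w wE] := @completely_closed_poly _ IHn (f c) (f d) (f p); rewrite ?f0 //.
  by move=> j; have [w /(congr1 f)] := h j; rewrite !rmorphM !rmorphXn => e; exists (f w).
exists (g w); rewrite -[LHS]fK wE /g /eval2 rmorphM hornerM.
by rewrite -[X in X * _]/(g (f d)) fK.
Qed.

(** * Traces of almost integral matrices *)

Section Trace.
Variable E : idomainType.
Variables (r : nat) (M : 'M[E]_r) (c theta : E).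
Hypothesis almost : forall j i k, divides (theta ^+ j) (c * (M ^+ j) i k).

(* Q j is the j-th power of the ideal (theta, X) of E[X]. *)
Let Q j (P : {poly E}) := forall i, divides (theta ^+ (j - i)) P`_i.

Let QD j P P' : Q j P -> Q j P' -> Q j (P + P').
Proof.
by move=> h h' i; have [a ha] := h i; have [b hb] := h' i; exists (a + b); rewrite coefD ha hb mulrDr.
Qed.

Let Q0 j : Q j 0.
Proof. by move=> i; exists 0; rewrite coef0 mulr0. Qed.

Let QM i j P P' : Q i P -> Q j P' -> Q (i + j) (P * P').
Proof.
move=> h h' k; rewrite coefM; apply: (big_ind (divides _)) => [|x y [a ->] [b ->]|l _].
- by exists 0; rewrite mulr0.
- by exists (a + b); rewrite mulrDr.
have [a ->] := h l; have [b ->] := h' (k - l)%N.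
exists (theta ^+ ((i - l) + (j - (k - l)) - (i + j - k)) * (a * b)).
rewrite mulrACA [RHS]mulrA -!exprD subnKC //.
by have := ltn_ord l; lia.
Qed.

Let QZ j P P' : Q j P -> Q j (P' * P).
Proof. by move=> h; apply: (@QM 0) => // i; exists P'`_i; rewrite sub0n expr0 mul1r. Qed.

(** A factor X - M contributes either X or [M], and each raises the order in (theta, X) by one. *)
Let charM j l i k : Q (j + l) (c%:P * (char_poly_mx M ^+ j *m map_mx polyC (M ^+ l)) i k).
Proof.
elim: j l i k => [|j IHj] l i k.
  move=> n; rewrite expr0 -[1]/(1%:M) mul1mx mxE -polyCM coefC add0n.
  by case: n => [|n]; [rewrite subn0; exact: almost|exists 0; rewrite mulr0].
have -> : c%:P * (char_poly_mx M ^+ j.+1 *m map_mx polyC (M ^+ l)) i k =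
   'X * (c%:P * (char_poly_mx M ^+ j *m map_mx polyC (M ^+ l)) i k) +
   (-1) * (c%:P * (char_poly_mx M ^+ j *m map_mx polyC (M ^+ l.+1)) i k).
  rewrite exprSr -[_ * char_poly_mx M]/(_ *m char_poly_mx M) -mulmxA [X in _ *m (X *m _)]/char_poly_mx.
  rewrite mulmxBl -map_mxM -[M *m M ^+ l]/(M * M ^+ l) -exprS mulmxBr mul_scalar_mx -scalemxAr !mxE.
  by rewrite mulrBr mulN1r mulrCA.
apply: QD; last by apply: QZ; rewrite addSnnS.
rewrite addSn; apply: (@QM 1) => // i'; rewrite coefX.
by case: i' => [|[|i']]; [exists 0|exists 1; rewrite expr0 mul1r|exists 0]; rewrite ?mulr0.
Qed.

Let Qprod j n (F : 'I_n -> {poly E}) : (forall i, Q j (F i)) -> Q (n * j) (\prod_i F i).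
Proof.
elim: n F => [|n IHn] F hF.
  by rewrite big_ord0 mul0n => i; exists ((1 : {poly E})`_i); rewrite sub0n expr0 mul1r.
by rewrite big_ord_recl mulSn; apply: QM => //; exact: IHn.
Qed.

Let charQ j : Q (r * j) (c%:P ^+ r * char_poly M ^+ j).
Proof.
have -> : c%:P ^+ r * char_poly M ^+ j = \det (c%:P *: char_poly_mx M ^+ j).
  rewrite detZ; congr (_ * _); elim: j => [|j IHj]; first by rewrite !expr0 det1.
  by rewrite !exprS IHj det_mulmx.
rewrite /determinant; apply: big_ind => [||s _]; [exact: Q0|exact: QD|].
apply: QZ; apply: Qprod => i; rewrite mxE.
have h k : Q j (c%:P * (char_poly_mx M ^+ j) i k).
  by have := @charM j 0 i k; rewrite addn0 expr0 map_mx1 mulmx1.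
exact: h.
Qed.

(** Up to the factor c^r, the j-th power of char_poly - X^r lies in the r j-th power of (theta, X),
    and its coefficient at X^((r-1) j) is (- tr M)^j. So theta^j divides c^r (tr M)^j for all j; no
    eigenvalues in an extension are needed. *)
Lemma trace_divides : completely_closed E -> c != 0 -> theta != 0 -> divides theta (\tr M).
Proof.
move=> ccE c0 theta0; case: (posnP r) => [r0|rpos].
  exists 0; rewrite mulr0 /mxtrace big1 // => i; have : 'I_r -> False by rewrite r0 => -[].
  by move=> /(_ i).
pose y := char_poly M - 'X^r.
have yQ j : Q (r * j) (c%:P ^+ r * y ^+ j).
  rewrite /y exprBn mulr_sumr; apply: big_ind => [||i _]; [exact: Q0|exact: QD|].
  rewrite mulrnAr -mulr_natl; apply: QZ.
  rewrite -mulrA mulrCA; apply: QZ; rewrite mulrA -exprM.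
  have -> : (r * j = r * (j - i) + r * i)%N by rewrite -mulnDr subnK // -ltnS.
  apply: QM; first exact: charQ.
  move=> k; rewrite coefXn; case: eqP => [->|_]; last by exists 0; rewrite mulr0.
  by exists 1; rewrite subnn expr0 mul1r.
have szy : (size y <= r.-1.+1)%N.
  apply/leq_sizeP => k; rewrite prednK // leq_eqVlt => /predU1P[<-|rk].
    by have /monicP := char_poly_monic M; rewrite lead_coefE size_char_poly coefB coefXn eqxx => ->; rewrite subrr.
  by rewrite coefB coefXn gtn_eqF // subr0 nth_default // size_char_poly.
have ytop j : (size (y ^+ j) <= (r.-1 * j).+1)%N /\ (y ^+ j)`_(r.-1 * j) = (- \tr M) ^+ j.
  elim: j => [|j [sj cj]]; first by rewrite muln0 !expr0 size_poly1 coef1.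
  rewrite mulnS !exprS; have [? ->] := coef_mul_top szy sj; split=> //; rewrite cj; congr (_ * _).
  rewrite /y coefB coefXn ltn_eqF ?subr0 ?prednK //; exact: char_poly_trace.
apply: (ccE (c ^+ r)) => //; first by rewrite expf_neq0.
move=> j; have := yQ j (r.-1 * j)%N; rewrite -polyC_exp coefCM (ytop j).2 -mulnBl.
have -> : (r - r.-1 = 1)%N by lia.
rewrite mul1n => -[w hw]; exists ((-1) ^+ j * w); rewrite mulrCA -hw mulrCA -exprMn.
by rewrite mulN1r opprK.
Qed.

End Trace.

(** * Traces of elements integral over a power of a parameter ideal *)

Section Order.
Variables (K : fieldType) (D : nat).
Local Notation B := {mpoly K[D]}.

(** The substitution X_i -> X_i Z. The order at the origin becomes divisibility by a power of Z, the
    form in which [trace_divides] can produce it. *)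
Definition grade : B -> {poly B} :=
  mmap (polyC \o @mpolyC D K) (fun i => ('X_i)%:P * 'X).

HB.instance Definition _ := GRing.RMorphism.on grade.

Lemma gradeD p q : grade (p + q) = grade p + grade q.
Proof. exact: rmorphD. Qed.

Lemma gradeM p q : grade (p * q) = grade p * grade q.
Proof. exact: rmorphM. Qed.

Lemma gradeXn p n : grade (p ^+ n) = grade p ^+ n.
Proof. exact: rmorphXn. Qed.

Lemma grade0 : grade 0 = 0. Proof. exact: rmorph0. Qed.

Lemma gradeX i : grade 'X_i = ('X_i)%:P * 'X.
Proof. by rewrite /grade mmapXU. Qed.

Lemma grade_monomial c k : grade (c *: 'X_[k]) = (c *: 'X_[k])%:P * 'X^(mdeg k).
Proof.
rewrite /grade mmapZ mmapX /mmap1; under eq_bigr do rewrite exprMn -rmorphXn /=.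
rewrite big_split /= -rmorph_prod -mpolyXE_id prodrXr -mdegE mulrA -polyCM.
by rewrite mul_mpolyC.
Qed.

Lemma grade_eval p : (grade p).[1] = p.
Proof.
pose f := horner_eval (1 : B) \o grade.
apply: (mpoly_rmorph_eq (f := f) (g := idfun)) => [c|i] /=.
  by rewrite /horner_eval /grade mmapC hornerC.
by rewrite /horner_eval gradeX hornerM hornerC hornerX mulr1.
Qed.

Opaque grade.

Lemma grade_coef p n m : ((grade p)`_n)@_m = p@_m *+ (mdeg m == n).
Proof.
elim/mpolyind: p => [|c k p _ _ hp]; first by rewrite grade0 coef0 mcoeff0 mul0rn.
rewrite gradeD grade_monomial coefD [LHS]mcoeffD hp [in RHS]mcoeffD mulrnDl; congr (_ + _).
rewrite coefCM coefXn mcoeffZ mcoeffX.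
have [->|km] := eqVneq k m.
  by rewrite eq_sym; case: eqP => _ /=; rewrite ?mulr1n ?mulr0n ?mulr1 ?mcoeffZ ?mcoeffX ?eqxx ?mulr1 // mulr0 mcoeff0.
by rewrite /= mulr0 mul0rn; case: eqP => _ /=; rewrite ?mulr1n ?mulr0n ?mulr1 ?mulr0 ?mcoeff0 // mcoeffZ mcoeffX (negbTE km) mulr0.
Qed.

Definition order_ge n (p : B) : Prop := divides 'X^n (grade p).

Lemma order_ge0 n : order_ge n 0.
Proof. by exists 0; rewrite grade0 mulr0. Qed.

Lemma order_geD n p q : order_ge n p -> order_ge n q -> order_ge n (p + q).
Proof. by move=> [a ha] [b hb]; exists (a + b); rewrite gradeD ha hb mulrDr. Qed.

Lemma order_geMl n p q : order_ge n q -> order_ge n (p * q).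
Proof. by move=> [a ha]; exists (grade p * a); rewrite gradeM ha mulrCA. Qed.

Lemma order_geM m n p q : order_ge m p -> order_ge n q -> order_ge (m + n) (p * q).
Proof. by move=> [a ha] [b hb]; exists (a * b); rewrite gradeM ha hb exprD mulrACA. Qed.

Lemma order_ge_sum n (T : Type) (s : seq T) (F : T -> B) :
  (forall i, order_ge n (F i)) -> order_ge n (\sum_(i <- s) F i).
Proof.
move=> h; apply: (big_ind (order_ge n)); [exact: order_ge0|exact: order_geD|].
by move=> i _; exact: h.
Qed.

Lemma order_ge_supp n p m : order_ge n p -> m \in msupp p -> (n <= mdeg m)%N.
Proof.
move=> [w hw]; rewrite mcoeff_msupp leqNgt; apply: contra => lt.
have := grade_coef p (mdeg m) m; rewrite eqxx mulr1n => <-.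
by rewrite hw mulrC coefMXn lt mcoeff0.
Qed.

Lemma order_geX i : order_ge 1 'X_i.
Proof. by exists ('X_i)%:P; rewrite gradeX expr1 mulrC. Qed.

Lemma order_ge_pow (A : comNzRingType) (io : {rmorphism K -> A}) (F : 'I_D -> A) n p :
  order_ge n p -> ideal_pow (ideal_gen (range F)) n (mmap io F p).
Proof.
move=> h; rewrite [p]mpolyE rmorph_sum big_seq.
apply: ideal_sum; first exact: ideal_pow_ideal.
move=> m /(order_ge_supp h) nm; rewrite /= mmapZ mmapX.
apply: idealM; first exact: ideal_pow_ideal.
apply: ideal_pow_le nm _; apply: mmap1_pow => i.
by apply: sub_ideal_gen; exists i.
Qed.

Lemma pow_order_ge (A : comNzRingType) (io : {rmorphism K -> A}) (F : 'I_D -> A) n x :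
  ideal_pow (ideal_gen (range F)) n x -> exists r (b : 'I_r -> B) (a : 'I_r -> A),
    (forall i, order_ge n (b i)) /\ x = \sum_i mmap io F (b i) * a i.
Proof.
elim: n x => [x _|n IHn x].
  exists 1%N, (fun=> 1), (fun=> x); split; last by rewrite big_ord1 rmorph1 mul1r.
  by move=> _; exists (grade 1); rewrite expr0 mul1r.
pose S n (x : A) := exists r (b : 'I_r -> B) (a : 'I_r -> A),
    (forall i, order_ge n (b i)) /\ x = \sum_i mmap io F (b i) * a i.
have S0 : S n.+1 0 by exists 0%N, (fun=> 0), (fun=> 0); split=> [[]//|]; rewrite big_ord0.
have SD y z : S n.+1 y -> S n.+1 z -> S n.+1 (y + z).
  move=> [r [b [a [hb ->]]]] [r' [b' [a' [hb' ->]]]].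
  exists (r + r')%N, (join_fun b b'), (join_fun a a'); split=> [i|].
    by rewrite /join_fun; case: (split i).
  rewrite big_split_ord; congr (_ + _); apply: eq_bigr => i _ /=.
    by rewrite !join_funl.
  by rewrite !join_funr.
rewrite /=; move: x; apply: (ideal_mul_ind (P := S n.+1) S0 SD) => u v hu /IHn[r [b [a [hb ->]]]].
elim/ideal_mul_ind: hu => [|y z hy hz|_ z [i _ <-] _].
- by rewrite mul0r.
- by rewrite mulrDl; exact: SD.
exists r, (fun j => 'X_i * b j), (fun j => z * a j); split=> [j|].
  by rewrite -add1n; apply: order_geM => //; exact: order_geX.
rewrite mulr_sumr; apply: eq_bigr => j _; rewrite rmorphM /= mmapXU.
ring.
Qed.

End Order.

Section Coordinates.
Variables (K : fieldType) (A : idomainType) (io : {rmorphism K -> A}).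
Variables (D : nat) (F : 'I_D -> A).
Local Notation B := {mpoly K[D]}.
Local Notation be := (mmap io F).
Hypotheses (indF : alg_indep io F) (finF : finite_over io F).

(** The [a] form a basis of [A] over [B] after inverting nonzero elements of [B], and [de] is a
    common denominator: [phi x] holds the coordinates of de x. *)
Definition coordinates r (a : 'I_r -> A) (de : B) (phi : A -> 'I_r -> B) : Prop :=
  [/\ de != 0, forall x, be de * x = \sum_i be (phi x i) * a i,
      forall x y i, phi (x + y) i = phi x i + phi y i,
      forall b x i, phi (be b * x) i = b * phi x i &
      forall i k, phi (a i) k = de *+ (i == k)].

Lemma exists_coordinates : exists r (a : 'I_r -> A) de phi, coordinates a de phi.
Proof.
have [q [e he]] := finF.
suff [r [a [de [de0 inda sp]]]] : exists r (a : 'I_r -> A) (de : B), [/\ de != 0,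
    forall c : 'I_r -> B, \sum_i be (c i) * a i = 0 -> forall i, c i = 0 &
    forall i : 'I_q, exists c : 'I_r -> B, be de * e i = \sum_j be (c j) * a j].
  have /choice[phi phiE] x : exists c : 'I_r -> B, be de * x = \sum_j be (c j) * a j.
    have [c ->] := he x; pose b i := sval (cid (sp i)).
    exists (fun j => \sum_i c i * b i j); rewrite mulr_sumr.
    under eq_bigr do rewrite mulrCA (svalP (cid (sp _))) mulr_sumr.
    rewrite exchange_big; apply: eq_bigr => j _ /=; rewrite rmorph_sum mulr_suml.
    by apply: eq_bigr => i _; rewrite rmorphM mulrA.
  have uniq_c c c' : \sum_j be (c j) * a j = \sum_j be (c' j) * a j -> forall j, c j = c' j.
    move=> cc' j; apply/eqP; rewrite -subr_eq0; apply/eqP; apply: (inda (fun j => c j - c' j)).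
    under eq_bigr do rewrite rmorphB mulrBl.
    by rewrite sumrB cc' subrr.
  exists r, a, de, phi; split=> // [x y|b x|i].
  - apply: uniq_c; rewrite -phiE mulrDr !phiE -big_split.
    by apply: eq_bigr => j _; rewrite rmorphD mulrDl.
  - apply: uniq_c; rewrite -phiE mulrCA phiE mulr_sumr.
    by apply: eq_bigr => j _; rewrite rmorphM mulrA.
  - apply: (uniq_c _ (fun k => de *+ (i == k))); rewrite -phiE (bigD1 i) //= eqxx big1 ?addr0 // => j.
    by rewrite eq_sym => /negbTE->; rewrite rmorph0 mul0r.
suff H k : (k <= q)%N -> exists r (a : 'I_r -> A) (de : B), [/\ de != 0,
    forall c : 'I_r -> B, \sum_i be (c i) * a i = 0 -> forall i, c i = 0 &
    forall i : 'I_q, (i < k)%N -> exists c : 'I_r -> B, be de * e i = \sum_j be (c j) * a j].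
  have [r [a [de [de0 ia h]]]] := H q (leqnn q).
  by exists r, a, de; split=> // i; apply: h.
elim: k => [_|k IHk kq].
  by exists 0%N, (fun=> 0), 1; split=> //; [exact: oner_neq0|move=> c _ []].
have [r [a [de [de0 ia h]]]] := IHk (ltnW kq); pose x := e (Ordinal kq).
have [[b [c [b0 hb]]]|nb] := pselect (exists b (c : 'I_r -> B), b != 0 /\
    be b * x = \sum_j be (c j) * a j).
  exists r, a, (de * b); split=> //; first exact: mulf_neq0.
  move=> i; rewrite ltnS leq_eqVlt => /predU1P[ik|/h[c' hc']].
    have -> : i = Ordinal kq by exact: val_inj.
    exists (fun j => de * c j); rewrite rmorphM -mulrA hb mulr_sumr.
    by apply: eq_bigr => j _; rewrite rmorphM mulrA.
  exists (fun j => b * c' j); rewrite rmorphM [be de * _]mulrC -mulrA hc' mulr_sumr.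
  by apply: eq_bigr => j _; rewrite rmorphM mulrA.
have wE j : widen_ord (leqnSn r) j = lift ord_max j.
  by apply: val_inj; rewrite /= /bump leqNgt ltn_ord.
exists r.+1, (ext_last a x), de; split=> // [c|i].
  rewrite big_ord_recr /= ext_last_max => hc.
  have c0 : c ord_max = 0.
    apply/eqP; apply: contrapT => /negP c0; apply: nb.
    exists (c ord_max), (fun j => - c (lift ord_max j)); split=> //.
    move/eqP: hc; rewrite addrC addr_eq0 => /eqP->; rewrite -sumrN; apply: eq_bigr => j _.
    by rewrite wE ext_last_lift rmorphN mulNr.
  move: hc; rewrite c0 rmorph0 mul0r addr0 => hc i.
  case: (unliftP ord_max i) => [j|] -> //; apply: (ia (fun j => c (lift ord_max j))).
  by rewrite -[RHS]hc; apply: eq_bigr => k' _; rewrite wE ext_last_lift.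
rewrite ltnS leq_eqVlt => /predU1P[ik|/h[c' hc']].
  have -> : i = Ordinal kq by exact: val_inj.
  exists (ext_last (fun=> 0) de); rewrite big_ord_recr /= !ext_last_max big1 ?add0r // => j _.
  by rewrite wE !ext_last_lift rmorph0 mul0r.
exists (ext_last c' 0); rewrite big_ord_recr /= !ext_last_max rmorph0 mul0r addr0 hc'.
by apply: eq_bigr => j _; rewrite wE !ext_last_lift.
Qed.

Variables (r : nat) (a : 'I_r -> A) (de : B) (phi : A -> 'I_r -> B).
Hypothesis crd : coordinates a de phi.

(** This is [de] times the trace of multiplication by [x]. *)
Definition coord_trace (x : A) : B := \sum_i phi (x * a i) i.

(** Once powers of the variable are divided out of an equation of [b], its constant term is a
    multiple of [b]. *)
Lemma nonzero_multiple (b : A) : b != 0 -> exists (b0 : B) (b' : A), b0 != 0 /\ b * b' = be b0.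
Proof.
move=> b0; have [P P0 PE] := alg_dependence (ext_last F b) finF.
pose Q := shear (fun=> 0) P.
have Q0 : Q != 0 by rewrite -(inj_eq (@shear_inj _ _ (fun=> 0))) rmorph0 in P0 *; rewrite P0.
have : eval2 io F b Q = 0.
  rewrite eval2_shear -[RHS]PE; apply: eq_mmap => i.
  case: (unliftP ord_max i) => [j|] ->; rewrite !(ext_last_lift, ext_last_max) //.
  by rewrite rmorph0 mul0r addr0.
have [n] := ubnP (size Q); elim: n {P P0 PE}Q Q0 => // n IHn Q Q0 sQ.
rewrite /eval2; have [Q1 QE] : exists Q1, Q = Q1 * 'X + (Q`_0)%:P.
  exists (\poly_(i < size Q) Q`_i.+1); apply/polyP => -[|i].
    by rewrite coefD coefMX coefC add0r.
  rewrite coefD coefMX coefC addr0 coef_poly /=; case: ltnP => // le.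
  by rewrite nth_default // ltnW.
have [Q00|Q00] := eqVneq (Q`_0) 0.
  move: QE; rewrite Q00 polyC0 addr0 => QE; rewrite QE rmorphM /= hornerM map_polyX hornerX => /eqP.
  rewrite mulf_eq0 (negbTE b0) orbF => /eqP; apply: IHn.
    by apply: contraNneq Q0 => e; rewrite QE e mul0r.
  have := sQ; rewrite QE size_mulX //; by apply: contraNneq Q0 => e; rewrite QE e mul0r.
rewrite QE rmorphD rmorphM /= hornerD hornerM map_polyX hornerX map_polyC hornerC => /eqP.
rewrite addr_eq0 => /eqP e; exists (- Q`_0), (map_poly be Q1).[b].
by rewrite oppr_eq0 rmorphN -e mulrC.
Qed.

(** The hypothesis expresses that [v] is integral over the N-th power of the parameter ideal.
    Iterated, it puts v^j b into the N j-th power, so the matrix of [v] is almost integral with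
    respect to Z^N, as [trace_divides] requires. *)
Lemma coord_trace_order (M : set A) N v b : (forall x, M x ->
    ideal_mul (ideal_pow (ideal_gen (range F)) N) M (v * x)) -> M b -> b != 0 ->
  exists c, coord_trace v = de * c /\ order_ge N c.
Proof.
move=> hM Mb b0; have [de0 deE phiD phiM phia] := crd.
have vj j x : M x -> ideal_mul (ideal_pow (ideal_gen (range F)) (N * j)) M (v ^+ j * x).
  move=> Mx; elim: j => [|j IHj].
    by rewrite muln0 expr0; exact: ideal_mul_mem.
  rewrite exprS -mulrA; elim/ideal_mul_ind: IHj => [|y z hy hz|y z hy /hM hz].
  - by rewrite mulr0; exact: ideal_mul0.
  - by rewrite mulrDr; exact: ideal_mulD.
  rewrite mulrCA; elim/ideal_mul_ind: hz => [|y' z' hy' hz'|y' z' hy' hz'].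
  - by rewrite mulr0; exact: ideal_mul0.
  - by rewrite mulrDr; exact: ideal_mulD.
  - by rewrite mulrA; apply: ideal_mul_mem => //; rewrite mulnS addnC; exact: ideal_powD_mem.
have phi0 i : phi 0 i = 0 by have := phiM 0 0 i; rewrite mulr0 mul0r.
have phi_sum n (G : 'I_n -> A) i : phi (\sum_j G j) i = \sum_j phi (G j) i.
  by apply: (big_morph (fun x => phi x i)) => // x y; exact: phiD.
have phi_ord n x i : ideal_pow (ideal_gen (range F)) n x -> order_ge n (phi x i).
  move=> /(pow_order_ge io)[s [c [y [hc ->]]]]; rewrite phi_sum; apply: order_ge_sum => j.
  by rewrite phiM mulrC; exact: order_geMl.
have [b1 [b' [b10 b1E]]] := nonzero_multiple b0.
pose M1 : 'M[B]_r := \matrix_(i, k) phi (v * a i) k.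
have M1E j i k : de * (M1 ^+ j) i k = de ^+ j * phi (v ^+ j * a i) k.
  elim: j i k => [|j IHj] i k.
    by rewrite !expr0 !mul1r phia mxE mulr_natr.
  rewrite exprS [(M1 * _) i k]mxE mulr_sumr.
  under eq_bigr do rewrite mulrCA IHj mxE mulrCA -phiM.
  rewrite -mulr_sumr -phi_sum exprSr -mulrA; congr (_ * _).
  rewrite -phiM; congr (phi _ k); rewrite exprSr -[v ^+ j * v * _]mulrA mulrCA deE mulr_sumr.
  by apply: eq_bigr => l _; rewrite mulrCA.
have ord j i k : order_ge (N * j) (b1 * phi (v ^+ j * a i) k).
  rewrite -phiM -b1E; apply: phi_ord.
  have -> : b * b' * (v ^+ j * a i) = (b' * a i) * (v ^+ j * b) by ring.
  apply: idealM; first exact: ideal_pow_ideal.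
  have := vj j b Mb; apply: ideal_mul_ind => [|y z|y z hy _].
  - exact: ideal0 (ideal_pow_ideal _ _).
  - exact: idealD (ideal_pow_ideal _ _).
  - by apply: idealMr => //; exact: ideal_pow_ideal.
have gr0 x : (grade x == 0) = (x == 0).
  apply/eqP/eqP => [h|->]; last exact: grade0.
  by rewrite -(grade_eval x) h horner0.
have mapX j : map_mx (@grade K D) M1 ^+ j = map_mx (@grade K D) (M1 ^+ j).
  elim: j => [|j IHj]; first by rewrite !expr0 map_mx1.
  by rewrite !exprS IHj -[RHS]/(map_mx _ (_ *m _)) map_mxM.
(* [M1] is [de] times the matrix of [v], hence the divisor grade(de) Z^N; the uniform multiplier
   contains [b1], the image of which is a multiple of [b]. *)
have [||||w hw] := @trace_divides _ r (map_mx (@grade K D) M1) (grade (b1 * de)) (grade de * 'X^N).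
- move=> j i k; have [w hw] := ord j i k; exists w.
  have e := gradeM (b1 * de) ((M1 ^+ j) i k).
  have e' : b1 * de * (M1 ^+ j) i k = de ^+ j * (b1 * phi (v ^+ j * a i) k).
    by rewrite -mulrA M1E mulrCA.
  have e2 : (map_mx (@grade K D) M1 ^+ j) i k = grade ((M1 ^+ j) i k).
    by rewrite mapX; exact: mxE.
  rewrite {}e2.
  transitivity (grade (b1 * de * (M1 ^+ j) i k)); first exact: esym.
  rewrite e'.
  transitivity (grade (de ^+ j) * grade (b1 * phi (v ^+ j * a i) k)); first exact: gradeM.
  rewrite hw.
  rewrite (gradeXn de j).
  rewrite exprMn -exprM mulrA //.
- exact/completely_closed_poly/completely_closed_mpoly.
- by rewrite gr0 mulf_neq0.
- by rewrite mulf_neq0 ?gr0 // -size_poly_gt0 size_polyXn.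
have trE : coord_trace v = \tr M1 by apply: eq_bigr => i _; rewrite mxE.
have {}hw : grade (\tr M1) = grade de * 'X^N * w.
  rewrite -hw /mxtrace [LHS](rmorph_sum (@grade K D)); apply: eq_bigr => i _.
  by rewrite [RHS]mxE.
have e1 : \tr M1 = de * w.[1].
  by rewrite -(grade_eval (\tr M1)) hw !hornerM grade_eval hornerXn expr1n mulr1.
exists w.[1]; split; first by rewrite trE.
exists w; apply: (@mulfI _ (grade de)); first by rewrite gr0.
by rewrite mulrA -hw -(gradeM de w.[1]) -e1.
Qed.

End Coordinates.

(** * The Jacobian multiplies elements integral over a power into the power *)

Lemma mpoly_alg_ind (R : nzRingType) n (P : {mpoly R[n]} -> Prop) :
  (forall c, P c%:MP) -> (forall i, P 'X_i) -> (forall p q, P p -> P q -> P (p + q)) ->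
  (forall p q, P p -> P q -> P (p * q)) -> forall p, P p.
Proof.
move=> PC PX PD PM; elim/mpolyind => [|c m p _ _ hp]; first exact: (PC 0).
apply: (PD) => //; rewrite -mul_mpolyC; apply: (PM) => //; rewrite mpolyXE_id.
apply: big_ind => [|x y hx hy|i _]; [exact: (PC 1)|exact: PM|].
by elim: (m i) => [|k IHk]; [exact: (PC 1)|rewrite exprS; exact: PM].
Qed.

Section DividedDifferences.
Variables (K : fieldType) (A : comNzRingType) (io : {rmorphism K -> A}).
Variables (n : nat) (th : 'I_n -> A).
Local Notation ev := (mmap io th).
Local Notation up := (map_mpoly io).

Lemma divided_differences Q : exists q : 'I_n -> {mpoly A[n]},
  up Q - (ev Q)%:MP = \sum_l ('X_l - (th l)%:MP) * q l /\
  forall l, (q l).@[th] = ev Q^`M(l).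
Proof.
elim/mpoly_alg_ind: Q => [c|i|P Q [p [pE p']] [q [qE q']]|P Q [p [pE p']] [q [qE q']]].
- exists (fun=> 0); split=> [|l]; last by rewrite meval0 mderivC rmorph0.
  by rewrite map_mpolyC mmapC subrr big1 // => l _; rewrite mulr0.
- exists (fun l => (l == i)%:R); split=> [|l].
    rewrite map_mpolyX mmapXU (bigD1 i) //= eqxx mulr1 big1 ?addr0 // => l /negbTE->.
    by rewrite mulr0.
  rewrite mderivX mnm1E eq_sym; case: eqP => [->|_] /=; last by rewrite scale0r !rmorph0.
  have -> : (U_(l) - U_(l))%MM = 0%MM :> 'X_{1..n}.
    by apply/mnmP => k; rewrite mnmBE subnn mnm0E.
  by rewrite mpolyX0 scale1r !rmorph1.
- exists (fun l => p l + q l); split=> [|l]; last by rewrite mevalD p' q' mderivD rmorphD.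
  rewrite !rmorphD /= opprD addrACA pE qE -big_split; apply: eq_bigr => l _ /=.
  by rewrite mulrDr.
- exists (fun l => p l * up Q + (ev P)%:MP * q l); split=> [|l].
    have -> : up (P * Q) - (ev (P * Q))%:MP =
        (up P - (ev P)%:MP) * up Q + (ev P)%:MP * (up Q - (ev Q)%:MP).
      by rewrite !rmorphM /=; ring.
    rewrite pE qE mulr_suml mulr_sumr -big_split; apply: eq_bigr => l _ /=; ring.
  have upE R : (up R).@[th] = ev R.
    apply: (mpoly_rmorph_eq (f := meval th \o up) (g := ev)) => [c|i] /=.
      by rewrite map_mpolyC mevalC mmapC.
    by rewrite map_mpolyX mevalXU mmapXU.
  rewrite mevalD !mevalM mevalC p' q' upE mderivM rmorphD !rmorphM /=; ring.
Qed.

Variable phi : A -> A.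
Hypothesis phiD : forall x y, phi (x + y) = phi x + phi y.
Hypothesis phiC : forall c x, phi (io c * x) = io c * phi x.

(** With X evaluated at [th] in a second copy of [A], this multiplies that copy by [x] and contracts
    it with [phi]. *)
Definition pairing (x : A) (Psi : {mpoly A[n]}) : A :=
  \sum_(m <- msupp Psi) Psi@_m * phi (mmap1 th m * x).

Lemma pairingE x Psi k : (msize Psi <= k)%N ->
  pairing x Psi = \sum_(m : 'X_{1..n < k}) Psi@_m * phi (mmap1 th m * x).
Proof.
pose I := [the subFinType _ of 'X_{1..n < k}] => le_pk.
rewrite /pairing (big_mksub I) ?msupp_uniq //=; first last.
  by move=> m /msize_mdeg_lt /leq_trans; apply.
by rewrite big_rmcond //= => m /memN_msupp_eq0 ->; rewrite mul0r.
Qed.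

Lemma pairingD x p q : pairing x (p + q) = pairing x p + pairing x q.
Proof.
pose k := maxn (msize (p + q)) (maxn (msize p) (msize q)).
rewrite !(@pairingE _ _ k) ?leq_max ?leqnn ?orbT //.
by rewrite -big_split; apply: eq_bigr => i _; rewrite mcoeffD mulrDl.
Qed.

Lemma pairing0 x : pairing x 0 = 0.
Proof. by rewrite /pairing msupp0 big_nil. Qed.

Lemma pairing_sum x (T : Type) (s : seq T) (G : T -> {mpoly A[n]}) :
  pairing x (\sum_(i <- s) G i) = \sum_(i <- s) pairing x (G i).
Proof. by apply: (big_morph (pairing x)) => [p q|]; rewrite ?pairingD ?pairing0. Qed.

Lemma pairingCM x a p : pairing x (a%:MP * p) = a * pairing x p.
Proof.
pose k := maxn (msize (a%:MP * p)) (msize p).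
rewrite !(@pairingE _ _ k) ?leq_max ?leqnn ?orbT //.
by rewrite mulr_sumr; apply: eq_bigr => i _; rewrite mcoeffCM mulrA.
Qed.

Lemma pairing_monomial x a m : pairing x (a *: 'X_[m]) = a * phi (mmap1 th m * x).
Proof.
rewrite -mul_mpolyC pairingCM; congr (_ * _).
by rewrite /pairing msuppX big_seq1 mcoeffX eqxx mul1r.
Qed.

Lemma pairingX x l p : pairing x ('X_l * p) = pairing (th l * x) p.
Proof.
elim/mpolyind: p => [|c m p _ _ hp]; first by rewrite mulr0 !pairing0.
rewrite mulrDr !pairingD hp; congr (_ + _).
rewrite -scalerAr -mpolyXD !pairing_monomial mmap1_add mmap1U; congr (_ * phi _).
by rewrite mulrCA mulrA.
Qed.

Lemma pairing_addl x y p : pairing (x + y) p = pairing x p + pairing y p.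
Proof.
by rewrite /pairing -big_split; apply: eq_bigr => m _; rewrite mulrDr phiD mulrDr.
Qed.

Lemma pairing_up x Q p : pairing x (up Q * p) = pairing (ev Q * x) p.
Proof.
elim/mpoly_alg_ind: Q x p => [c|i|P Q hP hQ|P Q hP hQ] x p.
- rewrite map_mpolyC pairingCM mmapC /pairing mulr_sumr; apply: eq_bigr => m _.
  by rewrite mulrCA; congr (_ * _); rewrite mulrCA phiC.
- by rewrite map_mpolyX pairingX mmapXU.
- by rewrite !rmorphD /= !mulrDl pairingD hP hQ pairing_addl.
- by rewrite !rmorphM /= -mulrA hP hQ mulrA [ev Q * _]mulrC.
Qed.

End DividedDifferences.

(** [Delta] is the determinant of the divided differences of the [Q]. By Cramer's rule (X_l - th_l)
    Delta is a combination of the differences Q_i(X) - Q_i(th), which pair to zero under a [phi]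
    linear over the Q_i(th). This is the duality of complete intersections. *)
Lemma pairing_jacobian (K : fieldType) (A : comNzRingType) (io : {rmorphism K -> A}) n
    (th : 'I_n -> A) (Q : 'I_n -> {mpoly K[n]}) : exists Delta : {mpoly A[n]},
  Delta.@[th] = \det (\matrix_(i, l) mmap io th (Q i)^`M(l)) /\
  forall phi : A -> A, (forall x y, phi (x + y) = phi x + phi y) ->
    (forall c x, phi (io c * x) = io c * phi x) ->
    (forall i x, phi (mmap io th (Q i) * x) = mmap io th (Q i) * phi x) ->
  forall P x, pairing th phi (mmap io th P * x) Delta = mmap io th P * pairing th phi x Delta.
Proof.
have /choice[q hq] i := divided_differences io th (Q i).
pose M : 'M[{mpoly A[n]}]_n := \matrix_(i, l) q i l.
exists (\det M); split.
  rewrite -(det_map_mx (meval th)); congr (\det _); apply/matrixP => i l.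
  by rewrite !mxE; exact: (hq i).2.
move=> phi phiD phiC phiQ.
have kill i x p : pairing th phi x ((map_mpoly io (Q i) - (mmap io th (Q i))%:MP) * p) = 0.
  rewrite mulrBl -mulNr -mpolyCN pairingD (pairing_up th phiD phiC) pairingCM mulNr; apply/eqP.
  rewrite subr_eq0 /pairing mulr_sumr; apply/eqP; apply: eq_bigr => m _.
  by rewrite [RHS]mulrCA; congr (_ * _); rewrite -phiQ mulrCA.
have step l x : pairing th phi (th l * x) (\det M) = th l * pairing th phi x (\det M).
  apply/eqP; rewrite -subr_eq0 -pairingX -mulNr -pairingCM -pairingD -mulrDl mpolyCN.
  have -> : ('X_l - (th l)%:MP) * \det M =
      \sum_i (\adj M l i) * (map_mpoly io (Q i) - (mmap io th (Q i))%:MP).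
    have : (\adj M *m (M *m \col_l ('X_l - (th l)%:MP))) l 0 = ('X_l - (th l)%:MP) * \det M.
      by rewrite mulmxA mul_adj_mx mul_scalar_mx !mxE mulrC.
    move=> <-; rewrite mxE; apply: eq_bigr => i _; congr (_ * _).
    by rewrite mxE (hq i).1; apply: eq_bigr => k _; rewrite !mxE mulrC.
  by rewrite pairing_sum big1 // => i _; rewrite mulrC kill.
elim/mpoly_alg_ind => [c|i|P P' hP hP'|P P' hP hP'] x.
- rewrite mmapC /pairing mulr_sumr; apply: eq_bigr => m _.
  by rewrite [RHS]mulrCA; congr (_ * _); rewrite -phiC mulrCA.
- by rewrite mmapXU step.
- by rewrite rmorphD /= mulrDl (pairing_addl _ phiD) hP hP' mulrDl.
- by rewrite rmorphM /= -mulrA hP hP' mulrA.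
Qed.

(** Linearity of the pairing with [Delta] yields a trace formula: Delta(th) v is the sum of the
    coefficients of [Delta] times the traces of th^m v. These traces have order at least [N], and
    Delta(th) is the Jacobian. *)
Theorem jacobian_order (K : fieldType) (A : idomainType) (io : {rmorphism K -> A})
    D n (F : 'I_D -> A) (th : 'I_n -> A) (Q : 'I_n -> {mpoly K[n]}) (M : set A) N v b :
  alg_indep io F -> finite_over io F -> (forall a, exists P, a = mmap io th P) ->
  (forall i, mmap io th (Q i) = 0 \/ exists j, mmap io th (Q i) = F j) ->
  is_ideal M -> M b -> b != 0 ->
  (forall x, M x -> ideal_mul (ideal_pow (ideal_gen (range F)) N) M (v * x)) ->
  ideal_pow (ideal_gen (range F)) N (\det (\matrix_(i, l) mmap io th (Q i)^`M(l)) * v).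
Proof.
move=> indF finF gen hQ hM Mb b0 vM; pose be := mmap io F.
have [r [a [de [phi crd]]]] := exists_coordinates finF.
have [de0 deE phiD phiM phia] := crd.
have be0 x : (be x == 0) = (x == 0).
  by apply/eqP/eqP => [/indF//|->]; exact: rmorph0.
have [Delta [DE Dlin]] := pairing_jacobian io th Q.
pose ps s x := be (phi x s).
have psD s x y : ps s (x + y) = ps s x + ps s y by rewrite /ps phiD /be rmorphD.
have psC s c x : ps s (io c * x) = io c * ps s x.
  by rewrite /ps -(mmapC F) phiM /be rmorphM.
have psQ s i x : ps s (mmap io th (Q i) * x) = mmap io th (Q i) * ps s x.
  case: (hQ i) => [->|[j ->]].
    by rewrite !mul0r /ps; have := phiM 0 0 s; rewrite rmorph0 !mul0r => ->; rewrite /be rmorph0.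
  by rewrite /ps -(mmapXU io F j) phiM /be rmorphM.
have lin s x : pairing th (ps s) x Delta = x * pairing th (ps s) 1 Delta.
  have [P ->] := gen x; rewrite -(Dlin _ (psD s) (psC s) (psQ s)).
  by rewrite mulr1.
have trE : \sum_(m <- msupp Delta) Delta@_m * be (coord_trace a phi (mmap1 th m * v)) =
    be de * (Delta.@[th] * v).
  transitivity (\sum_s pairing th (ps s) (a s * v) Delta).
    rewrite exchange_big; apply: eq_bigr => m _ /=; rewrite -mulr_sumr; congr (_ * _).
    rewrite /coord_trace /be rmorph_sum; apply: eq_bigr => s _; rewrite /ps; congr (be (phi _ s)).
    by rewrite -mulrA [v * _]mulrC.
  transitivity (v * \sum_s a s * pairing th (ps s) 1 Delta).
    by rewrite mulr_sumr; apply: eq_bigr => s _; rewrite lin mulrAC mulrC.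
  have -> : \sum_s a s * pairing th (ps s) 1 Delta = be de * Delta.@[th].
    under eq_bigr do rewrite /pairing mulr_sumr.
    rewrite exchange_big /= mevalE mulr_sumr; apply: eq_bigr => m _.
    under eq_bigr do rewrite mulr1 mulrCA.
    rewrite -mulr_sumr [RHS]mulrCA; congr (_ * _).
    by rewrite deE; apply: eq_bigr => s _; rewrite mulrC.
  by rewrite mulrC -mulrA.
have /choice[cm hcm] m : exists c, coord_trace a phi (mmap1 th m * v) = de * c /\ order_ge N c.
  apply: (coord_trace_order finF crd _ Mb b0) => x Mx.
  by rewrite -mulrA; apply: idealM; [exact: ideal_mul_ideal|exact: vM].
rewrite -DE; have -> : Delta.@[th] * v =
    \sum_(m <- msupp Delta) Delta@_m * be (cm m).
  apply: (@mulfI _ (be de)); first by rewrite be0.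
  rewrite -trE mulr_sumr; apply: eq_bigr => m _.
  by rewrite (hcm m).1 /be rmorphM mulrCA.
apply: ideal_sum; first exact: ideal_pow_ideal.
move=> m _; apply: idealM; first exact: ideal_pow_ideal.
exact/order_ge_pow/(hcm m).2.
Qed.

(** * Reductions modulo a parameter ideal *)

Lemma ideal_mul_sub (R : comPzRingType) (J K J' K' : set R) x :
  J `<=` J' -> K `<=` K' -> ideal_mul J K x -> ideal_mul J' K' x.
Proof.
move=> sJ sK; elim/ideal_mul_ind => [|y z|a b /sJ ha /sK hb].
- exact: ideal_mul0.
- exact: ideal_mulD.
- exact: ideal_mul_mem.
Qed.

Lemma ideal_mul_powM (R : comPzRingType) (G I : set R) k l a x :
  ideal_pow I l a -> ideal_mul G (ideal_pow I k) x -> ideal_mul G (ideal_pow I (l + k)) (a * x).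
Proof.
move=> ha; elim/ideal_mul_ind => [|y z hy hz|g z hg hz].
- by rewrite mulr0; exact: ideal_mul0.
- by rewrite mulrDr; exact: ideal_mulD.
- by rewrite mulrCA; apply: ideal_mul_mem => //; exact: ideal_powD_mem.
Qed.

Section FinitePowers.
Variables (K : fieldType) (A : comNzRingType) (io : {rmorphism K -> A}) (D : nat).

Lemma finite_monic (t w : 'I_D -> A) (rho : 'I_D -> {poly K}) : finite_over io t ->
  (forall i, rho i \is monic) -> (forall i, 1 < size (rho i))%N ->
  (forall i, w i = (map_poly io (rho i)).[t i]) -> finite_over io w.
Proof.
move=> [q [e he]] mon sz wE; pose T i := (size (rho i)).-1.
apply: (finite_over_perturb (t := t) (T := T) he) => [i|i r]; first by rewrite /T; have := sz i; lia.
pose low := \sum_(k < T i) (rho i)`_k *: 'X_[U_(i) *+ k] : {mpoly K[D]}.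
have lowE : mmap io t low = w i - t i ^+ T i.
  have szE : size (map_poly io (rho i)) = (T i).+1.
    by rewrite size_map_poly /T prednK // ltnW.
  have topE : (map_poly io (rho i))`_(T i) = 1.
    by rewrite coef_map; have /monicP := mon i; rewrite lead_coefE => ->; exact: rmorph1.
  rewrite wE horner_coef szE big_ord_recr /= topE mul1r addrK /low rmorph_sum; apply: eq_bigr => k _ /=.
  by rewrite mmapZ mmapX mmap1_mul mmap1U coef_map.
exists (fun s => if s == r then low else 0); split=> [s|].
  case: eqP => _; last by rewrite mmeasure0.
  apply: leq_trans (msize_sum _ _ _) _; apply/bigmax_leqP => k _.
  by apply: leq_trans (msizeZ_le _ _) _; rewrite msizeX mdegMn mdeg1 mul1n.
rewrite (bigD1 r) //= eqxx lowE big1 ?addr0 // => s /negbTE->.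
by rewrite rmorph0 mul0r.
Qed.

(** [T0] does not depend on [lam], since a scalar factor does not raise degrees. *)
Lemma finite_large_power (w f s : 'I_D -> A) : finite_over io w ->
  exists T0, forall T lam, (T0 <= T)%N ->
    finite_over io (fun i => w i ^+ T + f i + io lam * s i).
Proof.
move=> [q [e he]]; pose cf i r := sval (cid (he (f i * e r))); pose cs i r := sval (cid (he (s i * e r))).
have cfE i r : f i * e r = \sum_j mmap io w (cf i r j) * e j := svalP (cid (he (f i * e r))).
have csE i r : s i * e r = \sum_j mmap io w (cs i r j) * e j := svalP (cid (he (s i * e r))).
pose m i r := \max_j maxn (msize (cf i r j)) (msize (cs i r j)).
exists (\max_i \max_r m i r).+1 => T lam hT.
apply: (finite_over_perturb (t := w) (T := fun=> T) he) => [i|i r]; first by lia.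
exists (fun j => cf i r j + lam *: cs i r j); split=> [j|].
  have le : (maxn (msize (cf i r j)) (msize (cs i r j)) <= T)%N.
    apply: leq_trans (ltnW hT).
    apply: leq_trans (leq_bigmax (F := fun i => \max_r m i r) i).
    apply: leq_trans (leq_bigmax (F := m i) r).
    exact: (leq_bigmax (F := fun j => maxn (msize (cf i r j)) (msize (cs i r j))) j).
  apply: leq_trans (msizeD_le _ _) _; rewrite geq_max in le; case/andP: le => l1 l2.
  by rewrite geq_max l1 /=; apply: leq_trans (msizeZ_le _ _) l2.
have -> : w i ^+ T + f i + io lam * s i - w i ^+ T = f i + io lam * s i by ring.
rewrite mulrDl cfE -mulrA csE mulr_sumr -big_split.
by apply: eq_bigr => j _; rewrite rmorphD /= mmapZ mulrDl mulrA.
Qed.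

End FinitePowers.

Section Reduction.
Variables (K : fieldType) (A : idomainType) (io : {rmorphism K -> A}).
Variables (D : nat) (w : 'I_D -> A) (i1 : 'I_D) (I : set A).
Hypotheses (infK : infinite_field K) (hI : is_ideal I) (Iw : forall i, I (w i)).
Hypotheses (finw : finite_over io w) (w0 : w i1 != 0).

Local Notation nn := (ideal_gen (range w)).

Lemma homogeneous_part (m : nat) (b : 'I_m -> A) (Psi : {mpoly K[m]}) n :
  (mmap (polyC \o io) (fun i => (b i)%:P * 'X) Psi)`_n = mmap io b (pihomog mdeg n Psi).
Proof.
elim/mpolyind: Psi => [|c k p _ _ hp].
  by rewrite rmorph0 coef0 pihomog0 rmorph0.
rewrite rmorphD coefD hp pihomogD rmorphD; congr (_ + _) => /=.
have -> : pihomog mdeg n (c *: 'X_[k]) = c *: pihomog mdeg n 'X_[k] by exact: linearZ.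
rewrite mmapZ mmapX pihomogX /=.
have -> : mmap1 (fun i => (b i)%:P * 'X) k = (mmap1 b k)%:P * 'X^(mdeg k).
  rewrite /mmap1; under eq_bigr do rewrite exprMn -rmorphXn /=.
  by rewrite big_split /= -rmorph_prod prodrXr -mdegE.
rewrite coefCM coefCM coefXn eq_sym; case: eqP => _ /=.
  by rewrite mulr1 mmapZ mmapX.
by rewrite scaler0 mmap0 !mulr0.
Qed.

(** A[Z] is finite over the D+1 elements w and Z, so the elements b_i Z and w_i1, at least D+2 of
    them, satisfy a relation. Powers of w_i1 are divided out, and a homogeneous part of what remains
    takes at [b] a value divisible by w_i1 inside the right power of [I]. *)
Lemma homogeneous_relation m (b : 'I_m -> A) : (D < m)%N -> (forall i, I (b i)) ->
  exists n Psi, [/\ (0 < n)%N, Psi \is n.-homog, Psi != 0 &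
    ideal_mul nn (ideal_pow I n) (mmap io b Psi)].
Proof.
move=> Dm Ib; pose ioX : {rmorphism K -> {poly A}} := polyC \o io.
pose bX i := (b i)%:P * 'X : {poly A}.
have finX : finite_over ioX (ext_last (fun j => (w j)%:P) 'X).
  have [q [e he]] := finw; exists q, (fun i => (e i)%:P) => P.
  pose em := mmap (@mpolyC D.+1 K) (fun j => 'X_(lift ord_max j)).
  pose c a := sval (cid (he a)); have cE a : a = \sum_i mmap io w (c a i) * e i := svalP (cid (he a)).
  exists (fun i => \sum_(k < size P) em (c P`_k i) * 'X_ord_max ^+ k).
  rewrite -[LHS]coefK poly_def.
  under [RHS]eq_bigr do rewrite rmorph_sum mulr_suml.
  rewrite exchange_big; apply: eq_bigr => k _ /=.
  rewrite {1}[P`_k]cE -mul_polyC rmorph_sum mulr_suml; apply: eq_bigr => i _ /=.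
  rewrite !rmorphM rmorphXn /= mmapXU ext_last_max mulrAC; congr (_ * _ * _).
  pose y := ext_last (fun j => (w j)%:P) 'X.
  apply: (mpoly_rmorph_eq (f := polyC \o mmap io w) (g := mmap ioX y \o em)) => [a|j] /=.
    by rewrite /em !mmapC.
  by rewrite /em !mmapXU /y ext_last_lift.
have [P P0 PE] := alg_dependence_lt (ext_last bX (w i1)%:P) (Dm : (D.+1 < m.+1)%N) finX.
pose Q := shear (fun=> 0) P.
have Q0 : Q != 0 by rewrite -(inj_eq (@shear_inj _ _ (fun=> 0))) rmorph0 in P0 *; rewrite P0.
have : eval2 ioX bX (w i1)%:P Q = 0.
  rewrite eval2_shear -[RHS]PE; apply: eq_mmap => i.
  case: (unliftP ord_max i) => [j|] ->; rewrite !(ext_last_lift, ext_last_max) //.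
  by rewrite rmorph0 mul0r addr0.
move: Q Q0 => Q; have [n] := ubnP (size Q); elim: n Q => // n IHn Q sQ Q0; rewrite /eval2.
have [Q1 QE] : exists Q1, Q = Q1 * 'X + (Q`_0)%:P.
  exists (\poly_(i < size Q) Q`_i.+1); apply/polyP => -[|i].
    by rewrite coefD coefMX coefC add0r.
  rewrite coefD coefMX coefC addr0 coef_poly /=; case: ltnP => // le.
  by rewrite nth_default // ltnW.
have [Q00|Q00] := eqVneq (Q`_0) 0.
  move: QE; rewrite Q00 polyC0 addr0 => QE; rewrite QE rmorphM /= hornerM map_polyX hornerX => /eqP.
  rewrite mulf_eq0 polyC_eq0 (negbTE w0) orbF => /eqP; apply: IHn.
    have := sQ; rewrite QE size_mulX //; by apply: contraNneq Q0 => e; rewrite QE e mul0r.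
  by apply: contraNneq Q0 => e; rewrite QE e mul0r.
rewrite QE rmorphD rmorphM /= hornerD hornerM map_polyX hornerX map_polyC hornerC => /eqP.
rewrite addrC addr_eq0 => /eqP e.
have [l hl] : exists l, pihomog mdeg l Q`_0 != 0.
  apply: contrapT => nl; case/eqP: Q00; rewrite (pihomog_partitionE (leqnn (msize Q`_0))) big1 // => l _.
  by apply/eqP/negPn/negP => h; apply: nl; exists l.
pose i0 : 'I_m := Ordinal (leq_ltn_trans (leq0n D) Dm).
(* The factor X_i0 makes the degree positive, as the part found may be a constant. *)
exists l.+1, ('X_i0 * pihomog mdeg l Q`_0); split=> //.
- rewrite -add1n; apply: dhomogM; last exact: pihomogP.
  by rewrite dhomogX /= mdeg1.
- by rewrite mulf_neq0 // -msize_poly_eq0 msizeX.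
rewrite rmorphM /= mmapXU -homogeneous_part -/bX -/ioX.
have {}e := congr1 (fun p : {poly A} => p`_l) e; rewrite /= in e; rewrite e mulrC coefN coefMC.
rewrite horner_coef coef_sum mulNr -mulrA [w i1 * _]mulrC mulrA -mulNr mulrC.
apply: ideal_mul_mem; first by apply: sub_ideal_gen; exists i1.
apply: (idealN (ideal_pow_ideal I l.+1)).
rewrite mulrC; apply: ideal_mul_mem => //.
apply: ideal_sum => [|j _]; first exact: ideal_pow_ideal.
rewrite -polyC_exp coefMC coef_map /= homogeneous_part.
apply: idealMr; first exact: ideal_pow_ideal.
apply: mmap_homog => //; exact: pihomogP.
Qed.

(** A reduction of [I] only modulo w I^(r+1); Nakayama's lemma later removes this error term. *)
Definition reduces m (b : 'I_m -> A) (r : nat) : Prop :=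
  (forall i, I (b i)) /\ forall x, ideal_pow I r.+1 x ->
    ideal_add (ideal_mul (ideal_gen (range b)) (ideal_pow I r))
      (ideal_mul nn (ideal_pow I r.+1)) x.

(** Take [v] with Psi(v) nonzero, scaled to v_i0 = 1. Modulo the differences b_j - v_j b_i0 the
    relation Psi(b) becomes a unit times b_i0^n, so b_i0 is redundant once [r] is raised by n -
    1. *)
Lemma reduces_elim m (b : 'I_m.+1 -> A) r : (D <= m)%N -> reduces b r ->
  exists (b' : 'I_m -> A) r', reduces b' r'.
Proof.
move=> Dm [Ib hb]; have [n [Psi [n0 homP Psi0 hP]]] := homogeneous_relation (Dm : (D < m.+1)%N) Ib.
have [v hv] := nonvanishing idfun infK Psi0; rewrite /= in hv.
have homE c : Psi.@[fun i => c * v i] = c ^+ n * Psi.@[v].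
  rewrite !mevalE mulr_sumr big_seq [RHS]big_seq; apply: eq_bigr => k kP.
  rewrite mulrCA; congr (_ * _); under eq_bigr do rewrite exprMn.
  by rewrite big_split /= prodrXr -mdegE; have /dhomogP -> := homP.
have [i0 vi0] : exists i, v i != 0.
  apply: contrapT => nv; case/eqP: hv; have <- : Psi.@[fun i => 0 * v i] = Psi.@[v].
    apply: meval_eq => i; rewrite mul0r; apply/esym/eqP/negPn/negP => h.
    by apply: nv; exists i.
  by rewrite homE expr0n gtn_eqF // mul0r.
pose v' i := (v i0)^-1 * v i; have v'0 : v' i0 = 1 by rewrite /v' mulVf.
have hv' : Psi.@[v'] != 0 by rewrite homE mulf_neq0 // expf_neq0 // invr_eq0.
pose b' j := b (lift i0 j) - io (v' (lift i0 j)) * b i0.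
pose G := ideal_gen (range b').
have Gb i : G (b i - io (v' i) * b i0).
  case: (unliftP i0 i) => [j|] ->; first by apply: sub_ideal_gen; exists j.
  by rewrite v'0 rmorph1 mul1r subrr; exact: ideal0 (ideal_gen_ideal _).
have hpow k := ideal_pow_ideal I k.
(* The power of b_i0 is carried along until its exponent reaches [n]. *)
pose L k := ideal_add (ideal_mul G (ideal_pow I (r + k)))
   (ideal_add (ideal_mul [set b i0 ^+ k.+1] (ideal_pow I r)) (ideal_mul nn (ideal_pow I (r + k).+1))).
have LI k : is_ideal (L k).
  by apply: ideal_add_ideal; [|apply: ideal_add_ideal]; exact: ideal_mul_ideal.
have L1 k x : ideal_mul G (ideal_pow I (r + k)) x -> L k x.
  by move=> hx; apply: ideal_addl => //; apply: ideal_add_ideal; exact: ideal_mul_ideal.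
have L2 k x : ideal_mul [set b i0 ^+ k.+1] (ideal_pow I r) x -> L k x.
  move=> hx; apply: ideal_addr; first exact: ideal_mul_ideal.
  by apply: ideal_addl => //; exact: ideal_mul_ideal.
have L3 k x : ideal_mul nn (ideal_pow I (r + k).+1) x -> L k x.
  move=> hx; apply: ideal_addr; first exact: ideal_mul_ideal.
  by apply: ideal_addr => //; exact: ideal_mul_ideal.
have base x : ideal_pow I r.+1 x -> L 0 x.
  move=> /hb/ideal_addP[y [z [hy hz ->]]]; apply: idealD => //; last first.
    by apply: L3; rewrite addn0.
  elim/ideal_mul_ind: hy => [|y1 y2 h1 h2|g y' hg hy']; first exact: ideal0.
    exact: idealD.
  elim/ideal_mul_ind: hg => [|g1 g2 h1 h2|_ g' [i _ <-] _].
  - by rewrite mul0r; exact: ideal0.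
  - by rewrite mulrDl; exact: idealD.
  rewrite -[b i](subrK (io (v' i) * b i0)) mulrDl mulrDl; apply: idealD => //.
    rewrite -mulrA; apply: L1; rewrite addn0; apply: ideal_mul_mem => //; exact: idealM.
  have -> : io (v' i) * b i0 * g' * y' = b i0 ^+ 1 * (io (v' i) * g' * y') by ring.
  by apply: L2; apply: ideal_mul_mem => //; exact: idealM.
have mulb k x : L 0 x -> L k.+1 (b i0 ^+ k.+1 * x).
  have bk : ideal_pow I k.+1 (b i0 ^+ k.+1) by exact: ideal_powX.
  have e : (r + k.+1 = k.+1 + (r + 0))%N by lia.
  move=> /ideal_addP[y1 [_ [h1 /ideal_addP[y2 [y3 [h2 h3 ->]]] ->]]].
  rewrite !mulrDr; apply: idealD => //; [|apply: idealD => //].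
  - by apply: L1; rewrite e; exact: ideal_mul_powM.
  - elim/ideal_mul_ind: h2 => [|u1 u2 g1 g2|_ u -> hu].
    + by rewrite mulr0; exact: ideal0.
    + by rewrite mulrDr; exact: idealD.
    by rewrite mulrA -exprD addn1; apply: L2; exact: ideal_mul_mem.
  - by apply: L3; rewrite e -addnS; exact: ideal_mul_powM.
have step k x : ideal_pow I (r + k).+1 x -> L k x.
  elim: k x => [|k IHk] x; first by rewrite addn0; exact: base.
  rewrite addnS -[(r + k).+2]add1n; elim/ideal_pow_ind => [|y z|a y ha /IHk hy].
  - exact: ideal0.
  - exact: idealD.
  move: hy => /ideal_addP[y1 [_ [h1 /ideal_addP[y2 [y3 [h2 h3 ->]]] ->]]].
  rewrite !mulrDr; apply: idealD => //; [|apply: idealD => //].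
  - by apply: L1; rewrite addnS -[(r + k).+1]add1n; exact: ideal_mul_powM.
  - elim/ideal_mul_ind: h2 => [|u1 u2 g1 g2|_ u -> hu].
    + by rewrite mulr0; exact: ideal0.
    + by rewrite mulrDr; exact: idealD.
    rewrite mulrCA; apply: mulb; apply: base.
    by rewrite -add1n; exact: ideal_powD_mem.
  - by apply: L3; rewrite addnS -[(r + k).+2]add1n; exact: ideal_mul_powM.
exists b', (r + n.-1)%N; split=> [j|x /step]; first by apply: idealB => //; exact: idealM.
have hQ : is_ideal (ideal_add (ideal_mul G (ideal_pow I (r + n.-1))) (ideal_mul nn (ideal_pow I (r + n.-1).+1))).
  by apply: ideal_add_ideal; exact: ideal_mul_ideal.
rewrite /L prednK // => /ideal_addP[x1 [_ [h1 /ideal_addP[x2 [x3 [h2 h3 ->]]] ->]]].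
apply: idealD => //; first by apply: ideal_addl => //; exact: ideal_mul_ideal.
apply: idealD => //; last by apply: ideal_addr => //; exact: ideal_mul_ideal.
elim/ideal_mul_ind: h2 => [|u1 u2 g1 g2|_ u -> hu]; [exact: ideal0|exact: idealD|].
have evv : mmap io (io \o v') Psi = io Psi.@[v'].
  apply: (mpoly_rmorph_eq (f := mmap io (io \o v')) (g := io \o meval v')) => [a|i] /=.
    by rewrite mmapC mevalC.
  by rewrite mmapXU mevalXU.
have := mmap_reduce io Ib v' i0 homP; rewrite evv.
set c := Psi.@[v'] in hv' *; set d := _ - _ => hd.
have -> : b i0 ^+ n * u = io c^-1 * (u * mmap io b Psi) - io c^-1 * (u * d).
  have cc : io c^-1 * io c = 1 by rewrite -rmorphM mulVf // rmorph1.
  transitivity (io c^-1 * io c * (b i0 ^+ n * u)); first by rewrite cc mul1r.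
  by rewrite /d; ring.
apply: idealB => //; apply: idealM => //.
  apply: ideal_addr; first exact: ideal_mul_ideal.
  have -> : (r + n.-1).+1 = (r + n)%N by rewrite -addnS prednK.
  exact: ideal_mul_powM.
apply: ideal_addl; first exact: ideal_mul_ideal.
case: (n) n0 hd => // n' _ hd; apply: ideal_mul_powM => //.
apply: ideal_mul_sub hd => // z; apply: ideal_gen_min; first exact: ideal_gen_ideal.
by move=> _ [i _ <-]; exact: Gb.
Qed.

Lemma exists_reduction : noetherian A -> exists (f : 'I_D -> A) r, reduces f r.
Proof.
move=> noA; have [m [b0 [Ib0 gen]]] := noA _ hI.
suff H k (b : 'I_(D + k) -> A) r : reduces b r -> exists (f : 'I_D -> A) r', reduces f r'.
  apply: (H m (join_fun (fun=> 0) b0) 0%N); split=> [i|x hx].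
    by rewrite /join_fun; case: (split i) => // _; exact: ideal0.
  apply: ideal_addl; first exact/ideal_mul_ideal/ideal_pow_ideal.
  have /gen[c ->] := ideal_pow1E hI hx.
  apply: ideal_sum => [|i _]; first exact: ideal_mul_ideal.
  rewrite mulrC; apply: ideal_mul_mem => //; apply: sub_ideal_gen; exists (rshift D i) => //.
  by rewrite join_funr.
elim: k b r => [|k IHk] b r hb.
  by move: b hb; rewrite addn0 => b hb; exists b, r.
move: b hb; rewrite addnS => b /(reduces_elim (leq_addr _ _))[b' [r' hb']].
exact: IHk hb'.
Qed.

End Reduction.

(** * A weak Briançon–Skoda theorem *)

(** Degree D is reached only by linear coefficients from all of the first D rows; as a boolean,
    [split i] is 1 on these rows and 0 on the others. *)
Lemma det_coef_rows (R : comNzRingType) D g (M : 'M[{poly R}]_(D + g)) :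
  (forall i j, size (M (lshift g i) j) <= 2)%N ->
  (forall i j, size (M (rshift D i) j) <= 1)%N ->
  (\det M)`_D = \det (\matrix_(i, j) (M i j)`_(split i : bool)).
Proof.
move=> h2 h1; rewrite /determinant coef_sum; apply: eq_bigr => s _.
have -> : (-1) ^+ s * \prod_i M i (s i) = ((-1) ^+ s)%:P * \prod_i M i (s i).
  by rewrite rmorphXn rmorphN1.
rewrite coefCM; congr (_ * _).
have prod2 n (F : 'I_n -> {poly R}) : (forall i, size (F i) <= 2)%N ->
    (size (\prod_i F i)%R <= n.+1)%N /\ (\prod_i F i)`_n = \prod_i (F i)`_1.
  elim: n F => [|n IHn] F hF; first by rewrite !big_ord0 size_poly1 coef1.
  rewrite !big_ord_recl; have [s1 c1] := IHn (fun i => F (lift ord0 i)) (fun i => hF _).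
  by have [? ->] := @coef_mul_top _ _ _ 1 n (hF ord0) s1; rewrite c1.
have prod1 n (F : 'I_n -> {poly R}) : (forall i, size (F i) <= 1)%N ->
    (size (\prod_i F i)%R <= 1)%N /\ (\prod_i F i)`_0 = \prod_i (F i)`_0.
  elim: n F => [|n IHn] F hF; first by rewrite !big_ord0 size_poly1 coef1.
  rewrite !big_ord_recl; have [s1 c1] := IHn (fun i => F (lift ord0 i)) (fun i => hF _).
  by have [? ->] := @coef_mul_top _ _ _ 0 0 (hF ord0) s1; rewrite c1.
rewrite !big_split_ord /=.
have [sA cA] := prod2 D (fun i => M (lshift g i) (s (lshift g i))) (fun i => h2 i _).
have [sB cB] := prod1 g (fun i => M (rshift D i) (s (rshift D i))) (fun i => h1 i _).
have [_] := coef_mul_top sA sB; rewrite addn0 => ->; rewrite cA cB.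
congr (_ * _); apply: eq_bigr => i _; rewrite mxE.
  by rewrite -[lshift _ _]/(unsplit (inl i)) unsplitK.
by rewrite -[rshift _ _]/(unsplit (inr i)) unsplitK.
Qed.

(** * Perturbing a reduction *)

Section Perturbation.
Variables (K : fieldType) (A : idomainType) (io : {rmorphism K -> A}).
Variables (D : nat) (w : 'I_D -> A) (I : set A).
Hypotheses (hI : is_ideal I) (Iw : forall i, I (w i)).
Hypotheses (finw : finite_over io w) (noA : noetherian A).

Local Notation nn := (ideal_gen (range w)).

Lemma residue_span r : exists (L : finType) (c : L -> A), (forall l, ideal_pow I r (c l)) /\
  forall x, ideal_pow I r x -> exists k : L -> K,
    ideal_mul nn (ideal_pow I r) (x - \sum_l io (k l) * c l).
Proof.
have [q [e he]] := finw; have [m [g [Ig gen]]] := noA (ideal_pow_ideal I r).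
pose ca a := sval (cid (he a)); have caE a : a = \sum_i mmap io w (ca a i) * e i := svalP (cid (he a)).
have hQ : is_ideal (ideal_mul nn (ideal_pow I r)) by exact/ideal_mul_ideal/ideal_pow_ideal.
have hn : is_ideal nn by exact: ideal_gen_ideal.
have /choice[cst hc] P : exists a, nn (mmap io w P - io a).
  elim/mpoly_alg_ind: P => [a|k|P Q [a ha] [b hb]|P Q [a ha] [b hb]].
  - by exists a; rewrite mmapC subrr; exact: ideal0.
  - by exists 0; rewrite mmapXU rmorph0 subr0; apply: sub_ideal_gen; exists k.
  - by exists (a + b); rewrite mmapD rmorphD opprD addrACA; exact: idealD.
  - exists (a * b); rewrite !rmorphM.
    have -> : mmap io w P * mmap io w Q - io a * io b =
      (mmap io w P - io a) * mmap io w Q + io a * (mmap io w Q - io b) by ring.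
    by apply: idealD => //; [exact: idealMr|exact: idealM].
exists ('I_m * 'I_q)%type, (fun l => e l.2 * g l.1); split=> [l|x /gen[b ->]].
  by apply: idealM => //; exact: ideal_pow_ideal.
exists (fun l => cst (ca (b l.1) l.2)).
rewrite -(pair_bigA _ (fun i j => io (cst (ca (b i) j)) * (e j * g i))) /= -sumrB.
apply: ideal_sum => // i _; rewrite {1}[b i]caE mulr_suml -sumrB; apply: ideal_sum => // j _.
rewrite mulrA -mulrBl -mulrBl -mulrA; apply: ideal_mul_mem => //.
by apply: idealM => //; exact: ideal_pow_ideal.
Qed.

(** Being a reduction is an open condition: modulo w I^(r+1) only a finite-dimensional space over
    [K] matters, on which passing from f to f + lam s is the matrix 1 + lam E. The terms w^T vanish
    there because T > 1. *)
Lemma reduces_perturb (f s : 'I_D -> A) r T : (1 < T)%N -> reduces w I f r ->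
  (forall i, I (s i)) -> exists2 chi : {poly K}, chi != 0 &
    forall lam, chi.[lam] != 0 -> reduces w I (fun i => w i ^+ T + f i + io lam * s i) r.
Proof.
move=> T1 [If hf] Is; have [L [c [Ic gen]]] := residue_span r.
pose N := ideal_mul nn (ideal_pow I r.+1).
have hN : is_ideal N by exact/ideal_mul_ideal/ideal_pow_ideal.
have NI x z : I x -> ideal_mul nn (ideal_pow I r) z -> N (x * z).
  by move=> Ix hz; rewrite /N -add1n; apply: ideal_mul_powM => //; exact: ideal_pow1.
pose J : finType := ('I_D * L)%type; pose v (l : J) := f l.1 * c l.2.
have spanv x : ideal_pow I r.+1 x -> exists k : J -> K, N (x - \sum_l io (k l) * v l).
  move=> /hf[y hy hx]; suff [k hk] : exists k : J -> K, N (y - \sum_l io (k l) * v l).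
    by exists k; rewrite -(subrK y x) -addrA; exact: idealD.
  elim/ideal_mul_ind: hy => [|y1 y2 [k1 h1] [k2 h2]|a z ha hz].
  - exists (fun=> 0); rewrite big1 ?subr0; first exact: ideal0.
    by move=> l _; rewrite rmorph0 mul0r.
  - exists (fun l => k1 l + k2 l); under eq_bigr do rewrite rmorphD mulrDl.
    by rewrite big_split opprD addrACA; exact: idealD.
  elim/ideal_mul_ind: ha => [|a1 a2 [k1 h1] [k2 h2]|_ a' [i _ <-] _].
  - exists (fun=> 0); rewrite mul0r big1 ?subr0; first exact: ideal0.
    by move=> l _; rewrite rmorph0 mul0r.
  - exists (fun l => k1 l + k2 l); under eq_bigr do rewrite rmorphD mulrDl.
    by rewrite mulrDl big_split opprD addrACA; exact: idealD.
  have [|k hk] := gen (a' * z); first by apply: idealM => //; exact: ideal_pow_ideal.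
  exists (fun l => if l.1 == i then k l.2 else 0).
  have -> : \sum_l io (if l.1 == i then k l.2 else 0) * v l = f i * \sum_l io (k l) * c l.
    rewrite -(pair_bigA _ (fun i' b => io (if i' == i then k b else 0) * (f i' * c b))) /=.
    rewrite (bigD1 i) //= eqxx [X in _ + X]big1 ?addr0 => [|i' /negbTE->]; last first.
      by rewrite big1 // => b _; rewrite rmorph0 mul0r.
    by rewrite mulr_sumr; apply: eq_bigr => b _; rewrite mulrCA.
  by rewrite -mulrA -mulrBr; exact: NI.
pose m := #|{: J}|; pose u (l : 'I_m) : J := enum_val l.
have sum_u (G : J -> A) : \sum_l G l = \sum_(l < m) G (u l).
  by rewrite (reindex (@enum_val J J)) //=; apply: onW_bij; exact: enum_val_bij.
have sv (l : J) : ideal_pow I r.+1 (s l.1 * c l.2) by rewrite -add1n; apply: ideal_powD_mem => //; exact: ideal_pow1.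
pose Em l := sval (cid (spanv _ (sv l))).
have EmE l : N (s l.1 * c l.2 - \sum_l' io (Em l l') * v l') := svalP (cid (spanv _ (sv l))).
pose E : 'M[K]_m := \matrix_(a, b) Em (u a) (u b).
pose chi := \det (1%:M + 'X *: map_mx polyC E).
have chiE lam : chi.[lam] = \det (1%:M + lam *: E).
  rewrite -[LHS]/(horner_eval lam chi) -det_map_mx; congr (\det _); apply/matrixP => a b.
  rewrite !mxE /= rmorphD rmorphM /= /horner_eval hornerX hornerC; congr (_ + _).
  by case: (a == b); rewrite ?hornerC ?horner0.
(* [chi] takes the value 1 at 0, so almost every [lam] is allowed. *)
exists chi.
  have : chi.[0] != 0 by rewrite chiE scale0r addr0 det1 oner_eq0.
  by apply: contraNneq => ->; rewrite horner0.
move=> lam; rewrite chiE => dt0; set F := fun i => _.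
have IF i : I (F i).
  apply: idealD => //; last exact: idealM.
  apply: idealD => //; have -> : w i ^+ T = w i * w i ^+ T.-1 by rewrite -exprS prednK // ltnW.
  exact: idealMr.
split=> // x hx; have [k hk] := spanv x hx.
have Fv (a : 'I_m) : N (F (u a).1 * c (u a).2 - \sum_b io ((1%:M + lam *: E) a b) * v (u b)).
  have -> : \sum_b io ((1%:M + lam *: E) a b) * v (u b) =
      v (u a) + io lam * \sum_l' io (Em (u a) l') * v l'.
    rewrite (sum_u (fun l' => io (Em (u a) l') * v l')) mulr_sumr.
    under eq_bigr do rewrite !mxE rmorphD rmorphM mulrDl.
    rewrite big_split; congr (_ + _); last by apply: eq_bigr => b _; rewrite mulrA.
    rewrite (bigD1 a) //= eqxx rmorph1 mul1r big1 ?addr0 // => b /negbTE nb.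
    by rewrite eq_sym nb rmorph0 mul0r.
  have -> : F (u a).1 * c (u a).2 - (v (u a) + io lam * \sum_l' io (Em (u a) l') * v l') =
      w (u a).1 ^+ T * c (u a).2 + io lam * (s (u a).1 * c (u a).2 - \sum_l' io (Em (u a) l') * v l').
    by rewrite /F /v; ring.
  apply: idealD => //; last exact: idealM.
  have -> : w (u a).1 ^+ T = w (u a).1 * w (u a).1 * w (u a).1 ^+ T.-2.
    by rewrite -[w (u a).1 * w (u a).1]expr2 -exprD; congr (_ ^+ _); lia.
  rewrite -mulrA -mulrA; apply: ideal_mul_mem; first by apply: sub_ideal_gen; exists (u a).1.
  rewrite -add1n; apply: ideal_powD_mem; first exact: ideal_pow1.
  by apply: idealM => //; exact: ideal_pow_ideal.
pose W := invmx (1%:M + lam *: E).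
have WM : W *m (1%:M + lam *: E) = 1%:M by rewrite mulVmx // unitmxE unitfE.
have vF (a : 'I_m) : N (v (u a) - \sum_b io (W a b) * (F (u b).1 * c (u b).2)).
  have -> : v (u a) = \sum_b io (W a b) * \sum_b' io ((1%:M + lam *: E) b b') * v (u b').
    under eq_bigr do rewrite mulr_sumr.
    rewrite exchange_big /= (bigD1 a) //= [X in _ + X]big1 ?addr0 => [|b' nb'].
      under eq_bigr do rewrite mulrA -rmorphM.
      rewrite -mulr_suml -rmorph_sum; have := congr1 (fun M : 'M_(_) => M a a) WM; rewrite !mxE eqxx => ->.
      by rewrite rmorph1 mul1r.
    under eq_bigr do rewrite mulrA -rmorphM.
    rewrite -mulr_suml -rmorph_sum; have := congr1 (fun M : 'M_(_) => M a b') WM; rewrite !mxE eq_sym (negbTE nb') => ->.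
    by rewrite rmorph0 mul0r.
  rewrite -sumrB; apply: ideal_sum => // b _; rewrite -mulrBr; apply: idealM => //.
  by rewrite -opprB; apply: idealN.
pose y := \sum_(a < m) io (k (u a)) * \sum_b io (W a b) * (F (u b).1 * c (u b).2).
exists y.
  have hG : is_ideal (ideal_mul (ideal_gen (range F)) (ideal_pow I r)) by exact/ideal_mul_ideal/ideal_pow_ideal.
  apply: ideal_sum => // a _; apply: idealM => //; apply: ideal_sum => // b _; apply: idealM => //.
  by apply: ideal_mul_mem => //; apply: sub_ideal_gen; exists (u b).1.
have -> : x - y = (x - \sum_l io (k l) * v l) + (\sum_l io (k l) * v l - y) by ring.
apply: idealD => //; rewrite sum_u /y -sumrB; apply: ideal_sum => // a _.
by rewrite -mulrBr; apply: (idealM hN); exact: vF.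
Qed.

End Perturbation.

Lemma mderivXU (R : nzRingType) n (i j : 'I_n) : ('X_i : {mpoly R[n]})^`M(j) = (i == j)%:R.
Proof.
rewrite mderivX mnm1E; case: eqP => [->|_]; last by rewrite scale0r.
have -> : (U_(j) - U_(j))%MM = 0%MM :> 'X_{1..n}.
  by apply/mnmP => k; rewrite mnmBE subnn mnm0E.
by rewrite mpolyX0 scale1r.
Qed.

(** * The pencil of parameters *)

Section WeakBrianconSkoda.
Variables (K : fieldType) (A : idomainType) (io : {rmorphism K -> A}).
Variables (D g : nat) (t : 'I_D.+1 -> A) (s : 'I_g -> A) (p : 'I_g -> {mpoly K[D.+1 + g]}) (h : A).
Hypotheses (infK : infinite_field K) (noA : noetherian A).
Hypotheses (datum : jacobian_datum io t s p h) (fint : finite_over io t).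
Hypothesis gen : forall a, exists P, a = mmap io (join_fun t s) P.

Local Notation th := (join_fun t s).
Local Notation ev := (mmap io th).

(** These elements lie in every ideal containing t_0, and their Jacobian in [t] is triangular with
    determinant t_0^D. *)
Definition parameter (i : 'I_D.+1) : {mpoly K[D.+1 + g]} :=
  if i == ord0 then 'X_(lshift g ord0) else 'X_(lshift g ord0) * 'X_(lshift g i).

(* The rows of the relations p are free of lam, so the top coefficient comes from D + 1 rows. *)
Lemma parameter_jacobian (W : 'I_D.+1 -> {mpoly K[D.+1 + g]}) : exists P : {poly A},
  P`_D.+1 = h * t ord0 ^+ D /\ forall lam, P.[io lam] =
    \det (\matrix_(i, l) ev (join_fun (fun i => W i + lam *: parameter i) p i)^`M(l)).
Proof.
have [indt pth hE h0] := datum.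
pose U : 'M[A]_(D.+1 + g) := \matrix_(i, l) (ev (join_fun W p i)^`M(l)).
pose V : 'M[A]_(D.+1 + g) := \matrix_(i, l) (ev (join_fun parameter (fun=> 0) i)^`M(l)).
pose M : 'M[{poly A}]_(D.+1 + g) := map_mx polyC U + 'X *: map_mx polyC V.
exists (\det M); split; last first.
  move=> lam; rewrite -[LHS]/(horner_eval (io lam) (\det M)) -det_map_mx; congr (\det _).
  apply/matrixP => i l; rewrite !mxE /= /horner_eval hornerD hornerM hornerX !hornerC.
  rewrite /join_fun; case: (split i) => j.
    by rewrite mderivD mderivZ rmorphD /= mmapZ.
  by rewrite mderiv0 rmorph0 mulr0 addr0.
rewrite det_coef_rows; first last.
- move=> i j; rewrite !mxE !join_funr mderiv0 rmorph0 polyC0 mulr0 addr0.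
  exact: size_polyC_leq1.
- move=> i j; rewrite !mxE; apply: leq_trans (size_polyD _ _) _.
  rewrite geq_max (leq_trans (size_polyC_leq1 _)) //= mulrC.
  have [->|z0] := eqVneq (ev (join_fun parameter (fun=> 0) (lshift g i))^`M(j)) 0.
    by rewrite polyC0 mul0r size_poly0.
  by rewrite size_mulX ?polyC_eq0 // ltnS size_polyC_leq1.
pose Vt : 'M[A]_D.+1 := \matrix_(i, j) ev (parameter i)^`M(lshift g j).
pose H : 'M[A]_g := \matrix_(r, r') ev (p r)^`M(rshift D.+1 r').
have -> : \matrix_(i, j) (M i j)`_(split i : bool) =
    block_mx Vt 0 (\matrix_(i, j) ev (p i)^`M(lshift g j)) H.
  have c1 i j : (M i j)`_1 = V i j by rewrite !mxE coefD coefC coefXM coefC add0r.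
  have c0 i j : (M i j)`_0 = U i j by rewrite !mxE coefD coefC coefXM addr0.
  apply/matrixP => i j; rewrite mxE -(splitK i) -(splitK j) unsplitK.
  case: (split i) => i' /=; case: (split j) => j' /=; rewrite ?c1 ?c0 1?mxE ?(join_funl, join_funr).
  - by rewrite block_mxEul mxE.
  - rewrite block_mxEur mxE /parameter; case: eqP => _.
      by rewrite mderivXU eq_lrshift rmorph0.
    by rewrite mderivM !mderivXU !eq_lrshift mul0r mulr0 addr0 rmorph0.
  - by rewrite block_mxEdl mxE.
  - by rewrite block_mxEdr mxE.
rewrite det_lblock -/H -hE mulrC; congr (_ * _).
rewrite det_trig.
  rewrite big_ord_recl mxE /parameter eqxx mderivXU eqxx rmorph1 mul1r.
  under eq_bigr => i _.
    rewrite mxE /= mderivM !mderivXU !eq_lshift eqxx mulr1 mul0r add0r mmapXU join_funl; over.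
  by rewrite prodr_const card_ord.
apply/is_trig_mxP => i j ij; rewrite mxE /parameter.
have j0 : (ord0 == j) = false by apply/negbTE; rewrite -val_eqE /=; lia.
have ji : (i == j) = false by apply/negbTE; rewrite -val_eqE /=; lia.
case: eqP => _; rewrite ?mderivM !mderivXU !eq_lshift j0 ?rmorph0 //.
by rewrite ji mul0r mulr0 addr0 rmorph0.
Qed.

Theorem weak_briancon_skoda (rho : 'I_D.+1 -> {poly K}) (w : 'I_D.+1 -> A) (I M : set A) N u b :
  is_ideal I -> is_ideal M -> (forall i, rho i \is monic) -> (forall i, 1 < size (rho i))%N ->
  (forall i, w i = (map_poly io (rho i)).[t i]) -> w ord0 = t ord0 -> (forall i, I (w i)) ->
  M b -> b != 0 -> (forall x, M x -> ideal_mul (ideal_pow I N) M (u * x)) ->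
  ideal_pow I N (h * t ord0 ^+ D * u).
Proof.
move=> hI hM mon sz wE w0E Iw Mb b0 uM.
have [indt pth hE h0] := datum.
have t0 : t ord0 != 0.
  apply/eqP => t0; have := indt 'X_ord0; rewrite mmapXU t0 => /(_ erefl)/eqP.
  by rewrite -msize_poly_eq0 msizeX.
have finw := finite_monic fint mon sz wE.
have w0 : w ord0 != 0 by rewrite w0E.
have [f [r red]] := exists_reduction infK hI finw w0 noA.
have If := red.1; pose sp i := ev (parameter i).
have Isp i : I (sp i).
  rewrite /sp /parameter; case: eqP => _; first by rewrite mmapXU join_funl -w0E.
  by rewrite rmorphM /= !mmapXU !join_funl -w0E; exact: idealMr.
have [T0 hT0] := finite_large_power f sp finw.
pose T := maxn 2 T0.
have [chi chi0 hchi] := reduces_perturb hI Iw finw noA (leq_maxl 2 T0 : (1 < T)%N) red Isp.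
pose W i := (sval (cid (gen (w i)))) ^+ T + sval (cid (gen (f i))).
have WE i : ev (W i) = w i ^+ T + f i.
  by rewrite rmorphD rmorphXn /= -!(svalP (cid (gen _))).
have [P [Ptop Pev]] := parameter_jacobian W.
have hIN := ideal_pow_ideal I N.
rewrite -Ptop; move: D.+1; apply: (@interpolation K A io [set x | ideal_pow I N (x * u)] P chi) => //=.
- by rewrite mul0r; exact: ideal0.
- by move=> x y hx hy; rewrite mulrDl; exact: idealD.
- by move=> c x hx; rewrite -mulrA; exact: idealM.
move=> lam /hchi[IF redF]; rewrite Pev.
set F := fun i => _ in IF redF; set Jac := \det _.
have finF : finite_over io F by apply: hT0; exact: leq_maxr.
have indF := finite_alg_indep infK finF indt.
have fgI := noA (ideal_pow_ideal I r.+1).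
have hQ : is_ideal (ideal_mul (ideal_gen (range F)) (ideal_pow I r)) by exact/ideal_mul_ideal/ideal_pow_ideal.
(* Nakayama's lemma makes the reduction exact after multiplication by [gg], which is 1 modulo the
   parameters. *)
have [gg [nng hgg]] := nakayama hQ (ideal_gen_ideal (range w)) fgI redF.
have gpow k x : ideal_pow I (k + r) x ->
    ideal_mul (ideal_pow (ideal_gen (range F)) k) (ideal_pow I r) (gg ^+ k * x).
  elim: k x => [|k IHk] x hx; first by apply: ideal_mul_mem.
  have hP : is_ideal (ideal_mul (ideal_pow (ideal_gen (range F)) k.+1) (ideal_pow I r)).
    exact/ideal_mul_ideal/ideal_pow_ideal.
  move: hx; rewrite addSnnS; elim/ideal_pow_ind => [|y z hy hz|a y ha /hgg].
  - by rewrite mulr0; exact: ideal0.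
  - by rewrite mulrDr; exact: idealD.
  have -> : gg ^+ k.+1 * (a * y) = gg ^+ k * a * (gg * y) by rewrite exprSr; ring.
  elim/ideal_mul_ind => [|y1 y2 h1 h2|ph z hph hz].
  - by rewrite mulr0; exact: ideal0.
  - by rewrite mulrDr; exact: idealD.
  have -> : gg ^+ k * a * (ph * z) = ph * (gg ^+ k * (a * z)) by ring.
  have /IHk : ideal_pow I (k + r) (a * z) by exact: ideal_powD_mem.
  elim/ideal_mul_ind => [|y1 y2 h1 h2|ph' z' hph' hz'].
  - by rewrite mulr0; exact: ideal0.
  - by rewrite mulrDr; exact: idealD.
  by rewrite mulrA; apply: ideal_mul_mem => //; exact: ideal_mul_mem.
have IFs : ideal_gen (range F) `<=` I.
  by move=> x; apply: (ideal_gen_min hI) => _ [i _ <-]; exact: IF.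
(* The factor I^r absorbs the reduction number, so that [r] does not enter the conclusion. *)
pose M' := ideal_mul (ideal_pow I r) M.
have key : ideal_pow I N (Jac * (gg ^+ N * u)).
  apply: (ideal_pow_sub IFs).
  apply: (jacobian_order (M := M') (b := t ord0 ^+ r * b)) => //.
  - move=> i; rewrite /join_fun; case: (split i) => j; last by left; rewrite pth.
    right; exists j; rewrite mmapD WE mmapZ /F; congr (_ + _).
  - exact: ideal_mul_ideal.
  - by apply: ideal_mul_mem => //; apply: ideal_powX; rewrite -w0E.
  - by rewrite mulf_neq0 // expf_neq0.
  have hS : is_ideal (ideal_mul (ideal_pow (ideal_gen (range F)) N) M') by do 2 apply: ideal_mul_ideal.
  move=> x; elim/ideal_mul_ind => [|y z hy hz|y z hy /uM hz].
  - by rewrite mulr0; exact: ideal0.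
  - by rewrite mulrDr; exact: idealD.
  have -> : gg ^+ N * u * (y * z) = gg ^+ N * y * (u * z) by ring.
  elim/ideal_mul_ind: hz => [|y1 y2 h1 h2|a m ha hm].
  - by rewrite mulr0; exact: ideal0.
  - by rewrite mulrDr; exact: idealD.
  have -> : gg ^+ N * y * (a * m) = (gg ^+ N * (a * y)) * m by ring.
  have /gpow : ideal_pow I (N + r) (a * y) by exact: ideal_powD_mem.
  elim/ideal_mul_ind => [|y1 y2 h1 h2|ph z' hph hz'].
  - by rewrite mul0r; exact: ideal0.
  - by rewrite mulrDl; exact: idealD.
  by rewrite -mulrA; apply: ideal_mul_mem => //; exact: ideal_mul_mem.
have Ig : I (1 - gg ^+ N).
  rewrite -opprB; apply: idealN => //; rewrite subrX1; apply: idealMr => //.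
  rewrite -opprB; apply: idealN => //.
  by apply: ideal_gen_min nng => // _ [i _ <-].
(* To remove gg^N: (1 - gg^N)^N lies in I^N, and 1 minus it is a multiple of gg^N. *)
have := subrX1 (1 - gg ^+ N) N; set S := \sum_(i < N) _ => e.
have -> : Jac * u = (1 - gg ^+ N) ^+ N * (Jac * u) + S * (Jac * (gg ^+ N * u)).
  have -> : S * (Jac * (gg ^+ N * u)) = - ((1 - gg ^+ N - 1) * S) * (Jac * u) by ring.
  by rewrite -e; ring.
apply: idealD => //; first by apply: idealMr => //; exact: ideal_powX.
exact: idealM.
Qed.

End WeakBrianconSkoda.

(** * Residual parameters and the Briançon–Skoda theorem *)

Section ClassicalDomain.
Variables (Q : comNzRingType).
Hypothesis integral : forall x y : Q, x * y = 0 -> (x == 0) || (y == 0).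

(** An [idomainType] carries an inverse function; here it is chosen classically. *)
Definition classical_domain : Type := let _ := integral in Q.
HB.instance Definition _ := GRing.ComNzRing.on classical_domain.

Definition classical_unit : {pred classical_domain} := fun x => `[< exists y, y * x = 1 >].
Definition classical_inv (x : classical_domain) : classical_domain :=
  if pselect (exists y, y * x = 1) is left h then sval (cid h) else x.

Fact classical_mulVx : {in classical_unit, left_inverse 1 classical_inv *%R}.
Proof.
move=> x /asboolP hx; rewrite /classical_inv; case: pselect => // h.
exact: (svalP (cid h)).
Qed.

Fact classical_unitP (x y : classical_domain) : y * x = 1 -> classical_unit x.
Proof. by move=> h; apply/asboolP; exists y. Qed.

Fact classical_inv_out : {in [predC classical_unit], classical_inv =1 id}.
Proof.
move=> x; rewrite inE => /negP nx; rewrite /classical_inv; case: pselect => // h.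
by case: nx; apply/asboolP.
Qed.

HB.instance Definition _ := GRing.ComNzRing_hasMulInverse.Build classical_domain
  classical_mulVx classical_unitP classical_inv_out.
HB.instance Definition _ := GRing.ComUnitRing_isIntegral.Build classical_domain integral.

End ClassicalDomain.

Section PrimeQuotient.
Variables (R : comNzRingType) (P : set R).
Hypothesis hP : is_prime_ideal P.

Definition prime_pred : {pred R} := let _ := hP in fun x => `[< P x >].

Fact prime_pred_idealr : idealr_closed prime_pred.
Proof.
have [hI h1 _] := hP; split.
- by apply/asboolP; exact: ideal0.
- by apply/asboolP.
- by move=> a x y /asboolP hx /asboolP hy; apply/asboolP; apply: idealD => //; exact: idealM.
Qed.

HB.instance Definition _ := isIdealr.Build R prime_pred prime_pred_idealr.

Fact prime_pred_prime : prime_idealr_closed prime_pred.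
Proof.
move=> x y /asboolP; have [_ _ h] := hP => /h[hx|hy]; apply/orP; [left|right]; exact/asboolP.
Qed.

HB.instance Definition _ := isPrimeIdealrClosed.Build R prime_pred prime_pred_prime.

Lemma prime_quotient : exists (L : idomainType) (f : {rmorphism R -> L}),
  (forall y, exists x, f x = y) /\ forall x, f x = 0 <-> P x.
Proof.
pose Q : comNzRingType := {ideal_quot prime_pred}.
pose L : idomainType := classical_domain (@Quotient.rquot_IdomainAxiom R prime_pred).
pose f0 : {rmorphism R -> Q} := \pi_Q%qT.
pose f : {rmorphism R -> L} := f0.
exists L, f; split=> [y|x].
  by exists (repr (y : {ideal_quot prime_pred})); exact: reprK.
have -> : (f x = 0) <-> (x - 0 \in prime_pred).
  by rewrite Quotient.idealrBE; split=> [h|/eqP h]; [apply/eqP; rewrite h; exact/esym/rmorph0|rewrite [f x]h; exact: rmorph0].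
by rewrite subr0; split=> /asboolP.
Qed.

End PrimeQuotient.

Section Residual.
Variables (K : fieldType).
Hypotheses (infK : infinite_field K) (perfK : perfect_field K).

(** If a parameter t_0 were left, its inverse would act on the finite module by some matrix N, and
    det(1 - t_0 N) = 0 would be a relation with constant term 1 between independent elements. *)
Lemma zariski (L : idomainType) (io : {rmorphism K -> L}) n (xi : 'I_n -> L) :
  (forall a, exists P, a = mmap io xi P) -> (forall a : L, a != 0 -> exists b, a * b = 1) ->
  forall a, exists2 rho : {poly K}, rho \is monic & (map_poly io rho).[a] = 0.
Proof.
move=> gen fieldL a.
have [D [g [t [s [p [h [[indt _ _ _] [q [e fin]] gx]]]]]]] := normal_form io infK perfK xi.
have gen' b : exists P, b = mmap io (join_fun t s) P.
  have [P ->] := gen b; elim/mpoly_alg_ind: P => [c|i|P Q [P' hP] [Q' hQ]|P Q [P' hP] [Q' hQ]].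
  - by exists c%:MP; rewrite !mmapC.
  - by have [P' hP] := gx i; exists P'; rewrite mmapXU.
  - by exists (P' + Q'); rewrite !rmorphD /= hP hQ.
  - by exists (P' * Q'); rewrite !rmorphM /= hP hQ.
have fint : finite_over io t by exists q, e => b; have [P ->] := gen' b; exact: fin.
case: D t s p indt fin gx gen' fint => [|D] t s p indt fin gx gen' fint.
  have [P P0 PE] := alg_dependence (ext_last t a) fint.
  pose Q := shear (fun=> 0) P.
  have Q0 : Q != 0 by rewrite -(inj_eq (@shear_inj _ _ (fun=> 0))) rmorph0 in P0 *; rewrite P0.
  have QE : eval2 io t a Q = 0.
    rewrite eval2_shear -[RHS]PE; apply: eq_mmap => i.
    case: (unliftP ord_max i) => [j|] ->; rewrite !(ext_last_lift, ext_last_max) //.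
    by rewrite rmorph0 mul0r addr0.
  pose r := \poly_(i < size Q) (Q`_i)@_0.
  have rE i : io r`_i = mmap io t Q`_i.
    rewrite coef_poly; case: ltnP => hi; last by rewrite nth_default // !rmorph0.
    by rewrite [Q`_i in RHS]nvar0_mpolyC mmapC.
  have r0 : r != 0.
    apply: contraNneq Q0 => r0; apply/eqP/polyP => i; rewrite coef0 (nvar0_mpolyC Q`_i).
    by apply/eqP; rewrite mpolyC_eq0 -(fmorph_eq0 io) -(mmapC t) -nvar0_mpolyC -rE r0 coef0 rmorph0.
  exists ((lead_coef r)^-1 *: r).
    by rewrite monicE lead_coefZ mulVf // lead_coef_eq0.
  have -> : map_poly io ((lead_coef r)^-1 *: r) = io (lead_coef r)^-1 *: map_poly (mmap io t) Q.
    apply/polyP => i; rewrite coef_map [RHS]coefZ [in RHS]coef_map.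
    by rewrite coefZ /= rmorphM /=; congr (_ * _); exact: rE.
  by rewrite hornerZ -[_.[a]]/(eval2 io t a Q) QE mulr0.
have t0 : t ord0 != 0.
  apply/eqP => t0; have := indt 'X_ord0; rewrite mmapXU t0 => /(_ erefl)/eqP.
  by rewrite -msize_poly_eq0 msizeX.
have [b tb] := fieldL _ t0.
have [q' [e' fin']] := fint.
pose N i := sval (cid (fin' (b * e' i))).
have NE i : b * e' i = \sum_j mmap io t (N i j) * e' j := svalP (cid (fin' (b * e' i))).
pose M : 'M[{mpoly K[D.+1]}]_q' := \matrix_(i, j) ((i == j)%:R - 'X_ord0 * N i j).
have Me i : \sum_j map_mx (mmap io t) M i j * e' j = 0.
  under eq_bigr do rewrite !mxE rmorphB rmorphM /= mmapXU mulrBl -mulrA.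
  rewrite sumrB -mulr_sumr -NE mulrA tb mul1r (bigD1 i) //= eqxx rmorph1 mul1r big1 ?addr0 ?subrr // => j.
  by rewrite eq_sym => /negbTE->; rewrite rmorph0 mul0r.
have := det_trick Me; rewrite det_map_mx => dM.
have d1 : mmap io t (\det M) = 0.
  rewrite -[LHS]mulr1; have [c ->] := fin' 1; rewrite mulr_sumr big1 // => j _.
  by rewrite mulrCA dM mulr0.
have := congr1 (meval (fun=> 0)) (indt _ d1); rewrite meval0 -det_map_mx.
have -> : map_mx (meval (fun=> 0)) M = 1%:M.
  apply/matrixP => i j; rewrite !mxE rmorphB rmorphM /= mevalXU mul0r subr0.
  by case: eqP; rewrite ?meval1 ?meval0.
by rewrite det1 => /eqP; rewrite oner_eq0.
Qed.

(** A Krull intersection argument. Let [m] be maximal above (J : x) and c = rho(a) in [m], by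
    Zariski's lemma. A high power of [c] is added to [J]; if that captured x, some 1 - c d would
    multiply x into [J] and so lie in [m] together with c. *)
Lemma residual_element (A : comNzRingType) (io : {rmorphism K -> A}) n (xi : 'I_n -> A)
    (J : set A) x a : (forall a, exists P, a = mmap io xi P) -> noetherian A ->
  is_ideal J -> ~ J x ->
  exists J', [/\ is_ideal J', J `<=` J', ~ J' x &
    exists2 rho : {poly K}, rho \is monic & J' (map_poly io rho).[a]].
Proof.
move=> gen noA hJ nJx.
have [m [hm cm m1] maxm] := noetherian_max (F := [set m | [/\ is_ideal m, [set z | J (x * z)] `<=` m & ~ m 1]])
  (J0 := [set z | J (x * z)]) noA (fun m (h : [/\ _, _ & _]) => let: And3 h1 _ _ := h in h1)
  (And3 (colon_ideal x hJ) (fun z h => h) (fun h : J (x * 1) => nJx (eq_ind _ J h _ (mulr1 x)))).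
have inv y : ~ m y -> exists b, m (1 - y * b).
  move=> my; apply: contrapT => nb; apply: my.
  have h : is_ideal (ideal_add m (ideal_gen [set y])).
    by apply: ideal_add_ideal => //; exact: ideal_gen_ideal.
  have sm : m `<=` ideal_add m (ideal_gen [set y]).
    by move=> z hz; apply: ideal_addl => //; exact: ideal_gen_ideal.
  apply: (maxm (ideal_add m (ideal_gen [set y]))) => //.
    split=> //; first by move=> z /cm/sm.
    move=> /ideal_addP[c [_ [mc /ideal_gen1[b ->] e]]]; apply: nb; exists b.
    by rewrite e addrK.
  by apply: ideal_addr => //; exact: sub_ideal_gen.
have primem : is_prime_ideal m.
  split=> // y z myz; have [|my] := pselect (m y); first by left.
  right; have [b hb] := inv y my.
  have -> : z = z * (1 - y * b) + b * (y * z) by ring.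
  by apply: idealD => //; exact: idealM.
have [L [f [fsurj fker]]] := prime_quotient primem.
have [||rho mon rhoE] := @zariski L (f \o io) n (f \o xi) _ _ (f a).
- move=> y; have [z <-] := fsurj y; have [P ->] := gen z.
  by exists P; rewrite mmap_comp.
- move=> y y0; have [z zE] := fsurj y; have [|b hb] := inv z.
    by move=> /fker h; rewrite -zE h eqxx in y0.
  exists (f b); rewrite -zE -rmorphM; apply/esym/eqP; rewrite -subr_eq0 -(rmorph1 f) -rmorphB.
  exact/eqP/fker.
pose c := (map_poly io rho).[a].
have mc : m c by apply/fker; rewrite /c -horner_map -map_poly_comp.
pose Jx := ideal_add J (ideal_gen [set x]).
have hJx : is_ideal Jx by apply: ideal_add_ideal => //; exact: ideal_gen_ideal.
(* The ideals ((J, x) : c^e) become stationary, which fixes the power of [c] to add. *)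
have [|_ [e _ <-] maxe] := noetherian_max (F := [set [set z | Jx (c ^+ e * z)] | e in setT])
   (J0 := [set z | Jx (c ^+ 0 * z)]) noA _ (imageP _ I).
  by move=> _ [e _ <-]; exact: colon_ideal.
have stab z : Jx (c ^+ e.+1 * z) -> Jx (c ^+ e * z).
  apply: (maxe [set z | Jx (c ^+ e.+1 * z)]); first by exists e.+1.
  by move=> y hy /=; rewrite exprS -mulrA; exact: idealM.
exists (ideal_add J (ideal_gen [set c ^+ e.+1])); split.
- by apply: ideal_add_ideal => //; exact: ideal_gen_ideal.
- by move=> z hz; apply: ideal_addl => //; exact: ideal_gen_ideal.
- move=> /ideal_addP[i [_ [Ji /ideal_gen1[b ->] xE]]].
  have /stab/ideal_addP[i' [_ [Ji' /ideal_gen1[d ->] bE]]] : Jx (c ^+ e.+1 * b).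
    have -> : c ^+ e.+1 * b = x - i by rewrite xE addrAC subrr add0r.
    apply: idealB => //; last by apply: ideal_addl => //; exact: ideal_gen_ideal.
    by apply: ideal_addr => //; exact: sub_ideal_gen.
  have h1 : m (1 - c * d).
    apply: cm => /=; have -> : x * (1 - c * d) = i + c * i'.
      by rewrite {1}mulrBr mulr1 {1}xE exprS -mulrA bE; ring.
    by apply: idealD => //; exact: idealM.
  apply: m1; have -> : 1 = (1 - c * d) + c * d by rewrite subrK.
  by apply: idealD => //; exact: idealMr.
exists (rho ^+ e.+1); first exact: monic_exp.
apply: ideal_addr => //; apply: sub_ideal_gen; rewrite /= rmorphXn /= horner_exp //.
Qed.

Lemma residual_parameters (A : comNzRingType) (io : {rmorphism K -> A}) n (xi : 'I_n -> A)
    D (t : 'I_D -> A) (J : set A) x : (forall a, exists P, a = mmap io xi P) -> noetherian A ->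
  is_ideal J -> ~ J x ->
  exists J' (rho : 'I_D -> {poly K}), [/\ is_ideal J', J `<=` J', ~ J' x &
    forall i, [/\ rho i \is monic, (1 < size (rho i))%N & J' (map_poly io (rho i)).[t i]]].
Proof.
move=> gen noA hJ nJx.
suff H k : (k <= D)%N -> exists J', [/\ is_ideal J', J `<=` J', ~ J' x &
    forall i : 'I_D, (i < k)%N -> exists2 rho : {poly K}, rho \is monic & J' (map_poly io rho).[t i]].
  have [J' [hJ' sJ' nx h]] := H D (leqnn D).
  have /choice[rho hrho] i : exists r : {poly K}, r \is monic /\ J' (map_poly io r).[t i].
    by have [r mr hr] := h i (ltn_ord i); exists r.
  exists J', rho; split=> // i; have [mon Ji] := hrho i; split=> //.
  rewrite ltnNge; apply/negP => s1; apply: nx.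
  have r1 : rho i = 1.
    have := size1_polyC s1; have /monicP := mon; rewrite lead_coefE.
    have -> : size (rho i) = 1%N by apply/eqP; rewrite eqn_leq s1 size_poly_gt0 monic_neq0.
    by move=> -> ->.
  by rewrite -[x]mulr1; apply: idealM => //; move: Ji; rewrite r1 rmorph1 hornerC.
elim: k => [_|k IHk kD]; first by exists J; split.
have [J1 [hJ1 s1 n1 h1]] := IHk (ltnW kD).
have [J2 [hJ2 s2 n2 [rho mon hrho]]] := residual_element (t (Ordinal kD)) gen noA hJ1 n1.
exists J2; split=> // [z /s1/s2//|i]; rewrite ltnS leq_eqVlt => /predU1P[ik|/h1[r mr /s2 hr]].
  by exists rho => //; have -> : i = Ordinal kD by exact: val_inj.
by exists r.
Qed.

End Residual.

Definition full_datum (K : fieldType) (A : idomainType) (io : {rmorphism K -> A})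
    D g (t : 'I_D -> A) (s : 'I_g -> A) (p : 'I_g -> {mpoly K[D + g]}) (h : A) : Prop :=
  [/\ jacobian_datum io t s p h, finite_over io t &
      forall a, exists P, a = mmap io (join_fun t s) P].

Lemma full_datum_noetherian (K : fieldType) (A : idomainType) (io : {rmorphism K -> A})
    D g (t : 'I_D -> A) (s : 'I_g -> A) p h : full_datum io t s p h -> noetherian A.
Proof.
move=> [_ _ gen]; apply: (noetherian_surj (f := mmap io (join_fun t s))) (@mpoly_noetherian K _).
by move=> a; have [P ->] := gen a; exists P.
Qed.

(** * Adjoining polynomial variables *)

Section DatumExtension.
Variables (K : fieldType) (A : idomainType) (io : {rmorphism K -> A}) (m D g : nat).
Variables (t : 'I_D -> A) (s : 'I_g -> A) (p : 'I_g -> {mpoly K[D + g]}) (h : A).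
Hypotheses (infK : infinite_field K) (datum : full_datum io t s p h).

Definition ext_base : {rmorphism K -> {mpoly A[m]}} := @mpolyC m A \o io.
Definition ext_t : 'I_(m + D) -> {mpoly A[m]} := join_fun (fun i => 'X_i) (fun j => (t j)%:MP).
Definition ext_s (j : 'I_g) : {mpoly A[m]} := (s j)%:MP.
Definition ext_rel (P : {mpoly K[D + g]}) : {mpoly K[m + D + g]} :=
  mmap (@mpolyC _ K) (join_fun (fun j => 'X_(lshift g (rshift m j))) (fun r => 'X_(rshift (m + D) r))) P.

Lemma ext_relE P : mmap ext_base (join_fun ext_t ext_s) (ext_rel P) =
  (mmap io (join_fun t s) P)%:MP.
Proof.
apply: (mpoly_rmorph_eq (f := mmap ext_base (join_fun ext_t ext_s) \o mmap (@mpolyC _ K) _)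
  (g := @mpolyC m A \o mmap io (join_fun t s))) => [c|i] /=.
  by rewrite !mmapC.
rewrite !mmapXU -(splitK i); case: (split i) => j /=.
  by rewrite !join_funl mmapXU join_funl /ext_t join_funr.
by rewrite !join_funr mmapXU !join_funr.
Qed.

Lemma ext_rel_deriv P r : (ext_rel P)^`M(rshift (m + D) r) = ext_rel P^`M(rshift D r).
Proof.
rewrite /ext_rel mderiv_comp (bigD1 (rshift D r)) //= big1 ?addr0 => [|i].
  by rewrite join_funr mderivXU eqxx mulr1.
rewrite -(splitK i); case: (split i) => j /= nj.
  by rewrite join_funl mderivXU eq_lrshift mulr0.
by rewrite join_funr mderivXU !eq_rshift in nj *; rewrite (negbTE nj) mulr0.
Qed.

Lemma datum_extension : full_datum ext_base ext_t ext_s (fun r => ext_rel (p r)) h%:MP.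
Proof.
have [[indt pth hE h0] [q [e fin]] gen] := datum; split.
- split=> [P PE|r||]; last by rewrite mpolyC_eq0.
  (* The new variables are specialised to a point of the infinite field at which [P] does not
     vanish, leaving a relation between the old parameters. *)
  + apply/eqP; apply: contraT => P0; have [v hv] := nonvanishing idfun infK P0; rewrite /= in hv.
    pose Pc := mmap (@mpolyC D K) (join_fun (fun i => (v (lshift D i))%:MP) (fun j => 'X_j)) P.
    have Pc0 : mmap io t Pc = 0.
      have := congr1 (meval (fun i => io (v (lshift D i)))) PE; rewrite meval0 => <-.
      apply: (mpoly_rmorph_eq (f := mmap io t \o mmap (@mpolyC D K) _)
        (g := meval (fun i => io (v (lshift D i))) \o mmap ext_base ext_t)) => [c|i] /=.
        by rewrite !mmapC /= mevalC.
      rewrite !mmapXU -(splitK i) /ext_t; case: (split i) => j /=.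
        by rewrite !join_funl mmapC mevalXU.
      by rewrite !join_funr mmapXU mevalC.
    have := congr1 (meval (fun j => v (rshift m j))) (indt _ Pc0); rewrite meval0 => Pv.
    case/eqP: hv; rewrite -Pv.
    apply: (mpoly_rmorph_eq (f := meval v)
      (g := meval (fun j => v (rshift m j)) \o mmap (@mpolyC D K) _)) => [c|i] /=.
      by rewrite mmapC !mevalC.
    rewrite mmapXU mevalXU -(splitK i); case: (split i) => j /=.
      by rewrite join_funl mevalC.
    by rewrite join_funr mevalXU.
  + by rewrite ext_relE pth mpolyC0.
  + rewrite hE -(det_map_mx (@mpolyC m A)); congr (\det _); apply/matrixP => r r'; rewrite !mxE.
    by rewrite ext_rel_deriv ext_relE.
- suff H a : mspan ext_base ext_t (fun i => (e i)%:MP) a by exists q, (fun i => (e i)%:MP).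
  elim/mpolyind: a => [|c k a _ _ ha]; first exact: mspan0.
  apply: mspanD => //; rewrite -mul_mpolyC mulrC.
  have -> : 'X_[k] = mmap ext_base ext_t (mmap (@mpolyC _ K) (fun i => 'X_(lshift D i)) 'X_[k]).
    rewrite mmapX /mmap1 rmorph_prod mpolyXE_id; apply: eq_bigr => i _.
    by rewrite /= rmorphXn /= mmapXU /ext_t join_funl.
  apply: mspanM; have [b ->] := fin c; rewrite rmorph_sum.
  apply: mspan_sum => i _; rewrite /= mpolyCM.
  have -> : (mmap io t (b i))%:MP = mmap ext_base ext_t (mmap (@mpolyC _ K) (fun j => 'X_(rshift m j)) (b i)).
    apply: (mpoly_rmorph_eq (f := @mpolyC m A \o mmap io t)
      (g := mmap ext_base ext_t \o mmap (@mpolyC _ K) (fun j => 'X_(rshift m j)))) => [a0|j] /=.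
      by rewrite !mmapC.
    by rewrite !mmapXU /ext_t join_funr.
  by apply: mspanM; exact: (mspan_mem _ _ (fun i => (e i)%:MP)).
elim/mpoly_alg_ind => [c|i|a b [P ->] [Q ->]|a b [P ->] [Q ->]].
- by have [P ->] := gen c; exists (ext_rel P); rewrite ext_relE.
- by exists 'X_(lshift g (lshift D i)); rewrite mmapXU join_funl /ext_t join_funl.
- by exists (P + Q); rewrite rmorphD.
- by exists (P * Q); rewrite rmorphM.
Qed.

End DatumExtension.

(** If h u escaped I^(N-D), some ideal J above this power would still avoid h u while every t_i
    satisfies a monic equation rho_i modulo J. Adding the rho_i(t_i) to [I] is harmless modulo J and
    provides the parameters for the weak theorem. *)
Theorem briancon_skoda (K : fieldType) (A : idomainType) (io : {rmorphism K -> A})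
    D g (t : 'I_D -> A) (s : 'I_g -> A) p h (I M : set A) N u b :
  infinite_field K -> perfect_field K -> full_datum io t s p h ->
  is_ideal I -> is_ideal M -> M b -> b != 0 ->
  (forall x, M x -> ideal_mul (ideal_pow I N) M (u * x)) -> ideal_pow I (N - D) (h * u).
Proof.
move=> infK perfK datum hI hM Mb b0 uM; apply: contrapT => nhu.
have [ND|DN] := leqP N D.
  by apply: nhu; move/eqP: ND => ->.
have noA := full_datum_noetherian datum; have [_ _ gen] := datum.
have [J [rho [hJ sJ nJ hrho]]] := residual_parameters infK perfK t gen noA (ideal_pow_ideal I (N - D)) nhu.
pose wt i := (map_poly io (rho i)).[t i].
pose I' := ideal_add I (ideal_gen (range wt)).
have hI' : is_ideal I' by apply: ideal_add_ideal => //; exact: ideal_gen_ideal.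
have sI' : ideal_pow I' (N - D) `<=` J.
  move=> x /(ideal_pow_add hI (ideal_gen_ideal (range wt)))[y /sJ Jy hy].
  apply: (idealBr hJ _ Jy); apply: ideal_gen_min hy => // _ [i _ <-].
  by case: (hrho i).
have datum' := datum_extension 1 infK datum; have [jd' fin' gen'] := datum'.
pose y : {mpoly A[1]} := 'X_ord0.
pose Ip : set {mpoly A[1]} := ideal_add (ideal_gen ((fun a : A => a%:MP) @` I')) (ideal_gen [set y]).
have hIp : is_ideal Ip by apply: ideal_add_ideal; exact: ideal_gen_ideal.
have IpC a : I' a -> Ip a%:MP.
  move=> ha; apply: ideal_addl; first exact: ideal_gen_ideal.
  by apply: sub_ideal_gen; exists a.
have Ipy : Ip y by apply: ideal_addr; [exact: ideal_gen_ideal|exact: sub_ideal_gen].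
pose Mp : set {mpoly A[1]} := ideal_gen ((fun a : A => a%:MP) @` M).
pose rho' : 'I_(1 + D) -> {poly K} := join_fun (fun=> 'X) rho.
pose yt : 'I_(1 + D) -> {mpoly A[1]} := ext_t t.
pose w' i := (map_poly (ext_base io 1) (rho' i)).[yt i].
have w'0 : w' ord0 = y.
  have -> : ord0 = lshift D (ord0 : 'I_1) by exact: val_inj.
  by rewrite /w' /rho' /yt /ext_t !join_funl map_polyX hornerX.
have w'j j : w' (rshift 1 j) = (wt j)%:MP.
  rewrite /w' /rho' /yt /ext_t !join_funr map_poly_comp /wt -horner_map //=.
have t'0 : yt ord0 = y.
  have -> : ord0 = lshift D (ord0 : 'I_1) by exact: val_inj.
  by rewrite /yt /ext_t join_funl.
have : ideal_pow Ip N (h%:MP * yt ord0 ^+ D * u%:MP).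
  apply: (weak_briancon_skoda infK (full_datum_noetherian datum') jd' fin' gen'
    (rho := rho') (w := w') (M := Mp) (b := b%:MP)) => //.
  - exact: ideal_gen_ideal.
  - move=> i; rewrite /rho' -(@splitK 1 D i); case: (split (i : 'I_(1 + D))) => j /=; rewrite ?join_funl ?join_funr.
      exact: monicX.
    by case: (hrho j).
  - move=> i; rewrite /rho' -(@splitK 1 D i); case: (split (i : 'I_(1 + D))) => j /=; rewrite ?join_funl ?join_funr.
      by rewrite size_polyX.
    by case: (hrho j).
  - by rewrite w'0; exact/esym/t'0.
  - move=> i; rewrite -(@splitK 1 D i); case: (split (i : 'I_(1 + D))) => j /=.
      have -> : lshift D j = ord0 by apply: val_inj; case: j => -[].
      by rewrite w'0.
    rewrite w'j; apply: IpC; apply: ideal_addr => //; apply: sub_ideal_gen; by exists j.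
  - by apply: sub_ideal_gen; exists b.
  - by rewrite mpolyC_eq0.
  have hS : is_ideal (ideal_mul (ideal_pow Ip N) Mp) by apply: ideal_mul_ideal; exact: ideal_gen_ideal.
  move=> x; elim/ideal_mul_ind => [|x1 x2 h1 h2|_ x' [a Ma <-] _].
  - by rewrite mulr0; exact: ideal0.
  - by rewrite mulrDr; exact: idealD.
  rewrite mulrA -mpolyCM; apply: idealMr => //.
  elim/ideal_mul_ind: (uM a Ma) => [|x1 x2 h1 h2|x1 x2 h1 h2].
  - by rewrite mpolyC0; exact: ideal0.
  - by rewrite mpolyCD; exact: idealD.
  rewrite mpolyCM; apply: ideal_mul_mem; last by apply: sub_ideal_gen; exists x2.
  apply: (ideal_pow_rmorph (f := @mpolyC 1 A)) h1 => z Iz; apply: IpC.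
  by apply: ideal_addl => //; exact: ideal_gen_ideal.
rewrite t'0 => hyp; apply: nJ; apply: sI'.
(* [E n] contains the n-th power of (I', y); its condition at y^D puts h u into I'^(N-D). *)
pose E n : set {mpoly A[1]} := [set P | forall k, ideal_pow I' (n - mdeg k) P@_k].
have EM a c P Q : E a P -> E c Q -> E (a + c)%N (P * Q).
  move=> hP hQ k; rewrite mcoeffM; apply: ideal_sum; first exact: ideal_pow_ideal.
  move=> kk /eqP kE; apply: ideal_pow_le (ideal_powD_mem (hP _) (hQ _)).
  by have /(congr1 (@mdeg _)) := kE; rewrite mdegD; lia.
have hE n : is_ideal (E n).
  split=> [k|P Q hP hQ k|P Q hQ].
  - by rewrite mcoeff0; exact: ideal0 (ideal_pow_ideal _ _).
  - by rewrite mcoeffD; apply: (idealD (ideal_pow_ideal _ _)).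
  - by apply: (EM 0%N n) => // k; rewrite sub0n.
have IpE P : Ip P -> E 1 P.
  move=> /ideal_addP[P1 [P2 [h1 h2 ->]]]; apply: (idealD (hE 1%N)).
    apply: (ideal_gen_min (hE 1%N) _ h1) => _ [a Ia <-] k; rewrite mcoeffC.
    apply: (idealMr (ideal_pow_ideal _ _)); case: (mdeg k) => [|m]; rewrite ?subSS ?sub0n //.
    exact: ideal_pow1.
  apply: (ideal_gen_min (hE 1%N) _ h2) => _ -> k; rewrite mcoeffX; case: eqP => [<-|_].
    by rewrite mdeg1.
  exact: ideal0 (ideal_pow_ideal _ _).
have sE n P : ideal_pow Ip n P -> E n P.
  elim: n P => [|n IHn] P; first by move=> _ k; rewrite sub0n.
  elim/ideal_mul_ind => [|P1 P2 h1 h2|P1 P2 /IpE h1 /IHn h2].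
  - exact: ideal0 (hE _).
  - exact: (idealD (hE _)).
  by rewrite -add1n; exact: EM.
have := sE _ _ hyp (U_(ord0) *+ D)%MM.
rewrite mdegMn mdeg1 mul1n mulrAC -mpolyCM mcoeffCM /y.
have -> : 'X_ord0 ^+ D = 'X_[U_(ord0) *+ D] :> {mpoly A[1]} by rewrite mpolyXn.
by rewrite mcoeffX eqxx mulr1.
Qed.

(** * Uniform Artin–Rees over a perfect infinite field *)

(* Expanding T (z w) = (z + X) T w gives w in terms of z^j and the coefficients of T (z w). *)
Lemma kronecker (A : idomainType) (T : {rmorphism A -> {poly A}}) (I : set A) (z w : A) N :
  is_ideal I -> (forall a, (T a)`_0 = a) -> T z = z%:P + 'X -> ideal_pow I N.+1 (z * w) ->
  exists M b, [/\ is_ideal M, M b, b != 0 &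
    forall x, M x -> ideal_mul (ideal_pow I N) M (w * x)].
Proof.
move=> hI T0 Tz Izw.
have hp k := ideal_pow_ideal I k.
(* [T] is the identity at Z = 0, so each power of Z costs at most one power of [I]. *)
have TI k x i : ideal_pow I k x -> ideal_pow I (k - i) (T x)`_i.
  elim: k x i => [//|k IHk] x i; elim/ideal_mul_ind => [|y1 y2 h1 h2|a y Ia /IHk hy].
  - by rewrite rmorph0 coef0; exact: ideal0.
  - by rewrite rmorphD coefD; exact: idealD.
  rewrite rmorphM coefM; apply: ideal_sum => // l _.
  have [l0|l0] := posnP l.
    rewrite l0 subn0 T0; have [ki|ki] := leqP i k; last first.
      by have -> : (k.+1 - i = 0)%N by lia.
    by rewrite subSn //; apply: ideal_mul_mem => //; exact: hy.
  by apply: ideal_pow_le (idealM (hp _) (hy (i - l)%N)); have := ltn_ord l; lia.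
have z0 : z != 0.
  apply/eqP => z0; have := congr1 (fun p : {poly A} => p`_1) Tz.
  rewrite z0 rmorph0 coef0 coefD coefX coefC /= add0r => /eqP.
  by rewrite eq_sym oner_eq0.
pose m := maxn (size (T w)) N.
(* [M] is the m-th power of (I, z). Terms with a factor [z] use z w in I^(N+1); the term in I^m uses
   the expansion [wE] of w. *)
pose M : set A := [set x | exists a : 'I_m.+1 -> A, (forall i : 'I_m.+1, ideal_pow I (m - i) (a i)) /\ x = \sum_(i < m.+1) z ^+ i * a i].
have hM : is_ideal M.
  split=> [|x y [a [ha ->]] [b [hb ->]]|c x [a [ha ->]]].
  - exists (fun=> 0); split=> [i|]; first exact: ideal0.
    by rewrite big1 // => i _; rewrite mulr0.
  - exists (fun i => a i + b i); split=> [i|]; first exact: idealD.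
    by rewrite -big_split; apply: eq_bigr => i _; rewrite mulrDr.
  - exists (fun i => c * a i); split=> [i|]; first exact: idealM.
    by rewrite mulr_sumr; apply: eq_bigr => i _; rewrite mulrCA.
have Mmem i a : (i <= m)%N -> ideal_pow I (m - i) a -> M (z ^+ i * a).
  rewrite -ltnS => im ha; exists (fun l => if l == Ordinal im then a else 0); split=> [l|].
    by case: eqP => [->//|_]; exact: ideal0.
  by rewrite (bigD1 (Ordinal im)) //= eqxx big1 ?addr0 // => l /negbTE->; rewrite mulr0.
exists M, (z ^+ m); split=> //.
- by rewrite -[z ^+ m]mulr1; apply: Mmem; rewrite ?subnn.
- exact: expf_neq0.
have hY : is_ideal (ideal_mul (ideal_pow I N) M) by exact: ideal_mul_ideal.
move=> _ [a [ha ->]]; rewrite mulr_sumr; apply: ideal_sum => // -[[|i] im] _ /=; last first.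
  have := ha (Ordinal im) => /= hai.
  have -> : w * (z ^+ i.+1 * a (Ordinal im)) = z * w * (z ^+ i * a (Ordinal im)) by rewrite exprS; ring.
  move: Izw; rewrite -addn1; elim/ideal_pow_ind => [|y1 y2 h1 h2|c d hc hd].
  - by rewrite mul0r; exact: ideal0.
  - by rewrite mulrDl; exact: idealD.
  rewrite -mulrA; apply: ideal_mul_mem => //; rewrite mulrCA; apply: Mmem; first exact: ltnW.
  have -> : (m - i = 1 + (m - i.+1))%N by have : (i < m)%N := im; lia.
  exact: ideal_powD_mem.
set a0 := a _; have {}ha : ideal_pow I m a0 by have := ha (Ordinal im); rewrite subn0.
pose G k := (T (z * w))`_k.
have GE k : G k.+1 = z * (T w)`_k.+1 + (T w)`_k.
  by rewrite /G rmorphM Tz mulrDl coefD coefCM coefXM.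
have wE k : w = (- z) ^+ k * (T w)`_k + \sum_(j < k) (- z) ^+ j * G j.+1.
  elim: k => [|k IHk]; first by rewrite big_ord0 addr0 mul1r T0.
  by rewrite big_ord_recr /= GE [LHS]IHk exprSr; ring.
rewrite expr0 mul1r (wE m) [(T w)`_m]nth_default ?leq_maxl // mulr0 add0r mulr_suml.
apply: ideal_sum => // j _.
have hG : ideal_pow I (N + (m - j)) (G j.+1 * a0).
  apply: ideal_pow_le (ideal_powD_mem (TI _ _ j.+1 Izw) ha); lia.
rewrite -mulrA; elim/ideal_pow_ind: hG => [|y1 y2 h1 h2|c d hc hd].
- by rewrite mulr0; exact: ideal0.
- by rewrite mulrDr; exact: idealD.
rewrite mulrCA; apply: ideal_mul_mem => //.
have -> : (- z) ^+ j * d = (-1) ^+ j * (z ^+ j * d) by rewrite [RHS]mulrA -exprMn mulN1r.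
by apply: idealM => //; apply: Mmem => //; exact: ltnW.
Qed.

Section Killing.
Variables (K : fieldType) (e d : nat) (xi : 'I_d -> {mpoly K[e]}).
Hypotheses (infK : infinite_field K) (perfK : perfect_field K).
Local Notation C := {mpoly K[e]}.

(** Modulo [P] and the earlier diagonal elements, diag j becomes X_j - f(xi_j) in a polynomial ring
    over C/P, and translating X_j gives the [T] of [kronecker]. The Jacobian comes from C/P alone,
    so one [h] serves all j. *)
Lemma prime_killed (P : set C) : is_prime_ideal P ->
  exists2 h, ~ P h & forall j, diag_killed (@mpolyC e K) xi P h j.
Proof.
move=> primeP; have [hP P1 _] := primeP.
have [L [f [fsurj fker]]] := prime_quotient primeP.
pose io : {rmorphism K -> L} := f \o @mpolyC e K.
have [D [g [t [s [p [h0 [jd [q [b fin]] gx]]]]]]] := normal_form io infK perfK (fun i => f 'X_i).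
have gen a : exists Q, a = mmap io (join_fun t s) Q.
  have [Q <-] := fsurj a; elim/mpoly_alg_ind: Q => [c|i|Q R [Q' hQ] [R' hR]|Q R [Q' hQ] [R' hR]].
  - by exists c%:MP; rewrite mmapC.
  - exact: gx.
  - by exists (Q' + R'); rewrite !rmorphD /= hQ hR.
  - by exists (Q' * R'); rewrite !rmorphM /= hQ hR.
have datum : full_datum io t s p h0.
  split=> //; exists q, b => a; have [Q ->] := gen a; exact: fin.
have datum' := datum_extension d infK datum.
have [h fh] := fsurj h0; exists h => [/fker|j].
  by rewrite fh; have [_ _ _ /eqP] := jd.
pose A : idomainType := {mpoly L[d]}.
(* The variables X_i with i < j stay in [A] as idle ones, and [ret] retracts onto the part that
   matters; thus [A] is the same for all j. *)
pose x (i : 'I_d) : A := if (i < j)%N then (f (xi i))%:MP else 'X_i.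
pose eva : {rmorphism {mpoly C[d]} -> A} := mmap (@mpolyC d L \o f) x.
pose up : {rmorphism {mpoly K[d]} -> {mpoly C[d]}} := map_mpoly (@mpolyC e K).
have evaC c : eva c%:MP = (f c)%:MP by rewrite /eva /= mmapC.
have evaX i : eva 'X_i = x i by rewrite /eva /= mmapXU.
have evaP y : coef_ideal P y -> eva y = 0.
  move=> hy; rewrite /eva /= /mmap big1 // => m _ /=.
  by have -> : f y@_m = 0 by [apply/fker; exact: hy]; rewrite mpolyC0 mul0r.
have evaD y : diag_ideal xi j y -> eva y = 0.
  move=> hy; suff [] : is_ideal [set y | eva y = 0] /\ True => [hE _|].
    apply: (ideal_gen_min hE _ hy) => _ [i ij ->] /=.
    by rewrite /diag rmorphB evaC evaX /x ij subrr.
  split=> //; split=> [|y1 y2 h1 h2|c y1 h1] /=.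
  - exact: rmorph0.
  - by rewrite rmorphD h1 h2 addr0.
  - by rewrite rmorphM h1 mulr0.
have evaK y : eva y = 0 -> ideal_add (coef_ideal P) (diag_ideal xi j) y.
  pose sub : {rmorphism {mpoly C[d]} -> {mpoly C[d]}} :=
    mmap (@mpolyC d C) (fun i => if (i < j)%N then (xi i)%:MP else 'X_i).
  have hdiag : is_ideal (diag_ideal xi j) by exact: diag_ideal_ideal.
  have subE : eva y = map_mpoly f (sub y).
    apply: (mpoly_rmorph_eq (f := eva) (g := map_mpoly f \o sub)) => [c|i] /=.
      by rewrite evaC /sub /= mmapC map_mpolyC.
    rewrite evaX /sub /= mmapXU /x; case: ifP => _; by rewrite ?map_mpolyC ?map_mpolyX.
  move=> y0; exists (sub y).
    move=> m; apply/fker; rewrite -(mcoeff_map_mpoly f) -subE y0; exact: mcoeff0.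
  have : diag_ideal xi j (idfun y - sub y); last by [].
  apply: (mpoly_rmorph_mod (f := idfun) (g := sub) hdiag) => [c|i] /=.
    by rewrite /sub /= mmapC subrr; exact: ideal0.
  rewrite /sub /= mmapXU; case: ifP => ij; last by rewrite subrr; exact: ideal0.
  by apply: sub_ideal_gen; exists i.
pose ret : {rmorphism A -> A} := mmap (@mpolyC d L) x.
have ret_surj a : exists y, eva y = ret a.
  elim/mpoly_alg_ind: a => [c|i|a1 a2 [y1 h1] [y2 h2]|a1 a2 [y1 h1] [y2 h2]].
  - by have [y <-] := fsurj c; exists y%:MP; rewrite evaC /ret /= mmapC.
  - by exists 'X_i; rewrite evaX /ret /= mmapXU.
  - by exists (y1 + y2); rewrite !rmorphD h1 h2.
  - by exists (y1 * y2); rewrite !rmorphM h1 h2.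
have retC c : ret c%:MP = c%:MP by rewrite /ret /= mmapC.
have retX i : ret 'X_i = x i by rewrite /ret /= mmapXU.
have ret_eva y : ret (eva y) = eva y.
  apply: (mpoly_rmorph_eq (f := ret \o eva) (g := eva)) => [c|i].
    by rewrite -[LHS]/(ret (eva c%:MP)) evaC retC.
  rewrite -[LHS]/(ret (eva 'X_i)) evaX; case: (boolP (i < j)%N) => ij.
    by rewrite /x ij retC.
  by rewrite {1}/x (negbTE ij) retX.
(* One power is lost in [kronecker], and d + D, the number of parameters of the extended datum, in
   [briancon_skoda]. *)
exists (d + D).+1 => I n w hI.
pose v : {rmorphism {mpoly K[d]} -> A} := eva \o up.
pose IA := ideal_gen (v @` I).
have hIA : is_ideal IA by exact: ideal_gen_ideal.
have back k y : ideal_pow IA k (eva y) -> diag_mod (@mpolyC e K) xi P (ideal_pow I k) j y.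
  move=> /ideal_pow_gen [r [a [c [hac yE]]]].
  have /choice[a' ha'] i : exists a', ideal_pow I k a' /\ v a' = a i.
    by have [[a' ha' <-] _] := hac i; exists a'.
  have /choice[c' hc'] i := ret_surj (c i).
  have h0' : eva (y - \sum_i up (a' i) * c' i) = 0.
    rewrite rmorphB rmorph_sum -[X in X - _](ret_eva y) yE rmorph_sum -sumrB big1 // => i _.
    by rewrite !rmorphM hc' -(ha' i).2 ret_eva subrr.
  have [y1 [y2 [h1 h2 yy]]] := ideal_addP (evaK _ h0').
  rewrite -(subrK (\sum_i up (a' i) * c' i) y) yy.
  have hdm := diag_mod_ideal (@mpolyC e K) xi (ideal_pow I k) j hP.
  apply: (idealD hdm); first apply: (idealD hdm).
  - exact: diag_mod_coef.
  - exact: diag_mod_diag.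
  apply: diag_mod_ext => //; apply: ideal_sum; first exact: ext_ideal_ideal.
  by move=> i _; rewrite mulrC; apply: ext_ideal_mem; case: (ha' i).
have forth k y : diag_mod (@mpolyC e K) xi P (ideal_pow I k) j y -> ideal_pow IA k (eva y).
  move=> /diag_modP[y1 [y2 [y3 [/evaP h1 h2 /evaD h3 ->]]]].
  rewrite !rmorphD h1 h3 add0r addr0; have hk := ideal_pow_ideal IA k.
  elim/ideal_mul_ind: h2 => [|a b' ha hb'|_ b' [a ha <-] _].
  - by rewrite rmorph0; exact: ideal0.
  - by rewrite rmorphD; exact: idealD.
  rewrite rmorphM; apply: idealMr => //; apply: (ideal_pow_rmorph (f := v)) ha => z Iz.
  by apply: sub_ideal_gen; exists z.
move=> /forth; rewrite rmorphM addnS.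
pose T : {rmorphism A -> {poly A}} :=
  mmap (polyC \o @mpolyC d L) (fun i => ('X_i)%:P + (i == j)%:R * 'X).
have T0 a : (T a)`_0 = a.
  rewrite -horner_coef0.
  apply: (mpoly_rmorph_eq (f := horner_eval 0 \o T) (g := idfun)) => [c|i] /=.
    by rewrite /T /= mmapC /horner_eval hornerC.
  by rewrite /T /= mmapXU /horner_eval hornerD hornerM hornerX mulr0 addr0 hornerC.
have zE : eva (diag xi j) = 'X_j - (f (xi j))%:MP.
  by rewrite /diag rmorphB evaC evaX /x ltnn.
have Tz : T (eva (diag xi j)) = (eva (diag xi j))%:P + 'X.
  rewrite zE rmorphB /T /= mmapXU mmapC /= eqxx mul1r polyCB; ring.
move=> /(kronecker hIA T0 Tz)[M [b' [hM Mb b'0 hw]]].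
have := briancon_skoda infK perfK datum' hIA hM Mb b'0 hw.
rewrite addnK -fh -evaC -rmorphM; exact: back.
Qed.

Theorem uniform_artin_rees (b : set C) : is_ideal b -> exists c, forall (I : set {mpoly K[d]}) n u,
  is_ideal I -> b u -> ideal_pow (ideal_gen (mmap (@mpolyC e K) xi @` I)) (n + c) u ->
  ideal_mul b (ideal_pow (ideal_gen (mmap (@mpolyC e K) xi @` I)) n) u.
Proof.
exact: uniform_artin_rees_kill (@mpoly_noetherian K e) prime_killed b.
Qed.

End Killing.

(** * Perfect infinite extensions *)

Section PerfectClosure.
Variables (F : fieldType) (p : nat).
Hypothesis pF : p \in [pchar F].

Definition frob n (a : F) : F := a ^+ (p ^ n).

Lemma frobD n a b : frob n (a + b) = frob n a + frob n b.
Proof. by apply: exprDn_pchar; rewrite pnatX pnatE ?pF // (pcharf_prime pF). Qed.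

Lemma frobM n a b : frob n (a * b) = frob n a * frob n b.
Proof. exact: exprMn. Qed.

Lemma frob1 n : frob n 1 = 1. Proof. exact: expr1n. Qed.

Lemma frob00 n : frob n 0 = 0.
Proof. by rewrite /frob expr0n expn_eq0 gtn_eqF // prime_gt0 // (pcharf_prime pF). Qed.

Lemma frobN n a : frob n (- a) = - frob n a.
Proof. by apply/eqP; rewrite -addr_eq0 -frobD addNr frob00. Qed.

Lemma frobV n a : frob n a^-1 = (frob n a)^-1. Proof. exact: exprVn. Qed.

Lemma frob_add m n a : frob m (frob n a) = frob (n + m) a.
Proof. by rewrite /frob -exprM -expnD. Qed.

Lemma frob_inj n : injective (frob n).
Proof.
move=> a b e; apply/eqP; rewrite -subr_eq0; have : frob n (a - b) = 0 by rewrite frobD frobN e subrr.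
by move/eqP; rewrite expf_eq0 => /andP[].
Qed.

(* The pair (a, m) stands for the p^m-th root of a. *)
Definition root_eq (x y : F * nat) := frob y.2 x.1 == frob x.2 y.1.

Fact root_eq_refl x : root_eq x x. Proof. by rewrite /root_eq. Qed.
Fact root_eq_sym x y : root_eq x y = root_eq y x. Proof. by rewrite /root_eq eq_sym. Qed.
Fact root_eq_trans y x z : root_eq x y -> root_eq y z -> root_eq x z.
Proof.
move=> /eqP xy /eqP yz; apply/eqP; apply: (@frob_inj y.2).
by rewrite !frob_add addnC -frob_add xy frob_add addnC -frob_add yz frob_add addnC.
Qed.

Canonical root_equiv := EquivRel root_eq root_eq_refl root_eq_sym root_eq_trans.

Definition perf : Type := let _ := pF in {eq_quot root_eq}%qT.
HB.instance Definition _ : EqQuotient _ root_eq perf := EqQuotient.on perf.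
HB.instance Definition _ := Choice.on perf.

Lemma perf_eqP (x y : F * nat) : \pi_perf%qT x = \pi_perf%qT y <-> frob y.2 x.1 = frob x.2 y.1.
Proof. by split=> [/eqmodP/eqP|/eqP h]; last exact/eqmodP. Qed.

Lemma perf_repr (x : F * nat) : frob x.2 (repr (\pi_perf%qT x)).1 = frob (repr (\pi_perf%qT x)).2 x.1.
Proof. by apply/perf_eqP; rewrite reprK. Qed.

Definition perf_op2 (op : F -> F -> F) (u v : perf) : perf :=
  \pi_perf%qT (op (frob (repr v).2 (repr u).1) (frob (repr u).2 (repr v).1), ((repr u).2 + (repr v).2)%N).

Lemma perf_op2E (op : F -> F -> F) : (forall n a b, frob n (op a b) = op (frob n a) (frob n b)) ->
  forall x y, perf_op2 op (\pi_perf%qT x) (\pi_perf%qT y) =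
    \pi_perf%qT (op (frob y.2 x.1) (frob x.2 y.1), (x.2 + y.2)%N).
Proof.
move=> hop x y; apply/perf_eqP; rewrite /= !hop !frob_add.
have := perf_repr x; have := perf_repr y; case: (repr _) => b' n'; case: (repr _) => a' m' /= hy hx.
case: x y hx hy => [a m] [b n] /= hx hy; congr (op _ _).
  have -> : (n' + (m + n) = m + (n' + n))%N by lia.
  by rewrite -frob_add hx frob_add; congr frob; lia.
have -> : (m' + (m + n) = n + (m' + m))%N by lia.
by rewrite -frob_add hy frob_add; congr frob; lia.
Qed.

Definition perf_add := perf_op2 +%R.
Definition perf_mul := perf_op2 *%R.
Definition perf_opp (u : perf) : perf := \pi_perf%qT (- (repr u).1, (repr u).2).
Definition perf_inv (u : perf) : perf := \pi_perf%qT ((repr u).1^-1, (repr u).2).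
Definition perf_of (a : F) : perf := \pi_perf%qT (a, 0%N).

Lemma perf_addE x y : perf_add (\pi_perf%qT x) (\pi_perf%qT y) =
  \pi_perf%qT (frob y.2 x.1 + frob x.2 y.1, (x.2 + y.2)%N).
Proof. exact/perf_op2E/frobD. Qed.

Lemma perf_mulE x y : perf_mul (\pi_perf%qT x) (\pi_perf%qT y) =
  \pi_perf%qT (frob y.2 x.1 * frob x.2 y.1, (x.2 + y.2)%N).
Proof. exact/perf_op2E/frobM. Qed.

Lemma perf_oppE x : perf_opp (\pi_perf%qT x) = \pi_perf%qT (- x.1, x.2).
Proof. by apply/perf_eqP; rewrite /= !frobN perf_repr. Qed.

Lemma perf_invE x : perf_inv (\pi_perf%qT x) = \pi_perf%qT (x.1^-1, x.2).
Proof. by apply/perf_eqP; rewrite /= !frobV perf_repr. Qed.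

Lemma perfW (P : perf -> Prop) : (forall x, P (\pi_perf%qT x)) -> forall u, P u.
Proof. by move=> h u; rewrite -(reprK u). Qed.

Fact perf_addA : associative perf_add.
Proof.
move=> u v w; move: u v w; elim/perfW => x; elim/perfW => y; elim/perfW => z.
rewrite !perf_addE; apply/perf_eqP; rewrite /= !frobD !frob_add addrA.
by congr (_ + _ + _); congr frob; lia.
Qed.

Fact perf_addC : commutative perf_add.
Proof.
move=> u v; move: u v; elim/perfW => x; elim/perfW => y.
by rewrite !perf_addE addrC addnC.
Qed.

Fact perf_add0 : left_id (perf_of 0) perf_add.
Proof.
elim/perfW => x; rewrite perf_addE; apply/perf_eqP.
by rewrite /= frob00 add0r frob_add; congr frob; lia.
Qed.

Fact perf_addN : left_inverse (perf_of 0) perf_opp perf_add.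
Proof.
elim/perfW => x; rewrite perf_oppE perf_addE; apply/perf_eqP.
by rewrite /= frobN addNr !frob00.
Qed.

HB.instance Definition _ := GRing.isZmodule.Build perf perf_addA perf_addC perf_add0 perf_addN.

Fact perf_mulA : associative perf_mul.
Proof.
move=> u v w; move: u v w; elim/perfW => x; elim/perfW => y; elim/perfW => z.
rewrite !perf_mulE; apply/perf_eqP; rewrite /= !frobM !frob_add mulrA.
by congr (_ * _ * _); congr frob; lia.
Qed.

Fact perf_mulC : commutative perf_mul.
Proof.
move=> u v; move: u v; elim/perfW => x; elim/perfW => y.
by rewrite !perf_mulE mulrC addnC.
Qed.

Fact perf_mul1 : left_id (perf_of 1) perf_mul.
Proof.
elim/perfW => x; rewrite perf_mulE; apply/perf_eqP.
by rewrite /= frob1 mul1r frob_add; congr frob; lia.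
Qed.

Fact perf_mulDl : left_distributive perf_mul perf_add.
Proof.
move=> u v w; move: u v w; elim/perfW => x; elim/perfW => y; elim/perfW => z.
rewrite perf_addE !perf_mulE perf_addE; apply/perf_eqP; rewrite /= !(frobM, frobD) !frob_add.
rewrite mulrDl; congr (_ * _ + _ * _); congr frob; lia.
Qed.

Fact perf_10 : perf_of 1 != perf_of 0.
Proof. by apply/eqP => /perf_eqP /=; rewrite frob1 frob00 => /eqP; rewrite oner_eq0. Qed.

HB.instance Definition _ := GRing.Zmodule_isComNzRing.Build perf
  perf_mulA perf_mulC perf_mul1 perf_mulDl perf_10.

Fact perf_mulV (u : perf) : u != perf_of 0 -> perf_mul (perf_inv u) u = perf_of 1.
Proof.
move: u; elim/perfW => x x0; rewrite perf_invE perf_mulE; apply/perf_eqP.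
have x10 : x.1 != 0.
  by apply: contraNneq x0 => e; apply/eqP/perf_eqP; rewrite /= e !frob00.
by rewrite /= frobV !frob1 mulVf ?frob1 // expf_neq0.
Qed.

Fact perf_inv0 : perf_inv (perf_of 0) = perf_of 0.
Proof. by rewrite perf_invE invr0. Qed.

HB.instance Definition _ := GRing.ComNzRing_isField.Build perf perf_mulV perf_inv0.

Fact perf_of_zmod : zmod_morphism perf_of.
Proof.
move=> a b; rewrite -[perf_of a - _]/(perf_add (perf_of a) (perf_opp (perf_of b))).
by rewrite perf_oppE perf_addE.
Qed.

Fact perf_of_monoid : monoid_morphism perf_of.
Proof. by split=> // a b; rewrite -[perf_of a * _]/(perf_mul (perf_of a) (perf_of b)) perf_mulE. Qed.

HB.instance Definition _ := GRing.isZmodMorphism.Build F perf perf_of perf_of_zmod.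
HB.instance Definition _ := GRing.isMonoidMorphism.Build F perf perf_of perf_of_monoid.

Lemma perf_exp x n : (\pi_perf%qT x : perf) ^+ n = \pi_perf%qT (x.1 ^+ n, x.2).
Proof.
elim: n => [|n IHn].
  by rewrite !expr0; apply/perf_eqP; rewrite /= !frob1.
rewrite exprS IHn -[_ * _]/(perf_mul _ _) perf_mulE; apply/perf_eqP; rewrite /= !frobM !frob_add.
by rewrite exprS frobM; congr (_ * _); congr frob; lia.
Qed.

Lemma perf_perfect : perfect_field perf.
Proof.
move=> q qK u; have -> : q = p.
  have pK : p \in [pchar perf] by rewrite (fmorph_pchar perf_of).
  by have := pcharf_eq pK q; rewrite qK => /esym /eqP.
exists (\pi_perf%qT ((repr u).1, (repr u).2.+1)).
rewrite perf_exp -[RHS]reprK; apply/perf_eqP; rewrite /=.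
by rewrite /frob -exprM expnS.
Qed.

End PerfectClosure.

Lemma infinite_inj (K : fieldType) (g : nat -> K) : injective g -> infinite_field K.
Proof.
move=> gI s; apply: contrapT => h.
have sub : {subset map g (iota 0 (size s).+1) <= s}.
  by move=> x _; apply: contrapT => /negP xs; apply: h; exists x.
have := uniq_leq_size _ sub; rewrite map_inj_uniq // iota_uniq size_map size_iota => /(_ isT).
by rewrite ltnn.
Qed.

(** k(X) is infinite; it is replaced by its perfect closure in characteristic p and is perfect
    already in characteristic zero. *)
Theorem exists_perfect_infinite (k : fieldType) : exists (K : fieldType) (io : {rmorphism k -> K}),
  infinite_field K /\ perfect_field K.
Proof.
pose F : fieldType := {fraction {poly k}}.
pose j : {rmorphism k -> F} := @tofrac _ \o @polyC k.
pose g n : F := tofrac ('X^n : {poly k}).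
have gI : injective g.
  move=> m n /eqP; rewrite tofrac_eq => /eqP /(congr1 (fun q : {poly k} => size q)).
  by rewrite !size_polyXn => -[].
have [[p pF]|nF] := pselect (exists p, p \in [pchar F]).
  exists (perf pF), (perf_of pF \o j); split; last exact: perf_perfect.
  by apply: (@infinite_inj _ (perf_of pF \o g)) => m n /= /fmorph_inj /gI.
exists F, j; split; first exact: infinite_inj gI.
by move=> p pF; case: nF; exists p.
Qed.

(** * Uniform Artin–Rees for submodules of free modules over a polynomial ring *)

Definition uar_ring (C : comNzRingType) : Prop := forall b : set C, is_ideal b ->
  exists c, forall (I : set C) n u, is_ideal I -> b u -> ideal_pow I (n + c) u ->
    ideal_mul b (ideal_pow I n) u.

Lemma ideal_pow_lift (C C' : comNzRingType) (f : {rmorphism C -> C'}) (I : set C') n u :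
  (forall y, exists x, f x = y) -> ideal_pow I n u ->
  exists2 v, ideal_pow (f @^-1` I) n v & f v = u.
Proof.
move=> fs; elim: n u => [|n IHn] u; first by move=> _; have [v <-] := fs u; exists v.
apply: (@ideal_mul_ind _ _ _ (fun u => exists2 v, ideal_pow (f @^-1` I) n.+1 v & f v = u)).
- by exists 0; [exact: (ideal0 (ideal_pow_ideal _ _))|rewrite rmorph0].
- move=> _ _ [x hx <-] [y hy <-]; exists (x + y); last by rewrite rmorphD.
  exact: (idealD (ideal_pow_ideal _ _)).
- move=> a _ Ia /IHn [y hy <-]; have [x xE] := fs a; exists (x * y); last by rewrite rmorphM xE.
  by apply: ideal_mul_mem => //; rewrite /preimage /= xE.
Qed.

Lemma uar_ring_surj (C C' : comNzRingType) (f : {rmorphism C -> C'}) :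
  (forall y, exists x, f x = y) -> uar_ring C -> uar_ring C'.
Proof.
move=> fs uC b hb; have [c hc] := uC _ (ideal_preim f hb).
exists c => I n u hI bu /(ideal_pow_lift fs) [v Iv vE].
have := hc _ n v (ideal_preim f hI); rewrite -vE => /(_ _ Iv) h.
have {h} : ideal_mul (f @^-1` b) (ideal_pow (f @^-1` I) n) v by apply: h; rewrite /preimage /= vE.
apply: (@ideal_mul_ind _ _ _ (fun x => ideal_mul b (ideal_pow I n) (f x))) => [|x y|x y bx Iy].
- by rewrite rmorph0; exact: ideal_mul0.
- by rewrite rmorphD; exact: ideal_mulD.
- by rewrite rmorphM; apply: ideal_mul_mem => //; exact: (ideal_pow_rmorph _ Iy).
Qed.

Section Restriction.
Variables (k K : fieldType) (io : {rmorphism k -> K}).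

Definition restr : Type := let _ := io in K.
HB.instance Definition _ := GRing.Zmodule.on restr.

Definition restr_scale (a : k) (x : restr) : restr := (io a * (x : K) : K).
Fact restr_scaleA a b x : restr_scale a (restr_scale b x) = restr_scale (a * b) x.
Proof. by rewrite /restr_scale rmorphM mulrA. Qed.
Fact restr_scale1 : left_id 1 restr_scale.
Proof. by move=> x; rewrite /restr_scale rmorph1 mul1r. Qed.
Fact restr_scaleDr : right_distributive restr_scale +%R.
Proof. by move=> a x y; rewrite /restr_scale mulrDr. Qed.
Fact restr_scaleDl x : {morph restr_scale^~ x : a b / a + b}.
Proof. by move=> a b; rewrite /restr_scale rmorphD mulrDl. Qed.
HB.instance Definition _ := GRing.Zmodule_isLmodule.Build k restr
  restr_scaleA restr_scale1 restr_scaleDr restr_scaleDl.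

Lemma exists_retraction : exists rho : K -> k,
  [/\ forall x y, rho (x + y) = rho x + rho y, forall a x, rho (io a * x) = a * rho x & rho 1 = 1].
Proof.
have [|e0|rho [rL _ rho1]] := @exists_functional k restr [set 0] (1 : K).
- by split=> // a x y -> ->; rewrite scaler0 addr0.
- have /eqP := oner_neq0 K; exact.
have rho0 : rho 0 = 0 by have := rL (-1) 0 0; rewrite scaler0 addr0 mulN1r addNr.
exists rho; split=> // [x y|a x].
  by have := rL 1 x y; rewrite scale1r mul1r.
by have := rL a x 0; rewrite addr0 rho0 addr0.
Qed.

(** Linearity over k[X] makes [r] carry an extended ideal back into the ideal it comes from. *)
Lemma mpoly_retraction d : exists r : {mpoly K[d]} -> {mpoly k[d]},
  [/\ forall p q, r (p + q) = r p + r q, forall p q, r (map_mpoly io q * p) = q * r p & r 1 = 1].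
Proof.
have [rho [rD rM r1]] := exists_retraction.
have r0 : rho 0 = 0 by apply: (addrI (rho 0)); rewrite -rD !addr0.
have rS (T : Type) (s : seq T) (P : pred T) F : rho (\sum_(i <- s | P i) F i) = \sum_(i <- s | P i) rho (F i).
    exact: (big_morph rho rD r0).
pose r (p : {mpoly K[d]}) : {mpoly k[d]} := \sum_(m <- msupp p) rho p@_m *: 'X_[m].
have rE p m : (r p)@_m = rho p@_m.
  rewrite /r raddf_sum /=; have [mp|mp] := boolP (m \in msupp p).
    rewrite (bigD1_seq m) ?msupp_uniq //= mcoeffZ mcoeffX eqxx mulr1 big1 ?addr0 // => j jm.
    by rewrite mcoeffZ mcoeffX (negbTE jm) mulr0.
  rewrite big_seq big1 => [|j jp]; first by rewrite (memN_msupp_eq0 mp) r0.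
  rewrite mcoeffZ mcoeffX; case: eqP => [jm|_]; last by rewrite mulr0.
  by rewrite -jm jp in mp.
exists r; split=> [p q|p q|]; apply/mpolyP => m.
- by rewrite mcoeffD !rE mcoeffD rD.
- rewrite rE (mcoeffM q) mcoeffM rS; apply: eq_bigr => j _.
  by rewrite mcoeff_map_mpoly rM rE.
- by rewrite rE !mcoeff1; case: (m == 0)%MM.
Qed.

End Restriction.

Lemma mmap_idE (K : comNzRingType) d (p : {mpoly K[d]}) : mmap (@mpolyC d K) (fun i => 'X_i) p = p.
Proof.
have := @mpoly_rmorph_eq _ _ _ (mmap (@mpolyC d K) (fun i => 'X_i)) idfun; apply => [c|i] /=.
  by rewrite mmapC.
by rewrite mmapXU.
Qed.

Lemma ideal_gen_mul (R : comPzRingType) (X Y : set R) x y z :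
  ideal_gen X x -> ideal_gen Y y -> z = x * y -> ideal_gen (ideal_mul X Y) z.
Proof.
move=> Xx Yy ->; have hG := ideal_gen_ideal (ideal_mul X Y).
move: x Xx; apply: ideal_mul_ind => [|x x' hx hx'|a b Xa _].
- by rewrite mul0r; exact: (ideal0 hG).
- by rewrite mulrDl; exact: (idealD hG).
move: y Yy; apply: ideal_mul_ind => [|y y' hy hy'|a' b' Ya _].
- by rewrite mulr0; exact: (ideal0 hG).
- by rewrite mulrDr; exact: (idealD hG).
by rewrite mulrACA; apply: (idealMr hG); apply: sub_ideal_gen; exact: ideal_mul_mem.
Qed.

(** Over [K] the disjoint variables are identified by xi_i = X_i, so [mmap] is the identity there;
    [r] then descends the inclusion. *)
Theorem uar_mpoly (k : fieldType) d : uar_ring {mpoly k[d]}.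
Proof.
have [K [io [infK perfK]]] := exists_perfect_infinite k; have [r [rD rM r1]] := mpoly_retraction io d.
pose up : {rmorphism {mpoly k[d]} -> {mpoly K[d]}} := map_mpoly io.
move=> b hb; have hB := ideal_gen_ideal (up @` b).
have [c hc] := uniform_artin_rees (fun i : 'I_d => 'X_i) infK perfK hB.
exists c => I n u hI bu Iu.
have upE (J : set {mpoly k[d]}) : mmap (@mpolyC d K) (fun i => 'X_i) @` ideal_gen (up @` J) `<=` ideal_gen (up @` J).
  by move=> _ [x Jx <-]; rewrite mmap_idE.
have hG (X : set {mpoly K[d]}) : ideal_gen X `<=` ideal_gen (mmap (@mpolyC d K) (fun i => 'X_i) @` X).
  move=> x; apply: ideal_gen_min; first exact: ideal_gen_ideal.
  by move=> y Xy; apply: sub_ideal_gen; exists y; rewrite ?mmap_idE.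
have := hc (ideal_gen (up @` I)) n (up u) (ideal_gen_ideal _).
have upb : ideal_gen (up @` b) (up u) by apply: sub_ideal_gen; exists u.
move=> /(_ upb); set J := ideal_gen (_ @` ideal_gen (up @` I)).
have JI : J `<=` ideal_gen (up @` I).
  by move=> x; apply: ideal_gen_min (upE I); exact: ideal_gen_ideal.
have IJ y : I y -> J (up y) by move=> Iy; apply: hG; do 2 apply: sub_ideal_gen; exists y.
move=> /(_ (ideal_pow_rmorph IJ Iu)) h.
have {h} : ideal_gen (up @` ideal_mul b (ideal_pow I n)) (up u).
  move: (up u) h; apply: ideal_mul_ind => [|x y|x y].
  - exact: (ideal0 (ideal_gen_ideal _)).
  - exact: (idealD (ideal_gen_ideal _)).
  move=> bx /(ideal_pow_sub JI) /(ideal_pow_gen (f := up)) Iy.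
  have := ideal_gen_mul bx Iy erefl; apply: ideal_gen_min; first exact: ideal_gen_ideal.
  move=> z; apply: ideal_mul_ind => [|x1 y1|_ _ [x1 bx1 <-] [y1 Iy1 <-]].
  - exact: (ideal0 (ideal_gen_ideal _)).
  - exact: (idealD (ideal_gen_ideal _)).
  by apply: sub_ideal_gen; exists (x1 * y1); [exact: ideal_mul_mem|rewrite rmorphM].
have hM : is_ideal (ideal_mul b (ideal_pow I n)) := ideal_mul_ideal _ (ideal_pow_ideal _ _).
have rE : u = r (up u) by rewrite -[up u]mulr1 rM r1 mulr1.
rewrite [X in _ -> _ X]rE; move: (up u); apply: ideal_mul_ind => [|x y|_ y [x hx <-] _].
- have -> : r 0 = 0 by apply: (addrI (r 0)); rewrite -rD !addr0.
  exact: (ideal0 hM).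
- by rewrite rD; exact: (idealD hM).
by rewrite rM; exact: (idealMr hM).
Qed.

Section FreeModule.
Variables (k : fieldType) (d : nat) (T : finType).
Local Notation S := {mpoly k[d]}.

Definition submodule (N : set (T -> S)) : Prop :=
  [/\ N (fun=> 0), forall v w, N v -> N w -> N (fun t => v t + w t) &
      forall a v, N v -> N (fun t => a * v t)].

Lemma uar_mpoly_mpoly r : uar_ring {mpoly S[r]}.
Proof.
pose f : {rmorphism {mpoly k[d + r]} -> {mpoly S[r]}} :=
  mmap (@mpolyC r S \o @mpolyC d k) (join_fun (fun i => ('X_i)%:MP) (fun j => 'X_j)).
apply: (@uar_ring_surj {mpoly k[d + r]} {mpoly S[r]} f _ (@uar_mpoly k (d + r))).
have fD x y : (exists u, f u = x) -> (exists u, f u = y) -> exists u, f u = x + y.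
  by move=> [u <-] [v <-]; exists (u + v); rewrite rmorphD.
have fM x y : (exists u, f u = x) -> (exists u, f u = y) -> exists u, f u = x * y.
  by move=> [u <-] [v <-]; exists (u * v); rewrite rmorphM.
elim/mpoly_alg_ind => [p|j|p q|p q]; [|by exists 'X_(rshift d j); rewrite /f /= mmapXU join_funr|exact: fD|exact: fM].
elim/mpoly_alg_ind: p => [c|i|p q hp hq|p q hp hq].
- by exists c%:MP; rewrite /f /= mmapC.
- by exists 'X_(lshift r i); rewrite /f /= mmapXU join_funl.
- by rewrite mpolyCD; exact: fD.
- by rewrite mpolyCM; exact: fM.
Qed.

(* A vector v is encoded by the linear form sum_t v_t Y_t in auxiliary variables Y; the linear *)
(* coefficients are read off by differentiating at Y = 0. *)
Theorem uar_module (N : set (T -> S)) : submodule N -> exists c, forall (I : set S) n v,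
  is_ideal I -> N v -> (forall t, ideal_pow I (n + c) (v t)) ->
  exists q (y : 'I_q -> S) (nu : 'I_q -> T -> S),
    [/\ forall j, ideal_pow I n (y j), forall j, N (nu j) &
        forall t, v t = \sum_j y j * nu j t].
Proof.
move=> [N0 ND NM]; pose C := {mpoly S[#|T|]}.
pose form (v : T -> S) : C := \sum_t (v t)%:MP * 'X_(enum_rank t).
pose lin t (x : C) : S := x^`M(enum_rank t).@[fun=> 0].
have formE v : (form v).@[fun=> 0] = 0.
  by rewrite /form rmorph_sum big1 // => t _; rewrite rmorphM /= mevalXU mulr0.
have linD t : {morph lin t : x y / x + y} by move=> x y; rewrite /lin mderivD mevalD.
have lin0 t : lin t 0 = 0 by rewrite /lin mderiv0 meval0.
have linM v t x : lin t (form v * x) = v t * x.@[fun=> 0].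
  rewrite /lin mderivM mevalD !mevalM formE mul0r addr0; congr (_ * _).
    rewrite -[LHS]/(lin t (form v)) /form (big_morph _ (linD t) (lin0 t)) (bigD1 t) //= big1 ?addr0 /lin => [|s st].
    by rewrite mderivM mderivC mul0r add0r mevalM mevalC mderivXU eqxx mevalC mulr1.
  by rewrite mderivM mderivC mul0r add0r mevalM mevalC mderivXU (inj_eq enum_rank_inj) (negbTE st) mevalC mulr0.
have [c hc] := uar_mpoly_mpoly (ideal_gen_ideal (form @` N)).
exists c => I n v hI Nv Iv; pose J : set C := ideal_gen (@mpolyC #|T| S @` I).
have JI y : J y -> I y.@[fun=> 0].
  pose V := @meval _ S (fun _ : 'I_#|T| => 0) @^-1` I.
  suff : J `<=` V by apply.
  move=> {}y; apply: ideal_gen_min => [|_ [x Ix <-]]; first exact: ideal_preim.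
  by rewrite /V /preimage /= mevalC.
have Ju : ideal_pow J (n + c) (form v).
  apply: (ideal_sum _ (ideal_pow_ideal J _)) => t _; apply: (idealMr (ideal_pow_ideal _ _)).
  by apply: (ideal_pow_rmorph _ (Iv t)) => y Iy; apply: sub_ideal_gen; exists y.
have bu : ideal_gen (form @` N) (form v) by apply: sub_ideal_gen; exists v.
have := hc J n _ (ideal_gen_ideal _) bu Ju.
pose P (x : C) := exists q (y : 'I_q -> S) (nu : 'I_q -> T -> S),
    [/\ forall j, ideal_pow I n (y j), forall j, N (nu j) &
        forall t, lin t x = \sum_j y j * nu j t].
suff hP x : ideal_mul (ideal_gen (form @` N)) (ideal_pow J n) x -> P x.
  move=> /hP [q [y [nu [hy hnu e]]]]; exists q, y, nu; split=> // t.
  by rewrite -e -[form v]mulr1 linM rmorph1 mulr1.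
have P0 : P 0.
  exists 0%N, (fun=> 0), (fun _ _ => 0); split=> // [[]//|t].
  by rewrite big_ord0 lin0.
have PD x1 x2 : P x1 -> P x2 -> P (x1 + x2).
  move=> [q [y [nu [hy hnu e]]]] [q' [y' [nu' [hy' hnu' e']]]].
  exists (q + q')%N, (join_fun y y'), (join_fun nu nu'); split.
  - by move=> j; rewrite /join_fun; case: split.
  - by move=> j; rewrite /join_fun; case: split.
  move=> t; rewrite linD e e' big_split_ord /=.
  by congr (_ + _); apply: eq_bigr => j _; rewrite ?join_funl ?join_funr.
apply: ideal_mul_ind => // {}x a hx Ja; move: x hx; apply: ideal_mul_ind => [|x y hx hy|_ b [w Nw <-] _].
- by rewrite mul0r.
- by rewrite mulrDl; exact: PD.
exists 1%N, (fun=> (b * a).@[fun=> 0]), (fun=> w); split=> // [_|t].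
  by rewrite rmorphM; apply: (idealM (ideal_pow_ideal _ _)); exact: (ideal_pow_rmorph JI Ja).
by rewrite big_ord1 -mulrA linM mulrC.
Qed.

End FreeModule.

(** * Functionals of finite order along the diagonal *)

Section Taylor.
Variables (k : fieldType) (d : nat).
Local Notation S := {mpoly k[d]}.
Local Notation PP := {mpoly S[d]}.
Local Notation dg := (diag (fun i : 'I_d => 'X_i : S)).
Local Notation DI := (diag_ideal (fun i : 'I_d => 'X_i : S) d).

(* In PP = S[X] the coefficients S = k[x] are the polynomials in x, tau a is a(X), and the *)
(* diagonal is X = x. *)
Definition tau : S -> PP := map_mpoly (@mpolyC d k).
HB.instance Definition _ := GRing.RMorphism.on tau.

Lemma DI_ideal : is_ideal DI. Proof. exact: diag_ideal_ideal. Qed.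
Lemma DIn_ideal n : is_ideal (ideal_pow DI n). Proof. exact: ideal_pow_ideal. Qed.

Lemma DI_diag i : DI (dg i).
Proof. by rewrite -[dg i]mulr1; apply: diag_ideal_mem. Qed.

Lemma tau0 : tau 0 = 0. Proof. exact: rmorph0. Qed.
Lemma tau1 : tau 1 = 1. Proof. exact: rmorph1. Qed.
Lemma tauD x y : tau (x + y) = tau x + tau y. Proof. exact: rmorphD. Qed.
Lemma tauB x y : tau (x - y) = tau x - tau y. Proof. exact: rmorphB. Qed.
Lemma tauM x y : tau (x * y) = tau x * tau y. Proof. exact: rmorphM. Qed.
Lemma tauX i : tau 'X_i = 'X_i. Proof. exact: map_mpolyX. Qed.
Lemma tauC c : tau c%:MP = c%:MP%:MP. Proof. exact: map_mpolyC. Qed.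

Lemma tau_diag a : DI (tau a - a%:MP).
Proof.
apply: (mpoly_rmorph_mod (f := tau) (g := @mpolyC d S) DI_ideal) => [c|i].
    by rewrite /= tauC subrr; exact: (ideal0 DI_ideal).
by rewrite /= tauX; exact: DI_diag.
Qed.

Lemma diag_monomial b : ideal_pow DI (mdeg b) (mmap1 dg b).
Proof. exact: (mmap1_pow DI_diag b). Qed.

Definition on_diag : PP -> S := mmap idfun (fun i => 'X_i).
HB.instance Definition _ := GRing.RMorphism.on on_diag.

Lemma on_diag0 : on_diag 0 = 0. Proof. exact: rmorph0. Qed.
Lemma on_diagD x y : on_diag (x + y) = on_diag x + on_diag y. Proof. exact: rmorphD. Qed.
Lemma on_diagB x y : on_diag (x - y) = on_diag x - on_diag y. Proof. exact: rmorphB. Qed.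
Lemma on_diagM x y : on_diag (x * y) = on_diag x * on_diag y. Proof. exact: rmorphM. Qed.
Lemma on_diagC c : on_diag c%:MP = c. Proof. by rewrite /on_diag mmapC. Qed.
Lemma on_diagX i : on_diag 'X_i = 'X_i. Proof. by rewrite /on_diag mmapXU. Qed.

Lemma on_diag_tau a : on_diag (tau a) = a.
Proof.
apply: (mpoly_rmorph_eq (f := on_diag \o tau) (g := idfun)) => [c|i] /=.
  by rewrite tauC on_diagC.
by rewrite tauX on_diagX.
Qed.

Lemma on_diag_DI x : DI x -> on_diag x = 0.
Proof.
suff : DI `<=` on_diag @^-1` [set 0] by apply.
move=> {}x; apply: ideal_gen_min => [|_ [i _ ->]].
  apply: ideal_preim; split=> // [a b -> ->|a b ->]; first exact: addr0.
  exact: mulr0.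
by rewrite /preimage /= /diag rmorphB /= on_diagC on_diagX subrr.
Qed.

(* The inverse of the expansion in powers of the diagonal elements. *)
Definition shift : PP -> PP := mmap (@mpolyC d S) (fun i => 'X_i + ('X_i)%:MP).
HB.instance Definition _ := GRing.RMorphism.on shift.

Lemma shiftC c : shift c%:MP = c%:MP. Proof. by rewrite /shift mmapC. Qed.

Lemma shiftD x y : shift (x + y) = shift x + shift y. Proof. exact: rmorphD. Qed.
Lemma shiftM x y : shift (x * y) = shift x * shift y. Proof. exact: rmorphM. Qed.
Lemma shift_diag i : shift (dg i) = 'X_i.
Proof. by rewrite /diag rmorphB /= shiftC /shift mmapXU addrK. Qed.

Lemma shift_expansion p : mmap (@mpolyC d S) dg (shift p) = p.
Proof.
apply: (mpoly_rmorph_eq (f := mmap (@mpolyC d S) dg \o shift) (g := idfun)) => [c|i] /=.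
  by rewrite shiftC mmapC.
by rewrite /shift mmapXU rmorphD /= mmapXU mmapC subrK.
Qed.

Definition vanishes n (p : PP) : Prop := forall m, (mdeg m < n)%N -> p@_m = 0.

Lemma vanishesD n p q : vanishes n p -> vanishes n q -> vanishes n (p + q).
Proof. by move=> hp hq m mn; rewrite mcoeffD hp // hq // addr0. Qed.

Lemma vanishesM m n p q : vanishes m p -> vanishes n q -> vanishes (m + n) (p * q).
Proof.
move=> hp hq b bmn; rewrite mcoeffM big1 // => -[/= b1 b2] /eqP bE.
have [b1m|mb1] := ltnP (mdeg b1) m; first by rewrite hp ?mul0r.
rewrite hq ?mulr0 // -(ltn_add2l m); apply: leq_ltn_trans bmn.
by apply: leq_trans (eq_leq (esym (congr1 (@mdeg _) bE))); rewrite mdegD leq_add2r.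
Qed.

Lemma shift_DI x : DI x -> vanishes 1 (shift x).
Proof.
move: x; apply: (@ideal_mul_ind _ _ _ (fun x => vanishes 1 (shift x))) => [m _|a b ha hb|a b [i _ ->] _].
- by rewrite /shift mmap0 mcoeff0.
- by rewrite shiftD; exact: vanishesD.
rewrite shiftM; apply: (@vanishesM 1 0) => // m; rewrite shift_diag mcoeffX ltnS leqn0 mdeg_eq0.
by move=> /eqP ->; rewrite mnm1_eq0.
Qed.

Lemma shift_DIn n x : ideal_pow DI n x -> vanishes n (shift x).
Proof.
elim: n x => [//|n IHn]; apply: (@ideal_mul_ind _ _ _ (fun x => vanishes n.+1 (shift x))) => [m _|a b ha hb|a b Da Db].
- by rewrite /shift mmap0 mcoeff0.
- by rewrite shiftD; exact: vanishesD.
rewrite shiftM; exact: (vanishesM (shift_DI Da) (IHn _ Db)).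
Qed.

Section Expansion.
Variable N : nat.
Local Notation T := 'X_{1..d < N.+1}.

(** Used twice: with [rho] the constants, for coefficients in x, and with [rho] equal to [tau], for
    coefficients in X. *)
Lemma diag_expansion (rho : {rmorphism S -> PP}) (p : {mpoly S[d]}) :
  ideal_pow DI N.+1 (mmap rho dg p - \sum_(b : T) rho p@_b * mmap1 dg b).
Proof.
pose k0 := maxn N.+1 (msize p).
have pk : (msize p <= k0)%N by rewrite leq_maxr.
rewrite (mmapE _ pk) (bigID (fun m : 'X_{1..d < k0} => (mdeg m < N.+1)%N)) /=.
pose w (m : T) : 'X_{1..d < k0} := BMultinom (leq_trans (bmdeg m) (leq_maxl N.+1 (msize p))).
have m0 : (mdeg (0%MM : 'X_{1..d}) < N.+1)%N by rewrite mdeg0.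
rewrite (reindex_onto w (fun m => insubd (BMultinom m0) (m : 'X_{1..d}))) /=; last first.
  by move=> m mN; apply: val_inj; rewrite /= val_insubd mN.
rewrite (eq_bigl predT) /= => [|b]; last first.
  by rewrite bmdeg /=; apply/eqP/val_inj; rewrite val_insubd bmdeg.
rewrite addrAC subrr add0r; apply: (ideal_sum _ (DIn_ideal N.+1)) => m.
rewrite -leqNgt => mN; apply: (idealM (DIn_ideal N.+1)); apply: (ideal_pow_le mN).
exact: diag_monomial.
Qed.

Definition coord (p : PP) (b : T) : S := (shift p)@_b.

Lemma coordD p q b : coord (p + q) b = coord p b + coord q b.
Proof. by rewrite /coord shiftD mcoeffD. Qed.

Lemma coordCM c p b : coord (c%:MP * p) b = c * coord p b.
Proof. by rewrite /coord shiftM shiftC mcoeffCM. Qed.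

Lemma coord_DI p b : ideal_pow DI N.+1 p -> coord p b = 0.
Proof. by move=> hp; apply: (shift_DIn hp); exact: bmdeg. Qed.

Lemma coord_expansion p : ideal_pow DI N.+1 (p - \sum_b (coord p b)%:MP * mmap1 dg b).
Proof. by have := diag_expansion (@mpolyC d S) (shift p); rewrite shift_expansion. Qed.

Lemma tau_surjective p : exists q : {mpoly S[d]}, mmap tau dg q = p.
Proof.
have hD x y : (exists u, mmap tau dg u = x) -> (exists u, mmap tau dg u = y) ->
    exists u, mmap tau dg u = x + y.
  by move=> [u <-] [v <-]; exists (u + v); rewrite rmorphD.
have hM x y : (exists u, mmap tau dg u = x) -> (exists u, mmap tau dg u = y) ->
    exists u, mmap tau dg u = x * y.
  by move=> [u <-] [v <-]; exists (u * v); rewrite rmorphM.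
elim/mpoly_alg_ind: p => [a|i|p q|p q]; [|by exists ('X_i)%:MP; rewrite mmapC; exact: tauX|exact: hD|exact: hM].
elim/mpoly_alg_ind: a => [c|i|a b ha hb|a b ha hb].
- by exists c%:MP%:MP; rewrite mmapC; exact: tauC.
- exists (('X_i)%:MP - 'X_i); rewrite rmorphB /= mmapC mmapXU.
  by rewrite -[X in X - _]/(tau 'X_i) tauX /diag subKr.
- by rewrite mpolyCD; exact: hD.
- by rewrite mpolyCM; exact: hM.
Qed.

Lemma tau_expansion p : exists w : T -> S, ideal_pow DI N.+1 (p - \sum_b tau (w b) * mmap1 dg b).
Proof.
by have [q <-] := tau_surjective p; exists (fun b => q@_b); exact: (diag_expansion tau q).
Qed.

(** The dual of the jets of order N: composed with [tau], such a functional is a differential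
    operator of order at most N. *)
Definition admissible (lam : PP -> S) : Prop :=
  [/\ forall x y, lam (x + y) = lam x + lam y, forall c x, lam (c%:MP * x) = c * lam x &
      forall x, ideal_pow DI N.+1 x -> lam x = 0].

Lemma coord_admissible (l : T -> S) : admissible (fun p => \sum_b coord p b * l b).
Proof.
split=> [x y|c x|x hx].
- by rewrite -big_split; apply: eq_bigr => b _; rewrite coordD mulrDl.
- by rewrite big_distrr; apply: eq_bigr => b _; rewrite coordCM -mulrA.
- by rewrite big1 // => b _; rewrite coord_DI ?mul0r.
Qed.

End Expansion.

Lemma admissible_le M N lam : (M <= N)%N -> admissible M lam -> admissible N lam.
Proof. by move=> MN [h1 h2 h3]; split=> // x hx; apply/h3/ideal_pow_le/hx. Qed.

Lemma admissibleZ N lam c : admissible N lam -> admissible N (fun x => c * lam x).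
Proof.
move=> [h1 h2 h3]; split=> [x y|a x|x hx]; first by rewrite h1 mulrDr.
  by rewrite h2 mulrCA.
by rewrite h3 ?mulr0.
Qed.

End Taylor.

Lemma subspace_matrix (F : fieldType) n (W : set 'rV[F]_n) : subspace W ->
  exists M : 'M[F]_n, forall w, W w <-> (w <= M)%MS.
Proof.
move=> [W0 WL].
have WZ a x : W x -> W (a *: x) by move=> hx; rewrite -[_ *: _]addr0; exact: WL.
have WD x y : W x -> W y -> W (x + y) by move=> hx hy; rewrite -[x]scale1r; exact: WL.
have WM m (u : 'rV_m) (A : 'M_(m, n)) : (forall i, W (row i A)) -> W (u *m A).
  move=> hA; rewrite mulmx_sum_row; elim/big_ind: _ => // i _; exact: WZ.
pose Q r := `[< exists M : 'M[F]_n, (forall i, W (row i M)) /\ \rank M = r >].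
have [|r|r /asboolP [M [hM rM]] rmax] := @ex_maxnP Q n.
- by exists 0%N; apply/asboolP; exists 0; split=> [i|]; rewrite ?row0 ?mxrank0.
- by move=> /asboolP [M [_ <-]]; exact: rank_leq_col.
exists M => w; split=> [Ww|/submxP [u ->]]; last exact: WM.
have sM : (M <= M + w)%MS by exact: addsmxSl.
apply: submx_trans (addsmxSr M w) _.
rewrite -(mxrank_leqif_sup sM) eqn_leq mxrankS // rM; apply: rmax; apply/asboolP.
exists (M + w)%MS; split=> // i; have /sub_addsmxP [[u1 u2] ->] := row_sub i (M + w)%MS.
apply: WD; apply: WM => // j; have -> : row j w = w by apply/rowP => b; rewrite mxE ord1.
by [].
Qed.

Lemma common_denominator (L : idomainType) (I : finType) (c : I -> {fraction L}) :
  exists (v : L) (u : I -> L), v != 0 /\ forall i, tofrac v * c i = tofrac (u i).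
Proof.
have /choice [uv hc] i : exists uv : L * L, uv.2 != 0 /\ c i = tofrac uv.1 / tofrac uv.2.
  by have [u [v [v0 cE]]] := fraction_ratio (c i); exists (u, v).
exists (\prod_i (uv i).2), (fun i => (uv i).1 * \prod_(j | j != i) (uv j).2); split.
  by apply/prodf_neq0 => i _; have [] := hc i.
move=> i; have [v0 ->] := hc i; rewrite (bigD1 i) //= !tofracM.
by rewrite [LHS]mulrC mulrA mulfVK ?tofrac_eq0 // -mulrA.
Qed.

(** * Functionals at an associated prime *)

Section PrimeFunctionals.
Variables (k : fieldType) (d : nat).
Local Notation S := {mpoly k[d]}.
Local Notation PP := {mpoly S[d]}.
Local Notation iC := (@mpolyC d k).
Local Notation tau := (@tau k d).
Local Notation on_diag := (@on_diag k d).
Local Notation dg := (diag (fun i : 'I_d => 'X_i : S)).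
Local Notation DI := (diag_ideal (fun i : 'I_d => 'X_i : S) d).
Variables (aa p : set S).
Hypotheses (haa : is_ideal aa) (hp : is_prime_ideal p).

Let hpI : is_ideal p. Proof. by case: hp. Qed.

Definition pair_ideal : set PP := ideal_add (coef_ideal p) (ext_ideal iC aa).

Lemma pair_ideal_ideal : is_ideal pair_ideal.
Proof. by apply: ideal_add_ideal; [exact: coef_ideal_ideal|exact: ext_ideal_ideal]. Qed.

Lemma coef_on_diag u : coef_ideal p u -> p (on_diag u).
Proof. by move=> hu; rewrite /on_diag /mmap; apply: (ideal_sum _ hpI) => m _; apply: (idealMr hpI); exact: hu. Qed.

Lemma ext_on_diag V w : is_ideal V -> ext_ideal iC V w -> V (on_diag w).
Proof.
move=> hV; suff : ext_ideal iC V `<=` on_diag @^-1` V by apply.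
move=> {}w; apply: ideal_gen_min; first exact: ideal_preim.
by move=> _ [a Va <-]; rewrite /preimage /= -[map_mpoly _ a]/(tau a) on_diag_tau.
Qed.

(* On the intersection of the two ideals in disjoint sets of variables one can divide by p. *)
Lemma uniform_colon : exists N, forall s a, (forall x, p x -> aa (x * a)) ->
  ideal_add pair_ideal (ideal_pow DI N.+1) (s%:MP * tau a) -> aa (s * a).
Proof.
pose v : set S := [set a | forall x, p x -> aa (x * a)].
have hv : is_ideal v.
  split=> [x _|a b ha hb x px|c a ha x px]; first by rewrite mulr0; exact: (ideal0 haa).
    by rewrite mulrDr; apply: (idealD haa); [exact: ha|exact: hb].
  by rewrite mulrCA; apply: (idealM haa); exact: ha.
have aav : aa `<=` v by move=> a ha x px; exact: (idealM haa).
have hev : is_ideal (ext_ideal iC v : set PP) := ext_ideal_ideal _ _.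
pose M : set PP := ideal_add (ext_ideal iC v) pair_ideal.
have hM : is_ideal M := ideal_add_ideal hev pair_ideal_ideal.
(* Only the powers of the diagonal ideal matter here: an element of M in DI^(N+1) lies in the
   product of M and DI. *)
have [N hN] := @uar_mpoly_mpoly k d d M hM.
exists N => s a av /ideal_addP [be [de [hbe hde sE]]].
have tav : ext_ideal iC v (s%:MP * tau a) by apply: ext_ideal_mem.
have Mde : M de.
  have -> : de = s%:MP * tau a - be by rewrite sE addrAC subrr add0r.
  by apply: (idealB hM); [apply: ideal_addl => //; exact: pair_ideal_ideal|apply: ideal_addr].
have {hN} := hN DI 1%N de (@DI_ideal k d) Mde; rewrite add1n => /(_ hde).
move/(ideal_mul_ind (P := fun x => exists b e, [/\ pair_ideal b, ext_ideal iC v e, on_diag e = 0 & x = b + e])).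
case => [|||b [e [hb he e0 deE]]].
- exists 0, 0; rewrite addr0 on_diag0; split=> //; [exact: (ideal0 pair_ideal_ideal)|exact: (ideal0 hev)].
- move=> x y [b [e [hb he e0 ->]]] [b' [e' [hb' he' e0' ->]]].
  exists (b + b'), (e + e'); rewrite on_diagD e0 e0' addr0 addrACA; split=> //.
    exact: (idealD pair_ideal_ideal).
  exact: (idealD hev).
- move=> m y /ideal_addP [e [b [he hb ->]]] /(ideal_pow1E (@DI_ideal k d)) Dy.
  exists (b * y), (e * y); split.
  + exact: (idealMr pair_ideal_ideal).
  + exact: (idealMr hev).
  + by rewrite on_diagM (on_diag_DI Dy) mulr0.
  + by rewrite mulrDl addrC.
have /ideal_addP [ga [al [hga hal gaE]]] : pair_ideal (be + b) by exact: (idealD pair_ideal_ideal).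
have sE' : s%:MP * tau a = ga + al + e by rewrite sE deE addrA gaE.
(* [ga] lies in both extended ideals, hence in their product, which on the diagonal becomes p v and
   so falls into [aa]. *)
have gav : ext_ideal iC v ga.
  have -> : ga = s%:MP * tau a - e - al by rewrite sE' addrK addrK.
  by apply: (idealB hev); [exact: (idealB hev)|exact: ext_ideal_sub hal].
have gaa : aa (on_diag ga).
  have : ideal_mul (coef_ideal p) (ext_ideal iC v) ga by exact: coef_ext_cap.
  apply: (ideal_mul_ind (P := fun x => aa (on_diag x))) => [|x y hx hy|x y hx hy].
  - by rewrite on_diag0; exact: (ideal0 haa).
  - by rewrite on_diagD; exact: (idealD haa).
  - by rewrite on_diagM; apply: (ext_on_diag hv hy); exact: coef_on_diag.
have -> : s * a = on_diag ga + on_diag al.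
  have -> : on_diag ga + on_diag al = on_diag (s%:MP * tau a - e) by rewrite sE' addrK on_diagD.
  by rewrite on_diagB on_diagM e0 subr0 on_diagC on_diag_tau.
by apply: (idealD haa) => //; exact: ext_on_diag.
Qed.

(** Over the fraction field of S/p the jets form a finite-dimensional space, in which [W] is the
    image of [Z]. The functionals are the columns of a cokernel matrix of [W], with denominators
    cleared and lifted to S; they detect membership in [Z] up to multipliers outside [p]. *)
Theorem prime_functionals : exists N r (lam : 'I_r -> PP -> S),
  [/\ forall j, admissible N (lam j), forall j x a, aa a -> p (lam j (x * tau a)) &
      forall a, (forall x, p x -> aa (x * a)) -> (forall j, p (lam j (tau a))) ->
        exists2 s, ~ p s & aa (s * a)].
Proof.
have [N hN] := uniform_colon; have [L [f [fs fk]]] := prime_quotient hp.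
pose T : finType := 'X_{1..d < N.+1}; pose n := #|T|.
pose g : {rmorphism S -> {fraction L}} := @tofrac L \o f.
have g0 a : g a = 0 <-> p a.
  by rewrite -fk /g /=; split=> [/eqP|->]; rewrite ?tofrac_eq0 ?rmorph0 // => /eqP.
have gN0 a : ~ p a -> g a != 0 by move=> pa; apply/eqP => /g0.
have gS x : exists u v, ~ p v /\ x = g u / g v.
  have [u [v [v0 ->]]] := fraction_ratio x; have [u' uE] := fs u; have [v' vE] := fs v.
  exists u', v'; rewrite -fk vE /g /= uE vE; split=> // v0'; by rewrite v0' eqxx in v0.
have pM a b : ~ p a -> ~ p b -> ~ p (a * b) by move=> ha hb; case: hp => _ _ h /h [].
have gD x y : g (x + y) = g x + g y by exact: rmorphD.
have gM x y : g (x * y) = g x * g y by exact: rmorphM.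
have g1 : g 1 = 1 by exact: rmorph1.
have gE x : g x = tofrac (f x) by [].
clearbody g; pose Z : set PP := ideal_add pair_ideal (ideal_pow DI N.+1).
have hZ : is_ideal Z := ideal_add_ideal pair_ideal_ideal (DIn_ideal k d N.+1).
have coord0 (b : T) : coord 0 b = 0 by rewrite -(mul0r 0) -[0 in LHS]mpolyC0 coordCM mul0r.
pose W : set 'rV[{fraction L}]_n := [set x | exists s z, [/\ ~ p s, Z z &
  forall b : T, g s * x 0 (enum_rank b) = g (coord z b)]].
have hW : subspace W.
  split=> [|a x y [s1 [z1 [s1p hz1 e1]]] [s2 [z2 [s2p hz2 e2]]]].
    exists 1, 0; split=> [||b]; [by case: hp|exact: (ideal0 hZ)|].
    by rewrite mxE mulr0 coord0; apply/esym/g0; exact: (ideal0 hpI).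
  have [u [v [vp ->]]] := gS a.
  exists (v * s1 * s2), ((u * s2)%:MP * z1 + (v * s1)%:MP * z2); split.
  - by apply: (pM) => //; exact: pM.
  - by apply: (idealD hZ); exact: (idealM hZ).
  move=> b.
  rewrite mxE.
  rewrite mxE.
  rewrite coordD.
  rewrite coordCM.
  rewrite coordCM.
  have := e1 b; have := e2 b; move: (coord z1 b) (coord z2 b) (x 0 _) (y 0 _) => c1 c2 x1 y1 e2b e1b.
  rewrite gD !gM -e1b -e2b.
  have := gN0 _ vp; move: (g u) (g v) (g s1) (g s2) => a1 a2 a3 a4 a20.
  by field.
have [M hM] := subspace_matrix hW; pose C := cokermx M.
have [v [u [v0 uE]]] := common_denominator (fun ij : 'I_n * 'I_n => C ij.1 ij.2).
have [v' vE] := fs v; have /choice [u' u'E] ij := fs (u ij).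
pose lam (j : 'I_n) (z : PP) := \sum_(b : T) coord z b * u' (enum_rank b, j).
pose vec (z : PP) : 'rV_n := \row_i g (coord z (enum_val i : T)).
have lamE j z : g (lam j z) = tofrac v * (vec z *m C) 0 j.
  rewrite mxE big_distrr /= (reindex (@enum_rank T)) /=; last first.
    by apply: onW_bij; exact: enum_rank_bij.
  have gS' : g (\sum_(b : T) coord z b * u' (enum_rank b, j)) = \sum_(b : T) g (coord z b * u' (enum_rank b, j)).
    by apply: (big_morph g gD); apply/g0; exact: (ideal0 hpI).
  rewrite gS'; apply: eq_bigr => b _; rewrite mxE enum_rankK; move: (coord z b) => c.
  rewrite gM mulrCA; congr (_ * _).
  by rewrite (uE (enum_rank b, j)) gE u'E.
have Zvec z : W (vec z) <-> forall j, p (lam j z).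
  rewrite hM submxE; split=> [/eqP h j|h].
    by apply/g0; rewrite lamE h mxE mulr0.
  apply/eqP/rowP => j; rewrite [RHS]mxE; apply/eqP.
  have /g0/eqP := h j; rewrite lamE mulf_eq0 tofrac_eq0 (negbTE v0) /=.
  by [].
exists N, n, lam; split=> [j|j x a aaa|a ap hlam].
- exact: coord_admissible.
- move: j; apply/Zvec; exists 1, (x * tau a); split=> [||b]; first by case: hp.
    apply: ideal_addl; first exact: (DIn_ideal k d N.+1).
    apply: ideal_addr; first exact: coef_ideal_ideal.
    by apply: (idealM (ext_ideal_ideal _ _)); apply: sub_ideal_gen; exists a.
  by rewrite g1 mul1r mxE enum_rankK.
have [s [z [sp hz sE]]] : W (vec (tau a)) by apply/Zvec.
exists s => //; apply: hN => //; rewrite -/Z.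
(* The difference has all coordinates in [p], hence lies in [Z]. *)
rewrite -[_ * _](subrK z); apply: (idealD hZ) => //.
set y := _ - z; have hy (b : T) : p (coord y b).
  have -> : y = s%:MP * tau a + (- 1)%:MP * z by rewrite /y mpolyCN mpolyC1 mulN1r.
  apply/g0; rewrite coordD coordCM coordCM.
  have := sE b; rewrite mxE enum_rankK; move: (coord (tau a) b) (coord z b) => c1 c2 e.
  by rewrite mulN1r gD gM e rmorphN subrr.
rewrite -[y](subrK (\sum_(b : T) (coord y b)%:MP * mmap1 dg b)); apply: (idealD hZ).
  by apply: ideal_addr; [exact: pair_ideal_ideal|exact: coord_expansion].
apply: ideal_addl; first exact: (DIn_ideal k d N.+1).
apply: ideal_addl; first exact: ext_ideal_ideal.
have hcp : is_ideal (coef_ideal p : set PP) := coef_ideal_ideal d hpI.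
apply: (ideal_sum _ hcp) => b _; apply: (idealMr hcp).
exact: coef_idealC.
Qed.

End PrimeFunctionals.

(** * Associated primes without embedded components *)

Section AssociatedPrimes.
Variable R : comPzRingType.
Hypotheses (noR : noetherian R) (noemb : no_embedded_primes R).
Implicit Types (P Q : set R) (x y f : R).

Lemma annihilator_ideal y : is_ideal (annihilator y).
Proof.
split=> [|a b ha hb|a x hx]; rewrite /annihilator /=; first by rewrite mul0r.
  by rewrite mulrDl ha hb addr0.
by rewrite -mulrA hx mulr0.
Qed.

Lemma prime_mul P x y : is_prime_ideal P -> ~ P x -> ~ P y -> ~ P (x * y).
Proof. by case=> _ _ h px py /h []. Qed.

Lemma prime_pow P x n : is_prime_ideal P -> P (x ^+ n) -> P x.
Proof. by case=> _ P1 h; elim: n => [|n IHn]; rewrite ?expr0 // exprS => /h []. Qed.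

Lemma prime_nil P x : is_prime_ideal P -> x \in nilradical R -> P x.
Proof.
move=> hP /nilradicalP [n xn]; apply: (prime_pow (n := n) hP); rewrite xn.
by case: hP => /ideal0.
Qed.

(* Otherwise a maximal annihilator avoiding all s x^n is an associated prime strictly below P. *)
Lemma associated_power P x : associated_prime P -> P x ->
  exists s n, ~ P s /\ s * x ^+ n = 0.
Proof.
move=> hP Px; apply: contrapT => nex; have [[hPI P1 _] _] := hP.
have nz s n : ~ P s -> s * x ^+ n <> 0 by move=> sP e; apply: nex; exists s, n.
pose F : set (set R) := [set Q | exists2 y, Q = annihilator y &
  forall s n, ~ P s -> ~ Q (s * x ^+ n)].
have F1 : F (annihilator 1).
  by exists 1 => // s n sP; rewrite /annihilator /= mulr1; exact: nz.
have [|Q [y QE Qx] Qmax] := noetherian_max noR _ F1.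
  by move=> _ [y -> _]; exact: annihilator_ideal.
have hQI : is_ideal Q by rewrite QE; exact: annihilator_ideal.

(* The annihilator of v y contains [Q] and also [u], so it is too large for [F] and contains some s
   x^n. *)
have max u v : ~ Q u -> Q (u * v) -> exists s n, ~ P s /\ Q (s * x ^+ n * v).
  move=> Qu Quv; apply: contrapT => h; apply: Qu; apply: (Qmax (annihilator (v * y))).
  - exists (v * y) => // s n sP e; apply: h; exists s, n; split=> //.
    by move: e; rewrite QE /annihilator /= mulrA.
  - by move=> z; rewrite QE /annihilator /= mulrCA => ->; rewrite mulr0.
  - by move: Quv; rewrite QE /annihilator /= mulrA.
have Qprime : is_prime_ideal Q.
  split=> // [Q1|u v Quv]; first by apply: (Qx 1 0%N P1); rewrite expr0 mulr1.
  apply: contrapT => /not_orP [Qu Qv]; have [s [n [sP h]]] := max _ _ Qu Quv.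
  have [s' [m [s'P h']]] : exists s' m, ~ P s' /\ Q (s' * x ^+ m * (s * x ^+ n)).
    by apply: (max v) => //; rewrite mulrC.
  apply: (Qx (s' * s) (m + n)%N); first exact: prime_mul hP.1 _ _.
  by rewrite exprD mulrACA.
apply: (@noemb P); split=> //; exists Q; first by split=> //; exists y.
split=> [u Qu|PQ]; last by apply: (Qx 1 1%N P1); rewrite mul1r expr1; exact: PQ.
by apply: contrapT => Pu; apply: (Qx u 0%N Pu); rewrite expr0 mulr1.
Qed.

(** Each generator of [P] has a power killed by some s_i outside [P]; the product of the s_i
    multiplies all generators into the nilradical. *)
Lemma associated_separator P : associated_prime P ->
  exists2 s, ~ P s & forall x, P x -> s * x \in nilradical R.
Proof.
move=> hP; have [[hPI P1 _] _] := hP; have [r [g [Pg gE]]] := noR hPI.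
have /choice [s hs] i : exists s, ~ P s /\ exists n, s * g i ^+ n = 0.
  by have [s [n [sP e]]] := associated_power hP (Pg i); exists s; split=> //; exists n.
exists (\prod_i s i).
  by elim/big_ind: _ => // [x y|i _]; [exact: prime_mul hP.1|case: (hs i)].
move=> x /gE [c ->]; rewrite big_distrr; apply: rpred_sum => i _ /=.
rewrite mulrCA; apply: nilradical_mull; apply/nilradicalP.
have [_ [n e]] := hs i; exists n.+1; rewrite exprMn (bigD1 i) //=.
set z := \prod_(_ | _) _; rewrite !exprS.
have -> : s i * z * (s i * z) ^+ n * (g i * g i ^+ n) = z * (s i * z) ^+ n * g i * (s i * g i ^+ n).
  by move: ((s i * z) ^+ n) (g i ^+ n) => w gn; ring.
by rewrite e mulr0.
Qed.

(** Annihilation of [w] by the product of the ideals in the list. *)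
Fixpoint killed (s : seq (set R)) (w : R) : Prop :=
  if s is P :: s' then forall x, P x -> killed s' (x * w) else w = 0.

Lemma killedM s a w : killed s w -> killed s (a * w).
Proof.
elim: s w => [w /= ->|P s IHs w hw x Px]; first by rewrite mulr0.
by rewrite mulrCA; apply: IHs; exact: hw.
Qed.

Lemma killed_sub P s f : is_prime_ideal P -> P = annihilator f -> killed s f ->
  exists2 Q, List.In Q s & Q `<=` P.
Proof.
move=> hP; elim: s f => [|Q s IHs] f PE /= hf.
  by case: hP => _ []; rewrite PE /annihilator /= hf mulr0.
have [QP|/existsNP [x /not_implyP [Qx Px]]] := pselect (Q `<=` P); first by exists Q; [left|].
have [||Q' sQ' Q'P] := IHs (x * f); [|exact: hf|by exists Q'; [right|]].
apply/seteqP; split=> y; rewrite /annihilator /= => h.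
  by move: h; rewrite PE /annihilator /= mulrCA => ->; rewrite mulr0.
have : P (y * x) by rewrite PE /annihilator /= -mulrA.
by case: hP => _ _ hm /hm [].
Qed.

(** A maximal ideal [W] killed by a product of associated primes contains every f whose annihilator
    is a prime P, since P can be prepended to the list. So some listed Q is contained in P, and as P
    is not embedded they are equal. *)
Theorem associated_primes_finite : exists s : seq (set R),
  forall P, List.In P s <-> associated_prime P.
Proof.
pose F : set (set R) := [set W | is_ideal W /\ exists s, (forall P, List.In P s -> associated_prime P) /\
  forall w, W w -> killed s w].
have F0 : F [set 0].
  split; first by split=> // [x y -> ->|a x ->]; rewrite ?addr0 ?mulr0.
  by exists [::]; split.
have [|W [hW [s [sA hs]]] Wmax] := noetherian_max noR _ F0; first by move=> ? [].
exists s => P; split=> [/sA //|hP]; have [hPp [f PE]] := hP.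
have Wf : W f.
  pose W' := ideal_add W (ideal_gen [set f]).
  have hW' : is_ideal W' by apply: ideal_add_ideal => //; exact: ideal_gen_ideal.
  apply: (Wmax W'); last by apply: ideal_addr => //; exact: sub_ideal_gen.
    split=> //; exists (P :: s); split=> [Q [<- //|/sA //]|w /ideal_addP [a [b [Wa /ideal_gen1 [v ->] ->]]] x Px].
    have -> : x * (a + f * v) = x * a.
      by move: Px; rewrite PE /annihilator /= mulrDr mulrA => ->; rewrite mul0r addr0.
    by apply: killedM; exact: hs.
  by move=> a Wa; apply: ideal_addl => //; exact: ideal_gen_ideal.
have [Q sQ QP] := killed_sub hPp PE (hs _ Wf).
suff -> : P = Q by [].
apply/seteqP; split=> //; apply: contrapT => PQ.
by apply: (@noemb P); split=> //; exists Q; [exact: sA|split].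
Qed.

End AssociatedPrimes.

(** * Functionals separating the points of an algebra essentially of finite type *)

Section Separating.
Variables (k : fieldType) (d : nat) (R : comPzRingType).
Local Notation S := {mpoly k[d]}.
Local Notation PP := {mpoly S[d]}.
Local Notation tau := (@tau k d).
Variable sig : {rmorphism S -> R}.
Hypothesis loc : forall r, exists a s u, sig s * u = 1 /\ r * sig s = sig a.

Definition nil_ideal : set S := [set a | sig a \in nilradical R].

Lemma nilradical_ideal : is_ideal [set x | x \in nilradical R].
Proof. split=> [|x y|a x]; [exact: rpred0|exact: rpredD|exact: nilradical_mull]. Qed.

Lemma nil_ideal_ideal : is_ideal nil_ideal.
Proof. exact: ideal_preim nilradical_ideal. Qed.

Lemma localization_noetherian : noetherian R.
Proof.
move=> J hJ; have [r [g [Jg gE]]] := mpoly_noetherian (ideal_preim sig hJ).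
exists r, (sig \o g); split=> // x Jx; have [a [s [u [su xE]]]] := loc x.
have [|c aE] := gE a; first by rewrite /preimage /= -xE; exact: (idealMr hJ).
exists (fun i => u * sig (c i)).
have -> : x = u * sig a by rewrite -xE mulrCA [u * _]mulrC su mulr1.
by rewrite aE rmorph_sum big_distrr; apply: eq_bigr => i _; rewrite rmorphM /= mulrA.
Qed.

Hypothesis noemb : no_embedded_primes R.
Let noR := localization_noetherian.

Lemma unit_notin P s u : is_prime_ideal P -> sig s * u = 1 -> ~ P (sig s).
Proof. by case=> hI P1 _ su Ps; apply: P1; rewrite -su; exact: (idealMr hI). Qed.

Lemma prime_list_functionals (ps : seq (set R)) :
  (forall P, List.In P ps -> associated_prime P) -> exists N r (lam : 'I_r -> PP -> S),
  [/\ forall j, admissible N (lam j), forall j x a, sig a = 0 -> nil_ideal (lam j (x * tau a)) &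
      forall P a, List.In P ps -> (forall x, P (sig x) -> sig (x * a) = 0) ->
        (forall j, nil_ideal (lam j (tau a))) -> exists2 s, ~ P (sig s) & sig (s * a) = 0].
Proof.
elim: ps => [_|P ps IHps hps]; first by exists 0%N, 0%N, (fun _ _ => 0); split=> // [[]|[]].
have [|N1 [r1 [l1 [adm1 kill1 sep1]]]] := IHps; first by move=> Q hQ; apply: hps; right.
have hP : associated_prime P by apply: hps; left.
have [hPp _] := hP; have [hPI P1 Pm] := hPp.
(* This multiplier turns values in [P] into nilpotent ones and, being outside [P], loses no
   detection at [P]. *)
have [t0 Pt0 t0nil] := associated_separator noR noemb hP.
have [s0 [s [u [su s0E]]]] := loc t0.
have Ps0 : ~ P (sig s0) by rewrite -s0E; apply: prime_mul hPp Pt0 (unit_notin hPp su).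
have s0nil x : P (sig x) -> nil_ideal (s0 * x).
  move=> /t0nil h; rewrite /nil_ideal /= rmorphM -s0E mulrAC [_ * sig s]mulrC.
  exact: nilradical_mull.
pose aa : set S := [set a | sig a = 0].
have haa : is_ideal aa.
  split=> [|x y hx hy|a x hx]; rewrite /aa /=; first by rewrite rmorph0.
    by rewrite rmorphD hx hy addr0.
  by rewrite rmorphM hx mulr0.
have hpp : is_prime_ideal (sig @^-1` P).
  split=> [||x y]; first exact: ideal_preim.
    by rewrite /preimage /= rmorph1.
  by rewrite /preimage /= rmorphM => /Pm.

have [N2 [r2 [l2 [adm2 kill2 sep2]]]] := prime_functionals haa hpp.
exists (maxn N1 N2), (r1 + r2)%N, (join_fun l1 (fun j x => s0 * l2 j x)); split.
- move=> j; rewrite /join_fun; case: split => i; first exact: admissible_le (leq_maxl _ _) (adm1 i).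
  exact/admissibleZ/(admissible_le (leq_maxr _ _) (adm2 i)).
- move=> j x a a0; rewrite /join_fun; case: split => i; first exact: kill1.
  by apply: s0nil; exact: kill2.
move=> Q a hQ Qa hl.
have [QP|QP] := pselect (P = Q).
  rewrite -QP in Qa *; apply: sep2 => [x Px|j]; first exact: Qa.
  have := hl (rshift r1 j); rewrite join_funr => /(prime_nil hPp); rewrite rmorphM => /Pm [].
    by [].
  by [].
apply: sep1 => // [|j]; first by case: hQ.
by have := hl (lshift r2 j); rewrite join_funl.
Qed.

(** Among undetected elements with nonzero image in [R], one with maximal annihilator has an
    associated prime Q as annihilator. Detection at Q gives an s outside Q that kills it, a
    contradiction. *)
Theorem separating_functionals : exists N r (lam : 'I_r -> PP -> S),
  [/\ forall j, admissible N (lam j), forall j x a, sig a = 0 -> nil_ideal (lam j (x * tau a)) &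
      forall a, (forall j x, nil_ideal (lam j (x * tau a))) -> sig a = 0].
Proof.
have [ps hps] := associated_primes_finite noR noemb.
have [|N [r [lam [adm kill sep]]]] := @prime_list_functionals ps; first by move=> P /hps.
exists N, r, lam; split=> // a0 ha0; apply: contrapT => a00.
pose K : set S := [set a | forall j x, nil_ideal (lam j (x * tau a))].
have KM a b : K a -> K (b * a) by move=> h j x; rewrite tauM mulrA; exact: h.
pose F : set (set R) := [set Q | exists a, [/\ K a, sig a <> 0 & Q = annihilator (sig a)]].
have Fa0 : F (annihilator (sig a0)) by exists a0.
have [|Q [a [Ka sa QE]] Qmax] := noetherian_max noR _ Fa0.
  by move=> _ [a [_ _ ->]]; exact: annihilator_ideal.
have hQ : associated_prime Q.
  split; last by exists (sig a).
  split=> [|Q1|u v Quv]; first by rewrite QE; exact: annihilator_ideal.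
    by move: Q1; rewrite QE /annihilator /= mul1r.
  apply: contrapT => /not_orP [Qu Qv].
  have [b [s [w [sw bE]]]] := loc v.
  apply: Qu; apply: (Qmax (annihilator (sig (b * a)))).
  - exists (b * a); split; [exact: KM| |reflexivity].
    rewrite rmorphM -bE => e; apply: Qv; rewrite QE /annihilator /=.
    by rewrite -[v]mulr1 -sw mulrA mulrAC e mul0r.
  - by move=> z; rewrite QE /annihilator /= rmorphM mulrCA => ->; rewrite mulr0.
  - move: Quv; rewrite QE /annihilator /= rmorphM -bE => e.
    have -> : u * (v * sig s * sig a) = u * v * sig a * sig s by ring.
    by rewrite e mul0r.
have /hps psQ := hQ.
have [|j|s Qs e] := sep Q a psQ; first by move=> x; rewrite QE /annihilator /= rmorphM.
  by have := Ka j 1; rewrite mul1r.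
by apply: Qs; rewrite QE /annihilator /= -rmorphM.
Qed.

End Separating.

(** * Differential operators from functionals along the diagonal *)

Section Operators.
Variables (k : fieldType) (d : nat) (R : comPzRingType).
Local Notation S := {mpoly k[d]}.
Local Notation PP := {mpoly S[d]}.
Local Notation tau := (@tau k d).
Local Notation dg := (diag (fun i : 'I_d => 'X_i : S)).
Local Notation DI := (diag_ideal (fun i : 'I_d => 'X_i : S) d).
Variables (iota : {rmorphism k -> R}) (sig : {rmorphism S -> R}).
Hypothesis sigC : forall c, sig c%:MP = iota c.
Hypothesis loc : forall r, exists a s u, sig s * u = 1 /\ r * sig s = sig a.

Definition rsig : S -> Rred R := @to_red R \o sig.
HB.instance Definition _ := GRing.RMorphism.on rsig.

Lemma rsig0 : rsig 0 = 0. Proof. exact: rmorph0. Qed.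
Lemma rsig1 : rsig 1 = 1. Proof. exact: rmorph1. Qed.
Lemma rsigD x y : rsig (x + y) = rsig x + rsig y. Proof. exact: rmorphD. Qed.
Lemma rsigB x y : rsig (x - y) = rsig x - rsig y. Proof. exact: rmorphB. Qed.
Lemma rsigN x : rsig (- x) = - rsig x. Proof. exact: rmorphN. Qed.
Lemma rsigM x y : rsig (x * y) = rsig x * rsig y. Proof. exact: rmorphM. Qed.

Lemma rsig_eq0 a : rsig a = 0 <-> nil_ideal sig a.
Proof. by have := to_red_eqP (sig a) 0; rewrite rmorph0 subr0. Qed.

(* With e = u - v, the element v divides u^(N+1) - e^(N+1). *)
Lemma diag_inverse N (u v : PP) : DI (u - v) ->
  exists2 h, ideal_pow DI N.+1 (v * h - u ^+ N.+1) & DI (h - u ^+ N).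
Proof.
set e := u - v => De; have hD := @DI_ideal k d.
exists (\sum_(i < N.+1) u ^+ (N - i) * e ^+ i).
  have -> : v = u - e by rewrite /e opprB addrC subrK.
  rewrite -subrXX addrAC subrr add0r; apply: (idealN (DIn_ideal k d N.+1)).
  exact: ideal_powX.
rewrite big_ord_recl expr0 mulr1 subn0 addrC addrA addNr add0r.
apply: (ideal_sum _ hD) => i _; apply: (idealM hD); rewrite exprS; exact: (idealMr hD).
Qed.

Section OneFunctional.
Variables (N : nat) (lam : PP -> S).
Hypotheses (adm : admissible N lam) (kill : forall x a, sig a = 0 -> nil_ideal sig (lam (x * tau a))).

Lemma lamD x y : lam (x + y) = lam x + lam y. Proof. by case: adm. Qed.
Lemma lamC c x : lam (c%:MP * x) = c * lam x. Proof. by case: adm. Qed.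
Lemma lam_eq x y : ideal_pow DI N.+1 (x - y) -> lam x = lam y.
Proof. by case: adm => _ _ h3 /h3 e; rewrite -[x](subrK y) lamD e add0r. Qed.
Lemma lam0 : lam 0 = 0.
Proof. by rewrite -[X in lam X](mul0r 0) -[X in lam (X * _)]mpolyC0 lamC mul0r. Qed.

(** For f = a/s, the fraction tau a / tau s is represented modulo (X - x)^(N+1) by tau a h / w. The
    value is prescribed for all such presentations, so later computations may choose the convenient
    one. *)
Definition is_value (th : PP) (f : R) (y : Rred R) : Prop := forall a s h w,
  f * sig s = sig a -> ideal_pow DI N.+1 (tau s * h - w%:MP) ->
  rsig w * y = rsig (lam (th * (tau a * h))).

Lemma representation f : exists a s u h, [/\ sig s * u = 1, f * sig s = sig a,
  ideal_pow DI N.+1 (tau s * h - (s ^+ N.+1)%:MP) & DI (h - (s ^+ N)%:MP)].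
Proof.
have [a [s [u [su fE]]]] := loc f; have hD := @DI_ideal k d.
have [|h hh hh'] := @diag_inverse N s%:MP (tau s).
  by rewrite -opprB; apply: (idealN hD); exact: tau_diag.
by exists a, s, u, h; rewrite !rmorphXn.
Qed.

Lemma rsig_cancel s u n x y : sig s * u = 1 -> rsig (s ^+ n) * x = rsig (s ^+ n) * y -> x = y.
Proof.
move=> su e; have inv : to_red (u ^+ n) * rsig (s ^+ n) = 1.
  by rewrite /rsig /= -rmorphM rmorphXn -exprMn mulrC su expr1n rmorph1.
by rewrite -[x]mul1r -inv -mulrA e mulrA inv mul1r.
Qed.

(** Two presentations differ by a multiple of tau(a0 s - a s0); sig vanishes on a0 s - a s0, so
    [kill] disposes of it. *)
Lemma exists_value th f : exists y, is_value th f y.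
Proof.
have [a0 [s0 [u0 [h0 [su0 fE0 hh0 _]]]]] := representation f.
exists (to_red (u0 ^+ N.+1) * rsig (lam (th * (tau a0 * h0)))) => a s h w fE hw.
apply: (rsig_cancel (n := N.+1) su0).
have inv : rsig (s0 ^+ N.+1) * to_red (u0 ^+ N.+1) = 1.
  by rewrite /rsig /= -rmorphM rmorphXn -exprMn su0 expr1n rmorph1.
have AC4 (A B C X : Rred R) : A * (B * (C * X)) = (A * C) * (B * X) by ring.
rewrite AC4 inv mul1r -!rsigM.
apply/eqP; rewrite -subr_eq0 -rsigB; apply/eqP/rsig_eq0; rewrite -!lamC.
have -> : lam (w%:MP * (th * (tau a0 * h0))) = lam (th * h * h0 * tau (a0 * s - a * s0) + (s0 ^+ N.+1)%:MP * (th * (tau a * h))).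
  apply: lam_eq; set w0 := (s0 ^+ N.+1)%:MP.
  have -> : w%:MP * (th * (tau a0 * h0)) - (th * h * h0 * tau (a0 * s - a * s0) + w0 * (th * (tau a * h))) =
      - (th * tau a0 * h0) * (tau s * h - w%:MP) + (th * tau a * h) * (tau s0 * h0 - w0).
    rewrite tauB (tauM a0) (tauM a); move: (tau a0) (tau a) (tau s) (tau s0) (w%:MP) w0 => ? ? ? ? ? ?.
    by ring.
  by apply: (idealD (DIn_ideal k d N.+1)); exact: (idealM (DIn_ideal k d N.+1)).
rewrite lamD lamC addrK; apply: kill; rewrite rmorphB !rmorphM -fE -fE0.
by rewrite mulrAC subrr.
Qed.

Definition delta (th : PP) (f : R) : Rred R := sval (cid (exists_value th f)).

Lemma deltaE th f a s h w : f * sig s = sig a -> ideal_pow DI N.+1 (tau s * h - w%:MP) ->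
  rsig w * delta th f = rsig (lam (th * (tau a * h))).
Proof. by move: a s h w; exact: (svalP (cid (exists_value th f))). Qed.

Opaque delta.

Lemma delta_uniq th f y a s u h : sig s * u = 1 -> f * sig s = sig a ->
  ideal_pow DI N.+1 (tau s * h - (s ^+ N.+1)%:MP) ->
  rsig (s ^+ N.+1) * y = rsig (lam (th * (tau a * h))) -> delta th f = y.
Proof.
move=> su fE hh yE; apply: (rsig_cancel (n := N.+1) su); rewrite yE.
exact: (deltaE _ fE hh).
Qed.

Lemma delta_sig th a : delta th (sig a) = rsig (lam (th * tau a)).
Proof.
have := @deltaE th (sig a) a 1 1 1; rewrite rmorph1 mulr1 => /(_ erefl).
rewrite tau1 mulr1 subrr rsig1 mul1r mulr1; apply.
exact: (ideal0 (DIn_ideal k d N.+1)).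
Qed.

Lemma delta_sigM th b f : delta th (sig b * f) = delta (th * tau b) f.
Proof.
have [a [s [u [h [su fE hh _]]]]] := representation f.
apply: (delta_uniq (a := b * a) su _ hh); first by rewrite -mulrA fE rmorphM.
have e : th * tau b * (tau a * h) = th * (tau (b * a) * h) by rewrite (tauM b); move: (tau a) (tau b) => ? ?; ring.
by rewrite (deltaE _ fE hh) e.
Qed.

Lemma deltaD th f g : delta th (f + g) = delta th f + delta th g.
Proof.
have [a [s [u [h [su fE hh _]]]]] := representation f.
have [b [t [v [l [tv gE _ _]]]]] := representation g.
have [m hm _] : exists2 m, ideal_pow DI N.+1 (tau (s * t) * m - ((s * t) ^+ N.+1)%:MP) & DI (m - (s * t)%:MP ^+ N).
  rewrite rmorphXn; apply: diag_inverse; rewrite -opprB; apply: (idealN (@DI_ideal k d)).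
  exact: tau_diag.
have f' : f * sig (s * t) = sig (a * t) by rewrite !rmorphM mulrA fE.
have g' : g * sig (s * t) = sig (b * s) by rewrite !rmorphM mulrCA mulrC gE.
have st : sig (s * t) * (u * v) = 1 by rewrite rmorphM mulrACA su tv mulr1.
apply: (delta_uniq (a := a * t + b * s) st _ hm); first by rewrite mulrDl f' g' rmorphD.
have e : th * (tau (a * t + b * s) * m) = th * (tau (a * t) * m) + th * (tau (b * s) * m).
  by rewrite tauD; move: (tau (a * t)) (tau (b * s)) => ? ?; ring.
by rewrite mulrDr (deltaE th f' hm) (deltaE th g' hm) -rsigD -lamD -e.
Qed.

Lemma delta_thD th th' f : delta (th + th') f = delta th f + delta th' f.
Proof.
have [a [s [u [h [su fE hh _]]]]] := representation f.
apply: (delta_uniq su fE hh).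
by rewrite mulrDr (deltaE th fE hh) (deltaE th' fE hh) mulrDl lamD rsigD.
Qed.

Lemma delta_thC c th f : delta (c%:MP * th) f = rsig c * delta th f.
Proof.
have [a [s [u [h [su fE hh _]]]]] := representation f.
by apply: (delta_uniq su fE hh); rewrite mulrCA (deltaE _ fE hh) -mulrA lamC rsigM.
Qed.

Lemma delta_DI th f : ideal_pow DI N.+1 th -> delta th f = 0.
Proof.
move=> hth; have [a [s [u [h [su fE hh _]]]]] := representation f.
apply: (delta_uniq su fE hh); rewrite mulr0 (lam_eq (y := tau a * 0)) ?rsig0 //.
  by rewrite mulr0 lam0 rsig0.
by rewrite mulr0 subr0; exact: (idealMr (DIn_ideal k d N.+1)).
Qed.

Lemma delta_eq th th' f : ideal_pow DI N.+1 (th - th') -> delta th f = delta th' f.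
Proof. by move=> /(delta_DI f) e; rewrite -[th](subrK th') delta_thD e add0r. Qed.

(** Linearity in theta reduces all multipliers to finitely many monomials, which is why finitely
    many operators suffice. *)
Lemma delta_span (I : set (Rred R)) f : is_ideal I ->
  (forall b : 'X_{1..d < N.+1}, I (delta (mmap1 dg b) f)) -> forall th, I (delta th f).
Proof.
move=> hI hb th; rewrite (delta_eq _ (coord_expansion N th)).
elim/big_ind: _ => [|x y hx hy|b _].
- by rewrite delta_DI; [exact: (ideal0 hI)|exact: (ideal0 (DIn_ideal k d N.+1))].
- by rewrite delta_thD; exact: (idealD hI).
- by rewrite delta_thC; exact: (idealM hI).
Qed.

(** For f0 = b/s, multiplying the argument by f0 multiplies theta by tau b / tau s, and multiplying
    the value by f0 multiplies theta by b/s. Up to the unit s^(N+1), the two factors differ by an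
    element of the diagonal ideal. *)
Lemma bracket_delta m th f0 : ideal_pow DI m th -> exists u th', ideal_pow DI m.+1 th' /\
  forall f, delta th (f0 * f) - to_red f0 * delta th f = u * delta th' f.
Proof.
move=> hth; have [b [s [v [h [sv f0E hh hD]]]]] := representation f0.
exists (to_red (v ^+ N.+1)), (th * (h * tau b) + (- (s ^+ N * b))%:MP * th); split.
  have -> : th * (h * tau b) + (- (s ^+ N * b))%:MP * th =
      th * ((h - (s ^+ N)%:MP) * tau b + (s ^+ N)%:MP * (tau b - b%:MP)).
    by rewrite mpolyCN mpolyCM; move: (tau b) (s ^+ N)%:MP b%:MP => ? ? ?; ring.
  rewrite -addn1; apply: ideal_powD_mem => //; apply: ideal_pow1.
  apply: (idealD (@DI_ideal k d)); first exact: (idealMr (@DI_ideal k d)).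
  by apply: (idealM (@DI_ideal k d)); exact: tau_diag.
move=> f; apply: (rsig_cancel (n := N.+1) sv); rewrite mulrA.
have -> : rsig (s ^+ N.+1) * to_red (v ^+ N.+1) = 1.
  by rewrite /rsig /= -rmorphM rmorphXn -exprMn sv expr1n rmorph1.
have e1 : rsig (s ^+ N.+1) * delta th (f0 * f) = delta (th * (h * tau b)) f.
  have fE : sig b * f = sig s * (f0 * f) by rewrite -f0E; ring.
  rewrite [th * (h * _)]mulrA -delta_sigM fE delta_sigM -delta_thC.
  apply: delta_eq.
  have -> : (s ^+ N.+1)%:MP * th - th * h * tau s = - th * (tau s * h - (s ^+ N.+1)%:MP).
    by move: (tau s) (s ^+ N.+1)%:MP => ? ?; ring.
  exact: (idealM (DIn_ideal k d N.+1)).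
have e2 : rsig (s ^+ N.+1) * (to_red f0 * delta th f) = rsig (s ^+ N * b) * delta th f.
  rewrite mulrA; congr (_ * _); rewrite exprSr (rsigM (s ^+ N) s) (rsigM (s ^+ N) b) -mulrA; congr (_ * _).
  by rewrite /rsig /= -f0E rmorphM mulrC.
by rewrite mul1r mulrBr e1 e2 delta_thD delta_thC rsigN mulNr.
Qed.


Lemma delta0 th : delta th 0 = 0.
Proof. by have e := deltaD th 0 0; rewrite addr0 in e; apply: (addrI (delta th 0)); rewrite addr0 -e. Qed.

(** Each bracket raises the order of theta along the diagonal by one; from order N it reaches N+1,
    where the operator vanishes. *)
Lemma delta_Diff n th u : (n <= N)%N -> ideal_pow DI (N - n) th ->
  @Diff_le k R iota R^o (Rred R) n (fun f => u * delta th f).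
Proof.

elim: n th u => [|n IHn] th u nN hth /=.
  rewrite subn0 in hth => c x y; rewrite deltaD mulrDr; congr (_ + _).
  have [v [th' [hth' e]]] := bracket_delta c hth.
  have := e x; rewrite (delta_DI _ hth') mulr0 => /eqP; rewrite subr_eq0 => /eqP ->.
  by rewrite mulrCA.
split=> [c x y|f0].
  rewrite deltaD mulrDr; congr (_ + _); rewrite -sigC [c%:MP in RHS]lock.
  have -> : delta th (sig c%:MP * x) = rsig c%:MP * delta th x.
    by rewrite delta_sigM tauC mulrC delta_thC.
  by rewrite mulrCA -lock.
have [v [th' [hth' e]]] := bracket_delta f0 hth.
have -> : bracket (M := R^o) (fun f => u * delta th f) f0 = (fun f => u * v * delta th' f).
  apply: funext => f; rewrite /bracket -mulrA -e mulrBr; congr (_ - _).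
  by rewrite mulrCA.
apply: IHn; first exact: ltnW.
by move: hth'; rewrite subnSK.
Qed.

End OneFunctional.
End Operators.

(** * The colon ideal *)

Opaque delta tau.

(** Among at least p + q - 1 factors, p come from [B] or q from [D]. *)
Lemma ideal_pow_add_split (A : comPzRingType) (B D : set A) m p q x : is_ideal B -> is_ideal D ->
  (p + q <= m.+1)%N -> ideal_pow (ideal_add B D) m x ->
  ideal_add (ideal_pow B p) (ideal_pow D q) x.
Proof.
move=> hB hD; elim: m p q x => [|m IHm] [|p] [|q] x pq hx;
  try (by apply: ideal_addl => //; exact: ideal_pow_ideal);
  try (by apply: ideal_addr => //; exact: ideal_pow_ideal).
  by move: pq; rewrite !addSn addnS.
have hs := ideal_add_ideal (ideal_pow_ideal B p.+1) (ideal_pow_ideal D q.+1).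
move: x hx; apply: ideal_mul_ind => [|x y|_ y /ideal_addP [b [e [Bb De ->]]] hy].
- exact: (ideal0 hs).
- exact: (idealD hs).
rewrite mulrDl; apply: (idealD hs).
  have /ideal_addP [b' [e' [Bb' De' ->]]] : ideal_add (ideal_pow B p) (ideal_pow D q.+1) y.
    by apply: IHm hy; move: pq; rewrite !addSn.
  rewrite mulrDr; apply: ideal_add_mem; first exact: ideal_mul_mem.
  exact: (idealM (ideal_pow_ideal D q.+1)).
have /ideal_addP [b' [e' [Bb' De' ->]]] : ideal_add (ideal_pow B p.+1) (ideal_pow D q) y.
  by apply: IHm hy; move: pq; rewrite addnS.
rewrite mulrDr; apply: ideal_add_mem; last exact: ideal_mul_mem.
exact: (idealM (ideal_pow_ideal B p.+1)).
Qed.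

Section Colon.
Variables (k : fieldType) (d : nat) (R : comPzRingType).
Local Notation S := {mpoly k[d]}.
Local Notation PP := {mpoly S[d]}.
Local Notation tau := (@tau k d).
Local Notation dg := (diag (fun i : 'I_d => 'X_i : S)).
Local Notation DI := (diag_ideal (fun i : 'I_d => 'X_i : S) d).
Variables (sig : {rmorphism S -> R}).
Hypothesis loc : forall r, exists a s u, sig s * u = 1 /\ r * sig s = sig a.
Variables (N r : nat) (lam : 'I_r -> PP -> S).
Hypotheses (adm : forall j, admissible N (lam j)).
Hypothesis kill : forall j x a, sig a = 0 -> nil_ideal sig (lam j (x * tau a)).
Hypothesis sep : forall a, (forall j x, nil_ideal sig (lam j (x * tau a))) -> sig a = 0.
Local Notation nil := (nil_ideal sig).
Local Notation T := 'X_{1..d < N.+1}.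
Local Notation DN := (ideal_pow DI N.+1).
Let hnil : is_ideal nil := nil_ideal_ideal sig.
Let hDN : is_ideal DN := DIn_ideal k d N.+1.

Definition lam_kernel : set PP := [set x | forall j th, nil (lam j (th * x))].

Lemma lam_kernel_ideal : is_ideal lam_kernel.
Proof.
split=> [j th|x y hx hy j th|a x hx j th].
- by rewrite mulr0 (lam0 (adm j)); exact: (ideal0 hnil).
- by rewrite mulrDr (lamD (adm j)); apply: (idealD hnil); [exact: hx|exact: hy].
- by rewrite mulrA; exact: hx.
Qed.

Lemma DN_lam_kernel x : DN x -> lam_kernel x.
Proof.
move=> hx j th; rewrite (lam_eq (adm j) (y := th * 0)).
  by have [h _ _] := lam_kernel_ideal; exact: h.
by rewrite mulr0 subr0; exact: (idealM hDN).
Qed.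

Lemma lam_kernel_span x : (forall j (b : T), nil (lam j (mmap1 dg b * x))) -> lam_kernel x.
Proof.
move=> h j th; rewrite -[th](subrK (\sum_(b : T) (coord th b)%:MP * mmap1 dg b)) mulrDl (lamD (adm j)).
apply: (idealD hnil).
  rewrite -[_ * x]mul1r; apply: DN_lam_kernel; apply: (idealMr hDN); exact: coord_expansion.
rewrite mulr_suml; elim/big_ind: _ => [|y z hy hz|b _].
- by have [h0 _ _] := lam_kernel_ideal; have := h0 j 1; rewrite mul1r.
- by rewrite (lamD (adm j)); exact: (idealD hnil).
- by rewrite -mulrA (lamC (adm j)); exact: (idealM hnil).
Qed.

(** Modulo nilpotents, the image of k[x, X] under all functionals and monomial multipliers: the
    module for Artin-Rees in the variables x. *)
Definition order_module : set ('I_r * T -> S) := [set v | exists x : PP,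
  forall jb : 'I_r * T, nil (v jb - lam jb.1 (mmap1 dg jb.2 * x))].

Lemma order_module_submodule : submodule order_module.
Proof.
split=> [|v w [x hx] [y hy]|a v [x hx]].
- exists 0 => jb; rewrite sub0r; apply: (idealN hnil).
  by have [h _ _] := lam_kernel_ideal; exact: h.
- exists (x + y) => jb; rewrite mulrDr (lamD (adm _)) opprD addrACA.
  by apply: (idealD hnil); [exact: hx|exact: hy].
- exists (a%:MP * x) => jb; rewrite mulrCA (lamC (adm _)) -mulrBr.
  by apply: (idealM hnil); exact: hx.
Qed.

Definition diag_sum (w : T -> S) : PP := \sum_(b : T) tau (w b) * mmap1 dg b.

Lemma diag_sum0 : diag_sum (fun=> 0) = 0.
Proof. by apply: big1 => b _; rewrite tau0 mul0r. Qed.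

Lemma diag_sumD v w : diag_sum (fun b => v b + w b) = diag_sum v + diag_sum w.
Proof. by rewrite -big_split; apply: eq_bigr => b _; rewrite (tauD (v b)) mulrDl. Qed.

Lemma diag_sumM a w : diag_sum (fun b => a * w b) = tau a * diag_sum w.
Proof. by rewrite big_distrr; apply: eq_bigr => b _; rewrite (tauM a) -mulrA. Qed.

Lemma diag_sum_lin q (y : 'I_q -> S) (nu : 'I_q -> T -> S) :
  diag_sum (fun b => \sum_i y i * nu i b) = \sum_i tau (y i) * diag_sum (nu i).
Proof.
elim: q y nu => [|q IHq] y nu.
  rewrite [RHS]big_ord0 -diag_sum0; congr diag_sum.
  by apply: funext => b; rewrite big_ord0.
rewrite [RHS]big_ord_recl -IHq -diag_sumM -diag_sumD; congr diag_sum.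
by apply: funext => b; rewrite big_ord_recl.
Qed.

(** Coordinate vectors, with coefficients in X, of what agrees with some tau a modulo the joint
    kernel: the module for Artin-Rees in the variables X. *)
Definition tau_module : set (T -> S) := [set w | exists a, lam_kernel (tau a - diag_sum w)].

Lemma tau_module_submodule : submodule tau_module.
Proof.
have hL := lam_kernel_ideal; split=> [|v w [x hx] [y hy]|a v [x hx]].
- by exists 0; rewrite tau0 diag_sum0 subr0; exact: (ideal0 hL).
- exists (x + y).
  have -> : tau (x + y) - diag_sum (fun t => v t + w t) = (tau x - diag_sum v) + (tau y - diag_sum w).
    by rewrite (tauD x y) (diag_sumD v w) opprD addrACA.
  exact: (idealD hL hx hy).
- exists (a * x).
  have -> : tau (a * x) - diag_sum (fun t => a * v t) = tau a * (tau x - diag_sum v).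
    by rewrite (tauM a x) (diag_sumM a v) mulrBr.
  exact: (idealM hL hx).
Qed.

Section OneIdeal.
Variable J : set R.
Hypothesis hJ : is_ideal J.
Let J0 : set S := sig @^-1` J.
Let hJ0 : is_ideal J0 := ideal_preim sig hJ.
Let hJn n : is_ideal (ideal_pow J0 n) := ideal_pow_ideal J0 n.
Local Notation left_ideal := (ideal_gen (@mpolyC d S @` J0)).
Local Notation right_ideal := (ideal_gen (tau @` J0)).

Lemma red_pow_lift n y : ideal_pow (@to_red R @` J) n y ->
  exists t u z, [/\ sig t * u = 1, ideal_pow J0 n z & rsig sig t * y = rsig sig z].
Proof.
elim: n y => [|n IHn] y.
  move=> _; have [a [s [u [su xE]]]] := loc (red_repr y).
  exists s, u, a; split=> //; rewrite -[y]red_reprK /rsig /= -rmorphM mulrC; congr (to_red _).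
  exact: xE.

move: y; apply: (ideal_mul_ind (P := fun y => exists t u z,
    [/\ sig t * u = 1, ideal_pow J0 n.+1 z & rsig sig t * y = rsig sig z])).
- exists 1, 1, 0; rewrite rmorph1 mulr1 mulr0 rsig0; split=> //; exact: (ideal0 (hJn n.+1)).
- move=> x y [t [u [z [tu hz e]]]] [t' [u' [z' [tu' hz' e']]]].
  exists (t * t'), (u * u'), (t' * z + t * z'); split.
  + by rewrite rmorphM mulrACA tu tu' mulr1.
  + by apply: (idealD (hJn n.+1)); exact: (idealM (hJn n.+1)).
  + by rewrite rsigD !rsigM -e -e'; move: (rsig sig t) (rsig sig t') => ? ?; ring.
move=> _ y [x Jx <-] /IHn [t [u [z [tu hz e]]]]; have [a [s [v [sv xE]]]] := loc x.
exists (s * t), (v * u), (a * z); split.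
- by rewrite rmorphM mulrACA sv tu mulr1.
- by apply: ideal_mul_mem => //; rewrite /J0 /preimage /= -xE; exact: (idealMr hJ).
- rewrite !rsigM -e; have -> : rsig sig a = rsig sig s * to_red x.
    by rewrite /rsig /= -xE rmorphM mulrC.
  by move: (rsig sig s) (rsig sig t) => ? ?; ring.
Qed.

Lemma left_right x : left_ideal x -> ideal_add right_ideal DI x.
Proof.
have hR : is_ideal right_ideal := ideal_gen_ideal _.
have hs := ideal_add_ideal hR (@DI_ideal k d).
apply: ideal_gen_min => // _ [a Ja <-].
have -> : a%:MP = tau a + (a%:MP - tau a) by rewrite addrC subrK.
apply: ideal_add_mem; first by apply: sub_ideal_gen; exists a.
by rewrite -opprB; apply: (idealN (@DI_ideal k d)); exact: tau_diag.
Qed.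

Lemma right_pow_expansion n x : ideal_pow right_ideal n x -> exists w : T -> S,
  (forall b, ideal_pow J0 n (w b)) /\ DN (x - diag_sum w).
Proof.
move=> hx; have := @ideal_pow_gen S PP tau J0 n x hx; move: x {hx}.
apply: (ideal_mul_ind (P := fun x => exists w : T -> S,
  (forall b, ideal_pow J0 n (w b)) /\ DN (x - diag_sum w))).
- exists (fun=> 0); split=> [b|]; first exact: (ideal0 (hJn n)).
  by rewrite diag_sum0 subr0; exact: (ideal0 hDN).
- move=> x y [v [hv ev]] [w [hw ew]]; exists (fun b => v b + w b); split=> [b|]; first exact: (idealD (hJn n)).
  by rewrite (diag_sumD v w) opprD addrACA; exact: (idealD hDN ev ew).
move=> _ y [z Jz <-] _; have [w hw] := tau_expansion N y.
exists (fun b => z * w b); split=> [b|]; first exact: (idealMr (hJn n)).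
by rewrite (diag_sumM z w) -mulrBr; exact: (idealM hDN hw).
Qed.

(** With denominators cleared, the values at tau a form a vector of [order_module] with entries in
    J0^(n+c1). Artin-Rees makes it the vector of a sum of terms y x with y in J0^n, and the
    difference lies in the joint kernel. *)
Lemma colon_left n c1 a : (forall (I : set S) n v, is_ideal I -> order_module v ->
    (forall t, ideal_pow I (n + c1) (v t)) ->
    exists q (y : 'I_q -> S) (nu : 'I_q -> 'I_r * T -> S),
    [/\ forall j, ideal_pow I n (y j), forall j, order_module (nu j) &
        forall t, v t = \sum_j y j * nu j t]) ->
  (forall j (b : T), ideal_pow (@to_red R @` J) (n + c1) (rsig sig (lam j (mmap1 dg b * tau a)))) ->
  exists t u, sig t * u = 1 /\ ideal_add (ideal_pow left_ideal n) lam_kernel (t%:MP * tau a).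
Proof.
move=> uar hI.
have /choice [tz htz] (jb : 'I_r * T) : exists tz : S * S, (exists u, sig tz.1 * u = 1) /\
    ideal_pow J0 (n + c1) tz.2 /\ nil (tz.2 - tz.1 * lam jb.1 (mmap1 dg jb.2 * tau a)).
  have [t [u [z [tu hz e]]]] := red_pow_lift (hI jb.1 jb.2).
  exists (t, z); split; [by exists u|split=> //=]; apply/rsig_eq0.
  by rewrite rsigB rsigM e subrr.
pose t := \prod_jb (tz jb).1.
have [u tu] : exists u, sig t * u = 1.
  rewrite /t; elim/big_ind: _ => [|x y [u xu] [v yv]|jb _]; last by case: (htz jb).
    by exists 1; rewrite rmorph1 mulr1.
  by exists (u * v); rewrite rmorphM mulrACA xu yv mulr1.
pose v jb := (\prod_(i | i != jb) (tz i).1) * (tz jb).2.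
have vE jb : nil (v jb - t * lam jb.1 (mmap1 dg jb.2 * tau a)).
  have [_ [_ h]] := htz jb.
  have -> : t = (\prod_(i | i != jb) (tz i).1) * (tz jb).1 by rewrite /t (bigD1 jb) //= mulrC.
  by rewrite /v -mulrA -mulrBr; exact: (idealM hnil h).
have [||q [y [nu [hy hnu e]]]] := uar J0 n v hJ0.
- exists (t%:MP * tau a) => jb; rewrite mulrCA (lamC (adm _)); exact: vE.
- by move=> jb; apply: (idealM (hJn _)); case: (htz jb) => _ [].
have /choice [x hx] l := hnu l.
exists t, u; split=> //.
pose s := \sum_l (y l)%:MP * x l; exists s.
  have hL : is_ideal (ideal_pow left_ideal n) := ideal_pow_ideal _ _.
  apply: (ideal_sum _ hL) => l _; apply: (idealMr hL).
  by apply: (ideal_pow_rmorph _ (hy l)) => z Jz; apply: sub_ideal_gen; exists z.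
apply: lam_kernel_span => j b; rewrite mulrBr -mulN1r -mpolyC1 -mpolyCN (lamD (adm j)) (lamC (adm j)).
have -> : lam j (mmap1 dg b * s) = \sum_l y l * lam j (mmap1 dg b * x l).
  rewrite /s big_distrr /= (big_morph (lam j) (lamD (adm j)) (id1 := 0)).
    by apply: eq_bigr => l _; rewrite mulrCA (lamC (adm j)).
  exact: lam0 (adm j).
rewrite [mmap1 dg b * _]mulrCA (lamC (adm j)) mulN1r.
have -> : t * lam j (mmap1 dg b * tau a) - \sum_l y l * lam j (mmap1 dg b * x l) =
    \sum_l y l * (nu l (j, b) - lam j (mmap1 dg b * x l)) - (v (j, b) - t * lam j (mmap1 dg b * tau a)).
  have -> : \sum_l y l * (nu l (j, b) - lam j (mmap1 dg b * x l)) = v (j, b) - \sum_l y l * lam j (mmap1 dg b * x l).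
    by rewrite e -sumrB; apply: eq_bigr => l _; exact: mulrBr.
  by move: (v (j, b)) (\sum_l _) (t * _) => ? ? ?; ring.
apply: (idealB hnil); last exact: (vE (j, b)).
by apply: (ideal_sum _ hnil) => l _; apply: (idealM hnil); exact: (hx l (j, b)).
Qed.

(** An element of J0 in x is one in X plus a diagonal term. Of n + N factors, either n are in X or N
    + 1 are diagonal, and the latter products lie in the kernel. [diag_inverse] does the same for
    the denominator [t]. *)
Lemma colon_right n t a : ideal_add (ideal_pow left_ideal (n + N)) lam_kernel (t%:MP * tau a) ->
  ideal_add (ideal_pow right_ideal n) lam_kernel (tau (t ^+ N.+1 * a)).
Proof.
have hL := lam_kernel_ideal; have hR : is_ideal (ideal_pow right_ideal n) := ideal_pow_ideal _ _.
have hs := ideal_add_ideal hR hL.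
move=> /ideal_addP [x [l [hx hl e]]].
have hx' : ideal_add (ideal_pow right_ideal n) lam_kernel (t%:MP * tau a).
  rewrite e; apply: (idealD hs); last exact: ideal_addr.
  have : ideal_add (ideal_pow right_ideal n) DN x.
    apply: (ideal_pow_add_split (m := (n + N)%N)); rewrite ?addnS //.
    - exact: ideal_gen_ideal.
    - exact: DI_ideal.
    - exact: (ideal_pow_sub (fun z => @left_right z) hx).
  by apply: ideal_add_sub => // z; exact: DN_lam_kernel.
have [h hh _] := diag_inverse N (tau_diag t).
have -> : tau (t ^+ N.+1 * a) = h * (t%:MP * tau a) - (t%:MP * h - tau t ^+ N.+1) * tau a.
  have -> : tau (t ^+ N.+1 * a) = tau t ^+ N.+1 * tau a by rewrite tauM; congr (_ * _); exact: rmorphXn.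
  by move: (tau t ^+ N.+1) (tau a) (t%:MP) => ? ? ?; ring.
apply: (idealB hs); first exact: (idealM hs).
by apply: ideal_addr => //; apply: (idealMr hL); exact: DN_lam_kernel.
Qed.

(** Artin-Rees makes tau a congruent, modulo the kernel, to tau of a sum of y_i al_i with y_i in
    J0^n; by [sep] both have the same image in [R]. *)
Lemma colon_final n c2 a : (forall (I : set S) n v, is_ideal I -> tau_module v ->
    (forall t, ideal_pow I (n + c2) (v t)) ->
    exists q (y : 'I_q -> S) (nu : 'I_q -> T -> S),
    [/\ forall j, ideal_pow I n (y j), forall j, tau_module (nu j) &
        forall t, v t = \sum_j y j * nu j t]) ->
  ideal_add (ideal_pow right_ideal (n + c2)) lam_kernel (tau a) -> ideal_pow J n (sig a).
Proof.
have hL := lam_kernel_ideal.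
move=> uar /ideal_addP [x [l [hx hl e]]].
have [w [hw xE]] := right_pow_expansion hx.
have aw : lam_kernel (tau a - diag_sum w).
  rewrite e [x + l]addrC -addrA; apply: (idealD hL) => //; exact: DN_lam_kernel.
have [|q [y [nu [hy hnu we]]]] := uar J0 n w hJ0 _ hw; first by exists a.
have /choice [al hal] i := hnu i.
have : sig (a - \sum_i y i * al i) = 0.
  apply: sep => j th; move: j th; rewrite -/(lam_kernel _).
  have -> : tau (a - \sum_i y i * al i) = (tau a - diag_sum w) -
      \sum_i tau (y i) * (tau (al i) - diag_sum (nu i)).
    have -> : diag_sum w = \sum_i tau (y i) * diag_sum (nu i).
      by rewrite -diag_sum_lin; congr diag_sum; exact: funext.
    have e1 : tau (\sum_i y i * al i) = \sum_i tau (y i) * tau (al i).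
      by rewrite (big_morph tau (@tauD k d) (@tau0 k d)); apply: eq_bigr => i _; exact: tauM.
    have e2 : \sum_i tau (y i) * (tau (al i) - diag_sum (nu i)) =
        \sum_i tau (y i) * tau (al i) - \sum_i tau (y i) * diag_sum (nu i).
      by rewrite -sumrB; apply: eq_bigr => i _; exact: mulrBr.
    by rewrite tauB e1 e2 opprB addrA subrK.
  apply: (idealB hL) => //; apply: (ideal_sum _ hL) => i _; apply: (idealM hL); exact: hal.
move/eqP; rewrite rmorphB subr_eq0 => /eqP ->; rewrite rmorph_sum.
apply: (ideal_sum _ (ideal_pow_ideal J n)) => i _; rewrite rmorphM.
by apply: (idealMr (ideal_pow_ideal J n)); exact: (ideal_pow_rmorph _ (hy i)).
Qed.

End OneIdeal.

Theorem colon_subset : exists c, forall J n f, is_ideal J ->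
  (forall j (b : T), ideal_pow (@to_red R @` J) (n + c) (delta loc (adm j) (kill j) (mmap1 dg b) f)) ->
  ideal_pow J n f.
Proof.
have [c1 uar1] := uar_module order_module_submodule.
have [c2 uar2] := uar_module tau_module_submodule.
(* [c1] pays for Artin-Rees in x, [N] for the exchange of x with X, and [c2] for Artin-Rees in X. *)
exists (c2 + N + c1)%N => J n f hJ hf.
have [a [s [u [su fE]]]] := loc f.
have hI : is_ideal (ideal_pow (@to_red R @` J) (n + (c2 + N + c1))) := ideal_pow_ideal _ _.
have hall j th : ideal_pow (@to_red R @` J) (n + (c2 + N + c1)) (rsig sig (lam j (th * tau a))).
  rewrite -(delta_sig loc (adm j) (kill j)) -fE mulrC delta_sigM.
  exact: (delta_span hI (hf j)).
have [j b|t [v [tv ht]]] := @colon_left J hJ (n + c2 + N)%N c1 a uar1.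
  by have := hall j (mmap1 dg b); rewrite !addnA.
have h := @colon_final J hJ n c2 _ uar2 (colon_right ht).
have hJn := ideal_pow_ideal J n.
have -> : f = u * v ^+ N.+1 * sig (t ^+ N.+1 * a).
  have tvn : sig t ^+ N.+1 * v ^+ N.+1 = 1 by rewrite -exprMn tv expr1n.
  rewrite rmorphM rmorphXn -fE; have -> : u * v ^+ N.+1 * (sig t ^+ N.+1 * (f * sig s)) =
    f * (sig s * u) * (sig t ^+ N.+1 * v ^+ N.+1).
    by move: (v ^+ N.+1) (sig t ^+ N.+1) (sig s) => ? ? ?; ring.
  by rewrite su tvn !mulr1.
exact: (idealM hJn).
Qed.

(** The argument of [delta_span] with the zero ideal, followed by [sep]. *)
Lemma joint_kernel f : (forall j (b : T), delta loc (adm j) (kill j) (mmap1 dg b) f = 0) -> f = 0.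
Proof.
move=> hf; have [a [s [u [su fE]]]] := loc f.
have h0 : is_ideal [set y : Rred R | y = 0].
  by split=> // [x y -> ->|x y ->] /=; rewrite ?addr0 ?mulr0.
have : sig a = 0.
  apply: sep => j th; apply/rsig_eq0; rewrite -(delta_sig loc (adm j) (kill j)) -fE mulrC delta_sigM.
  exact: (delta_span h0 (hf j)).
by move=> a0; rewrite -[f]mulr1 -su mulrA fE a0 mul0r.
Qed.

End Colon.

Theorem theorem1 (k : fieldType) (R : comPzRingType) (iota : {rmorphism k -> R})
    (R_eft : essentially_of_finite_type iota)
    (R_noemb : no_embedded_primes R) :
  exists (m : nat) (delta : 'I_m -> R^o -> Rred R) (c : nat),
    noetherian_operators iota delta /\
    forall (J : set R), is_ideal J -> forall n : nat,
      colon (ideal_pow (@to_red R @` J) (n + c)) delta `<=` ideal_pow J n.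
Proof.
have [d [A [phi [U [psi [phi_surj _ [psiU psi_frac _] psiC]]]]]] := R_eft.
pose sig : {rmorphism {mpoly k[d]} -> R} := psi \o phi.
have loc r : exists a s u, sig s * u = 1 /\ r * sig s = sig a.
  have [a' [s' [/psiU [u su] rE]]] := psi_frac r.
  have [[a aE] [s sE]] := (phi_surj a', phi_surj s').
  by exists a, s, u; rewrite /sig /= aE sE.
have [N [r [lam [adm kill sep]]]] := separating_functionals loc R_noemb.
have [c hc] := colon_subset loc adm kill sep.
(* By [delta_span], pairs of a functional and a monomial multiplier of degree at most N give enough
   operators. *)
pose T : finType := 'X_{1..d < N.+1}; pose I : finType := ('I_r * T)%type.
pose op (j : 'I_r) (b : T) : R -> Rred R :=
  delta loc (adm j) (kill j) (mmap1 (diag (fun i : 'I_d => 'X_i : {mpoly k[d]})) b).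
pose ops (i : 'I_#|I|) : R^o -> Rred R := op (enum_val i).1 (enum_val i).2.
have opsE j b : op j b = ops (enum_rank (j, b)) by rewrite /ops enum_rankK.
exists #|I|, ops, c; split; first split.
- move=> i; exists N; rewrite /ops /op.
  have := @delta_Diff k d R iota sig psiC loc N _ (adm (enum_val i).1) (kill _) N
    (mmap1 (diag (fun i : 'I_d => 'X_i : {mpoly k[d]})) (enum_val i).2) 1 (leqnn _).
  rewrite subnn => /(_ Logic.I); congr (Diff_le _ _ _); apply: funext => f; exact: mul1r.
- apply/seteqP; split=> f /=.
    by move=> hf; apply: (joint_kernel (loc := loc) (adm := adm) (kill := kill) sep) => j b; have := hf (enum_rank (j, b)); rewrite -opsE.
  by move=> -> i; exact: delta0.
move=> J hJ n f hf; apply: hc => // j b; rewrite -/(op j b) opsE; exact: hf.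
Qed.
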